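(* Let $\Psi$ be an Orlicz function such that, for every $A>1$ and every $\varepsilon>0$, one has, as $x$ goes to infinity, $$\Psi(Ax)=O\big(\Psi(x)\,(\log\Psi(x))^\varepsilon\big).$$ Let $\phi\colon\mathbb{D}\to\mathbb{D}$ be an analytic self-map. If the composition operator $C_\phi\colon H^2\to H^2$ is in the Schatten class $S_p$ for some $p>0$, then the composition operator $C_\phi\colon H^\Psi\to H^\Psi$ is compact.
   Context: $\mathbb{D}$ is the open unit disk of $\mathbb{C}$, $\mathbb{T}=\partial\mathbb{D}$, and $m$ is normalized Lebesgue measure on $\mathbb{T}$. $H^p$ denotes the classical Hardy space on $\mathbb{D}$. For an analytic self-map $\phi\colon\mathbb{D}\to\mathbb{D}$, $C_\phi$ is the composition operator $f\mapsto f\circ\phi$. $S_p$ ($p>0$) is the Schatten class of compact operators on the Hilbert space $H^2$ whose singular numbers are in $\ell_p$. An Orlicz function is a non-decreasing convex function $\Psi\colon[0,\infty]\to[0,\infty]$ with $\Psi(0)=0$, $\Psi(\infty)=\infty$, which is moreover assumed to be continuous at $0$, strictly convex on $[0,\infty)$ (hence finite and increasing there), and such that $\Psi(x)/x\to\infty$ as $x\to\infty$. $L^\Psi(\mathbb{T})$ is the space of (classes of) measurable $f\colon\mathbb{T}\to\mathbb{C}$ for which there is $C>0$ with $\int_{\mathbb{T}}\Psi(|f|/C)\,dm<+\infty$; the Luxemburg norm $\|f\|_\Psi$ is the infimum of the constants $C>0$ such that this integral is $\le 1$. The Hardy-Orlicz space $H^\Psi$ is the space of all $f\in H^1$ whose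 boundary function $f^*$ lies in $L^\Psi(\mathbb{T})$, normed by $\|f^*\|_\Psi$. Every composition operator is bounded on every $H^p$ and on every $H^\Psi$. *)

(* Defs.v *)
From HB Require Import structures.
From mathcomp Require Import all_boot all_order all_algebra.
From mathcomp Require Import complex.
From mathcomp Require Import all_classical all_reals all_analysis.

Set Implicit Arguments.
Unset Strict Implicit.
Unset Printing Implicit Defensive.

Import Order.TTheory GRing.Theory Num.Theory.
Import numFieldNormedType.Exports.

Local Open Scope classical_set_scope.
Local Open Scope ring_scope.
Local Open Scope complex_scope.

(* Lets the Landau notation =O_ be used at +oo. *)
Canonical pinfty_filter_on (R : realType) : filter_on R :=
  FilterType (pinfty_nbhs R) _.

Definition operator_on (K : pzRingType) (V : lmodType K) (H : set V)
    (T : V -> V) : Prop :=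
  (forall u, H u -> H (T u)) /\
  (forall a u v, H u -> H v -> T (a *: u + v) = a *: T u + T v).

Definition compact_operator (R : realType) (K : pzRingType) (V : lmodType K)
    (H : set V) (nrm : V -> \bar R) (T : V -> V) : Prop :=
  operator_on H T /\
  forall u : nat -> V, (forall n, H (u n) /\ (nrm (u n) <= 1)%E) ->
    exists k : nat -> nat, exists v : V,
      [/\ {homo k : m n / (m < n)%N}, H v &
          nrm (T (u (k n)) - v) @[n --> \oo] --> 0%E].

Definition hilbert_norm (R : realType) (V : lmodType R[i])
    (ip : V -> V -> R[i]) (u : V) : \bar R :=
  (Num.sqrt (complex.Re (ip u u)))%:E.

(* P = |T|, i.e. P is the positive square root of T^* T; the identity
   P^2 = T^* T is written in weak form. *)
Definition is_absolute_value (R : realType) (V : lmodType R[i]) (H : set V)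
    (ip : V -> V -> R[i]) (T P : V -> V) : Prop :=
  [/\ operator_on H P,
      forall u, H u -> 0 <= ip (P u) u &
      forall u v, H u -> H v -> ip (P (P u)) v = ip (T u) (T v)].

(* s is the sequence of eigenvalues of |T|, in nonincreasing order and counted
   with multiplicity; if T has finite rank, s is completed by zeros (and e by
   vectors of the kernel, which is possible as soon as H is
   infinite-dimensional). *)
Definition singular_numbers (R : realType) (V : lmodType R[i]) (H : set V)
    (ip : V -> V -> R[i]) (T : V -> V) (s : nat -> R) : Prop :=
  exists P : V -> V, exists e : nat -> V,
    is_absolute_value H ip T P /\
    [/\ forall n, H (e n),
        forall m n, ip (e m) (e n) = (m == n)%:R,
        forall n, P (e n) = (s n)%:C *: e n,
        forall v, H v -> (forall n, ip v (e n) = 0) -> P v = 0 &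
        (forall n, 0 <= s n) /\ (forall n, s n.+1 <= s n)].

Definition schatten_class (R : realType) (V : lmodType R[i]) (H : set V)
    (ip : V -> V -> R[i]) (p : R) (T : V -> V) : Prop :=
  compact_operator H (hilbert_norm ip) T /\
  exists s : nat -> R, singular_numbers H ip T s /\
    (\sum_(0 <= n <oo) (s n `^ p)%:E < +oo)%E.

Definition disk (R : realType) : Type := {z : R[i] | `|z| < 1}.

Definition extend (R : realType) (f : disk R -> R[i]) (z : R[i]) : R[i] :=
  if insub z is Some w then f w else 0.

Definition analytic (R : realType) (f : disk R -> R[i]) : Prop :=
  forall z : disk R, derivable (extend f : R[i]^o -> R[i]^o) (val z) 1.

Definition cabs (R : realType) (z : R[i]) : R := complex.Re `|z|.

Definition expi (R : realType) (t : R) : R[i] := cos t +i* sin t.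

(* Functions on the unit circle are given as functions on R[i], of which only
   the values at the points exp(it), 0 <= t <= 2 pi, are used; m is dt / 2pi. *)
Definition circle_integral (R : realType) (g : R[i] -> \bar R) : \bar R :=
  (((2 * pi)^-1)%R%:E *
    \int[@lebesgue_measure R]_(t in `[0%R, (2 * pi)%R]) g (expi t))%E.

Definition circle_Cintegral (R : realType) (g : R[i] -> R[i]) : R[i] :=
  fine (circle_integral (fun z => (complex.Re (g z))%:E)) +i*
  fine (circle_integral (fun z => (complex.Im (g z))%:E)).

Definition circle_measurable (R : realType) (g : R[i] -> R[i]) : Prop :=
  measurable_fun `[0, 2 * pi] (fun t : R => complex.Re (g (expi t))) /\
  measurable_fun `[0, 2 * pi] (fun t : R => complex.Im (g (expi t))).

(* Radial limit; its value is junk where the limit does not exist, which is a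
   null subset of the circle when f is in H^1 (Fatou). *)
Definition boundary (R : realType) (f : disk R -> R[i]) (z : R[i]) : R[i] :=
  lim ((extend f (r%:C * z) : R[i]^o) @[r --> (1 : R)^'-]).

Definition hardy (R : realType) (p : R) : set (disk R -> R[i]) :=
  [set f | analytic f /\
    (ereal_sup [set circle_integral
       (fun z => (cabs (extend f (r%:C * z)%R) `^ p)%:E)
       | r in `[0%R, 1%R[ ] < +oo)%E].

Definition hardy2_ip (R : realType) (f g : disk R -> R[i]) : R[i] :=
  circle_Cintegral (fun z => boundary f z * (boundary g z)^*).

Definition comp_op (R : realType) (phi : disk R -> disk R)
    (f : disk R -> R[i]) : disk R -> R[i] := f \o phi.

Definition orlicz_function (R : realType) (Psi : \bar R -> \bar R) : Prop :=
  ([/\ (forall x, 0 <= x -> 0 <= Psi x),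
      (forall x y, 0 <= x -> x <= y -> Psi x <= Psi y),
      (forall (t : R) x y, (0 <= t <= 1)%R -> 0 <= x -> 0 <= y ->
         Psi (t%:E * x + (1 - t)%:E * y) <=
         t%:E * Psi x + (1 - t)%:E * Psi y),
      Psi 0 = 0 &
      Psi +oo = +oo] /\
  [/\ Psi x%:E @[x --> (0%R : R)^'+] --> Psi 0,
      (forall (t x y : R), (0 < t < 1)%R -> (0 <= x)%R -> (0 <= y)%R ->
         x <> y ->
         Psi (t * x + (1 - t) * y)%:E <
         t%:E * Psi x%:E + (1 - t)%:E * Psi y%:E) &
      Psi x%:E * x^-1%:E @[x --> +oo%R] --> +oo])%E.

Definition orlicz_integral (R : realType) (Psi : \bar R -> \bar R)
    (g : R[i] -> R[i]) (C : R) : \bar R :=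
  circle_integral (fun z => Psi (cabs (g z) / C)%:E).

Definition orlicz_space (R : realType) (Psi : \bar R -> \bar R) :
    set (R[i] -> R[i]) :=
  [set g | circle_measurable g /\
    exists C : R, 0 < C /\ (orlicz_integral Psi g C < +oo)%E].

Definition luxemburg_norm (R : realType) (Psi : \bar R -> \bar R)
    (g : R[i] -> R[i]) : \bar R :=
  ereal_inf [set C%:E | C in
    [set C : R | 0 < C /\ (orlicz_integral Psi g C <= 1)%E]].

Definition hardy_orlicz (R : realType) (Psi : \bar R -> \bar R) :
    set (disk R -> R[i]) :=
  [set f | hardy 1 f /\ orlicz_space Psi (boundary f)].

Definition hardy_orlicz_norm (R : realType) (Psi : \bar R -> \bar R)
    (f : disk R -> R[i]) : \bar R :=
  luxemburg_norm Psi (boundary f).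

(* Main.v *)
(* Everything is estimated on the circles |z| = r < 1, and Fatou's lemma is used
   as r tends to 1. The normalized Cauchy kernels at xi / (1 + 4^-j), |xi| = 1,
   are almost orthogonal in H^2, so the Schatten condition bounds the average of
   |C_phi v_j|^2 over j < N by a multiple of N^-d, and by a quasi-monotonicity in
   tau this gives mean (tau / |1 + tau - conj xi phi|^2) = O(N^-d) for
   tau <= 4^-N, uniformly in xi and r; monomials give mean |phi|^(2N) = O(N^-d).

   If G >= 0, mean (G^4) <= 1 and U is the Poisson integral of G, a T T^*
   argument turns these bounds into an estimate of the measures of the sets
   {U(phi) > 2^k}, whose sum with weights k^(d/2) 16^k has small tails. For f
   in a ball of H^Psi take G = Psi(|f^*| / 8)^(1/4): approximating f by
   polynomials B q^4, with B a finite Blaschke product, one gets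
   Psi(|f| / 128)^(1/4) <= U. Since Psi(128 A x) = O(Psi(x) (log Psi(x))^(d/2)),
   the integral of Psi(A |f o phi|) over {U(phi) > 2^k} is uniformly small.
   Off this set f o phi is bounded, and it is small where |phi| <= rho as soon
   as f is small on |z| <= rho. For a subsequence u_k -> v converging locally
   uniformly, mean Psi(A |(u_k - v) o phi|) <= 1 for large k, whatever A is. *)
Require Import Defs.
From HB Require Import structures.
From mathcomp Require Import all_boot all_order all_algebra.
From mathcomp Require Import complex.
From mathcomp Require Import all_classical all_reals all_analysis.
From mathcomp Require Import ring lra.
From mathcomp Require Import measurable_realfun.
Set Implicit Arguments.
Unset Strict Implicit.
Unset Printing Implicit Defensive.

Import Order.TTheory GRing.Theory Num.Theory.
Import numFieldNormedType.Exports.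

Local Open Scope classical_set_scope.
Local Open Scope ring_scope.
Local Open Scope complex_scope.

(** * Arithmetic of the real-valued modulus and of the points of the unit circle *)

Section ComplexBasics.
Context (R : realType).
Local Notation C := R[i].
Implicit Types (x y z w : C) (a b r t : R).

(** The obstacle is an endpoint: Jensen's inequality bounds Psi(|f|) by the Poisson integral of a
    function that is merely in L^1, and an L^1 density gives no summable bound for the level sets of
    U(phi). The T T^* argument is of L^2 type, so there must be room above the exponent 2: with G^4
    = Psi(|f^*| / 8), truncating G at height 2^(k-1) on the k-th level (real interpolation) bounds
    the sum of 16^k m(U(phi) > 2^k) by a multiple of the integral of G^4. The price is that the
    fourth root of Psi(|f|) must lie below a Poisson integral. Convexity is lost, but y |->
    Psi(y^4)^(1/4) still has a nondecreasing quotient by y, and |f|^(1/4) is below the Poisson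
    integral of its boundary values, which is what the factor q^4 supplies. Where U(phi) > 2^k one
    has 1 - |phi| = O(4^-k), so the kernel bound gains k^-d there: half of the exponent d pays for
    the logarithm in the growth of Psi, the other half makes the tails small. On circles |z| = r < 1
    all kernels are bounded, so Tonelli's theorem applies, and the final constants do not depend on
    r. *)

Lemma cabsE z : cabs z = Num.sqrt (complex.Re z ^+ 2 + complex.Im z ^+ 2).
Proof. by rewrite /cabs normc_def. Qed.

Lemma cabs_norm z : (cabs z)%:C = `|z|.
Proof. by rewrite /cabs normc_def. Qed.

Lemma cabs_ge0 z : 0 <= cabs z.
Proof. by rewrite cabsE sqrtr_ge0. Qed.

Lemma cabs_sqr z : cabs z ^+ 2 = complex.Re z ^+ 2 + complex.Im z ^+ 2.
Proof. by rewrite cabsE sqr_sqrtr// addr_ge0 ?sqr_ge0. Qed.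

Lemma RtoC_inj a b : a%:C = b%:C :> C -> a = b.
Proof. by case. Qed.

Lemma cabs_lt z a : (`|z| < a%:C) = (cabs z < a).
Proof. by rewrite -cabs_norm ltcR. Qed.

Lemma cabs0 : cabs (0 : C) = 0.
Proof. by apply: RtoC_inj; rewrite cabs_norm normr0. Qed.

Lemma cabs1 : cabs (1 : C) = 1.
Proof. by apply: RtoC_inj; rewrite cabs_norm normr1. Qed.

Lemma cabs_eq0 z : (cabs z == 0) = (z == 0).
Proof.
apply/eqP/eqP => [h|->]; last exact: cabs0.
by apply/eqP; rewrite -normr_eq0 -cabs_norm h.
Qed.

Lemma cabs_gt0 z : (0 < cabs z) = (z != 0).
Proof. by rewrite lt_def cabs_ge0 cabs_eq0 andbT. Qed.

Lemma cabsM z w : cabs (z * w) = cabs z * cabs w.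
Proof. by apply: RtoC_inj; rewrite rmorphM /= !cabs_norm normrM. Qed.

Lemma cabsV z : cabs z^-1 = (cabs z)^-1.
Proof. by apply: RtoC_inj; rewrite fmorphV /= !cabs_norm normfV. Qed.

Lemma cabsX z n : cabs (z ^+ n) = cabs z ^+ n.
Proof. by apply: RtoC_inj; rewrite rmorphXn /= !cabs_norm normrX. Qed.

Lemma cabsD z w : cabs (z + w) <= cabs z + cabs w.
Proof. by rewrite -lecR rmorphD /= !cabs_norm ler_normD. Qed.

Lemma cabsN z : cabs (- z) = cabs z.
Proof. by rewrite /cabs normrN. Qed.

Lemma cabsC z w : cabs (z - w) = cabs (w - z).
Proof. by rewrite /cabs distrC. Qed.

Lemma cabsB z w : cabs (z - w) <= cabs z + cabs w.
Proof. by rewrite -(cabsN w) cabsD. Qed.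

Lemma cabs_tri z w y : cabs (z - y) <= cabs (z - w) + cabs (w - y).
Proof. by rewrite -[z - y](subrKA w) cabsD. Qed.

Lemma cabs_triB z w : cabs z - cabs w <= cabs (z - w).
Proof. by rewrite lerBlDr -{1}(subrK w z) cabsD. Qed.

Lemma cabs_dist z w : `|cabs z - cabs w| <= cabs (z - w).
Proof. by rewrite ler_norml cabs_triB andbT lerNl opprB cabsC cabs_triB. Qed.

Lemma cabs_sum I (s : seq I) (P : pred I) (F : I -> C) :
  cabs (\sum_(i <- s | P i) F i) <= \sum_(i <- s | P i) cabs (F i).
Proof.
elim/big_ind2: _ => //; first by rewrite cabs0.
by move=> z a w b h1 h2; apply: le_trans (cabsD _ _) _; exact: lerD.
Qed.

Lemma cabs_conj z : cabs z^*%C = cabs z.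
Proof. by rewrite !cabsE; case: z => a b /=; rewrite sqrrN. Qed.

Lemma cabs_real a : cabs a%:C = `|a|.
Proof. by rewrite cabsE /= expr0n addr0 sqrtr_sqr. Qed.

Lemma cabs_nneg a : 0 <= a -> cabs a%:C = a.
Proof. by move=> a0; rewrite cabs_real ger0_norm. Qed.

Lemma Re_le_cabs z : `|complex.Re z| <= cabs z.
Proof. by rewrite -sqrtr_sqr cabsE ler_sqrt ?lerDl ?addr_ge0 ?sqr_ge0. Qed.

Lemma Im_le_cabs z : `|complex.Im z| <= cabs z.
Proof. by rewrite -sqrtr_sqr cabsE ler_sqrt ?lerDr ?addr_ge0 ?sqr_ge0. Qed.

Lemma cabs_le_ReIm z : cabs z <= `|complex.Re z| + `|complex.Im z|.
Proof.
rewrite -[leRHS]ger0_norm ?addr_ge0// -sqrtr_sqr cabsE ler_sqrt ?sqr_ge0//.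
rewrite -(real_normK (num_real (complex.Re z))) -(real_normK (num_real (complex.Im z))).
by rewrite sqrrD lerD2r lerDl mulrn_wge0// mulr_ge0.
Qed.

Lemma Re_le z : complex.Re z <= cabs z.
Proof. exact: le_trans (ler_norm _) (Re_le_cabs z). Qed.

Lemma ReD z w : complex.Re (z + w) = complex.Re z + complex.Re w.
Proof. by case: z w => [a b] []. Qed.
Lemma ImD z w : complex.Im (z + w) = complex.Im z + complex.Im w.
Proof. by case: z w => [a b] []. Qed.
Lemma ReN z : complex.Re (- z) = - complex.Re z.
Proof. by case: z. Qed.
Lemma ImN z : complex.Im (- z) = - complex.Im z.
Proof. by case: z. Qed.
Lemma ReB z w : complex.Re (z - w) = complex.Re z - complex.Re w.
Proof. by rewrite ReD ReN. Qed.
Lemma ImB z w : complex.Im (z - w) = complex.Im z - complex.Im w.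
Proof. by rewrite ImD ImN. Qed.
Lemma ReM z w : complex.Re (z * w) =
  complex.Re z * complex.Re w - complex.Im z * complex.Im w.
Proof. by case: z w => [a b] []. Qed.
Lemma ImM z w : complex.Im (z * w) =
  complex.Re z * complex.Im w + complex.Im z * complex.Re w.
Proof. by case: z w => [a b] []. Qed.
Lemma Re_conj z : complex.Re z^*%C = complex.Re z.
Proof. by case: z. Qed.
Lemma Im_conj z : complex.Im z^*%C = - complex.Im z.
Proof. by case: z. Qed.
Lemma ReZ a z : complex.Re (a%:C * z) = a * complex.Re z.
Proof. by rewrite ReM /= mul0r subr0. Qed.
Lemma ImZ a z : complex.Im (a%:C * z) = a * complex.Im z.
Proof. by rewrite ImM /= mul0r addr0. Qed.

Lemma ReIm_inj z w : complex.Re z = complex.Re w -> complex.Im z = complex.Im w ->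
  z = w.
Proof. by case: z w => [a b] [c d] /= -> ->. Qed.

Lemma conjM z w : (z * w)^*%C = z^*%C * w^*%C.
Proof. exact: (rmorphM (@conjc R)). Qed.
Lemma conjD z w : (z + w)^*%C = z^*%C + w^*%C.
Proof. exact: (rmorphD (@conjc R)). Qed.
Lemma conjN z : (- z)^*%C = - z^*%C.
Proof. exact: (rmorphN (@conjc R)). Qed.
Lemma conjB z w : (z - w)^*%C = z^*%C - w^*%C.
Proof. exact: (rmorphB (@conjc R)). Qed.
Lemma conjX z n : (z ^+ n)^*%C = z^*%C ^+ n.
Proof. exact: (rmorphXn (@conjc R)). Qed.
Lemma conjV z : (z^-1)^*%C = (z^*%C)^-1.
Proof. exact: (fmorphV (@conjc R)). Qed.
Lemma conjR a : (a%:C)^*%C = a%:C :> C.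
Proof. by rewrite /= oppr0. Qed.

Lemma mul_conj z : z * z^*%C = (cabs z ^+ 2)%:C.
Proof.
apply: ReIm_inj; first by rewrite ReM Re_conj Im_conj cabs_sqr /= mulrN opprK -!expr2.
by rewrite ImM Re_conj Im_conj /= mulrN mulrC addNr.
Qed.

Lemma expiD s t : expi (s + t) = expi s * expi t :> C.
Proof.
by apply: ReIm_inj; rewrite ?ReM ?ImM /= ?cosD ?sinD// addrC mulrC [X in _ + X]mulrC.
Qed.

Lemma expi0 : expi 0 = 1 :> C.
Proof. by rewrite /expi cos0 sin0. Qed.

Lemma expiN t : expi (- t) = (expi t)^*%C :> C.
Proof. by rewrite /expi cosN sinN. Qed.

Lemma expi_pi2 : expi (2 * pi) = 1 :> C.
Proof. by rewrite mulrC mulr_natr /expi cos2pi sin2pi. Qed.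

Lemma cabs_expi t : cabs (expi t : C) = 1.
Proof. by rewrite cabsE /= cos2Dsin2 sqrtr1. Qed.

Lemma expi_neq0 t : expi t != 0 :> C.
Proof. by rewrite -cabs_gt0 cabs_expi. Qed.

Lemma expiV t : (expi t)^-1 = (expi t)^*%C :> C.
Proof.
apply: (mulfI (expi_neq0 t)); rewrite mulfV ?expi_neq0//.
by rewrite mul_conj cabs_expi expr1n.
Qed.

(** The closed range of angles lets the extreme value theorem on [[0, 2 * pi]] cover the whole
    circle, as in [circ_sup]. *)
Lemma polar z : exists2 t, 0 <= t <= 2 * pi & z = (cabs z)%:C * expi t.
Proof.
have [->|z0] := eqVneq z 0.
  by exists 0; rewrite ?lexx ?mulr_ge0 ?pi_ge0// cabs0 mul0r.
have c0 : 0 < cabs z by rewrite cabs_gt0.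
set a := complex.Re z / cabs z; set b := complex.Im z / cabs z.
have ab : a ^+ 2 + b ^+ 2 = 1.
  by rewrite /a /b !expr_div_n -mulrDl -cabs_sqr divff// expf_neq0// gt_eqF.
have a1 : -1 <= a <= 1.
  by rewrite -ler_norml -sqr_norm_eq1 // || (have : a ^+ 2 <= 1 by rewrite -ab lerDl sqr_ge0); rewrite -ler_sqrt ?ltr01// sqrtr_sqr sqrtr1 ler_norml.
have za : z = (cabs z)%:C * (a +i* b).
  apply: ReIm_inj; rewrite ?ReZ ?ImZ /= /a /b mulrC divfK// gt_eqF//.
(* [acos] only describes the upper half-plane; below the real axis the angle is reflected to
   [2 * pi - acos a]. *)
have [b0|b0] := leP 0 b.
  exists (acos a).
    rewrite acos_ge0//= (le_trans (acos_lepi a1))// ler_peMl ?pi_ge0// ler1n//.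
  rewrite {1}za /expi acosK ?in_itv//= sin_acos//.
  by congr (_ * (_ +i* _)); rewrite -ab addrAC subrr add0r sqrtr_sqr ger0_norm.
exists (2 * pi - acos a).
  rewrite subr_ge0 (le_trans (acos_lepi a1)) ?ler_peMl ?pi_ge0 ?ler1n//=.
  by rewrite gerBl acos_ge0.
rewrite {1}za expiD expi_pi2 mul1r expiN /expi /= acosK ?in_itv//= sin_acos//.
by congr (_ * (_ +i* _)); rewrite -ab addrAC subrr add0r sqrtr_sqr ltr0_norm// opprK.
Qed.

End ComplexBasics.

(** * Limits, continuity and complex differentiability measured by the real modulus *)

Section ComplexTopology.
Context (R : realType).
Local Notation C := R[i].
Implicit Types (z w : C) (a b r t : R).

Lemma complex_pos z : 0 < z -> z = (complex.Re z)%:C /\ 0 < complex.Re z.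
Proof. by case: z => a b; rewrite ltcE /= => /andP[/eqP h1 h2]; split => //; congr (_ +i* _). Qed.

Lemma cvg_cabsP T (F : set_system T) (FF : Filter F) (f : T -> C) (l : C) :
  (f x : C^o) @[x --> F] --> (l : C^o) <->
  (forall e : R, 0 < e -> \forall x \near F, cabs (f x - l) < e).
Proof.
split=> [/cvgrPdist_lt h e e0|h].
  have e0' : 0 < e%:C :> C by rewrite ltcR.
  have := h _ e0'; apply: filterS => x /=.
  by rewrite cabs_lt cabsC.
apply/cvgrPdist_lt => e e0.
have [er e0'] := complex_pos e0.
have := h _ e0'; apply: filterS => x /=.
by rewrite er cabs_lt cabsC.
Qed.

Lemma cvg_cabs T (F : set_system T) (FF : Filter F) (f : T -> C) (l : C) :
  (f x : C^o) @[x --> F] --> (l : C^o) -> cabs (f x) @[x --> F] --> cabs l.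
Proof.
move=> /cvg_cabsP h; apply/cvgrPdist_lt => e e0.
have := h _ e0; apply: filterS => x; apply: le_lt_trans.
by rewrite distrC; exact: cabs_dist.
Qed.

Lemma cvg_Re T (F : set_system T) (FF : Filter F) (f : T -> C) (l : C) :
  (f x : C^o) @[x --> F] --> (l : C^o) -> complex.Re (f x) @[x --> F] --> complex.Re l.
Proof.
move=> /cvg_cabsP h; apply/cvgrPdist_lt => e e0.
have := h _ e0; apply: filterS => x; apply: le_lt_trans.
by rewrite distrC -ReB; exact: Re_le_cabs.
Qed.

Lemma cvg_Im T (F : set_system T) (FF : Filter F) (f : T -> C) (l : C) :
  (f x : C^o) @[x --> F] --> (l : C^o) -> complex.Im (f x) @[x --> F] --> complex.Im l.
Proof.
move=> /cvg_cabsP h; apply/cvgrPdist_lt => e e0.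
have := h _ e0; apply: filterS => x; apply: le_lt_trans.
by rewrite distrC -ImB; exact: Im_le_cabs.
Qed.

Lemma cvg_ReIm T (F : set_system T) (FF : Filter F) (f : T -> C) (l : C) :
  complex.Re (f x) @[x --> F] --> complex.Re l ->
  complex.Im (f x) @[x --> F] --> complex.Im l ->
  (f x : C^o) @[x --> F] --> (l : C^o).
Proof.
move=> /cvgrPdist_lt h1 /cvgrPdist_lt h2; apply/cvg_cabsP => e e0.
have e2 : 0 < e / 2 by rewrite divr_gt0.
near=> x; apply: le_lt_trans (cabs_le_ReIm _) _.
rewrite ReB ImB [ltRHS]splitr ltrD// distrC.
  by near: x; exact: h1.
by near: x; exact: h2.
Unshelve. all: by end_near. Qed.

Lemma cvg_conj T (F : set_system T) (FF : Filter F) (f : T -> C) (l : C) :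
  (f x : C^o) @[x --> F] --> (l : C^o) -> ((f x)^*%C : C^o) @[x --> F] --> (l^*%C : C^o).
Proof.
move=> /cvg_cabsP h; apply/cvg_cabsP => e /h; apply: filterS => x.
by rewrite -conjB cabs_conj.
Qed.

Lemma cvg_RtoC T (F : set_system T) (FF : Filter F) (f : T -> R) (l : R) :
  f x @[x --> F] --> l -> ((f x)%:C : C^o) @[x --> F] --> (l%:C : C^o).
Proof. by move=> h; apply: cvg_ReIm => //=; exact: cvg_cst. Qed.

Lemma cvgC_cst T (F : set_system T) (FF : Filter F) (c : C) :
  (c : C^o) @[x --> F] --> (c : C^o).
Proof. by apply: cvg_ReIm; exact: cvg_cst. Qed.

Lemma cvgC_add T (F : set_system T) (FF : Filter F) (f g : T -> C) (l m : C) :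
  (f x : C^o) @[x --> F] --> (l : C^o) -> (g x : C^o) @[x --> F] --> (m : C^o) ->
  (f x + g x : C^o) @[x --> F] --> (l + m : C^o).
Proof.
move=> hf hg; apply: cvg_ReIm; rewrite ?ReD ?ImD.
  by under eq_fun do rewrite ReD; apply: cvgD; exact: cvg_Re.
by under eq_fun do rewrite ImD; apply: cvgD; exact: cvg_Im.
Qed.

Lemma cvgC_opp T (F : set_system T) (FF : Filter F) (f : T -> C) (l : C) :
  (f x : C^o) @[x --> F] --> (l : C^o) ->
  (- f x : C^o) @[x --> F] --> (- l : C^o).
Proof.
move=> hf; apply: cvg_ReIm; rewrite ?ReN ?ImN.
  by under eq_fun do rewrite ReN; apply: cvgN; exact: cvg_Re.
by under eq_fun do rewrite ImN; apply: cvgN; exact: cvg_Im.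
Qed.

Lemma cvgC_mul T (F : set_system T) (FF : Filter F) (f g : T -> C) (l m : C) :
  (f x : C^o) @[x --> F] --> (l : C^o) -> (g x : C^o) @[x --> F] --> (m : C^o) ->
  (f x * g x : C^o) @[x --> F] --> (l * m : C^o).
Proof.
move=> hf hg; apply: cvg_ReIm; rewrite ?ReM ?ImM.
  by under eq_fun do rewrite ReM; apply: cvgB; apply: cvgM;
    (exact: cvg_Re || exact: cvg_Im).
by under eq_fun do rewrite ImM; apply: cvgD; apply: cvgM;
    (exact: cvg_Re || exact: cvg_Im).
Qed.

Lemma cvgC_inv T (F : set_system T) (FF : Filter F) (f : T -> C) (l : C) : l != 0 ->
  (f x : C^o) @[x --> F] --> (l : C^o) ->
  ((f x)^-1 : C^o) @[x --> F] --> (l^-1 : C^o).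
Proof.
have E z : z^-1 = ((cabs z ^+ 2)^-1)%:C * z^*%C.
  have [->|z0] := eqVneq z 0; first by rewrite cabs0 expr0n invr0 (_ : 0^-1 = 0 :> R) ?mul0r// invr0.
  apply: (mulfI z0); rewrite mulfV// mulrCA mul_conj -rmorphM /= mulVf//.
  by rewrite expf_neq0// cabs_eq0.
move=> l0 hf; rewrite E; under eq_fun do rewrite E.
apply: cvgC_mul; last exact: cvg_conj.
apply: cvg_RtoC; apply: cvgV; first by rewrite expf_neq0// cabs_eq0.
by under eq_fun do rewrite expr2; rewrite expr2; apply: cvgM; exact: cvg_cabs.
Qed.

(** The balls of [C^o] have radii in the partially ordered field [C]; this filter uses real radii,
    and the limit rules above, which hold for any filter, give the continuity rules. *)
Definition cnbhs z : set_system C :=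
  [set P | exists2 d : R, 0 < d & forall w, cabs (w - z) < d -> P w].

#[local] Instance cnbhs_filter z : Filter (cnbhs z).
Proof.
split.
- by exists 1.
- move=> P Q [d d0 hd] [e e0 he]; exists (Num.min d e); first by rewrite lt_min d0.
  by move=> w; rewrite lt_min => /andP[/hd ? /he].
- by move=> P Q PQ [d d0 hd]; exists d => // w /hd /PQ.
Qed.

Variant ccont (F : C -> C) z : Prop :=
  Ccont of (F w : C^o) @[w --> cnbhs z] --> (F z : C^o).

Lemma ccontP (F : C -> C) z : ccont F z <->
  forall e : R, 0 < e -> exists2 d, 0 < d &
    forall w, cabs (w - z) < d -> cabs (F w - F z) < e.
Proof.
split=> [[/cvg_cabsP h] e /h//|h].
by split; apply/cvg_cabsP => e /h.
Qed.

Lemma ccont_cst c z : ccont (fun=> c) z.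
Proof. by split; exact: cvgC_cst. Qed.

Lemma ccontD (F G : C -> C) z : ccont F z -> ccont G z -> ccont (fun w => F w + G w) z.
Proof. move=> [hF] [hG]; split; exact: (@cvgC_add C (cnbhs z) (cnbhs_filter z) F G (F z) (G z)). Qed.

Lemma ccontN (F : C -> C) z : ccont F z -> ccont (fun w => - F w) z.
Proof. move=> [hF]; split; exact: (@cvgC_opp C (cnbhs z) (cnbhs_filter z) F (F z)). Qed.

Lemma ccontM (F G : C -> C) z : ccont F z -> ccont G z -> ccont (fun w => F w * G w) z.
Proof. move=> [hF] [hG]; split; exact: (@cvgC_mul C (cnbhs z) (cnbhs_filter z) F G (F z) (G z)). Qed.

Lemma ccontV (F : C -> C) z : F z != 0 -> ccont F z -> ccont (fun w => (F w)^-1) z.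
Proof. move=> F0 [hF]; split; exact: (@cvgC_inv C (cnbhs z) (cnbhs_filter z) F (F z)). Qed.

Lemma ccont_id z : ccont id z.
Proof. by apply/ccontP => e e0; exists e. Qed.

Lemma ccont_comp (F G : C -> C) z : ccont G z -> ccont F (G z) ->
  ccont (fun w => F (G w)) z.
Proof.
move=> /ccontP cG /ccontP cF; apply/ccontP => e /cF[d /cG[d' d0' h'] h].
by exists d' => // w /h' /h.
Qed.

(** Caratheodory's form of the complex derivative, whose value is [psi z]. No quotient occurs, so
    the rules for sums, products and compositions reduce to identities checked by [ring]. *)
Definition cdiff (F : C -> C) z := exists2 psi : C -> C,
  ccont psi z & forall w, F w = F z + psi w * (w - z).

(** The identity in [cdiff] is required for every [w], so locality is not automatic: the slope is
    replaced by the difference quotient away from [z]. *)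
Lemma cdiff_near (F G : C -> C) z d : 0 < d ->
  (forall w, cabs (w - z) < d -> F w = G w) -> cdiff F z -> cdiff G z.
Proof.
move=> d0 FG [psi cpsi Fe].
exists (fun w => if w == z then psi z else (G w - G z) / (w - z)); last first.
  move=> w; case: eqVneq => [->|wz]; first by rewrite subrr mulr0 addr0.
  by rewrite divfK ?subr_eq0// addrC subrK.
have FGz : F z = G z by apply: FG; rewrite subrr cabs0.
move/ccontP : cpsi => cpsi; apply/ccontP => e /cpsi[d1 d10 h].
exists (Num.min d d1) => [|w]; first by rewrite lt_min d0.
rewrite lt_min => /andP[w1 w2]; rewrite eqxx; case: eqVneq => [wz|wz].
  by rewrite subrr cabs0 (le_lt_trans _ (h z _)) ?cabs_ge0// subrr cabs0.
rewrite -FG// -FGz Fe addrAC subrr add0r mulfK ?subr_eq0//; exact: h.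
Qed.

Lemma cdiff_cst c z : cdiff (fun=> c) z.
Proof.
by exists (fun=> 0) => [|w]; [exact: ccont_cst|rewrite mul0r addr0].
Qed.

Lemma cdiff_id z : cdiff id z.
Proof. by exists (fun=> 1) => [|w]; [exact: ccont_cst|rewrite mul1r addrC subrK]. Qed.

Lemma cdiff_cts (F : C -> C) z : cdiff F z -> ccont F z.
Proof.
move=> [psi cpsi Fe]; have -> : F = (fun w => F z + psi w * (w - z)) by apply/funext.
apply: ccontD; first exact: ccont_cst.
have h1 := ccontD (@ccont_id z) (ccont_cst (- z) z).
exact: (ccontM cpsi h1).
Qed.

Lemma cdiffD (F G : C -> C) z : cdiff F z -> cdiff G z -> cdiff (fun w => F w + G w) z.
Proof.
move=> [p cp Fp] [q cq Gq]; exists (fun w => p w + q w).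
  exact: ccontD.
by move=> w; rewrite Fp Gq; ring.
Qed.

Lemma cdiffM (F G : C -> C) z : cdiff F z -> cdiff G z -> cdiff (fun w => F w * G w) z.
Proof.
move=> dF dG; move: (cdiff_cts dG) => cG; move: dF dG => [p cp Fp] [q cq Gq].
exists (fun w => p w * G w + F z * q w).
  have h1 := ccontM (ccont_cst (F z) z) cq.
  exact: (ccontD (ccontM cp cG) h1).
by move=> w; rewrite Fp (Gq w); ring.
Qed.

Lemma cdiffN (F : C -> C) z : cdiff F z -> cdiff (fun w => - F w) z.
Proof.
move=> [p cp Fp]; exists (fun w => - p w); first exact: ccontN.
by move=> w; rewrite Fp; ring.
Qed.

Lemma cdiffB (F G : C -> C) z : cdiff F z -> cdiff G z -> cdiff (fun w => F w - G w) z.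
Proof. by move=> dF dG; apply: cdiffD => //; exact: cdiffN. Qed.

Lemma cdiffX (F : C -> C) n z : cdiff F z -> cdiff (fun w => F w ^+ n) z.
Proof.
move=> dF; elim: n => [|n IH]; first exact: cdiff_cst.
have -> : (fun w => F w ^+ n.+1) = (fun w => F w * F w ^+ n).
  by apply/funext => w; rewrite exprS.
exact: cdiffM.
Qed.

Lemma cdiff_comp (F G : C -> C) z : cdiff G z -> cdiff F (G z) ->
  cdiff (fun w => F (G w)) z.
Proof.
move=> dG; move: (cdiff_cts dG) => cG; move: dG => [q cq Gq] [p cp Fp].
exists (fun w => p (G w) * q w); last first.
  by move=> w; rewrite (Fp (G w)) (Gq w); ring.
exact: (ccontM (ccont_comp cG cp) cq).
Qed.

Lemma cdiff_inv z : z != 0 -> cdiff (fun w => w^-1) z.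
Proof.
(* The convention [0^-1 = 0] breaks the slope identity at [w = 0], so the function is first altered
   at that point, which lies at distance [cabs z] from [z]. *)
move=> z0; apply: (@cdiff_near (fun w => if w == 0 then z^-1 - z^-1 * w^-1 * (w - z) else w^-1) _ z (cabs z)).
- by rewrite cabs_gt0.
- move=> w; case: eqVneq => // ->; rewrite sub0r cabsN ltxx//.
exists (fun w => - (z^-1 * w^-1)).
  apply: ccontN; apply: ccontM; first exact: ccont_cst.
  by apply: ccontV => //; exact: ccont_id.
move=> w; rewrite (negbTE z0); case: eqVneq => [_|w0]; first by ring.
by field; rewrite z0 w0.
Qed.

Lemma cdiffV (F : C -> C) z : F z != 0 -> cdiff F z -> cdiff (fun w => (F w)^-1) z.
Proof. by move=> F0 dF; apply: (cdiff_comp dF); exact: cdiff_inv. Qed.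

Lemma derivable_cdiff (F : C -> C) z :
  derivable (F : C^o -> C^o) z 1 <-> cdiff F z.
Proof.
split.
  move=> /cvg_ex[/= l hl].
  exists (fun w => if w == z then l else (F w - F z) / (w - z)); last first.
    move=> w; case: eqVneq => [->|wz]; first by rewrite subrr mulr0 addr0.
    by rewrite divfK ?subr_eq0// addrC subrK.
  move/cvg_cabsP : hl => hl; apply/ccontP => e e0.
  have := hl _ e0; rewrite near_withinE => /nbhs_ballP[d /= d0 hd].
  have [dr d0'] := complex_pos d0.
  exists (complex.Re d) => //.
  move=> w wz; rewrite eqxx; case: eqVneq => [_|wz0]; first by rewrite subrr cabs0.
  have := hd (w - z); rewrite -ball_normE /= sub0r normrN dr cabs_lt => /(_ wz).
  rewrite subr_eq0 => /(_ wz0).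
  by rewrite /shift /= -[_ *: 1]/((w - z) * 1) mulr1 subrK -[_ *: _]/(_ * _) mulrC.
move=> [p cp Fp]; apply/cvg_ex; exists (p z).
move/ccontP : cp => cp; apply/cvg_cabsP => e /cp[d d0 hd].
rewrite near_withinE; apply/nbhs_ballP; exists d%:C => /=; first by rewrite ltcR.
move=> h; rewrite -ball_normE /= sub0r normrN cabs_lt => hd1 h0.
rewrite /shift /= -[_ *: 1]/(h * 1) mulr1 -[_ *: _]/(_ * _).
rewrite (Fp (h + z)) addrAC subrr add0r addrK mulrC mulfK//.
by apply: hd; rewrite addrK.
Qed.

Lemma extendE (f : disk R -> C) (z : disk R) : extend f (val z) = f z.
Proof. by rewrite /extend valK. Qed.

Lemma disk_cabs (z : disk R) : cabs (val z) < 1.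
Proof. by rewrite -cabs_lt; exact: (valP z). Qed.

Lemma in_disk z : cabs z < 1 -> exists w : disk R, val w = z.
Proof.
move=> h; have h' : `|z| < 1 by rewrite -[1]/(1%:C) cabs_lt.
by exists (exist _ z h').
Qed.

Lemma analyticP (f : disk R -> C) :
  analytic f <-> forall z, cabs z < 1 -> cdiff (extend f) z.
Proof.
split=> [h z /in_disk[w <-]|h z]; first by apply/derivable_cdiff/h.
by apply/derivable_cdiff/h/disk_cabs.
Qed.

End ComplexTopology.

(** * Integrals of continuous real functions over segments *)

Section IntervalIntegral.
Context (R : realType).
Implicit Types (f g : R -> R) (a b c x : R).
Local Notation mu := (@lebesgue_measure R).

Definition itvint f a b : R := \int[mu]_(x in `[a, b]) f x.

Definition ctsab f a b := forall x, a <= x <= b -> {for x, continuous f}.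

Lemma ctsab_integrable f a b : ctsab f a b -> mu.-integrable `[a, b] (EFin \o f).
Proof.
move=> cf; apply: continuous_compact_integrable; first exact: segment_compact.
apply: continuous_in_subspaceT => x /set_mem /=; rewrite in_itv /= => /cf.
exact.
Qed.

Lemma itvint_split f a b c : ctsab f a c -> a <= b <= c ->
  itvint f a c = itvint f a b + itvint f b c.
Proof.
move=> cf /andP[ab bc]; apply/eqP; rewrite addrC -subr_eq; apply/eqP.
have ifc := ctsab_integrable cf.
rewrite /itvint Rintegral_itvB ?bnd_simp//.
apply: Rintegral_itv_obnd_cbnd; apply: integrableS ifc => //.
by apply: subset_itvr; rewrite bnd_simp.
Qed.

Lemma itvint_le f a b M : a <= b -> ctsab f a b ->
  (forall x, a <= x <= b -> `|f x| <= M) -> `|itvint f a b| <= M * (b - a).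
Proof.
move=> ab cf fM; have ifc := ctsab_integrable cf.
apply: le_trans (le_normr_Rintegral _ _) _ => //.
have -> : M * (b - a) = \int[mu]_(x in `[a, b]) M.
  rewrite Rintegral_cst//= lebesgue_measure_itv /= lte_fin.
  by move: ab; rewrite le_eqVlt => /predU1P[->|->]//; rewrite ltxx subrr.
apply: le_Rintegral => //.
- exact: integrable_norm.
- apply: ctsab_integrable => x _; exact: cvg_cst.
Qed.

Lemma ctsabB f g a b : ctsab f a b -> ctsab g a b -> ctsab (fun x => f x - g x) a b.
Proof. by move=> cf cg x hx; apply: cvgB; [exact: cf|exact: cg]. Qed.

Lemma ctsab_cst c a b : ctsab (fun=> c) a b.
Proof. by move=> x _; exact: cvg_cst. Qed.

Lemma itvintB f g a b : ctsab f a b -> ctsab g a b ->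
  itvint (fun x => f x - g x) a b = itvint f a b - itvint g a b.
Proof. by move=> cf cg; apply: RintegralB => //; exact: ctsab_integrable. Qed.

Lemma itvint_cst a b c : a <= b -> itvint (fun=> c) a b = c * (b - a).
Proof.
move=> ab; rewrite /itvint Rintegral_cst//= lebesgue_measure_itv /= lte_fin.
by move: ab; rewrite le_eqVlt => /predU1P[->|->]//; rewrite ltxx subrr.
Qed.

End IntervalIntegral.

(** * Goursat's lemma on rectangles, without continuity of the derivatives *)

Section Goursat.
Context (R : realType).
Variables u v : R -> R -> R.

(* The two functions have total differentials with d_s u = d_t v, so that the
   contour integral below is the one that Green's formula makes vanish. *)
Definition green_at s t := exists a b c : R, forall e : R, 0 < e ->
  exists2 d : R, 0 < d & forall s' t', `|s' - s| < d -> `|t' - t| < d ->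
    `|u s' t' - (u s t + a * (s' - s) + b * (t' - t))| <= e * (`|s' - s| + `|t' - t|) /\
    `|v s' t' - (v s t + c * (s' - s) + a * (t' - t))| <= e * (`|s' - s| + `|t' - t|).

(** The counterclockwise integral of [u dt + v ds] around the rectangle. *)
Definition contour s1 s2 t1 t2 : R :=
  itvint (u s2) t1 t2 - itvint (u s1) t1 t2 -
  itvint (v^~ t2) s1 s2 + itvint (v^~ t1) s1 s2.

Variables s1 s2 t1 t2 : R.
Hypothesis s12 : s1 <= s2.
Hypothesis t12 : t1 <= t2.
Hypothesis gr : forall s t, s1 <= s <= s2 -> t1 <= t <= t2 -> green_at s t.

Let affine_cts (w : R -> R) x k0 : 
  (forall e : R, 0 < e -> exists2 d : R, 0 < d & forall y, `|y - x| < d -> `|w y - (w x + k0 * (y - x))| <= e * `|y - x|) ->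
  {for x, continuous w}.
Proof.
move=> h; have [d d0 hd] := h 1 ltr01.
apply/cvgrPdist_le => /= e e0.
have k1 : 0 < 1 + `|k0| by rewrite ltr_pwDl.
near=> y; have yx : `|y - x| < d.
  by near: y; exists d => //= y; rewrite distrC.
have yx2 : `|y - x| < e / (1 + `|k0|).
  near: y; exists (e / (1 + `|k0|)); first by rewrite /= divr_gt0.
  by move=> y /=; rewrite distrC.
have := hd _ yx; rewrite mul1r => h1.
have -> : w x - w y = - (w y - (w x + k0 * (y - x))) - k0 * (y - x) by ring.
rewrite (le_trans (ler_normB _ _))// normrN normrM.
move: yx2; rewrite ltr_pdivlMr// => yx2; nra.
Unshelve. all: by end_near. Qed.

Lemma green_cts_u s t : s1 <= s <= s2 -> t1 <= t <= t2 -> {for t, continuous (u s)}.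
Proof.
move=> hs ht; have [a [b [c h]]] := gr hs ht.
apply: (@affine_cts _ _ b) => e /h[d d0 hd]; exists d => // y yt.
have := hd s y; rewrite subrr normr0 => /(_ d0 yt)[+ _].
by rewrite mulr0 addr0 add0r.
Qed.

Lemma green_cts_v s t : s1 <= s <= s2 -> t1 <= t <= t2 -> {for s, continuous (v^~ t)}.
Proof.
move=> hs ht; have [a [b [c h]]] := gr hs ht.
apply: (@affine_cts _ _ c) => e /h[d d0 hd]; exists d => // y yt.
have := hd y t; rewrite subrr normr0 => /(_ yt d0)[_ +].
by rewrite mulr0 !addr0.
Qed.

Let cu s a b : s1 <= s <= s2 -> t1 <= a -> b <= t2 -> ctsab (u s) a b.
Proof.
move=> hs ha hb x /andP[ax xb]; apply: green_cts_u => //.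
by rewrite (le_trans ha ax) (le_trans xb hb).
Qed.

Let cv t a b : t1 <= t <= t2 -> s1 <= a -> b <= s2 -> ctsab (v^~ t) a b.
Proof.
move=> ht ha hb x /andP[ax xb]; apply: green_cts_v => //.
by rewrite (le_trans ha ax) (le_trans xb hb).
Qed.

Let A := s2 - s1.
Let B := t2 - t1.
Let inr n (p : R * R) := [/\ s1 <= p.1, t1 <= p.2,
  p.1 + A / 2 ^+ n <= s2 & p.2 + B / 2 ^+ n <= t2].
Let W n (p : R * R) := contour p.1 (p.1 + A / 2 ^+ n) p.2 (p.2 + B / 2 ^+ n).

Let half n (C : R) : C / 2 ^+ n = C / 2 ^+ n.+1 + C / 2 ^+ n.+1.
Proof. by rewrite exprS invfM mulrCA [X in X + _]mulrC [X in _ + X]mulrC -splitr. Qed.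

Let A0 n : 0 <= A / 2 ^+ n.
Proof. by rewrite divr_ge0 ?exprn_ge0// subr_ge0. Qed.
Let B0 n : 0 <= B / 2 ^+ n.
Proof. by rewrite divr_ge0 ?exprn_ge0// subr_ge0. Qed.

(** Bisection: the inner edges cancel, so the integral is the sum over the four quarters, and one of
    them carries at least a quarter of its absolute value. *)
Let step n p : inr n p -> exists q, [/\ inr n.+1 q,
  p.1 <= q.1, q.1 + A / 2 ^+ n.+1 <= p.1 + A / 2 ^+ n,
  p.2 <= q.2 /\ q.2 + B / 2 ^+ n.+1 <= p.2 + B / 2 ^+ n &
  `|W n p| <= 4 * `|W n.+1 q|].
Proof.
case: p => s t [/= hs ht hs' ht'].
rewrite /W /=; move: hs' ht'; rewrite !(half n).
set a := A / 2 ^+ n.+1; set b := B / 2 ^+ n.+1 => hs' ht'.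
have a0 : 0 <= a by exact: A0.
have b0 : 0 <= b by exact: B0.
have E : contour s (s + (a + a)) t (t + (b + b)) =
  contour s (s + a) t (t + b) + contour (s + a) (s + a + a) t (t + b) +
  contour s (s + a) (t + b) (t + b + b) +
  contour (s + a) (s + a + a) (t + b) (t + b + b).
  rewrite /contour !addrA.
  rewrite (@itvint_split _ (u (s + a + a)) t (t + b) (t + b + b)); last 2 first.
  - by apply: cu; lra.
  - lra.
  rewrite (@itvint_split _ (u s) t (t + b) (t + b + b)); last 2 first.
  - by apply: cu; lra.
  - lra.
  rewrite (@itvint_split _ (v^~ (t + b + b)) s (s + a) (s + a + a)); last 2 first.
  - by apply: cv; lra.
  - lra.
  rewrite (@itvint_split _ (v^~ t) s (s + a) (s + a + a)); last 2 first.
  - by apply: cv; lra.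
  - lra.
  ring.
rewrite E.
set w1 := contour _ _ _ _; set w2 := contour _ _ _ _.
set w3 := contour _ _ _ _; set w4 := contour _ _ _ _.
have : `|w1 + w2 + w3 + w4| <= 4 * `|w1| \/ `|w1 + w2 + w3 + w4| <= 4 * `|w2| \/
   `|w1 + w2 + w3 + w4| <= 4 * `|w3| \/ `|w1 + w2 + w3 + w4| <= 4 * `|w4|.
  have N1 := ler_normD (w1 + w2 + w3) w4.
  have N2 := ler_normD (w1 + w2) w3.
  have N3 := ler_normD w1 w2.
  have [|h1] := leP `|w1 + w2 + w3 + w4| (4 * `|w1|); first by left.
  have [|h2] := leP `|w1 + w2 + w3 + w4| (4 * `|w2|); first by right; left.
  have [|h3] := leP `|w1 + w2 + w3 + w4| (4 * `|w3|); first by right; right; left.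
  right; right; right; lra.
move=> [h|[h|[h|h]]].
- by exists (s, t); rewrite /inr /= -/a -/b; split => //; try split; lra.
- by exists (s + a, t); rewrite /inr /= -/a -/b; split => //; try split; lra.
- by exists (s, t + b); rewrite /inr /= -/a -/b; split => //; try split; lra.
- by exists (s + a, t + b); rewrite /inr /= -/a -/b; split => //; try split; lra.
Qed.

Let local_bound s t e : s1 <= s <= s2 -> t1 <= t <= t2 -> 0 < e ->
  exists2 d : R, 0 < d & forall n p, inr n p ->
    p.1 <= s <= p.1 + A / 2 ^+ n -> p.2 <= t <= p.2 + B / 2 ^+ n ->
    A / 2 ^+ n + B / 2 ^+ n < d ->
    `|W n p| <= 2 * e * (A / 2 ^+ n + B / 2 ^+ n) ^+ 2.
Proof.
move=> hs ht e0; have [a [b [c h]]] := gr hs ht.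
have [d d0 hd] := h _ e0; exists d => // n [s' t'] [/= hs1 ht1 hs2 ht2].
rewrite /W /=; move: hs2 ht2 (A0 n) (B0 n).
set x := A / 2 ^+ n; set y := B / 2 ^+ n => hs2 ht2 x0 y0 hss htt xyd.
have c1 : ctsab (u (s' + x)) t' (t' + y) by apply: cu; lra.
have c2 : ctsab (u s') t' (t' + y) by apply: cu; lra.
have c3 : ctsab (v^~ (t' + y)) s' (s' + x) by apply: cv; lra.
have c4 : ctsab (v^~ t') s' (s' + x) by apply: cv; lra.
have k1 : ctsab (fun=> a * x) t' (t' + y) by exact: ctsab_cst.
have k2 : ctsab (fun=> a * y) s' (s' + x) by exact: ctsab_cst.
(* Opposite edges are paired. The affine parts contribute [a * x * y] to both pairs and cancel: this
   is where the equality of the two crossed derivatives enters. *)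
have -> : contour s' (s' + x) t' (t' + y) =
  itvint (fun r => (u (s' + x) r - u s' r) - a * x) t' (t' + y) -
  itvint (fun r => (v r (t' + y) - v r t') - a * y) s' (s' + x).
  rewrite (itvintB (ctsabB c1 c2) k1) (itvintB c1 c2).
  rewrite (itvintB (ctsabB c3 c4) k2) (itvintB c3 c4).
  rewrite !itvint_cst ?lerDl// /contour; ring.
have H r q : s' <= r <= s' + x -> t' <= q <= t' + y ->
    `|u r q - (u s t + a * (r - s) + b * (q - t))| <= e * (x + y) /\
    `|v r q - (v s t + c * (r - s) + a * (q - t))| <= e * (x + y).
  move=> hr hq.
  have h1 : `|r - s| <= x by rewrite ler_norml; lra.
  have h2 : `|q - t| <= y by rewrite ler_norml; lra.
  have [||h3 h4] := hd r q; [lra|lra|].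
  have h5 : e * (`|r - s| + `|q - t|) <= e * (x + y).
    by rewrite ler_pM2l// lerD.
  by rewrite (le_trans h3 h5) (le_trans h4 h5).
apply: le_trans (ler_normB _ _) _.
have -> : 2 * e * (x + y) ^+ 2 = 2 * e * (x + y) * (t' + y - t') + 2 * e * (x + y) * (s' + x - s') by ring.
apply: lerD; apply: itvint_le; rewrite ?lerDl//.
- by do 2 apply: ctsabB => //.
- move=> r hr; have [|h1 _] := H (s' + x) r _ hr; first lra.
  have [|h2 _] := H s' r _ hr; first lra.
  move: h1 h2; rewrite !ler_norml; lra.
- by do 2 apply: ctsabB => //.
- move=> r hr; have [|_ h1] := H r (t' + y) hr; first lra.
  have [|_ h2] := H r t' hr; first lra.
  move: h1 h2; rewrite !ler_norml; lra.
Qed.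

Lemma goursat : contour s1 s2 t1 t2 = 0.
Proof.
have [f hf] : exists f : nat * (R * R) -> R * R, forall np, inr np.1 np.2 ->
  [/\ inr np.1.+1 (f np),
  np.2.1 <= (f np).1, (f np).1 + A / 2 ^+ np.1.+1 <= np.2.1 + A / 2 ^+ np.1,
  np.2.2 <= (f np).2 /\ (f np).2 + B / 2 ^+ np.1.+1 <= np.2.2 + B / 2 ^+ np.1 &
  `|W np.1 np.2| <= 4 * `|W np.1.+1 (f np)|].
  suff H (np : nat * (R * R)) : exists q : R * R, inr np.1 np.2 ->
     [/\ inr np.1.+1 q, np.2.1 <= q.1, q.1 + A / 2 ^+ np.1.+1 <= np.2.1 + A / 2 ^+ np.1,
      np.2.2 <= q.2 /\ q.2 + B / 2 ^+ np.1.+1 <= np.2.2 + B / 2 ^+ np.1 &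
      `|W np.1 np.2| <= 4 * `|W np.1.+1 q|].
    by have [f hf] := choice H; exists f.
  case: np => n p /=.
  have [/step[q hq]|h] := pselect (inr n p); first by exists q.
  by exists p.
pose P := fix P n := if n is m.+1 then f (m, P m) else (s1, t1).
have P0 : inr 0 (P 0%N).
  by rewrite /inr /= expr0 !divr1 /A /B; split; lra.
have PS n : inr n (P n).
  by elim: n => // n /(hf (n, P n))[].
have PW n : `|W 0 (P 0%N)| <= 4 ^+ n * `|W n (P n)|.
  elim: n => [|n IH]; first by rewrite mul1r.
  have [_ _ _ _ h] := hf (n, P n) (PS n).
  rewrite (le_trans IH)// exprSr -mulrA ler_pM2l ?exprn_gt0//.
have nest1 m n : (m <= n)%N -> (P m).1 <= (P n).1 /\
    (P n).1 + A / 2 ^+ n <= (P m).1 + A / 2 ^+ m.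
  elim: n => [|n IH]; first by rewrite leqn0 => /eqP ->.
  rewrite leq_eqVlt ltnS => /orP[/eqP ->//|/IH[h1 h2]].
  have [_ h3 h4 _ _] := hf (n, P n) (PS n).
  by rewrite (le_trans h1 h3) (le_trans h4 h2).
have nest2 m n : (m <= n)%N -> (P m).2 <= (P n).2 /\
    (P n).2 + B / 2 ^+ n <= (P m).2 + B / 2 ^+ m.
  elim: n => [|n IH]; first by rewrite leqn0 => /eqP ->.
  rewrite leq_eqVlt ltnS => /orP[/eqP ->//|/IH[h1 h2]].
  have [_ _ _ [h3 h4] _] := hf (n, P n) (PS n).
  by rewrite (le_trans h1 h3) (le_trans h4 h2).
have squeeze (p q : nat -> R) : (forall n, p n <= q n) ->
    (forall m n, (m <= n)%N -> p m <= p n /\ q n <= q m) ->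
    exists s, forall n, p n <= s <= q n.
  move=> pq nest; exists (sup (range p)) => n.
  have pq' m : p m <= q n.
    have [mn|/ltnW nm] := leqP m n.
      exact: le_trans (nest _ _ mn).1 (pq n).
    exact: le_trans (pq m) (nest _ _ nm).2.
  apply/andP; split.
    apply: ub_le_sup; last by exists n.
    by exists (q n) => _ [m _ <-].
  apply: ge_sup; first by exists (p 0%N); exists 0%N.
  by move=> _ [m _ <-].
have [s hs] : exists s, forall n, (P n).1 <= s <= (P n).1 + A / 2 ^+ n.
  by apply: squeeze => // n; rewrite lerDl A0.
have [t ht] : exists t, forall n, (P n).2 <= t <= (P n).2 + B / 2 ^+ n.
  by apply: squeeze => // n; rewrite lerDl B0.
have ss : s1 <= s <= s2.
  by have := hs 0%N; rewrite /= expr0 divr1 /A; lra.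
have tt : t1 <= t <= t2.
  by have := ht 0%N; rewrite /= expr0 divr1 /B; lra.
have W0 : W 0 (P 0%N) = contour s1 s2 t1 t2.
  by rewrite /W /= expr0 !divr1 /A /B; congr contour; ring.
apply/eqP; rewrite -W0 -normr_le0; apply/ler_addgt0Pr => e e0; rewrite add0r.
(* The factor [4 ^+ n] is exactly compensated by the square of the half-perimeter of the n-th
   rectangle, which leaves [(A + B) ^+ 2]; adding 1 keeps the divisor positive for a degenerate
   rectangle. *)
have D1 : 0 < 1 + (A + B) ^+ 2 by rewrite ltr_pwDl// sqr_ge0.
have e'0 : 0 < e / 2 / (1 + (A + B) ^+ 2) by rewrite !divr_gt0.
have [d d0 hd] := local_bound ss tt e'0.
have [n hn] : exists n, A / 2 ^+ n + B / 2 ^+ n < d.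
  have : (A + B) / 2 ^+ n @[n --> \oo] --> 0.
    rewrite -[X in _ --> X](mulr0 (A + B)).
    apply: cvgM; first exact: cvg_cst.
    under eq_fun do rewrite -exprVn.
    by apply: cvg_expr; rewrite ger0_norm ?invr_ge0// invf_lt1// ltr1n.
  move=> /cvgrPdist_lt/(_ d d0)[n _ /(_ n (leqnn _)) /=].
  rewrite sub0r normrN => h; exists n; rewrite -mulrDl.
  exact: le_lt_trans (ler_norm _) h.
have := hd n (P n) (PS n) (hs n) (ht n) hn => hW.
apply: (le_trans (PW n)).
have p4 : 0 < 4 ^+ n :> R by rewrite exprn_gt0.
apply: (le_trans (y := 4 ^+ n * (2 * (e / 2 / (1 + (A + B) ^+ 2)) * (A / 2 ^+ n + B / 2 ^+ n) ^+ 2))).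
  by rewrite ler_pM2l.
have -> : 4 ^+ n = (2 ^+ n) ^+ 2 :> R by rewrite -exprM mulnC exprM (_ : 2 ^+ 2 = 4)// -natrX.
have p2 : 2 ^+ n != 0 :> R by rewrite expf_neq0.
have -> : (2 ^+ n) ^+ 2 * (2 * (e / 2 / (1 + (A + B) ^+ 2)) * (A / 2 ^+ n + B / 2 ^+ n) ^+ 2)
  = e * ((A + B) ^+ 2 / (1 + (A + B) ^+ 2)).
  by field; rewrite p2 gt_eqF.
by rewrite ger_pMr// ler_pdivrMr// mul1r lerDr.
Qed.

End Goursat.

(** * Means over the circle, as integrals in the angle for a probability measure *)

Lemma twopi_gt0 (R : realType) : 0 < 2 * pi :> R.
Proof. by rewrite mulr_gt0// pi_gt0. Qed.

(** A probability on the whole line carried by [[0, 2 * pi]]: domains of integration are always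
    [setT], and bounded measurable functions are integrable. *)
Notation mC R := (uniform_prob (@twopi_gt0 R)).

Section CircleMean.
Context (R : realType).
Local Notation C := R[i].
Local Notation mu := (@lebesgue_measure R).
Implicit Types (f g h : R -> R) (F G : R -> C) (a b c M : R) (z : C).

Definition intg f := (mC R).-integrable setT (EFin \o f).
Definition mint f : R := \int[mC R]_t f t.

Lemma intg_meas f : intg f -> measurable_fun setT f.
Proof. by move=> /integrableP[/measurable_EFinP]. Qed.

Lemma intg_bounded f M : measurable_fun setT f -> (forall t, `|f t| <= M) -> intg f.
Proof.
move=> mf fM; apply: measurable_bounded_integrable => //.
  have h : (mC R setT < +oo)%E by rewrite probability_setT ltry.
  exact: h.
exists M; split; first exact: num_real.
by move=> x Mx t _; exact: le_trans (fM t) (ltW Mx).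
Qed.

Lemma intg_cst c : intg (fun=> c).
Proof. by apply: (@intg_bounded _ `|c|) => //; exact: measurable_cst. Qed.

Lemma intgD f g : intg f -> intg g -> intg (fun t => f t + g t).
Proof. exact: integrableD. Qed.

Lemma intgZ c f : intg f -> intg (fun t => c * f t).
Proof. exact: integrableZl. Qed.

Lemma intgB f g : intg f -> intg g -> intg (fun t => f t - g t).
Proof. exact: integrableB. Qed.

Lemma intg_norm f : intg f -> intg (fun t => `|f t|).
Proof. exact: integrable_norm. Qed.

Lemma intg_le f g : measurable_fun setT f -> (forall t, `|f t| <= g t) ->
  intg g -> intg f.
Proof.
move=> mf fg ig; apply: le_integrable ig => //; first exact/measurable_EFinP.
by move=> t _ /=; rewrite lee_fin (le_trans (fg t)) ?ler_norm.
Qed.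

Lemma intgM f h M : intg f -> measurable_fun setT h -> (forall t, `|h t| <= M) ->
  intg (fun t => h t * f t).
Proof.
move=> iF mh hM; apply: (@intg_le _ (fun t => M * `|f t|)).
- by apply: measurable_funM => //; exact: intg_meas.
- by move=> t; rewrite normrM ler_wpM2r.
- by apply: intgZ; exact: intg_norm.
Qed.

Lemma intg_sum I (s : seq I) (f : I -> R -> R) : (forall i, intg (f i)) ->
  intg (fun t => \sum_(i <- s) f i t).
Proof.
move=> h; elim: s => [|i s IH].
  by under [X in intg X]eq_fun do rewrite big_nil; exact: intg_cst.
by under [X in intg X]eq_fun do rewrite big_cons; exact: intgD.
Qed.

Lemma mintD f g : intg f -> intg g -> mint (fun t => f t + g t) = mint f + mint g.
Proof. exact: RintegralD. Qed.

Lemma mintB f g : intg f -> intg g -> mint (fun t => f t - g t) = mint f - mint g.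
Proof. exact: RintegralB. Qed.

Lemma mintZ c f : intg f -> mint (fun t => c * f t) = c * mint f.
Proof. by move=> iF; rewrite /mint RintegralZl. Qed.

Lemma mintN f : intg f -> mint (fun t => - f t) = - mint f.
Proof.
move=> iF; rewrite -[RHS]mulN1r -mintZ//.
by apply: eq_Rintegral => t _; rewrite mulN1r.
Qed.

Lemma mint_cst c : mint (fun=> c) = c.
Proof. by rewrite /mint Rintegral_cst//= probability_setT mulr1. Qed.

Lemma mint_eq f g : (forall t, f t = g t) -> mint f = mint g.
Proof. by move=> fg; congr mint; apply/funext. Qed.

Lemma mint_le f g : intg f -> intg g -> (forall t, f t <= g t) -> mint f <= mint g.
Proof. by move=> iF ig fg; apply: le_Rintegral. Qed.

Lemma mint_ge0 f : (forall t, 0 <= f t) -> 0 <= mint f.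
Proof. by move=> f0; apply: Rintegral_ge0. Qed.

Lemma mint_sum I (s : seq I) (f : I -> R -> R) : (forall i, intg (f i)) ->
  mint (fun t => \sum_(i <- s) f i t) = \sum_(i <- s) mint (f i).
Proof.
move=> h; elim: s => [|i s IH].
  rewrite big_nil -[RHS](mint_cst 0); apply: mint_eq => t; exact: big_nil.
rewrite big_cons -IH -mintD//; first by apply: mint_eq => t; rewrite big_cons.
exact: intg_sum.
Qed.

Lemma mintE f : intg f -> (\int[mC R]_t (f t)%:E)%E = (mint f)%:E.
Proof. by move=> iF; rewrite /mint /Rintegral fineK//; exact: integrable_fin_num. Qed.

Lemma intg_ge0 f : measurable_fun setT f -> (forall t, 0 <= f t) ->
  (\int[mC R]_t (f t)%:E < +oo)%E -> intg f.
Proof.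
move=> mf f0 foo; apply/integrableP; split; first exact/measurable_EFinP.
by under eq_integral do rewrite gee0_abs ?lee_fin//.
Qed.

Lemma intg_lee f M : measurable_fun setT f -> (forall t, 0 <= f t) ->
  (\int[mC R]_t (f t)%:E <= M%:E)%E -> intg f /\ mint f <= M.
Proof.
move=> mf f0 fM; have iF : intg f.
  by apply: intg_ge0 => //; apply: le_lt_trans fM _; rewrite ltry.
by split => //; rewrite -lee_fin -mintE.
Qed.

Local Notation ae P := {ae mC R, forall t, P t}.

Lemma aeS (P Q : R -> Prop) : (forall t, P t -> Q t) -> ae P -> ae Q.
Proof. by move=> PQ; apply: negligibleS => t /= h1 h2; apply/h1/PQ. Qed.

Lemma aeI (P Q : R -> Prop) : ae P -> ae Q -> ae (fun t => P t /\ Q t).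
Proof.
move=> hP hQ; have := negligibleU hP hQ; apply: negligibleS => t /= h.
by apply: contrapT => /not_orP[/contrapT ? /contrapT ?]; apply: h.
Qed.

Lemma aeT (P : R -> Prop) : (forall t, P t) -> ae P.
Proof. by move=> hP; apply: (@aeS (fun=> True)) => //; exact: aeW. Qed.

Lemma mint_ae f g : measurable_fun setT f -> intg g -> ae (fun t => f t = g t) ->
  intg f /\ mint f = mint g.
Proof.
move=> mf ig fg.
have E h : measurable_fun setT h -> ae (fun t => h t = f t) -> 
   (\int[mC R]_t (h t)%:E = \int[mC R]_t (f t)%:E)%E.
  move=> mh hf; apply: ae_eq_integral => //; try exact/measurable_EFinP.
  by apply: aeS hf => t -> _.
have iF : intg f.
  apply/integrableP; split; first exact/measurable_EFinP.
  move/integrableP : ig => [mg]; apply: le_lt_trans.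
  apply: ae_ge0_le_integral => //.
  - by apply: measurableT_comp => //; exact/measurable_EFinP.
  - by apply: measurableT_comp => //; exact/measurable_EFinP.
  - by apply: aeS fg => t /= -> _.
split => //; apply: EFin_inj; rewrite -!mintE//; apply/esym/E.
  exact: intg_meas.
by apply: aeS fg => t ->.
Qed.

Lemma mint_ae_le f g : intg f -> intg g -> (forall t, 0 <= f t) -> (forall t, 0 <= g t) ->
  ae (fun t => f t <= g t) -> mint f <= mint g.
Proof.
move=> iF ig f0 g0 fg; rewrite -lee_fin -!mintE//.
apply: ae_ge0_le_integral => //.
- by move=> t _; rewrite lee_fin.
- by apply/measurable_EFinP; exact: intg_meas.
- by move=> t _; rewrite lee_fin.
- by apply/measurable_EFinP; exact: intg_meas.
- by apply: aeS fg => t /= h _; rewrite lee_fin.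
Qed.

Lemma mint_dct (f_ : nat -> R -> R) f g : (forall n, measurable_fun setT (f_ n)) ->
  measurable_fun setT f -> intg g -> ae (fun t => f_ n t @[n --> \oo] --> f t) ->
  (forall n, ae (fun t => `|f_ n t| <= g t)) ->
  [/\ intg f, forall n, intg (f_ n) & mint (f_ n) @[n --> \oo] --> mint f].
Proof.
move=> mf_ mf ig cv dom.
have dom' : ae (fun t => forall n, `|f_ n t| <= g t) by exact: ae_foralln.
have if_ n : intg (f_ n).
  apply/integrableP; split; first by apply/measurable_EFinP; exact: mf_.
  move/integrableP : (ig) => [mg]; apply: le_lt_trans.
  apply: ae_ge0_le_integral => //.
  - by apply: measurableT_comp => //; apply/measurable_EFinP; exact: mf_.
  - by apply: measurableT_comp => //.
  - by apply: aeS (dom n) => t /= h _; rewrite lee_fin (le_trans h) ?ler_norm.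
have [] := @dominated_convergence _ _ _ (mC R) setT measurableT
  (fun n t => (f_ n t)%:E) (fun t => (f t)%:E) (fun t => (g t)%:E).
- by move=> n; apply/measurable_EFinP; exact: mf_.
- exact/measurable_EFinP.
- by apply: aeS cv => t h _; apply/cvg_EFin; [exact: nearW|].
- exact: ig.
- by apply: aeS dom' => t h n _; rewrite lee_fin.
move=> iF _ cvi; split => //.
by move: cvi; rewrite mintE// => /fine_cvg.
Qed.

Lemma mint_fatou (f_ : nat -> R -> R) f M : (forall n, intg (f_ n)) ->
  (forall n t, 0 <= f_ n t) -> measurable_fun setT f -> (forall t, 0 <= f t) ->
  (forall n, mint (f_ n) <= M) -> ae (fun t => f_ n t @[n --> \oo] --> f t) ->
  intg f /\ mint f <= M.
Proof.
move=> if_ f_0 mf f0 leM cv; apply: intg_lee => //.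
have mE n : measurable_fun setT (fun t : R => (f_ n t)%:E) by apply/measurable_EFinP; exact: intg_meas.
apply: (@le_trans _ _ (\int[mC R]_t limn_einf (fun n => (f_ n t)%:E))%E).
  apply: ae_ge0_le_integral => //.
  - by move=> t _; rewrite lee_fin.
  - exact/measurable_EFinP.
  - move=> t _; rewrite limn_einf_lim; apply: lime_ge; first exact: is_cvg_einfs.
    by apply: nearW => n; apply: le_ereal_inf_tmp => _ [m _ <-]; rewrite lee_fin.
  - under eq_fun do rewrite limn_einf_lim.
    apply: (emeasurable_fun_cvg (fun n t => einfs (fun m => (f_ m t)%:E) n)).
      by move=> n; exact: (measurable_fun_einfs (f := fun m t => (f_ m t)%:E)).
    by move=> t _; exact: is_cvg_einfs.
  - apply: aeS cv => t /= h _; rewrite (_ : limn_einf _ = (f t)%:E)//.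
    apply: (cvg_limn_einf_sup _).1.
    by apply/cvg_EFin; [exact: nearW|].
apply: (le_trans (@fatou _ _ _ (mC R) setT measurableT (fun n t => (f_ n t)%:E) _ _)).
- by move=> n; exact: mE.
- by move=> n t _; rewrite lee_fin.
- rewrite limn_einf_lim; apply: lime_le; first exact: is_cvg_einfs.
  apply: nearW => n; apply: (@le_trans _ _ (\int[mC R]_t (f_ n t)%:E)%E).
    by apply: ereal_inf_lbound; exists n => //=.
  by rewrite mintE// lee_fin.
Qed.

Lemma mint_uniform f : intg f -> mu.-integrable `[0, 2 * pi] (EFin \o f) ->
  mint f = (2 * pi)^-1 * itvint f 0 (2 * pi).
Proof.
move=> iF il; apply: EFin_inj; rewrite -mintE// EFinM /itvint /Rintegral fineK; last first.
  exact: integrable_fin_num.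
have mf := intg_meas iF.
rewrite [LHS]integralE [X in (_ * X)%E]integralE muleBr//; last first.
  by rewrite fin_num_adde_defr//; exact: integrable_pos_fin_num il.
by congr (_ - _)%E; rewrite integral_uniform ?subr0//;
  (apply: measurable_funepos || apply: measurable_funeneg); exact/measurable_EFinP.
Qed.

Lemma intg_lebesgue f : measurable_fun setT f ->
  mu.-integrable `[0, 2 * pi] (EFin \o f) -> intg f.
Proof.
move=> mf /integrableP[_ foo]; apply/integrableP; split; first exact/measurable_EFinP.
rewrite integral_uniform//; last by apply: measurableT_comp => //; exact/measurable_EFinP.
rewrite subr0 lte_mul_pinfty ?lee_fin ?invr_ge0 ?ltW ?twopi_gt0//.
Qed.

Lemma lebesgue_intg f : intg f -> mu.-integrable `[0, 2 * pi] (EFin \o f).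
Proof.
move=> iF; have mf := intg_meas iF; apply/integrableP; split.
  by apply: measurable_funTS; exact/measurable_EFinP.
move/integrableP : iF => [_].
rewrite integral_uniform//; last by apply: measurableT_comp => //; exact/measurable_EFinP.
rewrite subr0 => h; rewrite ltey; apply/negP => /eqP E; move: h; rewrite E.
by rewrite gt0_muley ?lte_fin ?invr_gt0 ?twopi_gt0// ltxx.
Qed.

Lemma intg_cts f : continuous f -> intg f.
Proof.
move=> cf; apply: intg_lebesgue.
  exact: continuous_measurable_fun.
by apply: ctsab_integrable => x _; exact: cf.
Qed.

Lemma mint_itvint f : continuous f -> mint f = (2 * pi)^-1 * itvint f 0 (2 * pi).
Proof.
move=> cf; apply: mint_uniform; first exact: intg_cts.
by apply: ctsab_integrable => x _; exact: cf.
Qed.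

Lemma circle_integralE (g : C -> \bar R) :
  measurable_fun setT (fun t : R => g (expi t)) -> (forall z, 0 <= g z)%E ->
  circle_integral g = (\int[mC R]_t g (expi t))%E.
Proof. by move=> mg g0; rewrite integral_uniform// subr0. Qed.

Lemma circle_integralEr (g : C -> R) :
  intg (fun t => g (expi t)) ->
  circle_integral (fun z => (g z)%:E) = (mint (fun t => g (expi t)))%:E.
Proof.
move=> ig; have il := lebesgue_intg ig; rewrite mint_uniform// EFinM /itvint /Rintegral fineK//.
exact: integrable_fin_num.
Qed.

Definition cintg F := intg (fun t => complex.Re (F t)) /\ intg (fun t => complex.Im (F t)).

Definition cavg F : C := mint (fun t => complex.Re (F t)) +i* mint (fun t => complex.Im (F t)).

Definition cmeas F := measurable_fun setT (fun t => complex.Re (F t)) /\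
  measurable_fun setT (fun t => complex.Im (F t)).

Lemma cmeas_cabs F : cmeas F -> measurable_fun setT (fun t => cabs (F t)).
Proof.
move=> [m1 m2]; under eq_fun do rewrite cabsE.
apply: (measurableT_comp (continuous_measurable_fun (@sqrt_continuous R))).
by apply: measurable_funD; exact: measurable_funX.
Qed.

Lemma cintg_meas F : cintg F -> cmeas F.
Proof. by move=> [/intg_meas ? /intg_meas]. Qed.

Lemma cintg_cabs F : cintg F -> intg (fun t => cabs (F t)).
Proof.
move=> iF; apply: (@intg_le _ (fun t => `|complex.Re (F t)| + `|complex.Im (F t)|)).
- by apply: cmeas_cabs; exact: cintg_meas.
- by move=> t; rewrite ger0_norm ?cabs_ge0// cabs_le_ReIm.
- by apply: intgD; apply: intg_norm; case: iF.
Qed.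

Lemma cintg_le F g : cmeas F -> (forall t, cabs (F t) <= g t) -> intg g -> cintg F.
Proof.
move=> [m1 m2] Fg ig; split; apply: intg_le ig => // t; apply: le_trans (Fg t).
  exact: Re_le_cabs.
exact: Im_le_cabs.
Qed.

Lemma cmeasD F G : cmeas F -> cmeas G -> cmeas (fun t => F t + G t).
Proof.
move=> [f1 f2] [g1 g2]; split.
  by under eq_fun do rewrite ReD; exact: measurable_funD.
by under eq_fun do rewrite ImD; exact: measurable_funD.
Qed.

Lemma cmeasM F G : cmeas F -> cmeas G -> cmeas (fun t => F t * G t).
Proof.
move=> [f1 f2] [g1 g2]; split.
  by under eq_fun do rewrite ReM; apply: measurable_funB; exact: measurable_funM.
by under eq_fun do rewrite ImM; apply: measurable_funD; exact: measurable_funM.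
Qed.

Lemma cmeas_conj F : cmeas F -> cmeas (fun t => (F t)^*%C).
Proof.
move=> [f1 f2]; split.
  by under eq_fun do rewrite Re_conj.
by under eq_fun do rewrite Im_conj; exact: measurableT_comp.
Qed.

Lemma cmeas_cst z0 : cmeas (fun=> z0).
Proof. by split; exact: measurable_cst. Qed.

Lemma cmeasB F G : cmeas F -> cmeas G -> cmeas (fun t => F t - G t).
Proof.
move=> mF mG; have -> : (fun t => F t - G t) = (fun t => F t + (-1) * G t).
  by apply/funext => t; rewrite mulN1r.
by apply: cmeasD => //; apply: cmeasM => //; exact: cmeas_cst.
Qed.

Lemma cintgD F G : cintg F -> cintg G -> cintg (fun t => F t + G t).
Proof.
move=> [f1 f2] [g1 g2]; split.
  by under [X in intg X]eq_fun do rewrite ReD; exact: intgD.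
by under [X in intg X]eq_fun do rewrite ImD; exact: intgD.
Qed.

Lemma cintgZ z0 F : cintg F -> cintg (fun t => z0 * F t).
Proof.
move=> [f1 f2]; split.
  by under [X in intg X]eq_fun do rewrite ReM; apply: intgB; exact: intgZ.
by under [X in intg X]eq_fun do rewrite ImM; apply: intgD; exact: intgZ.
Qed.

Lemma cintgB F G : cintg F -> cintg G -> cintg (fun t => F t - G t).
Proof.
move=> iF iG; have -> : (fun t => F t - G t) = (fun t => F t + (-1) * G t).
  by apply/funext => t; rewrite mulN1r.
by apply: cintgD => //; exact: cintgZ.
Qed.

Lemma cintgM F G M : cintg F -> cmeas G -> (forall t, cabs (G t) <= M) ->
  cintg (fun t => G t * F t).
Proof.
move=> iF mG GM; apply: (@cintg_le _ (fun t => M * cabs (F t))).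
- by apply: cmeasM => //; exact: cintg_meas.
- by move=> t; rewrite cabsM ler_wpM2r ?cabs_ge0.
- by apply: intgZ; exact: cintg_cabs.
Qed.

Lemma cintg_cst z0 : cintg (fun=> z0).
Proof. by split; exact: intg_cst. Qed.

Lemma cavgD F G : cintg F -> cintg G -> cavg (fun t => F t + G t) = cavg F + cavg G.
Proof.
move=> [f1 f2] [g1 g2]; apply: ReIm_inj; rewrite ?ReD ?ImD /=.
  by rewrite -mintD//; apply: mint_eq => t; rewrite ReD.
by rewrite -mintD//; apply: mint_eq => t; rewrite ImD.
Qed.

Lemma cavgZ z0 F : cintg F -> cavg (fun t => z0 * F t) = z0 * cavg F.
Proof.
move=> [f1 f2]; apply: ReIm_inj; rewrite ?ReM ?ImM /=.
  by rewrite -!mintZ// -mintB; [apply: mint_eq => t; rewrite ReM|exact: intgZ|exact: intgZ].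
by rewrite -!mintZ// -mintD; [apply: mint_eq => t; rewrite ImM|exact: intgZ|exact: intgZ].
Qed.

Lemma cavg_eq F G : (forall t, F t = G t) -> cavg F = cavg G.
Proof. by move=> FG; congr cavg; apply/funext. Qed.

Lemma cavgB F G : cintg F -> cintg G -> cavg (fun t => F t - G t) = cavg F - cavg G.
Proof.
move=> iF iG; rewrite -[- cavg G]mulN1r -cavgZ// -cavgD//; last exact: cintgZ.
by apply: cavg_eq => t; rewrite mulN1r.
Qed.

Lemma cavg_cst z0 : cavg (fun=> z0) = z0.
Proof. by apply: ReIm_inj; rewrite /= mint_cst. Qed.

Lemma cintg_sum I (s : seq I) (F : I -> R -> C) : (forall i, cintg (F i)) ->
  cintg (fun t => \sum_(i <- s) F i t).
Proof.
move=> h; elim: s => [|i s IH].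
  by under [X in cintg X]eq_fun do rewrite big_nil; exact: cintg_cst.
by under [X in cintg X]eq_fun do rewrite big_cons; exact: cintgD.
Qed.

Lemma cavg_sum I (s : seq I) (F : I -> R -> C) : (forall i, cintg (F i)) ->
  cavg (fun t => \sum_(i <- s) F i t) = \sum_(i <- s) cavg (F i).
Proof.
move=> h; elim: s => [|i s IH].
  by rewrite big_nil -[RHS](cavg_cst 0); apply: cavg_eq => t; exact: big_nil.
rewrite big_cons -IH -cavgD//; first by apply: cavg_eq => t; rewrite big_cons.
exact: cintg_sum.
Qed.

Lemma cavg_conj F : cintg F -> cavg (fun t => (F t)^*%C) = (cavg F)^*%C.
Proof.
move=> [f1 f2]; apply: ReIm_inj => /=.
  by apply: mint_eq => t; rewrite Re_conj.
by rewrite -mintN//; apply: mint_eq => t; rewrite Im_conj.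
Qed.

Lemma cavg_real f : cavg (fun t => (f t)%:C) = (mint f)%:C.
Proof. by rewrite /cavg /= mint_cst. Qed.

(* Pair the mean with its own conjugate: the real part of that product is at
   most |mean| times the mean of the modulus. *)
Lemma cabs_cavg F : cintg F -> cabs (cavg F) <= mint (fun t => cabs (F t)).
Proof.
move=> iF; set z0 := cavg F.
have [->|z00] := eqVneq z0 0; first by rewrite cabs0 mint_ge0// => t; exact: cabs_ge0.
have cp : 0 < cabs z0 by rewrite cabs_gt0.
rewrite -(ler_pM2l cp) -expr2.
have -> : cabs z0 ^+ 2 = mint (fun t => complex.Re (z0^*%C * F t)).
  by have := cavgZ z0^*%C iF; rewrite -/z0 mulrC mul_conj => /(congr1 (@complex.Re R)) /= ->.
rewrite -mintZ; last exact: cintg_cabs.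
apply: mint_le.
- by have [] := cintgZ z0^*%C iF.
- by apply: intgZ; exact: cintg_cabs.
- by move=> t; rewrite (le_trans (Re_le _))// cabsM cabs_conj.
Qed.

Definition ccts F := continuous (fun t => complex.Re (F t)) /\
  continuous (fun t => complex.Im (F t)).

Lemma ccts_cintg F : ccts F -> cintg F.
Proof. by move=> [c1 c2]; split; exact: intg_cts. Qed.

Lemma ccts_meas F : ccts F -> cmeas F.
Proof. by move=> /ccts_cintg /cintg_meas. Qed.

Lemma cctsP F : ccts F <-> forall t, (F x : C^o) @[x --> t] --> (F t : C^o).
Proof.
split=> [[c1 c2] t|h]; first by apply: cvg_ReIm; [exact: c1|exact: c2].
by split=> t; [exact: cvg_Re (h t)|exact: cvg_Im (h t)].
Qed.

Lemma cctsD F G : ccts F -> ccts G -> ccts (fun t => F t + G t).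
Proof. by move=> /cctsP hF /cctsP hG; apply/cctsP => t; apply: cvgC_add; [exact: hF|exact: hG]. Qed.

Lemma cctsM F G : ccts F -> ccts G -> ccts (fun t => F t * G t).
Proof. by move=> /cctsP hF /cctsP hG; apply/cctsP => t; apply: cvgC_mul; [exact: hF|exact: hG]. Qed.

Lemma ccts_conj F : ccts F -> ccts (fun t => (F t)^*%C).
Proof. by move=> /cctsP hF; apply/cctsP => t; apply: cvg_conj; exact: hF. Qed.

Lemma ccts_cst z0 : ccts (fun=> z0).
Proof. by apply/cctsP => t; exact: cvgC_cst. Qed.

Lemma ccts_expi : ccts (@expi R).
Proof. by split=> /=; [exact: continuous_cos|exact: continuous_sin]. Qed.

Lemma ccts_cabs F : ccts F -> continuous (fun t => cabs (F t)).
Proof. by move=> /cctsP h t; apply: cvg_cabs; exact: h. Qed.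

Lemma ccts_comp (H : C -> C) F : ccts F -> (forall t, ccont H (F t)) ->
  ccts (fun t => H (F t)).
Proof.
move=> /cctsP cF cH; apply/cctsP => t; apply/cvg_cabsP => e e0.
have [d d0 hd] := (ccontP _ _).1 (cH t) _ e0.
by have /cvg_cabsP/(_ _ d0) := cF t; apply: filterS => x; exact: hd.
Qed.

(** Tonelli's theorem. The bound [M] on the kernel makes every inner mean finite, so that the
    equality can be stated between real numbers. *)
Lemma mint_swap (k : R -> R -> R) f g M :
  measurable_fun setT (fun p : R * R => k p.1 p.2) ->
  (forall s t, 0 <= k s t <= M) -> intg f -> intg g ->
  (forall t, 0 <= f t) -> (forall t, 0 <= g t) ->
  [/\ intg (fun t => mint (fun s => k s t * f s)),
      intg (fun s => mint (fun t => k s t * g t)) &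
  mint (fun s => f s * mint (fun t => k s t * g t)) =
  mint (fun t => g t * mint (fun s => k s t * f s))].
Proof.
move=> mk k0 iF ig f0 g0.
have M0 : 0 <= M by have /andP[h1 h2] := k0 0 0; exact: le_trans h1 h2.
have mf := intg_meas iF; have mg := intg_meas ig.
have mk1 s : measurable_fun setT (k s).
  exact: (measurable_fun_pair2 s mk).
have mk2 t : measurable_fun setT (k^~ t).
  exact: (measurable_fun_pair1 t mk).
have nk s t : `|k s t| <= M by have /andP[h1 h2] := k0 s t; rewrite ger0_norm.
have k00 s t : 0 <= k s t by have /andP[] := k0 s t.
have i1 s : intg (fun t => k s t * g t) by exact: (@intgM _ _ M).
have i2 t : intg (fun s => k s t * f s) by exact: (@intgM _ _ M).
pose H (p : R * R) := (f p.1 * k p.1 p.2 * g p.2)%:E.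
have mH : measurable_fun setT H.
  apply/measurable_EFinP; apply: measurable_funM; first apply: measurable_funM => //.
    by apply: measurableT_comp => //; exact: measurable_fst.
  by apply: measurableT_comp => //; exact: measurable_snd.
have H0 p : (0 <= H p)%E by rewrite lee_fin !mulr_ge0.
have mG1 : measurable_fun setT (fun s => mint (fun t => k s t * g t)).
  have := measurable_fun_fubini_tonelli_F (m2 := mC R) (fun p : R * R => (k p.1 p.2 * g p.2)%:E).
  move=> h; apply/measurable_EFinP; move: h.
  rewrite (_ : fubini_F _ _ = EFin \o (fun s => mint (fun t => k s t * g t))); last first.
    by apply/funext => s; rewrite /fubini_F /= mintE.
  apply; last by move=> p; rewrite lee_fin mulr_ge0.
  apply/measurable_EFinP; apply: measurable_funM => //.
  by apply: measurableT_comp => //; exact: measurable_snd.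
have mG2 : measurable_fun setT (fun t => mint (fun s => k s t * f s)).
  have := measurable_fun_fubini_tonelli_G (m1 := mC R) (fun p : R * R => (k p.1 p.2 * f p.1)%:E).
  move=> h; apply/measurable_EFinP; move: h.
  rewrite (_ : fubini_G _ _ = EFin \o (fun t => mint (fun s => k s t * f s))); last first.
    by apply/funext => s; rewrite /fubini_G /= mintE.
  apply; last by move=> p; rewrite lee_fin mulr_ge0.
  apply/measurable_EFinP; apply: measurable_funM => //.
  by apply: measurableT_comp => //; exact: measurable_fst.
have b1 s : `|mint (fun t => k s t * g t)| <= M * mint g.
  rewrite ger0_norm ?mint_ge0// => [|t]; last by rewrite mulr_ge0.
  rewrite -mintZ//; apply: mint_le => //; first exact: intgZ.
  by move=> t; rewrite ler_wpM2r//; have /andP[] := k0 s t.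
have b2 t : `|mint (fun s => k s t * f s)| <= M * mint f.
  rewrite ger0_norm ?mint_ge0// => [|s]; last by rewrite mulr_ge0.
  rewrite -mintZ//; apply: mint_le => //; first exact: intgZ.
  by move=> s; rewrite ler_wpM2r//; have /andP[] := k0 s t.
have ib1 := intg_bounded mG1 b1; have ib2 := intg_bounded mG2 b2.
split; [exact: ib2|exact: ib1|apply: EFin_inj].
have j1 : intg (fun s => f s * mint (fun t => k s t * g t)).
  have := intgM iF mG1 b1; congr (is_true (integrable _ _ _)).
  by apply/funext => s /=; rewrite mulrC.
have j2 : intg (fun t => g t * mint (fun s => k s t * f s)).
  have := intgM ig mG2 b2; congr (is_true (integrable _ _ _)).
  by apply/funext => s /=; rewrite mulrC.
rewrite -(mintE j1) -(mintE j2).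
have := fubini_tonelli (m1 := mC R) (m2 := mC R) H mH H0.
have -> : (\int[mC R]_x \int[mC R]_y H (x, y) =
   \int[mC R]_t (f t * mint (fun t0 => k t t0 * g t0))%:E)%E.
  apply: eq_integral => s _; rewrite -mintZ// -mintE; last exact: intgZ.
  by apply: eq_integral => t _; rewrite /H /= mulrA.
have -> : (\int[mC R]_y \int[mC R]_x H (x, y) =
   \int[mC R]_t (g t * mint (fun s => k s t * f s))%:E)%E => //.
apply: eq_integral => t _; rewrite -mintZ// -mintE; last exact: intgZ.
by apply: eq_integral => s _; rewrite /H /=; congr EFin; ring.
Qed.

End CircleMean.


(** * Logarithmic coordinates, in which an annulus becomes a rectangle *)

Section ExponentialChart.
Context (R : realType).
Local Notation C := R[i].
Implicit Types (F : C -> C) (z w : C) (a b r s t e d : R).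

Lemma is_derive_approx (f : R -> R) (x df : R) : is_derive x 1 f df -> forall e, 0 < e ->
  exists2 d, 0 < d & forall h, `|h| < d -> `|f (x + h) - f x - df * h| <= e * `|h|.
Proof.
move=> [/cvg_ex[/= l hl] fdf] e e0.
have ldf : l = df by rewrite -fdf; apply/esym/cvg_lim.
move: hl => /cvgrPdist_lt/(_ e e0); rewrite near_withinE => -[d /= d0 hd].
exists d => // h hh; have [->|h0] := eqVneq h 0.
  by rewrite addr0 subrr mulr0 subr0 !normr0 mulr0.
have /= := hd h; rewrite sub0r normrN => /(_ hh h0).
rewrite ldf /shift /= [_%:A]mulr1 => /ltW h1.
have -> : f (x + h) - f x - df * h = - (df - h^-1 * (f (h + x) - f x)) * h.
  by rewrite (addrC h); field.
by rewrite normrM normrN ler_wpM2r.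
Qed.

Lemma exp_chart_approx e : 0 < e -> exists2 d, 0 < d & forall a b, `|a| < d -> `|b| < d ->
  cabs ((expR a)%:C * expi b - 1 - (a +i* b)) <= e * (`|a| + `|b|).
Proof.
move=> e0; pose e1 := Num.min 1 (e / 8).
have e10 : 0 < e1 by rewrite lt_min ltr01 divr_gt0.
have e11 : e1 <= 1 by rewrite ge_min lexx.
have e18 : e1 <= e / 8 by rewrite ge_min lexx orbT.
have [d1 d10 h1] := is_derive_approx (is_derive_expR 0) e10.
have [d2 d20 h2] := is_derive_approx (is_derive_cos 0) e10.
have [d3 d30 h3] := is_derive_approx (is_derive_sin 0) e10.
exists (Num.min (Num.min d1 (e / 24)) (Num.min d2 d3)).
  by rewrite !lt_min d10 d20 d30 divr_gt0.
move=> a b; rewrite !lt_min => /andP[/andP[a1 a2] _] /andP[/andP[_ b4] /andP[b2 b3]].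
move: (h1 a a1) (h2 b b2) (h3 b b3).
rewrite !add0r expR0 cos0 sin0 oppr0 mul0r !mul1r ?subr0 ?addr0.
set ra := expR a - 1 - a; set rc := cos b - 1; set rs := sin b - b => k1 k2 k3.
apply: le_trans (cabs_le_ReIm _) _.
rewrite !ReB !ImB !ReZ !ImZ /=.
have -> : expR a * cos b - 1 - a = ra + rc + (a + ra) * rc by rewrite /ra /rc; ring.
have -> : expR a * sin b - 0 - b = rs + (a + ra) * (b + rs) by rewrite /ra /rs; ring.
have p1 := ler_normD (ra + rc) ((a + ra) * rc).
have p2 := ler_normD ra rc.
have p3 := ler_normD rs ((a + ra) * (b + rs)).
have q1 : `|a + ra| <= 2 * `|a|.
  by apply: le_trans (ler_normD _ _) _; have := normr_ge0 a; nra.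
have q2 : `|b + rs| <= 2 * `|b|.
  by apply: le_trans (ler_normD _ _) _; have := normr_ge0 b; nra.
have q3 : `|(a + ra) * rc| <= 2 * `|a| * `|b|.
  rewrite normrM; apply: ler_pM => //; apply: le_trans k2 _.
  by have := normr_ge0 b; nra.
have q4 : `|(a + ra) * (b + rs)| <= 2 * `|a| * (2 * `|b|) by rewrite normrM ler_pM.
have q5 : `|a| * `|b| <= e / 24 * `|a|.
  by rewrite mulrC ler_wpM2r// ltW.
have q6 : e1 * `|a| <= e / 8 * `|a| by rewrite ler_wpM2r.
have q7 : e1 * `|b| <= e / 8 * `|b| by rewrite ler_wpM2r.
have := normr_ge0 a; have := normr_ge0 b; nra.
Qed.

(** In the coordinates [z = exp (s + i t)] the derivative of [F] is [p w * w]. By the Cauchy-Riemann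
    equations the s-derivative of the real part and the t-derivative of the imaginary part are both
    its real part, as [green_at] demands. *)
Lemma green_exp F s t : cdiff F ((expR s)%:C * expi t) ->
  green_at (fun s t => complex.Re (F ((expR s)%:C * expi t)))
           (fun s t => complex.Im (F ((expR s)%:C * expi t))) s t.
Proof.
move=> [p /ccontP cp Fp]; set w := (expR s)%:C * expi t in cp Fp *.
exists (complex.Re (p w * w)), (- complex.Im (p w * w)), (complex.Im (p w * w)).
move=> e e0.
have W0 : 0 <= cabs w by exact: cabs_ge0.
have P0 : 0 <= cabs (p w) by exact: cabs_ge0.
pose K := 1 + cabs w * (cabs (p w) + 3).
have K0 : 0 < K by rewrite ltr_pwDl// mulr_ge0// addr_ge0.
pose e1 := Num.min 1 (e / K).
have e10 : 0 < e1 by rewrite lt_min ltr01 divr_gt0.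
have [d1 d10 h1] := exp_chart_approx e10.
have [d2 d20 h2] := cp _ e10.
have W1 : 0 < 1 + 3 * cabs w by lra.
pose d := Num.min d1 (d2 / 2 / (1 + 3 * cabs w)).
have d0 : 0 < d by rewrite lt_min d10 !divr_gt0.
exists d => // s' t' hs ht.
set a := s' - s; set b := t' - t.
have [as1 as2] : `|a| < d1 /\ `|a| < d2 / 2 / (1 + 3 * cabs w).
  by move: hs; rewrite lt_min => /andP[].
have [bs1 bs2] : `|b| < d1 /\ `|b| < d2 / 2 / (1 + 3 * cabs w).
  by move: ht; rewrite lt_min => /andP[].
set w' := (expR s')%:C * expi t'.
have w'E : w' - w = w * ((expR a)%:C * expi b - 1).
  rewrite /w' /w -[s'](subrK s) -[t'](subrK t) -/a -/b.
  by rewrite expRD expiD !rmorphM /=; ring.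
have k1 := h1 a b as1 bs1.
set X := (expR a)%:C * expi b - 1 in w'E k1.
have e11 : e1 <= 1 by rewrite ge_min lexx.
have A0 := normr_ge0 a; have B0 := normr_ge0 b.
have abb : cabs (a +i* b) <= `|a| + `|b| by exact: cabs_le_ReIm.
have kX : cabs X <= 2 * (`|a| + `|b|).
  rewrite -[X](subrK (a +i* b)); apply: le_trans (cabsD _ _) _; nra.
have ww' : cabs (w' - w) < d2.
  rewrite w'E cabsM; move: as2 bs2; rewrite !ltr_pdivlMr// => as2 bs2.
  have k2 : cabs w * cabs X <= cabs w * (2 * (`|a| + `|b|)) by rewrite ler_wpM2l.
  apply: le_lt_trans k2 _; nra.
have k3 := ltW (h2 w' ww').
have E : F w' - F w - p w * w * (a +i* b) =
   p w' * w * (X - (a +i* b)) + (p w' - p w) * w * (a +i* b).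
  by rewrite (Fp w') w'E; ring.
have pw' : cabs (p w') <= cabs (p w) + 1.
  by rewrite -[p w'](subrK (p w)) addrC; apply: le_trans (cabsD _ _) _; rewrite lerD2l (le_trans k3).
have bound : cabs (F w' - F w - p w * w * (a +i* b)) <= e * (`|a| + `|b|).
  rewrite E; apply: le_trans (cabsD _ _) _.
  rewrite (cabsM (p w' * w)) (cabsM (p w') w) (cabsM ((p w' - p w) * w)) (cabsM (p w' - p w) w).
  have m1 : cabs (p w') * cabs w * cabs (X - (a +i* b)) <=
     (cabs (p w) + 1) * cabs w * (e1 * (`|a| + `|b|)).
    by apply: ler_pM; rewrite ?mulr_ge0 ?cabs_ge0// ler_wpM2r.
  have m2 : cabs (p w' - p w) * cabs w * cabs (a +i* b) <= e1 * cabs w * (`|a| + `|b|).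
    by apply: ler_pM; rewrite ?mulr_ge0 ?cabs_ge0// ler_wpM2r.
  have m3 : e1 * K <= e by rewrite -ler_pdivlMr// ge_min lexx orbT.
  apply: le_trans (lerD m1 m2) _.
  have -> : (cabs (p w) + 1) * cabs w * (e1 * (`|a| + `|b|)) + e1 * cabs w * (`|a| + `|b|)
    = e1 * (cabs w * (cabs (p w) + 2)) * (`|a| + `|b|) by ring.
  apply: ler_wpM2r; first by rewrite addr_ge0.
  by apply: le_trans m3; rewrite /K ler_pM2l//; nra.
have ReE : complex.Re (F w' - F w - p w * w * (a +i* b)) = complex.Re (F w') -
  (complex.Re (F w) + complex.Re (p w * w) * a + - complex.Im (p w * w) * b).
  by rewrite !ReB [complex.Re (_ * (a +i* b))]ReM -[complex.Re (a +i* b)]/a -[complex.Im (a +i* b)]/b; ring.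
have ImE : complex.Im (F w' - F w - p w * w * (a +i* b)) = complex.Im (F w') -
  (complex.Im (F w) + complex.Im (p w * w) * a + complex.Re (p w * w) * b).
  by rewrite !ImB [complex.Im (_ * (a +i* b))]ImM -[complex.Re (a +i* b)]/a -[complex.Im (a +i* b)]/b; ring.
split; first by rewrite -ReE; exact: le_trans (Re_le_cabs _) bound.
by rewrite -ImE; exact: le_trans (Im_le_cabs _) bound.
Qed.

End ExponentialChart.

(** * Mean value property and Taylor coefficients *)

Section CircleMeans.
Context (R : realType).
Local Notation C := R[i].
Implicit Types (F f : C -> C) (z w : C) (a b r s t e d rho : R).

Definition circ F r t : C := F (r%:C * expi t).

Lemma cabs_circle r t : 0 <= r -> cabs (r%:C * expi t : C) = r.
Proof. by move=> r0; rewrite cabsM cabs_expi mulr1 cabs_nneg. Qed.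

Lemma ccts_circle r : ccts (fun t => r%:C * expi t : C).
Proof. by apply: cctsM; [exact: ccts_cst|exact: ccts_expi]. Qed.

Lemma ccts_circ F r : (forall t, ccont F (r%:C * expi t)) -> ccts (circ F r).
Proof. by move=> h; apply: ccts_comp => //; exact: ccts_circle. Qed.

Lemma ccts_circ_cdiff F r R0 : 0 <= r < R0 -> (forall z, cabs z < R0 -> cdiff F z) ->
  ccts (circ F r).
Proof.
move=> /andP[r0 rR] h; apply: ccts_circ => t; apply: cdiff_cts; apply: h.
by rewrite cabs_circle.
Qed.

Let mean_Re F R0 r1 r2 : (forall z, 0 < cabs z < R0 -> cdiff F z) ->
  0 < r1 -> r1 <= r2 -> r2 < R0 ->
  mint (fun t => complex.Re (circ F r1 t)) = mint (fun t => complex.Re (circ F r2 t)).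
Proof.
move=> hF r10 r12 r2R.
have r20 : 0 < r2 by exact: lt_le_trans r10 r12.
have cR r : 0 < r -> r < R0 -> continuous (fun t => complex.Re (circ F r t)).
  move=> r0 rR; apply: (proj1 (ccts_circ _)) => t; apply: cdiff_cts; apply: hF.
  by rewrite cabs_circle ?r0// ltW.
rewrite !mint_itvint; [|exact: cR|apply: cR => //; exact: le_lt_trans r12 r2R].
congr (_ * _).
have := @goursat R (fun s t => complex.Re (F ((expR s)%:C * expi t)))
   (fun s t => complex.Im (F ((expR s)%:C * expi t))) (ln r1) (ln r2) 0 (2 * pi).
rewrite ler_ln ?posrE// => /(_ r12 (ltW (twopi_gt0 R))).
have H : forall s t : R, ln r1 <= s <= ln r2 -> 0 <= t <= 2 * pi ->
   green_at (fun s t => complex.Re (F ((expR s)%:C * expi t)))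
   (fun s t => complex.Im (F ((expR s)%:C * expi t))) s t.
  move=> s t /andP[_ s2] _; apply: green_exp; apply: hF.
  rewrite cabs_circle ?expR_ge0// expR_gt0/=; apply: le_lt_trans r2R.
  by rewrite -[leRHS]lnK ?posrE// ler_expR.
move=> /(_ H); rewrite /contour !lnK ?posrE//.
(* The edges at angles [0] and [2 * pi] agree by periodicity and cancel, so that Goursat's lemma
   only compares the two circles. *)
rewrite (_ : (fun s => complex.Im (F ((expR s)%:C * expi (2 * pi)))) =
  (fun s => complex.Im (F ((expR s)%:C * expi 0)))); last first.
  by apply/funext => s; rewrite expi_pi2 expi0.
by move/eqP; rewrite -addrA addNr addr0 subr_eq0 => /eqP ->.
Qed.

(** A singularity at 0 is allowed, since the annulus avoids it; this is what permits the application
    to [f z / z ^+ n] in [coefs_exist]. The imaginary part of [F] is the real part of [-i F]. *)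
Lemma circle_mean_const F R0 r1 r2 : (forall z, 0 < cabs z < R0 -> cdiff F z) ->
  0 < r1 -> r1 <= r2 -> r2 < R0 -> cavg (circ F r1) = cavg (circ F r2).
Proof.
move=> hF r10 r12 r2R; apply: ReIm_inj => /=; first exact: (mean_Re hF).
have := @mean_Re (fun z => (0 +i* (-1)) * F z) R0 r1 r2.
have E r : mint (fun t => complex.Re (circ (fun z => (0 +i* (-1)) * F z) r t)) =
           mint (fun t => complex.Im (circ F r t)).
  by apply: mint_eq => t; rewrite /circ ReM /= mul0r sub0r mulN1r opprK.
rewrite !E; apply => // z hz; apply: cdiffM; [exact: cdiff_cst|exact: hF].
Qed.

Lemma mean_value F R0 r : (forall z, cabs z < R0 -> cdiff F z) ->
  0 <= r < R0 -> cavg (circ F r) = F 0.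
Proof.
move=> hF /andP[r0 rR]; have R00 : 0 < R0 by exact: le_lt_trans rR.
have [->|rn0] := eqVneq r 0.
  by rewrite -[RHS]cavg_cst; apply: cavg_eq => t; rewrite /circ mul0r.
have {r0} rp : 0 < r by rewrite lt_def rn0.
apply/eqP; rewrite -subr_eq0 -cabs_eq0.
have cF0 : ccont F 0 by apply: cdiff_cts; apply: hF; rewrite cabs0.
rewrite eq_le cabs_ge0 andbT; apply/ler_addgt0Pr => e e0; rewrite add0r.
have [d d0 hd] := (ccontP _ _).1 cF0 _ e0.
pose r1 := Num.min r (d / 2).
have r10 : 0 < r1 by rewrite lt_min rp divr_gt0.
have r1r : r1 <= r by rewrite ge_min lexx.
have r1d : r1 < d.
  by apply: le_lt_trans (_ : d / 2 < d); rewrite ?ge_min ?lexx ?orbT// ltr_pdivrMr// ltr_pMr// ltr1n.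
rewrite -(@circle_mean_const F R0 r1 r)//; last by move=> z /andP[_ /hF].
have cF1 : ccts (circ F r1).
  by apply: (@ccts_circ_cdiff _ _ R0) => //; rewrite ltW//= (le_lt_trans r1r).
have iF := ccts_cintg cF1.
rewrite -[F 0]cavg_cst -cavgB//; last exact: cintg_cst.
apply: le_trans (cabs_cavg _) _; first by apply: cintgB => //; exact: cintg_cst.
rewrite -[leRHS]mint_cst; apply: mint_le.
- by apply: cintg_cabs; apply: cintgB => //; exact: cintg_cst.
- exact: intg_cst.
- move=> t; apply/ltW/hd; rewrite subr0 cabs_circle//; exact: ltW.
Qed.

Lemma cavg_expi n : cavg (fun t => expi t ^+ n.+1 : C) = 0.
Proof.
have := @mean_value (fun z => z ^+ n.+1) 2 1.
have -> : cavg (circ (fun z => z ^+ n.+1) 1) = cavg (fun t => expi t ^+ n.+1 : C).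
  by apply: cavg_eq => t; rewrite /circ mul1r.
move=> ->; rewrite ?expr0n// ?ler01 ?ltr1n//.
by move=> z _; apply: cdiffX; exact: cdiff_id.
Qed.

Lemma ccts_expiX n : ccts (fun t => expi t ^+ n : C).
Proof.
elim: n => [|n IH]; first exact: ccts_cst.
by under eq_fun do rewrite exprS; apply: cctsM => //; exact: ccts_expi.
Qed.

(** The Taylor coefficients of [f], read off from circle means so that no power series has to be
    summed. The vanishing of the negative frequencies is what makes the Poisson integral of [f] a
    series in [z] alone. *)
Definition coefs f R0 (a : nat -> C) := forall r n, 0 <= r < R0 ->
  cavg (fun t => circ f r t * (expi t)^*%C ^+ n) = a n * (r ^+ n)%:C /\
  cavg (fun t => circ f r t * expi t ^+ n.+1) = 0.

Lemma coefs_exist f R0 : 0 < R0 -> (forall z, cabs z < R0 -> cdiff f z) ->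
  exists a : nat -> C, coefs f R0 a.
Proof.
move=> R00 hf.
pose r0 := R0 / 2.
have r00 : 0 < r0 by rewrite divr_gt0.
have r0R : r0 < R0 by rewrite ltr_pdivrMr// ltr_pMr// ltr1n.
exists (fun n => cavg (fun t => circ f r0 t * (expi t)^*%C ^+ n) * ((r0 ^+ n)^-1)%:C).
move=> r n /andP[rp rR]; split; last first.
  have [->|rn0] := eqVneq r 0.
    have -> : (fun t => circ f 0 t * expi t ^+ n.+1) = (fun t => f 0 * expi t ^+ n.+1).
      by apply/funext => t; rewrite /circ mul0r.
    by rewrite cavgZ ?cavg_expi ?mulr0//; apply: ccts_cintg; exact: ccts_expiX.
  have := @mean_value (fun z => f z * z ^+ n.+1) R0 r.
  rewrite expr0n /= mulr0 rp rR => /(_ _ isT) => h.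
  have {}h : cavg (circ (fun z => f z * z ^+ n.+1) r) = 0.
    by apply: h => z zR; apply: cdiffM; [exact: hf|apply: cdiffX; exact: cdiff_id].
  have rc : (r ^+ n.+1)%:C != 0 :> C.
    by rewrite -cabs_gt0 cabs_real normr_gt0 expf_neq0.
  apply: (mulfI rc); rewrite mulr0 -cavgZ; last first.
    apply: ccts_cintg; apply: cctsM; last exact: ccts_expiX.
    by apply: ccts_circ_cdiff hf; rewrite rp.
  rewrite -[RHS]h; apply: cavg_eq => t.
  by rewrite /circ exprMn -rmorphXn /=; ring.
have [->|rn0] := eqVneq r 0.
  case: n => [|n].
    rewrite expr0 invr1 !mulr1 /=.
    have -> : cavg (fun t => circ f 0 t * (expi t)^*%C ^+ 0) = f 0.
      by rewrite -[RHS]cavg_cst; apply: cavg_eq => t; rewrite /circ mul0r mulr1.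
    rewrite -(@mean_value f R0 r0)//; last by rewrite ltW.
    by apply: cavg_eq => t; rewrite mulr1.
  rewrite expr0n /= mulr0.
  have -> : (fun t => circ f 0 t * (expi t)^*%C ^+ n.+1) = (fun t => f 0 * (expi t)^*%C ^+ n.+1).
    by apply/funext => t; rewrite /circ mul0r.
  have E : (fun t => (expi t)^*%C ^+ n.+1) = (fun t => (expi t ^+ n.+1)^*%C) :> (R -> C).
    by apply/funext => t; rewrite conjX.
  have iE : cintg (fun t => (expi t)^*%C ^+ n.+1 : C).
    by rewrite E; apply: ccts_cintg; apply: ccts_conj; exact: ccts_expiX.
  rewrite (cavgZ _ iE) E.
  rewrite cavg_conj; last by apply: ccts_cintg; exact: ccts_expiX.
  by rewrite cavg_expi conjc0 mulr0.
have {rp} rp : 0 < r by rewrite lt_def rn0.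
(* The n-th Fourier coefficient on the circle of radius [s], divided by [s ^+ n], is the circle mean
   of [f z / z ^+ n], which does not depend on [s]. *)
pose F z := f z * (z ^+ n)^-1.
have hF z : 0 < cabs z < R0 -> cdiff F z.
  move=> /andP[z0 zR]; apply: cdiffM; first exact: hf.
  apply: cdiffV; first by rewrite expf_neq0// -cabs_gt0.
  by apply: cdiffX; exact: cdiff_id.
have FE s : 0 < s -> s < R0 -> cavg (circ F s) =
    ((s ^+ n)^-1)%:C * cavg (fun t => circ f s t * (expi t)^*%C ^+ n).
  move=> s0 sR; rewrite -cavgZ; last first.
    apply: ccts_cintg; apply: cctsM; first by apply: ccts_circ_cdiff hf; rewrite ltW.
    by under eq_fun do rewrite -conjX; apply: ccts_conj; exact: ccts_expiX.
  apply: cavg_eq => t; rewrite /circ /F -expiV exprVn exprMn invfM -rmorphXn -fmorphV /=.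
  ring.
have key : cavg (circ F r) = cavg (circ F r0).
  have [rr0|/ltW r0r] := leP r r0; first exact: (circle_mean_const hF).
  by apply/esym/(circle_mean_const hF).
move: key; rewrite !FE// [X in _ = X]mulrC => <-.
rewrite mulrAC -rmorphM /= mulVf ?mul1r// expf_neq0// gt_eqF.
Qed.

End CircleMeans.

(** * Rewriting rules for the embedding of the reals *)

Section RealComplex.
Context (R : realType).
Local Notation C := R[i].
Implicit Types a b : R.

Lemma RtoCM a b : (a * b)%:C = a%:C * b%:C :> C.
Proof. exact: (rmorphM (real_complex R)). Qed.

Lemma RtoCX a n : (a ^+ n)%:C = a%:C ^+ n :> C.
Proof. exact: (rmorphXn (real_complex R)). Qed.

Lemma RtoCB a b : (a - b)%:C = a%:C - b%:C :> C.
Proof. exact: (rmorphB (real_complex R)). Qed.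

Lemma RtoCD a b : (a + b)%:C = a%:C + b%:C :> C.
Proof. exact: (rmorphD (real_complex R)). Qed.

Lemma RtoCV a : (a^-1)%:C = (a%:C)^-1 :> C.
Proof. exact: (fmorphV (real_complex R)). Qed.

Lemma RtoC1 : 1%:C = 1 :> C.
Proof. by []. Qed.

Lemma cvg_exprS a : 0 <= a -> a < 1 -> a ^+ n.+1 @[n --> \oo] --> 0.
Proof.
move=> a0 a1; rewrite -(mulr0 a); under eq_fun do rewrite exprS.
by apply: cvgM; [exact: cvg_cst|apply: cvg_expr; rewrite ger0_norm].
Qed.

End RealComplex.

(** * The Poisson kernel: size, expansion, total mass and behaviour as an approximate identity *)

Section PoissonKernel.
Context (R : realType).
Local Notation C := R[i].
Implicit Types (z w q : C) (a b r s t e d rho : R) (g : R -> C).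

Definition pois z t : R := (1 - cabs z ^+ 2) / cabs (expi t - z) ^+ 2.

Lemma cabs_expiB z t : 1 - cabs z <= cabs (expi t - z).
Proof. by rewrite -{1}(cabs_expi t) cabs_triB. Qed.

Lemma cabs_expiB_gt0 z t : cabs z < 1 -> 0 < cabs (expi t - z).
Proof. by move=> z1; apply: lt_le_trans (cabs_expiB z t); rewrite subr_gt0. Qed.

Lemma pois_ge0 z t : cabs z < 1 -> 0 <= pois z t.
Proof.
by move=> z1; have c0 := cabs_ge0 z; rewrite divr_ge0 ?sqr_ge0// subr_ge0 expr_le1// ltW.
Qed.

Lemma pois_le z t : cabs z < 1 -> pois z t <= 2 / (1 - cabs z).
Proof.
move=> z1; have h0 : 0 < 1 - cabs z by rewrite subr_gt0.
have h1 := cabs_expiB z t; have h2 := cabs_expiB_gt0 t z1; have h3 := cabs_ge0 z.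
rewrite /pois ler_pdivrMr ?exprn_gt0// mulrAC ler_pdivlMr//.
have : (1 - cabs z) ^+ 2 <= cabs (expi t - z) ^+ 2 by rewrite lerXn2r// ?nnegrE ?cabs_ge0// ltW.
nra.
Qed.

Lemma pois_far z w t d : 0 < d -> cabs z < 1 -> cabs (z - w) <= d / 2 ->
  d <= cabs (expi t - w) -> pois z t <= 8 / d ^+ 2 * (1 - cabs z).
Proof.
move=> d0 z1 zw dw; have h3 := cabs_ge0 z.
have h1 : d / 2 <= cabs (expi t - z).
  have := cabs_tri (expi t) z w; lra.
have h2 : 0 < d / 2 by rewrite divr_gt0.
have h4 : (d / 2) ^+ 2 <= cabs (expi t - z) ^+ 2.
  by rewrite lerXn2r// ?nnegrE ?cabs_ge0// ltW.
rewrite /pois ler_pdivrMr; last by rewrite exprn_gt0// (lt_le_trans h2).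
apply: (@le_trans _ _ (8 / d ^+ 2 * (1 - cabs z) * (d / 2) ^+ 2)); last first.
  by rewrite ler_wpM2l// mulr_ge0 ?subr_ge0 ?ltW// divr_gt0// exprn_gt0.
have -> : 8 / d ^+ 2 * (1 - cabs z) * (d / 2) ^+ 2 = 2 * (1 - cabs z).
  by field; rewrite gt_eqF.
nra.
Qed.

Lemma pois_Re z t : cabs z < 1 ->
  pois z t = complex.Re ((expi t + z) / (expi t - z)).
Proof.
move=> z1; have h := cabs_expiB_gt0 t z1.
have h0 : expi t - z != 0 by rewrite -cabs_gt0.
have E : (expi t + z) / (expi t - z) =
   ((cabs (expi t - z) ^+ 2)^-1)%:C * ((expi t + z) * (expi t - z)^*%C).
  apply: (mulIf h0); rewrite divfK// -!mulrA [_^*%C * _]mulrC mul_conj mulrCA -rmorphM /=.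
  by rewrite mulVf ?mulr1// expf_neq0// gt_eqF.
rewrite E ReZ /pois mulrC; congr (_ * _).
rewrite ReM conjB ReB ImB !Re_conj !Im_conj ReD ImD -(expr1n R 2) -{1}(cabs_expi t) !cabs_sqr.
ring.
Qed.

Lemma ccts_expiB z : ccts (fun t => expi t - z).
Proof. by apply: cctsD; [exact: ccts_expi|exact: ccts_cst]. Qed.

Lemma pois_cts z : cabs z < 1 -> continuous (pois z).
Proof.
move=> z1 t; apply: cvgM; first exact: cvg_cst.
apply: cvgV; first by rewrite expf_neq0// gt_eqF// cabs_expiB_gt0.
have h := ccts_cabs (ccts_expiB z).
by rewrite expr2; under eq_fun do rewrite expr2; apply: cvgM; exact: h.
Qed.

Lemma pois_meas z : cabs z < 1 -> measurable_fun setT (pois z).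
Proof. by move=> z1; apply: continuous_measurable_fun; exact: pois_cts. Qed.

Lemma pois_norm z t : cabs z < 1 -> `|pois z t| <= 2 / (1 - cabs z).
Proof. by move=> z1; rewrite ger0_norm ?pois_le// pois_ge0. Qed.

Lemma pois_intg z : cabs z < 1 -> intg (pois z).
Proof. by move=> z1; apply: (intg_bounded (pois_meas z1)) => t; exact: pois_norm. Qed.

Lemma cmeas_real (f : R -> R) : measurable_fun setT f -> cmeas (fun t => (f t)%:C).
Proof. by move=> mf; split => //=; exact: measurable_cst. Qed.

Lemma pois_cintg z g : cabs z < 1 -> cintg g -> cintg (fun t => (pois z t)%:C * g t).
Proof.
move=> z1 ig; apply: (@cintgM _ _ _ (2 / (1 - cabs z))) => //.
  by apply: cmeas_real; exact: pois_meas.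
by move=> t; rewrite cabs_real pois_norm.
Qed.

Lemma pois_intgM z (f : R -> R) : cabs z < 1 -> intg f -> intg (fun t => pois z t * f t).
Proof.
move=> z1 iF; apply: (@intgM _ _ _ (2 / (1 - cabs z))) => //; first exact: pois_meas.
by move=> t; exact: pois_norm.
Qed.

Lemma geom_tail q n : q != 1 ->
  (1 - q)^-1 = \sum_(i < n) q ^+ i + q ^+ n / (1 - q).
Proof.
move=> q1; have h : 1 - q != 0 by rewrite subr_eq0 eq_sym.
apply: (mulIf h); rewrite mulVf// mulrDl divfK//.
set S := \sum_(i < n) _.
have -> : S * (1 - q) = - ((q - 1) * S) by ring.
by rewrite -subrX1 opprB subrK.
Qed.

(* With q = z e^{-it}, the kernel is 2 Re (1/(1-q)) - 1. *)
Lemma pois_expand z t n : cabs z < 1 -> let q := z * (expi t)^*%C in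
  (pois z t)%:C = \sum_(i < n.+1) q ^+ i + \sum_(i < n) (q^*%C) ^+ i.+1 +
                  (2 * complex.Re (q ^+ n.+1 / (1 - q)))%:C.
Proof.
move=> z1 q; have qz : cabs q = cabs z by rewrite cabsM cabs_conj cabs_expi mulr1.
have q1 : q != 1.
  by apply: contraTneq z1 => h; rewrite -qz h cabs1 ltxx.
have h : 1 - q != 0 by rewrite subr_eq0 eq_sym.
have e0 := expi_neq0 t.
have E : (expi t + z) / (expi t - z) = 2 * (1 - q)^-1 - 1.
  have -> : z = expi t * q by rewrite /q mulrCA mul_conj cabs_expi expr1n mulr1.
  by field; rewrite h -{1}[expi t]mulr1 -mulrBr mulf_neq0.
rewrite pois_Re// E; set T := q ^+ n.+1 / _.
rewrite (geom_tail n.+1 q1) -/T; set S := \sum_(i < n.+1) q ^+ i.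
have -> : \sum_(i < n) (q^*%C) ^+ i.+1 = S^*%C - 1.
  rewrite /S big_ord_recl expr0 conjD (_ : 1^*%C = 1 :> C) ?conjR// [RHS]addrAC subrr add0r.
  rewrite (rmorph_sum (@conjc R)); apply: eq_bigr => i _.
  by rewrite lift0; exact/esym/conjX.
apply: ReIm_inj.
  rewrite ReB ReM !ReD ReN Re_conj /=; ring.
rewrite !ImD ImN Im_conj /=; ring.
Qed.

Lemma mint_pois_cavg z g : cabs z < 1 -> cintg g ->
  cabs (cavg (fun t => (pois z t)%:C * g t)) <= mint (fun t => pois z t * cabs (g t)).
Proof.
move=> z1 ig; apply: le_trans (cabs_cavg (pois_cintg z1 ig)) _.
apply: mint_le.
- by apply: cintg_cabs; exact: pois_cintg.
- by apply: pois_intgM => //; exact: cintg_cabs.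
- by move=> t; rewrite cabsM cabs_real ger0_norm// pois_ge0.
Qed.

Lemma cintg_expiM g n : cintg g -> cintg (fun t => expi t ^+ n * g t).
Proof.
move=> ig; apply: (@cintgM _ _ _ 1) => //; first by apply: ccts_meas; exact: ccts_expiX.
by move=> t; rewrite cabsX cabs_expi expr1n.
Qed.

Lemma cintg_conjexpiM g n : cintg g -> cintg (fun t => (expi t)^*%C ^+ n * g t).
Proof.
move=> ig; apply: (@cintgM _ _ _ 1) => //.
  apply: ccts_meas.
  have -> : (fun t => (expi t)^*%C ^+ n : C) = (fun t => (expi t ^+ n)^*%C).
    by apply/funext => t; rewrite conjX.
  by apply: ccts_conj; exact: ccts_expiX.
by move=> t; rewrite cabsX cabs_conj cabs_expi expr1n.
Qed.

(** The expansion of the kernel is integrated against [g]: its conjugate half meets only frequencies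
    that vanish by hypothesis, and its geometric remainder is bounded in modulus. *)
Lemma poisson_fourier z g (c : nat -> C) n : cabs z < 1 -> cintg g ->
  (forall n, cavg (fun t => (expi t)^*%C ^+ n * g t) = c n) ->
  (forall n, cavg (fun t => expi t ^+ n.+1 * g t) = 0) ->
  cabs (cavg (fun t => (pois z t)%:C * g t) - \sum_(i < n.+1) c i * z ^+ i) <=
  2 * cabs z ^+ n.+1 / (1 - cabs z) * mint (fun t => cabs (g t)).
Proof.
move=> z1 ig hc h0.
pose q t := z * (expi t)^*%C.
have qz t : cabs (q t) = cabs z by rewrite cabsM cabs_conj cabs_expi mulr1.
pose T t := (2 * complex.Re (q t ^+ n.+1 / (1 - q t)))%:C * g t.
have i1 i : cintg (fun t => z ^+ i * ((expi t)^*%C ^+ i * g t)).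
  by apply: cintgZ; exact: cintg_conjexpiM.
have i2 i : cintg (fun t => (z^*%C) ^+ i.+1 * (expi t ^+ i.+1 * g t)).
  by apply: cintgZ; exact: cintg_expiM.
have E t : (pois z t)%:C * g t = \sum_(i < n.+1) z ^+ i * ((expi t)^*%C ^+ i * g t) +
   \sum_(i < n) (z^*%C) ^+ i.+1 * (expi t ^+ i.+1 * g t) + T t.
  rewrite (pois_expand t n z1) -/(q t) (mulrDl _ _ (g t)) (mulrDl _ _ (g t)) !mulr_suml; congr (_ + _ + _).
    by apply: eq_bigr => i _; rewrite /q exprMn mulrA.
  by apply: eq_bigr => i _; rewrite /q conjM conjcK exprMn mulrA.
have iS1 : cintg (fun t => \sum_(i < n.+1) z ^+ i * ((expi t)^*%C ^+ i * g t)).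
  by apply: cintg_sum => i; exact: i1.
have iS2 : cintg (fun t => \sum_(i < n) (z^*%C) ^+ i.+1 * (expi t ^+ i.+1 * g t)).
  by apply: cintg_sum => i; exact: i2.
have TE : T = (fun t => (pois z t)%:C * g t - (\sum_(i < n.+1) z ^+ i * ((expi t)^*%C ^+ i * g t) +
   \sum_(i < n) (z^*%C) ^+ i.+1 * (expi t ^+ i.+1 * g t))).
  by apply/funext => t; rewrite E addrAC subrr add0r.
have iT : cintg T.
  by rewrite TE; apply: cintgB; [exact: pois_cintg|exact: cintgD].
have -> : cavg (fun t => (pois z t)%:C * g t) = \sum_(i < n.+1) c i * z ^+ i + cavg T.
  rewrite (cavg_eq E) cavgD//; last exact: cintgD.
  rewrite cavgD// !cavg_sum//; congr (_ + _).
  rewrite [X in _ + X]big1 ?addr0; last first.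
    by move=> i _; rewrite cavgZ ?h0 ?mulr0//; exact: cintg_expiM.
  by apply: eq_bigr => i _; rewrite cavgZ ?hc 1?mulrC//; exact: cintg_conjexpiM.
rewrite addrAC subrr add0r; apply: le_trans (cabs_cavg iT) _.
rewrite -mintZ; last exact: cintg_cabs.
apply: mint_le; [exact: cintg_cabs|by apply: intgZ; exact: cintg_cabs|move=> t].
rewrite /T cabsM ler_wpM2r ?cabs_ge0// cabs_real normrM ger0_norm// -mulrA ler_wpM2l//.
apply: le_trans (Re_le_cabs _) _; rewrite cabsM cabsX cabsV qz.
rewrite ler_wpM2l ?exprn_ge0 ?cabs_ge0//.
rewrite lef_pV2 ?posrE ?subr_gt0//.
  by rewrite -(qz t) -{1}(cabs1 R) cabs_triB.
apply: lt_le_trans (_ : 0 < 1 - cabs z) _; first by rewrite subr_gt0.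
by rewrite -(qz t) -{1}(cabs1 R) cabs_triB.
Qed.

(** This is [poisson_fourier] for [g = 1]: every partial sum equals 1 and the remainder tends to
    0. *)
Lemma mint_pois z : cabs z < 1 -> mint (pois z) = 1.
Proof.
move=> z1; have h n := @poisson_fourier z (fun=> 1) (fun n => (n == 0%N)%:R) n z1 (cintg_cst 1).
have c1 n : cavg (fun t => (expi t)^*%C ^+ n * 1) = (n == 0%N)%:R :> C.
  have -> : (fun t => (expi t)^*%C ^+ n * 1 : C) = (fun t => (expi t ^+ n)^*%C).
    by apply/funext => t; rewrite mulr1 conjX.
  rewrite cavg_conj; last by apply: ccts_cintg; exact: ccts_expiX.
  case: n => [|n]; last by rewrite cavg_expi conjc0.
  by rewrite (_ : (fun t => _) = (fun=> 1)) ?cavg_cst ?conjR//; apply/funext => t; rewrite expr0.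
have c2 n : cavg (fun t => expi t ^+ n.+1 * 1) = 0 :> C.
  by rewrite -[RHS](cavg_expi R n); apply: cavg_eq => t; rewrite mulr1.
apply/eqP; rewrite -subr_eq0 -normr_eq0 eq_le normr_ge0 andbT.
have lim : 2 * cabs z ^+ n.+1 / (1 - cabs z) @[n --> \oo] --> 0.
  rewrite -(mul0r (1 - cabs z)^-1) -(mulr0 2); apply: cvgM; last exact: cvg_cst.
  apply: cvgM; first exact: cvg_cst.
  by apply: cvg_exprS => //; exact: cabs_ge0.
apply/ler_addgt0Pr => e e0; rewrite add0r.
move/cvgrPdist_lt : lim => /(_ e e0)[n _ /(_ n (leqnn _))].
rewrite /= sub0r normrN => /ltW hn; apply: le_trans (ler_norm _) _.
rewrite normr_id; apply: le_trans hn; apply: le_trans (ler_norm _).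
have := h n c1 c2; rewrite [mint _](_ : _ = 1) ?mulr1; last first.
  by rewrite -[RHS]mint_cst; apply: mint_eq => t; rewrite cabs1.
apply: le_trans; rewrite big_ord_recl /= mul1r expr0 big1 ?addr0; last first.
  by move=> i _; rewrite mul0r.
have -> : cavg (fun t => (pois z t)%:C * 1) = (mint (pois z))%:C.
  by rewrite -cavg_real; apply: cavg_eq => t; rewrite mulr1.
by rewrite -RtoC1 -RtoCB cabs_real.
Qed.

Lemma mint_pois_le z (f : R -> R) M : cabs z < 1 -> intg f -> (forall t, f t <= M) ->
  mint (fun t => pois z t * f t) <= M.
Proof.
move=> z1 iF fM; rewrite -[M]mulr1 -(mint_pois z1) -mintZ ?pois_intg//.
apply: mint_le; [exact: pois_intgM|by apply: intgZ; exact: pois_intg|move=> t].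
by rewrite mulrC ler_wpM2r// pois_ge0.
Qed.

Lemma poisson_radial g t0 : cintg g ->
  (forall e, 0 < e -> exists2 d, 0 < d &
    forall t, cabs (expi t - expi t0 : C) < d -> cabs (g t - g t0) <= e) ->
  forall e, 0 < e -> exists2 d, 0 < d & forall r, 0 <= r < 1 -> 1 - r < d ->
   cabs (cavg (fun t => (pois (r%:C * expi t0) t)%:C * g t) - g t0) <= e.
Proof.
move=> ig cg e e0; have [d d0 hd] := cg _ (divr_gt0 e0 (@ltr0Sn R 1)).
have igB : cintg (fun t => g t - g t0) by apply: cintgB => //; exact: cintg_cst.
set M := mint (fun t => cabs (g t - g t0)).
have M0 : 0 <= M by apply: mint_ge0 => t; exact: cabs_ge0.
pose K := 1 + 8 / d ^+ 2 * M.
have K0 : 0 < K by rewrite ltr_pwDl// mulr_ge0// divr_ge0// exprn_ge0// ltW.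
exists (Num.min (d / 2) (e / 2 / K)); first by rewrite lt_min !divr_gt0.
move=> r /andP[r0 r1]; rewrite lt_min => /andP[rd re].
set z := r%:C * expi t0; have zr : cabs z = r by rewrite cabs_circle.
have z1 : cabs z < 1 by rewrite zr.
have ze : cabs (z - expi t0) <= d / 2.
  rewrite /z -[X in _ - X]mul1r -mulrBl cabsM cabs_expi mulr1 -[1]/(1%:C) -rmorphB.
  by rewrite cabs_real distrC ger0_norm ?subr_ge0 ltW.
have -> : cavg (fun t => (pois z t)%:C * g t) - g t0 =
    cavg (fun t => (pois z t)%:C * (g t - g t0)).
  have iP : cintg (fun t => (pois z t)%:C : C) by split; [exact: pois_intg|exact: intg_cst].
  have eg : g t0 = cavg (fun t => g t0 * (pois z t)%:C).
    by rewrite cavgZ// cavg_real mint_pois// mulr1.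
  rewrite {1}eg -cavgB; [|exact: pois_cintg|exact: cintgZ].
  by apply: cavg_eq => t; rewrite mulrBr; congr (_ - _); rewrite mulrC.
apply: le_trans (mint_pois_cavg z1 igB) _.
apply: (@le_trans _ _ (mint (fun t => e / 2 * pois z t + 8 / d ^+ 2 * (1 - r) * cabs (g t - g t0)))).
  apply: mint_le.
  - by apply: pois_intgM => //; exact: cintg_cabs.
  - apply: intgD; first by apply: intgZ; exact: pois_intg.
    by apply: intgZ; exact: cintg_cabs.
  move=> t; have p0 := pois_ge0 t z1; have c0 := cabs_ge0 (g t - g t0).
  have [td|td] := ltP (cabs (expi t - expi t0 : C)) d.
    rewrite mulrC ler_wpDr//; last by rewrite ler_wpM2r// hd.
    apply: mulr_ge0 => //; apply: mulr_ge0; last by rewrite subr_ge0 ltW.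
    by rewrite divr_ge0// exprn_ge0// ltW.
  rewrite ler_wpDl//; first by rewrite mulr_ge0// divr_ge0// ltW.
  by rewrite ler_wpM2r// -zr; exact: (pois_far d0 z1 ze td).
rewrite mintD; last 2 first.
- by apply: intgZ; exact: pois_intg.
- by apply: intgZ; exact: cintg_cabs.
rewrite (mintZ _ (pois_intg z1)) (mintZ _ (cintg_cabs igB)) mint_pois// mulr1.
rewrite -/M [leRHS]splitr lerD2l.
move: re; rewrite ltr_pdivlMr// => re.
apply: le_trans (ltW re); rewrite mulrAC mulrC ler_wpM2l ?subr_ge0 ?(ltW r1)//.
by rewrite /K lerDr.
Qed.

End PoissonKernel.

(** * Poisson formula, Taylor remainder and Cauchy bounds for holomorphic functions *)

Section PowerSeries.
Context (R : realType).
Local Notation C := R[i].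
Implicit Types (z w : C) (a b q r s t e d rho : R).

Variables (f : C -> C) (R0 : R).
Hypothesis R00 : 0 < R0.
Hypothesis hf : forall z, cabs z < R0 -> cdiff f z.
Variable c : nat -> C.
Hypothesis hc : coefs f R0 c.

Let cf rho : 0 <= rho -> rho < R0 -> cintg (circ f rho).
Proof. by move=> h1 h2; apply: ccts_cintg; apply: ccts_circ_cdiff hf; rewrite h1. Qed.

Let c1 rho n : 0 <= rho -> rho < R0 ->
  cavg (fun t => (expi t)^*%C ^+ n * circ f rho t) = c n * (rho ^+ n)%:C.
Proof.
move=> h1 h2; have [|<- _] := @hc rho n; first by rewrite h1.
by apply: cavg_eq => t; rewrite mulrC.
Qed.

Let c2 rho n : 0 <= rho -> rho < R0 -> cavg (fun t => expi t ^+ n.+1 * circ f rho t) = 0.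
Proof.
move=> h1 h2; have [|_ <-] := @hc rho n; first by rewrite h1.
by apply: cavg_eq => t; rewrite mulrC.
Qed.

Lemma poisson_partial z rho n : cabs z < rho -> rho < R0 ->
  cabs (cavg (fun t => (pois (z * (rho^-1)%:C) t)%:C * circ f rho t) -
        \sum_(i < n.+1) c i * z ^+ i) <=
  2 * (cabs z / rho) ^+ n.+1 / (1 - cabs z / rho) * mint (fun t => cabs (circ f rho t)).
Proof.
move=> zr rR; have r0 : 0 < rho by apply: le_lt_trans zr; exact: cabs_ge0.
set w := z * _.
have wE : cabs w = cabs z / rho by rewrite cabsM cabs_nneg// invr_ge0 ltW.
have w1 : cabs w < 1 by rewrite wE ltr_pdivrMr// mul1r.
have h := @poisson_fourier R w (circ f rho) (fun i => c i * (rho ^+ i)%:C) n w1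
  (cf (ltW r0) rR) (fun n => c1 n (ltW r0) rR) (fun n => c2 n (ltW r0) rR).
rewrite -wE; apply: le_trans h; rewrite le_eqVlt; apply/orP; left; apply/eqP.
congr (cabs (_ - _)); apply: eq_bigr => i _; rewrite /w exprMn mulrCA -mulrA.
have E : (rho ^+ i)%:C * (rho^-1)%:C ^+ i = 1 :> C.
  by rewrite -RtoCX -RtoCM exprVn mulfV// expf_neq0// gt_eqF.
by rewrite E mulr1 mulrC.
Qed.

Let tail0 q M e : 0 <= q -> q < 1 -> 0 < e -> exists n, 2 * q ^+ n.+1 / (1 - q) * M <= e.
Proof.
move=> q0 q1 e0.
have lim : 2 * q ^+ n.+1 / (1 - q) * M @[n --> \oo] --> 0.
  rewrite -(mul0r M); apply: cvgM; last exact: cvg_cst.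
  rewrite -(mul0r (1 - q)^-1) -(mulr0 2); apply: cvgM; last exact: cvg_cst.
  apply: cvgM; first exact: cvg_cst.
  exact: cvg_exprS.
move/cvgrPdist_lt : lim => /(_ e e0)[n _ /(_ n (leqnn _))].
rewrite /= sub0r normrN => /ltW hn; exists n; exact: le_trans (ler_norm _) hn.
Qed.

(* The Poisson means over the circles of radius |z| and rho > |z| have the same
   Taylor sums, hence agree inside the smaller circle; the former tends to f. *)
Lemma poisson_formula z rho : cabs z < rho -> rho < R0 ->
  f z = cavg (fun t => (pois (z * (rho^-1)%:C) t)%:C * circ f rho t).
Proof.
move=> zr rR; have r0 : 0 < rho by apply: le_lt_trans zr; exact: cabs_ge0.
pose U s w := cavg (fun t => (pois (w * (s^-1)%:C) t)%:C * circ f s t).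
rewrite -/(U rho z).
have [z0|z0] := eqVneq z 0.
  rewrite z0 /U mul0r -(@mean_value _ f R0 rho)//; last by rewrite ltW.
  apply: cavg_eq => t; rewrite /pois cabs0 subr0 cabs_expi expr1n expr0n subr0 divr1.
  by rewrite mul1r.
have sz : 0 < cabs z by rewrite cabs_gt0.
set s := cabs z in zr sz.
have sR : s < R0 by exact: lt_trans rR.
have UU w : cabs w < s -> U s w = U rho w.
  move=> ws; have wr := lt_trans ws zr.
  apply/eqP; rewrite -subr_eq0 -cabs_eq0 eq_le cabs_ge0 andbT.
  apply/ler_addgt0Pr => e e0; rewrite add0r.
  have e20 : 0 < e / 2 by rewrite divr_gt0.
  set q := cabs w / s; set q' := cabs w / rho.
  have q0 : 0 <= q by rewrite divr_ge0 ?cabs_ge0// ltW.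
  have q1 : q < 1 by rewrite ltr_pdivrMr// mul1r.
  have q'0 : 0 <= q' by rewrite divr_ge0 ?cabs_ge0// ltW.
  have q'q : q' <= q by rewrite ler_wpM2l ?cabs_ge0// lef_pV2 ?posrE// ltW.
  have q'1 := le_lt_trans q'q q1.
  pose M := mint (fun t => cabs (circ f s t)) + mint (fun t => cabs (circ f rho t)).
  have m1 : 0 <= mint (fun t => cabs (circ f s t)) by apply: mint_ge0 => t; exact: cabs_ge0.
  have m2 : 0 <= mint (fun t => cabs (circ f rho t)) by apply: mint_ge0 => t; exact: cabs_ge0.
  have [n hn] := tail0 M q0 q1 e20.
  have h1 := poisson_partial n ws sR; have h2 := poisson_partial n wr rR.
  rewrite -/(U s w) -/q in h1; rewrite -/(U rho w) -/q' in h2.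
  have A0 : 0 <= 2 * q ^+ n.+1 / (1 - q).
    by rewrite divr_ge0 ?mulr_ge0 ?exprn_ge0// subr_ge0 ltW.
  have A1 : 2 * q' ^+ n.+1 / (1 - q') <= 2 * q ^+ n.+1 / (1 - q).
    apply: ler_pM; rewrite ?mulr_ge0 ?exprn_ge0// ?invr_ge0 ?subr_ge0 ?(ltW q'1)//.
      by rewrite ler_wpM2l// lerXn2r.
    by rewrite lef_pV2 ?posrE ?subr_gt0// lerD2l lerN2.
  have {}h1 : cabs (U s w - \sum_(i < n.+1) c i * w ^+ i) <= e / 2.
    by apply: le_trans h1 _; apply: le_trans hn; rewrite ler_wpM2l// lerDl.
  have {}h2 : cabs (U rho w - \sum_(i < n.+1) c i * w ^+ i) <= e / 2.
    apply: le_trans h2 _; apply: le_trans hn.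
    by apply: le_trans (ler_wpM2r m2 A1) _; rewrite ler_wpM2l// lerDr.
  have := cabs_tri (U s w) (\sum_(i < n.+1) c i * w ^+ i) (U rho w).
  by move: h2; rewrite (cabsC (U rho w)); lra.
have [t0 _ zE] := polar z; rewrite -/s in zE.
apply/eqP; rewrite -subr_eq0 -cabs_eq0 eq_le cabs_ge0 andbT.
apply/ler_addgt0Pr => e e0; rewrite add0r.
have e30 : 0 < e / 3 by rewrite divr_gt0.
have cz : ccont f z by apply: cdiff_cts; exact: hf.
have [d d0 hd] : exists2 d, 0 < d & forall r, 0 <= r < 1 -> 1 - r < d ->
   cabs (cavg (fun t => (pois (r%:C * expi t0) t)%:C * circ f s t) - circ f s t0) <= e / 3.
  apply: poisson_radial => //; first by apply: cf => //; exact: ltW.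
  move=> e1 e10; have [d d0 hd] := (ccontP _ _).1 cz _ e10.
  exists (d / s); first by rewrite divr_gt0.
  move=> t ht; rewrite /circ -zE; apply/ltW/hd.
  rewrite zE -mulrBr cabsM cabs_nneg ?ltW//.
  by move: ht; rewrite ltr_pdivlMr// mulrC.
have fz : circ f s t0 = f z by rewrite /circ -zE.
pose q := s / rho.
have q0 : 0 <= q by rewrite divr_ge0// ltW.
have q1 : q < 1 by rewrite ltr_pdivrMr// mul1r.
have [n hn] := tail0 (mint (fun t => cabs (circ f rho t))) q0 q1 (divr_gt0 e30 (@ltr0Sn R 1)).
pose S w := \sum_(i < n.+1) c i * w ^+ i.
have cS : ccont S z.
  rewrite /S; elim: (n.+1) => [|m IH].
    have -> : (fun w => \sum_(i < 0) c i * w ^+ i) = (fun=> 0).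
      by apply/funext => w; rewrite big_ord0.
    exact: ccont_cst.
  have -> : (fun w => \sum_(i < m.+1) c i * w ^+ i) =
            (fun w => \sum_(i < m) c i * w ^+ i + c m * w ^+ m).
    by apply/funext => w; rewrite big_ord_recr.
  apply: ccontD => //; apply: cdiff_cts; apply: cdiffM; first exact: cdiff_cst.
  by apply: cdiffX; exact: cdiff_id.
have [d' d'0 hd'] := (ccontP _ _).1 cS _ e30.
pose h := Num.min (1 / 2) (Num.min (d / 2) (d' / 2 / s)).
have h0 : 0 < h by rewrite !lt_min !divr_gt0.
have [h1 h2 h3] : [/\ h <= 1 / 2, h <= d / 2 & h <= d' / 2 / s].
  by rewrite !ge_min !lexx !orbT.
pose r := 1 - h; have r01 : 0 <= r < 1 by rewrite /r; lra.
have zr1 : cabs (r%:C * z) < s.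
  by rewrite cabsM cabs_nneg ?gtr_pMl//; case/andP: r01.
have k1 : cabs (U s (r%:C * z) - f z) <= e / 3.
  rewrite -fz.
  have -> : U s (r%:C * z) = cavg (fun t => (pois (r%:C * expi t0) t)%:C * circ f s t).
    apply: cavg_eq => t; congr ((pois _ _)%:C * _).
    have sn0 : s%:C != 0 :> C by rewrite -cabs_gt0 cabs_nneg// ltW.
    by rewrite {1}zE RtoCV; field.
  by apply: hd => //; rewrite /r; lra.
have k2 : cabs (S (r%:C * z) - S z) <= e / 3.
  apply/ltW/hd'; rewrite -[X in _ - X]mul1r -mulrBl cabsM -[1]/(1%:C) -rmorphB cabs_real.
  rewrite /r (_ : 1 - h - 1 = - h); last by ring.
  rewrite normrN ger0_norm ?(ltW h0)// -/s -ltr_pdivlMr//.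
  apply: le_lt_trans h3 _; rewrite ltr_pM2r ?invr_gt0//.
  by rewrite ltr_pdivrMr// ltr_pMr// ltr1n.
have k3 w : cabs w <= s -> cabs (U rho w - S w) <= e / 6.
  move=> ws; apply: le_trans (poisson_partial n (le_lt_trans ws zr) rR) _.
  have -> : e / 6 = e / 3 / 2 by field.
  apply: le_trans hn; rewrite ler_wpM2r ?mint_ge0// => [t|]; first exact: cabs_ge0.
  have wq : cabs w / rho <= q by rewrite ler_wpM2r// invr_ge0 ltW.
  have w0 : 0 <= cabs w / rho by rewrite divr_ge0 ?cabs_ge0// ltW.
  apply: ler_pM; rewrite ?mulr_ge0 ?exprn_ge0// ?invr_ge0 ?subr_ge0 ?(ltW (le_lt_trans wq q1))//.
    by rewrite ler_wpM2l// lerXn2r.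
  by rewrite lef_pV2 ?posrE ?subr_gt0 ?(le_lt_trans wq q1)// lerD2l lerN2.
have k4 := k3 _ (ltW zr1); have k5 := k3 z (lexx _).
rewrite -UU// in k4.
have t1 := cabs_tri (f z) (U s (r%:C * z)) (U rho z).
have t2 := cabs_tri (U s (r%:C * z)) (S (r%:C * z)) (U rho z).
have t3 := cabs_tri (S (r%:C * z)) (S z) (U rho z).
move: k1 k5; rewrite (cabsC (U s _)) (cabsC (U rho z)) => k1 k5; lra.
Qed.

Lemma taylor_bound z rho n : cabs z < rho -> rho < R0 ->
  cabs (f z - \sum_(i < n.+1) c i * z ^+ i) <=
  2 * (cabs z / rho) ^+ n.+1 / (1 - cabs z / rho) * mint (fun t => cabs (circ f rho t)).
Proof.
by move=> zr rR; rewrite (poisson_formula zr rR); exact: poisson_partial.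
Qed.

Lemma coef_bound rho n : 0 <= rho -> rho < R0 ->
  cabs (c n) * rho ^+ n <= mint (fun t => cabs (circ f rho t)).
Proof.
move=> r0 rR; rewrite -[rho ^+ n]cabs_nneg ?exprn_ge0// -cabsM -(c1 n r0 rR).
have i1 : cintg (fun t => (expi t)^*%C ^+ n * circ f rho t).
  by apply: cintg_conjexpiM; exact: cf.
apply: le_trans (cabs_cavg i1) _; apply: mint_le; [exact: cintg_cabs|exact/cintg_cabs/cf|].
by move=> t; rewrite cabsM cabsX cabs_conj cabs_expi expr1n mul1r.
Qed.

End PowerSeries.

(** * Fatou's theorem: radial limits of Poisson integrals at Lebesgue points *)

Section Fatou.
Context (R : realType).
Local Notation C := R[i].
Local Notation mu := (@lebesgue_measure R).
Implicit Types (z w : C) (r s t e d x rho eta : R) (f F : R -> R) (g : R -> C).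

Lemma ae_lebesgue_mC (P : R -> Prop) : {ae mu, forall t, P t} -> {ae mC R, forall t, P t}.
Proof.
move=> [N [mN N0 sN]]; exists N; split => //.
exact: (proj1 (null_content_dominatesP _ _) (@dominates_uniform_prob R 0 (2 * pi) (twopi_gt0 R))).
Qed.

(** The endpoints are discarded so that small intervals around [t0] stay inside the support of
    [mC R]. *)
Lemma ae_mC_itv : {ae mC R, forall t, 0 < t < 2 * pi}.
Proof.
have m1 : measurable (`]0, 2 * pi[%classic : set R) by [].
exists (~` `]0, 2 * pi[%classic); split.
- exact: measurableC.
- rewrite /uniform_prob integral_uniform_pdf.
  have sub : (~` `]0, 2 * pi[%classic `&` `[0, 2 * pi]%classic : set R) `<=` [set 0; 2 * pi].
    move=> x [/= h]; rewrite in_itv /= => /andP[x0 x2].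
    have [->|n0] := eqVneq x 0; first by left.
    have [->|n1] := eqVneq x (2 * pi); first by right.
    by exfalso; apply: h; rewrite in_itv /= !lt_def n0 x0 eq_sym n1 x2.
  apply: null_set_integral => //.
  - by apply: measurableI => //; exact: measurableC.
  - apply/measurable_EFinP; apply: measurable_funTS; exact: measurable_uniform_pdf.
  apply: (@subset_measure0 _ _ _ mu _ [set 0; 2 * pi]) => //.
  - by apply: measurableI => //; exact: measurableC.
  - by apply: measurableU.
  - apply/eqP; rewrite -measure_le0; apply: le_trans (measureU2 _ _ _) _ => //.
    have s1 (x : R) : (mu [set x] = 0)%E by exact: lebesgue_measure_set1.
    have s2 (x : R) : (mu [set x] <= 0)%E by rewrite s1.
    by apply: (@le_trans _ _ (0 + 0)%E); [apply: leeD; exact: s2|rewrite adde0].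
- by move=> t /= h; rewrite in_itv.
Qed.

Lemma cabs_expi1 x : cabs (expi x - 1 : C) ^+ 2 = (2 * sin (x / 2)) ^+ 2.
Proof.
rewrite cabs_sqr ReB ImB /= subr0.
have h1 := cos2Dsin2 x; have h2 : cos x = 1 - 2 * sin (x / 2) ^+ 2.
  rewrite -{1}[x](@divfK _ 2)// mulr_natr cos_mulr2n cos2sin2 -mulr_natl; ring.
have -> : sin x ^+ 2 = 1 - cos x ^+ 2 by rewrite -h1; ring.
rewrite h2; ring.
Qed.

Lemma cabs_expiBexpi s t : cabs (expi s - expi t : C) = cabs (expi (s - t) - 1 : C).
Proof.
have -> : expi s = expi (s - t) * expi t :> C by rewrite -expiD subrK.
by rewrite -[X in _ - X]mul1r -mulrBl cabsM cabs_expi mulr1.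
Qed.

Lemma cabs_expi1N x : cabs (expi (- x) - 1 : C) = cabs (expi x - 1 : C).
Proof.
have -> : expi (- x) - 1 = (expi x - 1)^*%C :> C.
  by rewrite conjB -expiN; congr (_ - _); rewrite -RtoC1 conjR.
exact: cabs_conj.
Qed.

Lemma chord_far eta : 0 < eta -> exists2 d, 0 < d &
  forall x, eta <= `|x| <= 2 * pi - eta -> d <= cabs (expi x - 1 : C).
Proof.
(* For [eta > pi] no [x] satisfies the constraint; otherwise the chord is [2 |sin (x / 2)|], and
   [sin] has a positive minimum on a segment inside []0, pi[]. *)
move=> e0; have [ep|ep] := leP eta pi; last first.
  by exists 1 => // x /andP[h1 h2]; have := le_trans h1 h2; lra.
have ab : eta / 2 <= pi - eta / 2 by lra.
have [c cab hc] := @EVT_min R sin (eta / 2) (pi - eta / 2) ab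
  (continuous_subspaceT (@continuous_sin R)).
have s0 : 0 < sin c.
  by apply: sin_gt0_pi; move: cab; rewrite in_itv /= => /andP[h1 h2]; lra.
exists (2 * sin c) => [|x hx]; first by rewrite mulr_gt0.
have -> : cabs (expi x - 1 : C) = cabs (expi `|x| - 1 : C).
  by case: (ger0P x) => // _; rewrite cabs_expi1N.
have h1 : sin c <= sin (`|x| / 2) by apply: hc; rewrite in_itv /=; lra.
have B : (2 * sin c) ^+ 2 <= cabs (expi `|x| - 1 : C) ^+ 2.
  rewrite cabs_expi1 lerXn2r ?nnegrE ?ler_wpM2l//; apply: mulr_ge0 => //; first exact: ltW.
  exact: le_trans (ltW s0) h1.
by rewrite -(@ler_pXn2r _ 2)// ?nnegrE ?cabs_ge0// mulr_ge0// ltW.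
Qed.

Lemma chord_near : exists2 d, 0 < d & forall x, `|x| < d -> `|x| / 2 <= cabs (expi x - 1 : C).
Proof.
have [d d0 hd] := @exp_chart_approx R (1 / 2) (divr_gt0 ltr01 (@ltr0Sn R 1)).
exists d => // x xd; have := hd 0 x; rewrite normr0 => /(_ d0 xd).
rewrite expR0 RtoC1 mul1r add0r => h.
have hx : cabs (0 +i* x) = `|x| by rewrite cabsE /= expr0n add0r sqrtr_sqr.
have := cabs_triB (0 +i* x) (expi x - 1 : C).
rewrite hx (cabsC (0 +i* x)); lra.
Qed.

Lemma four_expr k : 4 ^+ k = (2 ^+ k) ^+ 2 :> R.
Proof. by rewrite -exprM mulnC exprM (_ : 2 ^+ 2 = 4)// -natrX. Qed.

Lemma dyadic_sum n : \sum_(k < n) (2 ^+ k)^-1 <= 2 :> R.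
Proof.
have -> : \sum_(k < n) (2 ^+ k)^-1 = 2 - 2 / 2 ^+ n :> R.
  elim: n => [|n IH]; first by rewrite big_ord0 expr0 divr1 subrr.
  rewrite big_ord_recr /= IH exprS; field; rewrite expf_neq0//.
by rewrite gerBl divr_ge0// exprn_ge0.
Qed.

Lemma pois_near z t d : cabs z < 1 -> 0 < d -> d <= cabs (expi t - z) ->
  pois z t <= 2 * (1 - cabs z) / d ^+ 2.
Proof.
move=> z1 d0 hd; have h3 := cabs_ge0 z.
rewrite /pois; apply: ler_pM; rewrite ?invr_ge0 ?sqr_ge0//.
- by rewrite subr_ge0 expr_le1// ltW.
- by nra.
- by rewrite lef_pV2 ?posrE ?exprn_gt0// ?(lt_le_trans d0 hd)// lerXn2r// ?nnegrE ?cabs_ge0// ltW.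
Qed.

Definition ballind (t0 rho t : R) : R := (`|t - t0| < rho)%R%:R.

Lemma ballind_meas t0 rho : measurable_fun setT (ballind t0 rho).
Proof.
have -> : ballind t0 rho = \1_(ball t0 rho).
  apply/funext => t; rewrite /ballind indicE; congr (nat_of_bool _)%:R.
  apply/idP/idP => h; first by rewrite inE /ball /= distrC.
  by move: h; rewrite inE /ball /= distrC.
apply: measurable_indic; exact: measurable_ball.
Qed.

Lemma ballind_intg t0 rho F : intg F -> intg (fun t => ballind t0 rho t * F t).
Proof.
move=> iF; apply: (@intgM _ _ _ 1) => //; first exact: ballind_meas.
by move=> t; rewrite /ballind; case: (_ < _); rewrite ?normr1 ?normr0.
Qed.

(** For [F = |f - f t0|] this is the Lebesgue point condition at [t0]. *)
Definition small_means t0 F := forall e, 0 < e -> exists2 rho0, 0 < rho0 &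
  forall rho, 0 < rho -> rho < rho0 -> mint (fun t => ballind t0 rho t * F t) <= e * rho.

(* The kernel is dominated by a sum of multiples of indicators of the dyadic
   intervals of radius 2^k (1 - r) about t0, plus O(1 - r) far away. *)
Lemma pois_small_means t0 F : 0 < t0 < 2 * pi -> intg F -> (forall t, 0 <= F t) ->
  small_means t0 F -> forall e, 0 < e -> exists2 d, 0 < d &
  forall r, 0 <= r < 1 -> 1 - r < d -> mint (fun t => pois (r%:C * expi t0) t * F t) <= e.
Proof.
move=> /andP[t00 t01] iF F0 sm e e0.
have M0 : 0 <= mint F by exact: mint_ge0.
(* The k-th dyadic interval contributes [8 * 16 * (e / 16 / 32) / 2 ^+ k = e / 4 / 2 ^+ k], and the
   dyadic series is at most 2: the near part costs [e / 2]. *)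
have e'0 : 0 < e / 16 / 32 by rewrite !divr_gt0.
have [rho1 rho10 hr1] := sm _ e'0.
have [dn dn0 hn] := chord_near.
pose rho0 := Num.min (Num.min rho1 dn) (Num.min t0 (2 * pi - t0)).
have rho00 : 0 < rho0 by rewrite !lt_min rho10 dn0 t00 subr_gt0.
have [a1 a2] : rho0 <= rho1 /\ rho0 <= dn by rewrite !ge_min !lexx !orbT.
have [a3 a4] : rho0 <= t0 /\ rho0 <= 2 * pi - t0 by rewrite !ge_min !lexx !orbT.
have [df df0 hf] := chord_far (divr_gt0 rho00 (@ltr0Sn R 1)).
pose K := 1 + 8 / df ^+ 2 * mint F.
have K0 : 0 < K by rewrite ltr_pwDl// mulr_ge0// divr_ge0// exprn_ge0// ltW.
exists (Num.min (Num.min rho0 (df / 2)) (e / 2 / K)); first by rewrite lt_min lt_min rho00 !divr_gt0.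
move=> r /andP[r0 r1]; rewrite lt_min lt_min => /andP[/andP[dr1 dr2] dr3].
set z := r%:C * expi t0; have zr : cabs z = r by rewrite cabs_circle.
have z1 : cabs z < 1 by rewrite zr.
set del := 1 - r in dr1 dr2 dr3; have del0 : 0 < del by rewrite subr_gt0.
have ze : cabs (z - expi t0) = del.
  rewrite /z -[X in _ - X]mul1r -mulrBl cabsM cabs_expi mulr1 -RtoC1 -RtoCB.
  by rewrite cabs_real distrC ger0_norm ?ltW.
(* [n] is the last dyadic scale below [rho0]; outside it [t] is at distance at least [rho0 / 2] from
   [t0], where the kernel is [O(1 - r)]. *)
have [n n1 n2] : exists2 n, 2 ^+ n * del < rho0 & rho0 <= 2 ^+ n.+1 * del.
  have ex : exists n, rho0 <= 2 ^+ n * del.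
    have : del * (2^-1) ^+ 0 < rho0 by rewrite mulr1.
    have lim : rho0 * (2^-1) ^+ n @[n --> \oo] --> 0.
      rewrite -(mulr0 rho0); apply: cvgM; first exact: cvg_cst.
      by apply: cvg_expr; rewrite ger0_norm ?invr_ge0// invf_lt1// ltr1n.
    move/cvgrPdist_lt : lim => /(_ _ del0)[n _ /(_ n (leqnn _))].
    rewrite /= sub0r normrN => h _; exists n; move/ltW: (le_lt_trans (ler_norm _) h).
    by rewrite exprVn ler_pdivrMr ?exprn_gt0// mulrC.
  case: (ex_minnP ex) => -[|m] hm mmin; first by move: hm; rewrite expr0 mul1r leNgt dr1.
  by exists m => //; rewrite ltNge; apply/negP => /mmin; rewrite ltnn.
have bound : {ae mC R, forall t, pois z t * F t <=
   \sum_(k < n.+1) (8 * 16) / (4 ^+ k * del) * (ballind t0 (2 ^+ k * del) t * F t) +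
   8 / df ^+ 2 * del * F t}.
  apply: aeS ae_mC_itv => t /andP[ht0 ht1].
  have s0 : 0 <= \sum_(k < n.+1) (8 * 16) / (4 ^+ k * del) * (ballind t0 (2 ^+ k * del) t * F t).
    by apply: sumr_ge0 => k _; rewrite !mulr_ge0 ?invr_ge0 ?mulr_ge0 ?exprn_ge0 ?ler0n ?(ltW del0)//.
  have [far|near_] := leP (2 ^+ n * del) `|t - t0|.
    rewrite -[leLHS]add0r; apply: lerD => //; rewrite ler_wpM2r//.
    have hx : df <= cabs (expi t - expi t0 : C).
      rewrite cabs_expiBexpi; apply: hf; apply/andP; split.
        by apply: le_trans far; move: n2; rewrite exprS -mulrA; lra.
      by rewrite ler_norml; lra.
    have := @pois_far R z (expi t0) t df df0 z1 _ hx.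
    by rewrite zr -/del ze; apply; exact: ltW.
  rewrite -[leLHS]addr0; apply: lerD; last by rewrite !mulr_ge0 ?invr_ge0 ?sqr_ge0 ?(ltW del0).
  have ex : exists k, `|t - t0| < 2 ^+ k * del by exists n.
  case: (ex_minnP ex) => k hk kmin.
  have kn : (k < n.+1)%N by rewrite ltnS; exact: kmin.
  rewrite (bigD1 (Ordinal kn)) //= -[leLHS]addr0; apply: lerD; last first.
    by apply: sumr_ge0 => j _; rewrite !mulr_ge0 ?invr_ge0 ?mulr_ge0 ?exprn_ge0 ?ler0n ?(ltW del0)//.
  rewrite {1}/ballind hk mul1r ler_wpM2r//.
  have b1 : del <= cabs (expi t - z) by have := cabs_expiB z t; rewrite zr.
  case: k hk kmin {kn} => [|k] hk kmin.
    apply: le_trans (pois_near z1 del0 b1) _.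
    rewrite zr -/del expr0 mul1r expr2 invfM mulrA mulfK ?gt_eqF//.
    by rewrite ler_wpM2r ?invr_ge0 ?(ltW del0)//; lra.
  have hk' : 2 ^+ k * del <= `|t - t0|.
    by rewrite leNgt; apply/negP => /kmin; rewrite ltnn.
  have b2 : 2 ^+ k * del / 4 <= cabs (expi t - z).
    have c1 : `|t - t0| / 2 <= cabs (expi t - expi t0 : C).
      rewrite cabs_expiBexpi; apply: hn; apply: lt_le_trans a2.
      exact: lt_trans near_ n1.
    have c2 := cabs_tri (expi t) z (expi t0); rewrite ze in c2; lra.
  have p0 : 0 < 2 ^+ k * del / 4 by rewrite !mulr_gt0 ?exprn_gt0.
  apply: le_trans (pois_near z1 p0 b2) _; rewrite zr -/del.
  have -> : 4 ^+ k.+1 = 4 * (2 ^+ k) ^+ 2 :> R.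
    by rewrite exprS four_expr.
  rewrite le_eqVlt; apply/orP; left; apply/eqP; field.
  by rewrite expf_neq0// gt_eqF.
have iB : intg (fun t => \sum_(k < n.+1) (8 * 16) / (4 ^+ k * del) * (ballind t0 (2 ^+ k * del) t * F t)).
  by apply: intg_sum => k; apply: intgZ; exact: ballind_intg.
apply: (@le_trans _ _ (mint (fun t => \sum_(k < n.+1) (8 * 16) / (4 ^+ k * del) *
   (ballind t0 (2 ^+ k * del) t * F t) + 8 / df ^+ 2 * del * F t))).
  apply: mint_ae_le => //.
  - exact: pois_intgM.
  - by apply: intgD => //; exact: intgZ.
  - by move=> t; rewrite mulr_ge0// pois_ge0.
  - move=> t; rewrite addr_ge0//; last by rewrite !mulr_ge0 ?invr_ge0 ?sqr_ge0 ?(ltW del0).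
    by apply: sumr_ge0 => k _; rewrite !mulr_ge0 ?invr_ge0 ?mulr_ge0 ?exprn_ge0 ?ler0n ?(ltW del0)//.
rewrite mintD//; last exact: intgZ.
rewrite mintZ// [leRHS]splitr lerD//; last first.
  move: dr3; rewrite ltr_pdivlMr// => dr3; apply: le_trans (ltW dr3).
  by rewrite mulrAC [leLHS]mulrC ler_wpM2l ?(ltW del0)// /K lerDr.
rewrite mint_sum; last by move=> k; apply: intgZ; exact: ballind_intg.
apply: (@le_trans _ _ (\sum_(k < n.+1) (e / 4) * (2 ^+ k)^-1)); last first.
  rewrite -mulr_sumr; apply: (@le_trans _ _ (e / 4 * 2)); last by lra.
  by rewrite ler_wpM2l ?dyadic_sum// divr_ge0// ltW.
apply: ler_sum => k _; rewrite mintZ; last exact: ballind_intg.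
have p2 : 0 < 2 ^+ k :> R by rewrite exprn_gt0.
have kn : 2 ^+ k * del < rho1.
  apply: lt_le_trans a1; apply: le_lt_trans n1; rewrite ler_wpM2r ?(ltW del0)//.
  by rewrite ler_eXn2l ?ltr1n// -ltnS.
have h := hr1 _ (mulr_gt0 p2 del0) kn.
have q0 : 0 <= (8 * 16) / (4 ^+ k * del) by rewrite divr_ge0// mulr_ge0 ?exprn_ge0// ltW.
apply: le_trans (ler_wpM2l q0 h) _.
rewrite four_expr.
rewrite le_eqVlt; apply/orP; left; apply/eqP; field.
by rewrite !gt_eqF.
Qed.

Lemma lebesgue_pt_small_means f t0 : 0 < t0 < 2 * pi -> intg f ->
  lebesgue_pt (f \_ `[0, 2 * pi]) t0 -> small_means t0 (fun t => `|f t - f t0|).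
Proof.
move=> /andP[t00 t01] iF lp e e0.
have iF0 : intg (fun t => `|f t - f t0|).
  by apply: intg_norm; apply: intgB => //; exact: intg_cst.
have p0 := twopi_gt0 R.
(* [davg] divides by the length [2 * rho] of the interval, while [mC R] carries the factor
   [(2 * pi)^-1]: the threshold [e * pi] for the former is [e * rho] for the mean. *)
have e'0 : (0 < (e * pi)%:E)%E by rewrite lte_fin mulr_gt0// pi_gt0.
have /lp : nbhs 0%E [set y : \bar R | (y < (e * pi)%:E)%E].
  exists (e * pi) => [|y /=]; first by rewrite /= -lte_fin.
  by rewrite sub0r normrN lte_fin; exact: le_lt_trans (ler_norm _).
move=> [d /= d0 hd].
pose rho0 := Num.min d (Num.min t0 (2 * pi - t0)).
have rho00 : 0 < rho0 by rewrite !lt_min d0 t00 subr_gt0.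
have [a1 a2 a3] : [/\ rho0 <= d, rho0 <= t0 & rho0 <= 2 * pi - t0] by rewrite !ge_min !lexx !orbT.
exists rho0 => // rho rp rr.
have /= := hd rho; rewrite sub0r normrN gtr0_norm// => /(_ (lt_le_trans rr a1) rp).
have inI t : `|t - t0| < rho -> 0 <= t <= 2 * pi.
  by rewrite ltr_norml => /andP[h1 h2]; lra.
have t0I : t0 \in `[0, 2 * pi]%classic by rewrite inE /= in_itv /= !ltW.
rewrite /davg /iavg lebesgue_measure_ball ?(ltW rp)//.
have -> : (\int[mu]_(y in ball t0 rho) `|((center ((f \_ `[0%R, (2 * pi)%R]) t0) \o f \_ `[0%R, (2 * pi)%R]) y)%:E|
   = \int[mu]_(y in `[0%R, (2 * pi)%R]) (ballind t0 rho y * `|f y - f t0|)%:E)%E.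
  have bI : ball t0 rho = `[0, 2 * pi]%classic `&` ball t0 rho.
    apply/seteqP; split=> t /=; last by case.
    by rewrite /ball /= distrC => h; split => //; rewrite in_itv /=; exact: inI.
  rewrite bI integral_mkcondr; apply: eq_integral => t tI.
  rewrite patchE /ballind; case: ifPn.
    rewrite inE /ball /= distrC => ->; rewrite mul1r /= !patchE tI t0I.
    by [].
  by rewrite notin_setE /ball /= distrC => /negP/negbTE ->; rewrite mul0r.
have iB := ballind_intg t0 rho iF0.
have := @integral_uniform R 0 (2 * pi) (twopi_gt0 R) (fun t => (ballind t0 rho t * `|f t - f t0|)%:E).
rewrite mintE// => /(_ (proj2 (@measurable_EFinP _ _ _ _ _) (intg_meas iB))) h.
have {}h : ((2 * pi) * mint (fun t => ballind t0 rho t * `|f t - f t0|))%:E =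
   (\int[mu]_(y in `[0%R, (2 * pi)%R]) (ballind t0 rho y * `|f y - f t0|)%:E)%E.
  rewrite EFinM h ?subr0; last by move=> t; rewrite lee_fin mulr_ge0// /ballind ler0n.
  by rewrite muleA -EFinM divff ?gt_eqF// mul1e.
rewrite -h inver ifF; last by rewrite gt_eqF// pmulrn_rgt0.
rewrite -EFinM lte_fin => h'; apply: ltW.
have rn : 0 < rho *+ 2 by rewrite pmulrn_rgt0.
move: h'; rewrite mulrC ltr_pdivrMr// -[rho *+ 2]mulr_natl => h'.
have pp := pi_gt0 R.
rewrite -(ltr_pM2l p0); apply: (lt_le_trans h').
by rewrite le_eqVlt; apply/orP; left; apply/eqP; ring.
Qed.

Lemma fatou_real f : intg f -> {ae mC R, forall t0, forall e, 0 < e -> exists2 d, 0 < d &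
  forall r, 0 <= r < 1 -> 1 - r < d ->
  mint (fun t => pois (r%:C * expi t0) t * `|f t - f t0|) <= e}.
Proof.
move=> iF.
have loc : locally_integrable setT (f \_ `[0, 2 * pi]).
  apply: open_integrable_locally; first exact: openT.
  have := lebesgue_intg iF; rewrite integrable_mkcond//.
  by rewrite restrict_EFin.
have h := ae_lebesgue_mC (lebesgue_differentiation loc).
apply: aeS (aeI h ae_mC_itv) => t0 [lp ht0].
apply: pois_small_means => //.
  by apply: intg_norm; apply: intgB => //; exact: intg_cst.
exact: lebesgue_pt_small_means.
Qed.

Lemma fatou_radial g : cintg g -> {ae mC R, forall t0, forall e, 0 < e -> exists2 d, 0 < d &
  forall r, 0 <= r < 1 -> 1 - r < d ->
  cabs (cavg (fun t => (pois (r%:C * expi t0) t)%:C * g t) - g t0) <= e}.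
Proof.
move=> ig; case: (ig) => i1 i2.
apply: aeS (aeI (fatou_real i1) (fatou_real i2)) => t0 [h1 h2] e e0.
have e20 : 0 < e / 2 by rewrite divr_gt0.
have [d1 d10 hd1] := h1 _ e20; have [d2 d20 hd2] := h2 _ e20.
exists (Num.min d1 d2) => [|r r01]; first by rewrite lt_min d10.
rewrite lt_min => /andP[/(hd1 r r01) k1 /(hd2 r r01) k2].
have r0 : 0 <= r by case/andP: r01.
have r1 : r < 1 by case/andP: r01.
set z := _ * _ in k1 k2 *; have z1 : cabs z < 1 by rewrite cabs_circle.
have ic : cintg (fun=> g t0) by exact: cintg_cst.
have iP : cintg (fun t => (pois z t)%:C : C) by split; [exact: pois_intg|exact: intg_cst].
have eg : g t0 = cavg (fun t => g t0 * (pois z t)%:C).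
  by rewrite cavgZ// cavg_real mint_pois// mulr1.
have -> : cavg (fun t => (pois z t)%:C * g t) - g t0 = cavg (fun t => (pois z t)%:C * (g t - g t0)).
  rewrite {1}eg -cavgB; [|exact: pois_cintg|exact: cintgZ].
  by apply: cavg_eq => t; rewrite mulrBr; congr (_ - _); rewrite mulrC.
have igB : cintg (fun t => g t - g t0) by exact: cintgB.
apply: le_trans (mint_pois_cavg z1 igB) _.
apply: (@le_trans _ _ (mint (fun t => pois z t * `|complex.Re (g t) - complex.Re (g t0)| +
   pois z t * `|complex.Im (g t) - complex.Im (g t0)|))).
  apply: mint_le.
  - by apply: pois_intgM => //; exact: cintg_cabs.
  - by apply: intgD; apply: pois_intgM => //; apply: intg_norm; apply: intgB => //; exact: intg_cst.
  - by move=> t; rewrite -mulrDr ler_wpM2l ?pois_ge0// -ReB -ImB cabs_le_ReIm.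
rewrite mintD; last 2 first.
- by apply: pois_intgM => //; apply: intg_norm; apply: intgB => //; exact: intg_cst.
- by apply: pois_intgM => //; apply: intg_norm; apply: intgB => //; exact: intg_cst.
lra.
Qed.

End Fatou.

(** * Square integrable functions: Cauchy-Schwarz and the Riesz-Fischer theorem *)

Section SquareIntegrable.
Context (R : realType).
Local Notation C := R[i].
Implicit Types (u v : R -> R) (g h : R -> C) (e d M : R).

Lemma discriminant (A B D : R) : 0 <= A -> (forall x, 0 <= x ^+ 2 * A + 2 * x * B + D) ->
  B ^+ 2 <= A * D.
Proof.
move=> A0 h; have D0 : 0 <= D by have := h 0; rewrite expr0n mulr0 !mul0r !add0r.
have [A00|An] := eqVneq A 0.
  (* If [A = 0] and [B] were nonzero, this [x] would give the affine expression the value -1. *)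
  have := h (- (D + 1) / (2 * B)); rewrite A00 mulr0 add0r mul0r.
  have [->|B0] := eqVneq B 0; first by rewrite expr0n.
  have -> : 2 * (- (D + 1) / (2 * B)) * B + D = - 1 by field.
  by rewrite ler0N1.
have Ap : 0 < A by rewrite lt_def An.
have := h (- B / A).
have -> : (- B / A) ^+ 2 * A + 2 * (- B / A) * B + D = (A * D - B ^+ 2) / A by field.
by rewrite pmulr_lge0 ?invr_gt0// subr_ge0.
Qed.

Definition sqintg g := cmeas g /\ intg (fun t => cabs (g t) ^+ 2).

Lemma intg_prod u v : measurable_fun setT u -> measurable_fun setT v ->
  intg (fun t => u t ^+ 2) -> intg (fun t => v t ^+ 2) -> intg (fun t => u t * v t).
Proof.
move=> mu mv iu iv; apply: (@intg_le _ _ (fun t => u t ^+ 2 + v t ^+ 2)).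
- exact: measurable_funM.
- move=> t; rewrite ler_norml; apply/andP; split; nra.
- exact: intgD.
Qed.

Lemma cauchy_schwarz u v : measurable_fun setT u -> measurable_fun setT v ->
  intg (fun t => u t ^+ 2) -> intg (fun t => v t ^+ 2) ->
  mint (fun t => u t * v t) ^+ 2 <= mint (fun t => u t ^+ 2) * mint (fun t => v t ^+ 2).
Proof.
move=> mu mv iu iv; have iuv := intg_prod mu mv iu iv.
apply: discriminant; first by apply: mint_ge0 => t; exact: sqr_ge0.
move=> x.
have -> : x ^+ 2 * mint (fun t => u t ^+ 2) + 2 * x * mint (fun t => u t * v t) +
   mint (fun t => v t ^+ 2) = mint (fun t => (x * u t + v t) ^+ 2).
  rewrite -!mintZ// -!mintD//; try (by apply: intgD => //; exact: intgZ); try exact: intgZ.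
  by apply: mint_eq => t; ring.
by apply: mint_ge0 => t; exact: sqr_ge0.
Qed.

Lemma mint_sqr_le u : measurable_fun setT u -> intg (fun t => u t ^+ 2) ->
  intg u /\ mint u ^+ 2 <= mint (fun t => u t ^+ 2).
Proof.
move=> mu iu; have i1 : intg (fun=> 1 ^+ 2 : R) by exact: intg_cst.
have m1 := intg_meas (@intg_cst R 1).
have E : (fun t => u t * 1) = u by apply/funext => t; rewrite mulr1.
split; first by rewrite -E; exact: (intg_prod mu m1 iu i1).
by have := cauchy_schwarz mu m1 iu i1; rewrite E mint_cst expr1n mulr1.
Qed.

Lemma sqintg_cintg g : sqintg g -> cintg g.
Proof.
move=> [mg ig]; apply: (cintg_le mg (fun t => lexx (cabs (g t)))).
by have [] := mint_sqr_le (cmeas_cabs mg) ig.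
Qed.

Lemma cabsD_sqr (z w : C) : cabs (z + w) ^+ 2 <= 2 * cabs z ^+ 2 + 2 * cabs w ^+ 2.
Proof.
have h := cabsD z w; have h0 := cabs_ge0 (z + w); have h1 := cabs_ge0 z; have h2 := cabs_ge0 w.
have : cabs (z + w) ^+ 2 <= (cabs z + cabs w) ^+ 2 by rewrite lerXn2r// nnegrE addr_ge0.
have := sqr_ge0 (cabs z - cabs w); nra.
Qed.

Lemma sqintgD g h : sqintg g -> sqintg h -> sqintg (fun t => g t + h t).
Proof.
move=> [mg ig] [mh ih]; split; first exact: cmeasD.
apply: (@intg_le _ _ (fun t => 2 * cabs (g t) ^+ 2 + 2 * cabs (h t) ^+ 2)).
- by apply: measurable_funX; apply: cmeas_cabs; exact: cmeasD.
- by move=> t; rewrite ger0_norm ?sqr_ge0// cabsD_sqr.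
- by apply: intgD; exact: intgZ.
Qed.

Lemma sqintgZ (c : C) g : sqintg g -> sqintg (fun t => c * g t).
Proof.
move=> [mg ig]; split; first by apply: cmeasM => //; exact: cmeas_cst.
have -> : (fun t => cabs (c * g t) ^+ 2) = (fun t => cabs c ^+ 2 * cabs (g t) ^+ 2).
  by apply/funext => t; rewrite cabsM exprMn.
exact: intgZ.
Qed.

Lemma sqintgB g h : sqintg g -> sqintg h -> sqintg (fun t => g t - h t).
Proof.
move=> sg sh; have -> : (fun t => g t - h t) = (fun t => g t + (-1) * h t).
  by apply/funext => t; rewrite mulN1r.
by apply: sqintgD => //; exact: sqintgZ.
Qed.

Lemma sqintg_cts g : ccts g -> sqintg g.
Proof.
move=> cg; split; first exact: ccts_meas.
apply: intg_cts; under eq_fun do rewrite expr2.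
by move=> t; apply: cvgM; exact: ccts_cabs.
Qed.

Lemma sqintg_mul g h : sqintg g -> sqintg h -> cintg (fun t => g t * h t).
Proof.
move=> [mg ig] [mh ih]; apply: (@cintg_le _ _ (fun t => cabs (g t) * cabs (h t))).
- exact: cmeasM.
- by move=> t; rewrite cabsM.
- by apply: intg_prod => //; exact: cmeas_cabs.
Qed.

Lemma sqintg_conj g : sqintg g -> sqintg (fun t => (g t)^*%C).
Proof.
move=> [mg ig]; split; first exact: cmeas_conj.
by under [X in intg X]eq_fun do rewrite cabs_conj.
Qed.

Lemma mint_tri_sqr g h : sqintg g -> sqintg h ->
  mint (fun t => cabs (g t + h t) ^+ 2) <=
  2 * mint (fun t => cabs (g t) ^+ 2) + 2 * mint (fun t => cabs (h t) ^+ 2).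
Proof.
move=> sg sh; case: (sg) (sh) => mg ig [mh ih]; rewrite -!mintZ// -mintD; try exact: intgZ.
apply: mint_le; [by have [] := sqintgD sg sh|by apply: intgD; exact: intgZ|].
by move=> t; exact: cabsD_sqr.
Qed.

(** Beppo Levi: the sum of the series is integrable, hence finite almost everywhere. *)
Lemma ae_bounded_series (h : nat -> R -> R) S : (forall k, intg (h k)) ->
  (forall k t, 0 <= h k t) -> (forall n, \sum_(k < n) mint (h k) <= S) ->
  {ae mC R, forall t, exists B, forall n, \sum_(k < n) h k t <= B}.
Proof.
move=> ih h0 hS.
pose H t := (\sum_(0 <= k <oo) (h k t)%:E)%E.
have mh k : measurable_fun setT (fun t : R => (h k t)%:E).
  by apply/measurable_EFinP; exact: intg_meas.
have mH : measurable_fun setT H.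
  by apply: ge0_emeasurable_sum => [k t _|k _]; [rewrite lee_fin|exact: mh].
have iH : (mC R).-integrable setT H.
  apply/integrableP; split => //.
  have -> : (\int[mC R]_t `|H t| = \int[mC R]_t H t)%E.
    by apply: eq_integral => t _; rewrite gee0_abs// nneseries_ge0// => k _ _; rewrite lee_fin.
  rewrite integral_nneseries//; last by move=> k t _; rewrite lee_fin.
  apply: (@le_lt_trans _ _ S%:E); last exact: ltry.
  apply: lime_le; first by apply: is_cvg_nneseries => k _ _; apply: integral_ge0 => t _; rewrite lee_fin.
  apply: nearW => n; rewrite big_mkord.
  under eq_bigr do rewrite mintE//.
  by rewrite sumEFin lee_fin.
have := integrable_ae measurableT iH; apply: aeS => t /(_ I) Hfin.
exists (fine (H t)) => n; rewrite -lee_fin fineK// -sumEFin.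
by rewrite -(big_mkord xpredT (fun k => (h k t)%:E)); apply: nneseries_lim_ge => k _; rewrite lee_fin.
Qed.

Lemma geometric_step_cvg (x : nat -> R) M : (forall k, `|x k.+1 - x k| <= M / 2 ^+ k) ->
  cvg (x n @[n --> \oo]).
Proof.
move=> h.
have M0 : 0 <= M by have := h 0%N; rewrite expr0 divr1; exact: le_trans.
have E n : x n = x 0%N + \sum_(0 <= k < n) (x k.+1 - x k).
  by rewrite telescope_sumr// addrC subrK.
have -> : x = (fun n => x 0%N + series (fun k => x k.+1 - x k) n) by apply/funext => n; rewrite E.
apply: is_cvgD; first exact: is_cvg_cst.
apply: normed_cvg; apply: (@series_le_cvg _ _ (geometric M (2^-1))).
- by move=> n; exact: normr_ge0.
- by move=> n; rewrite /geometric /= mulr_ge0// exprn_ge0// invr_ge0.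
- by move=> n; rewrite /geometric /= exprVn.
- by apply: is_cvg_geometric_series; rewrite ger0_norm ?invr_ge0// invf_lt1// ltr1n.
Qed.

(** On a measurable null set containing the bad points the sequence is replaced by 0; it then
    converges everywhere and its limit is measurable. *)
Lemma ae_cvg_measurable (h : nat -> R -> R) : (forall n, measurable_fun setT (h n)) ->
  {ae mC R, forall t, cvg (h n t @[n --> \oo])} ->
  exists2 h0 : R -> R, measurable_fun setT h0 & {ae mC R, forall t, h n t @[n --> \oo] --> h0 t}.
Proof.
move=> mh [N [mN N0 sN]].
have mi : measurable_fun setT (\1_(~` N) : R -> R).
  by apply: measurable_indic; exact: measurableC.
exists (fun t => lim (h n t * \1_(~` N) t @[n --> \oo])).
  apply: (@measurable_fun_cvg _ _ R setT (fun n t => h n t * \1_(~` N) t)).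
    by move=> n; exact: measurable_funM.
  move=> t _; have [tN|tN] := pselect (N t).
    have E : (fun n => h n t * \1_(~` N) t) = (fun=> 0).
      by apply/funext => n; rewrite indicE memNset ?mulr0//=; exact.
    by rewrite E; exact: is_cvg_cst.
  suff : cvg (h n t * \1_(~` N) t @[n --> \oo]) by [].
  have E : (fun n => h n t * \1_(~` N) t) = (fun n => h n t).
    by apply/funext => n; rewrite indicE mem_set//= mulr1.
  by rewrite E; apply: contrapT => h'; apply: tN; apply: sN.
exists N; split => // t /= ht; apply: contrapT => tN; apply: ht.
have E : (fun n => h n t * \1_(~` N) t) = (fun n => h n t).
  by apply/funext => n; rewrite indicE mem_set//= mulr1.
by rewrite E; apply: contrapT => h'; apply: tN; apply: sN.
Qed.

Lemma sqintg_complete (g : nat -> R -> C) : (forall k, sqintg (g k)) ->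
  (forall e, 0 < e -> exists J, forall j k, (J <= j)%N -> (J <= k)%N ->
     mint (fun t => cabs (g j t - g k t) ^+ 2) <= e) ->
  exists2 G, sqintg G & forall e, 0 < e -> exists J, forall j, (J <= j)%N ->
     mint (fun t => cabs (g j t - G t) ^+ 2) <= e.
Proof.
move=> sg cau.
(* With squared distances at most [8^-k], the weighted series of [4^k d_k^2] has a mean bounded by
   2; its terms are then bounded at almost every point, so that [d_k = O(2^-k)] there. *)
have p8 k : 0 < (8 ^+ k)^-1 :> R by rewrite invr_gt0 exprn_gt0.
have [f hf] := choice (fun k => cau _ (p8 k)).
pose s := fix s n := if n is m.+1 then maxn (s m).+1 (f m.+1) else f 0%N.
have sf n : (f n <= s n)%N by case: n => //= n; exact: leq_maxr.
have ss n : (s n < s n.+1)%N by rewrite /= leq_max ltnSn.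
have sn n : (n <= s n)%N by elim: n => // n IH; exact: leq_ltn_trans (ss n).
have sle n : (s n <= s n.+1)%N by exact: ltnW.
pose d k t := cabs (g (s k.+1) t - g (s k) t).
have sd k : sqintg (fun t => g (s k.+1) t - g (s k) t) by exact: sqintgB.
have nn k t : 0 <= 4 ^+ k * d k t ^+ 2 by apply: mulr_ge0; [exact: exprn_ge0|exact: sqr_ge0].
have hd k : mint (fun t => 4 ^+ k * d k t ^+ 2) <= (2 ^+ k)^-1.
  rewrite mintZ; last by have [] := sd k.
  apply: (@le_trans _ _ (4 ^+ k * (8 ^+ k)^-1)).
    rewrite ler_wpM2l ?exprn_ge0//; apply: hf; first exact: leq_trans (sf k) (sle k).
    exact: sf.
  have -> : 8 ^+ k = 4 ^+ k * 2 ^+ k :> R by rewrite -exprMn; congr (_ ^+ _); rewrite -natrM.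
  by rewrite invfM mulrA mulfV ?mul1r// expf_neq0.
have bd : {ae mC R, forall t, exists B, forall n, \sum_(k < n) 4 ^+ k * d k t ^+ 2 <= B}.
  apply: (@ae_bounded_series (fun k t => 4 ^+ k * d k t ^+ 2) 2).
  - by move=> k; apply: intgZ; have [] := sd k.
  - exact: nn.
  - move=> n; apply: le_trans (dyadic_sum R n); apply: ler_sum => k _; exact: hd.
have step t : (exists B, forall n, \sum_(k < n) 4 ^+ k * d k t ^+ 2 <= B) ->
    exists M, forall k, d k t <= M / 2 ^+ k.
  move=> [B hB]; have B0 : 0 <= B by have := hB 0%N; rewrite big_ord0.
  exists (Num.sqrt B) => k; rewrite ler_pdivlMr ?exprn_gt0//.
  have d0 : 0 <= d k t by exact: cabs_ge0.
  rewrite -(@ler_pXn2r _ 2)// ?nnegrE ?mulr_ge0 ?exprn_ge0 ?sqrtr_ge0//.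
  rewrite sqr_sqrtr// exprMn -four_expr mulrC; apply: le_trans (hB k.+1).
  by rewrite big_ord_recr /= lerDr sumr_ge0.
have [G1 mG1 hG1] : exists2 h0 : R -> R, measurable_fun setT h0 &
   {ae mC R, forall t, complex.Re (g (s n) t) @[n --> \oo] --> h0 t}.
  apply: (@ae_cvg_measurable (fun n t => complex.Re (g (s n) t))).
    by move=> n; have [[]] := sg (s n).
  apply: aeS bd => t /step[M hM]; apply: (@geometric_step_cvg _ M) => k.
  by rewrite -ReB; exact: le_trans (Re_le_cabs _) (hM k).
have [G2 mG2 hG2] : exists2 h0 : R -> R, measurable_fun setT h0 &
   {ae mC R, forall t, complex.Im (g (s n) t) @[n --> \oo] --> h0 t}.
  apply: (@ae_cvg_measurable (fun n t => complex.Im (g (s n) t))).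
    by move=> n; have [[]] := sg (s n).
  apply: aeS bd => t /step[M hM]; apply: (@geometric_step_cvg _ M) => k.
  by rewrite -ImB; exact: le_trans (Im_le_cabs _) (hM k).
pose G t := G1 t +i* G2 t.
have mG : cmeas G by split.
(* Only a subsequence converges pointwise; Fatou's lemma along it, with [j] fixed, carries the
   Cauchy estimate to the limit for the full sequence. *)
have key e : 0 < e -> exists J, forall j, (J <= j)%N ->
    intg (fun t => cabs (g j t - G t) ^+ 2) /\ mint (fun t => cabs (g j t - G t) ^+ 2) <= e.
  move=> e0; have [J hJ] := cau _ e0; exists J => j Jj.
  apply: (@mint_fatou _ (fun n t => cabs (g j t - g (s (J + n)%N) t) ^+ 2)).
  - by move=> n; have [] := sqintgB (sg j) (sg (s (J + n)%N)).
  - by move=> n t; exact: sqr_ge0.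
  - by apply: measurable_funX; apply: cmeas_cabs; apply: cmeasB => //; have [] := sg j.
  - by move=> t; exact: sqr_ge0.
  - by move=> n; apply: hJ => //; exact: leq_trans (leq_addr _ _) (sn _).
  apply: aeS (aeI hG1 hG2) => t [h1 h2].
  have hc : (g (s n) t : C^o) @[n --> \oo] --> (G t : C^o) by exact: cvg_ReIm.
  have hc' : (g (s (J + n)%N) t : C^o) @[n --> \oo] --> (G t : C^o).
    by move: hc; rewrite -(cvg_shiftn J); under eq_fun do rewrite addnC.
  have hd' : cabs (g j t - g (s (J + n)%N) t) @[n --> \oo] --> cabs (g j t - G t).
    apply: cvg_cabs; apply: cvgC_add; first exact: cvgC_cst.
    exact: cvgC_opp.
  by rewrite expr2; under eq_fun do rewrite expr2; exact: cvgM.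
have sG : sqintg G.
  split => //; have [J hJ] := key _ ltr01; have [iJ _] := hJ J (leqnn _).
  have sJ : sqintg (fun t => g J t - G t).
    by split => //; apply: cmeasB => //; have [] := sg J.
  have [_] := sqintgB (sg J) sJ.
  by under [X in intg X -> _]eq_fun do rewrite opprB addrC subrK.
by exists G => // e /key[J hJ]; exists J => j /hJ[].
Qed.

End SquareIntegrable.

(** * Radial limits and the measurability of the boundary function *)

Section RadialBoundary.
Context (R : realType).
Local Notation C := R[i].
Implicit Types (F : C -> C) (z l : C) (r t e d : R).

(** [bd (extend f)] is [boundary f] by definition; functions on all of [C] can thus be treated
    without the subtype. *)
Definition bd F z : C := lim ((F (r%:C * z) : C^o) @[r --> (1 : R)^'-]).

Definition radlim F t l := forall e, 0 < e -> exists2 d, 0 < d &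
  forall r, 0 <= r < 1 -> 1 - r < d -> cabs (F (r%:C * expi t) - l) <= e.

Lemma radlim_cvg F t l : radlim F t l ->
  (F (r%:C * expi t) : C^o) @[r --> (1 : R)^'-] --> (l : C^o).
Proof.
move=> h; apply/cvg_cabsP => e e0.
have [d d0 hd] := h _ (divr_gt0 e0 (@ltr0Sn R 1)).
near=> r; have r1 : r < 1 by near: r; exact: nbhs_left_lt.
have r0 : 0 <= r by near: r; apply: nbhs_left_ge; exact: ltr01.
have rd : 1 - r < d.
  rewrite ltrBlDl -ltrBlDr; near: r; apply: nbhs_left_gt; by rewrite gtrBl.
apply: le_lt_trans (hd r _ rd) _; first by rewrite r0.
by rewrite ltr_pdivrMr// ltr_pMr// ltr1n.
Unshelve. all: by end_near. Qed.

Lemma cvg_radlim F t l : (F (r%:C * expi t) : C^o) @[r --> (1 : R)^'-] --> (l : C^o) ->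
  radlim F t l.
Proof.
move=> /cvg_cabsP h e /h [d /= d0 hd].
exists d => // r /andP[r0 r1] rd; apply/ltW/hd => //=.
by rewrite ger0_norm// subr_ge0 ltW.
Qed.

Lemma bd_lim F t l : radlim F t l -> bd F (expi t) = l.
Proof.
by move=> /radlim_cvg h; exact: (cvg_lim (@norm_hausdorff _ (R[i]^o)) h).
Qed.

Lemma radlim_seq F t l : radlim F t l ->
  (F ((1 - (n.+1%:R)^-1)%:C * expi t) : C^o) @[n --> \oo] --> (l : C^o).
Proof.
move=> h; apply/cvg_cabsP => e e0.
have [d d0 hd] := h _ (divr_gt0 e0 (@ltr0Sn R 1)).
near=> n.
have nd : (n.+1%:R)^-1 < d by near: n; apply: (near_infty_natSinv_lt (PosNum d0)).
apply: (@le_lt_trans _ _ (e / 2)); last by rewrite ltr_pdivrMr// ltr_pMr// ltr1n.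
apply: hd; last by rewrite opprB addrC subrK.
by rewrite subr_ge0 invf_le1// ler1n /= gtrBl invr_gt0.
Unshelve. all: by end_near. Qed.

Variable F : C -> C.
Hypothesis cF : forall r, 0 <= r -> r < 1 -> ccts (circ F r).

Let natSinv_gt0 k : 0 < (k.+1%:R)^-1 :> R.
Proof. by rewrite invr_gt0. Qed.

Let natSinv_lt n j : (n < j)%N -> 1 - (n.+1%:R)^-1 < 1 - (j.+1%:R)^-1 :> R.
Proof. by move=> nj; rewrite ltrD2l ltrN2 ltf_pV2 ?posrE// ltr_nat. Qed.

Let natSinv_lt1 n : 1 - (n.+1%:R)^-1 < 1 :> R.
Proof. by rewrite gtrBl invr_gt0. Qed.

Let E k n := [set t : R | forall r r', 1 - (n.+1%:R)^-1 < r < 1 -> 0 <= r ->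
   1 - (n.+1%:R)^-1 < r' < 1 -> 0 <= r' -> cabs (circ F r t - circ F r' t) <= (k.+1%:R)^-1].

Let E_closed k n : closed (E k n).
Proof.
have -> : E k n = \bigcap_(p in [set p : R * R | [/\ 1 - (n.+1%:R)^-1 < p.1 < 1, 0 <= p.1,
   1 - (n.+1%:R)^-1 < p.2 < 1 & 0 <= p.2]]) [set t | cabs (circ F p.1 t - circ F p.2 t) <= (k.+1%:R)^-1].
  apply/seteqP; split=> [t h p [h1 h2 h3 h4]|t h r r' h1 h2 h3 h4]; first exact: h.
  by apply: (h (r, r')).
apply: closed_bigI => -[r r'] [/= /andP[_ r1] r0 /andP[_ r'1] r'0].
apply: (@closed_comp _ _ (fun t => cabs (circ F r t - circ F r' t)) [set x | x <= (k.+1%:R)^-1]).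
  move=> t _; apply: ccts_cabs; apply: cctsD; first exact: cF.
  have -> : (fun t => - circ F r' t) = (fun t => (-1) * circ F r' t).
    by apply/funext => s; rewrite mulN1r.
  by apply: cctsM; [exact: ccts_cst|exact: cF].
exact: closed_le.
Qed.

Let D := \bigcap_k \bigcup_n E k n.

Let D_meas : measurable (D : set R).
Proof.
apply: bigcap_measurable => // k _; apply: bigcup_measurable => n _.
by apply: closed_measurable; exact: E_closed.
Qed.

Let radlim_D t l : radlim F t l -> D t.
Proof.
move=> h k _; have [d d0 hd] := h _ (divr_gt0 (natSinv_gt0 k) (@ltr0Sn R 1)).
have [n _ hn] := near_infty_natSinv_lt (PosNum d0).
exists n => // r r' /andP[r1 r2] r0 /andP[r'1 r'2] r'0.
have nd : (n.+1%:R)^-1 < d by have := hn n (leqnn n).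
move: nd r1 r'1; set w := (n.+1%:R)^-1 => nd r1 r'1.
have k1 : cabs (circ F r t - l) <= (k.+1%:R)^-1 / 2 by apply: hd; [rewrite r0|lra].
have k2 : cabs (circ F r' t - l) <= (k.+1%:R)^-1 / 2 by apply: hd; [rewrite r'0|lra].
apply: le_trans (cabs_tri _ l _) _; rewrite (cabsC l) [leRHS]splitr; exact: lerD.
Qed.

Let D_radlim t : D t -> exists l, radlim F t l.
Proof.
move=> Dt.
pose x n := circ F (1 - (n.+1%:R)^-1) t.
have cau k : exists n, forall r r', 1 - (n.+1%:R)^-1 < r < 1 -> 0 <= r ->
   1 - (n.+1%:R)^-1 < r' < 1 -> 0 <= r' -> cabs (circ F r t - circ F r' t) <= (k.+1%:R)^-1.
  by have [n _ h] := Dt k I; exists n.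
have xcau (p : C -> R) : (forall z w, `|p z - p w| <= cabs (z - w)) ->
    cvg (p (x n) @[n --> \oo]).
  move=> pl; apply: cauchy_cvg; apply/cauchy_ballP => e e0.
  have [k _ hk] := near_infty_natSinv_lt (PosNum e0).
  have ke : (k.+1%:R)^-1 < e by have := hk k (leqnn k).
  have [n hn] := cau k.
  exists ([set y | exists2 m, (n < m)%N & y = p (x m)], [set y | exists2 m, (n < m)%N & y = p (x m)]).
    by split; exists n.+1 => // m /= nm; exists m.
  move=> [_ _] [/= [m nm ->] [m' nm' ->]]; rewrite /ball /=.
  apply: le_lt_trans (pl _ _) _; apply: le_lt_trans ke.
  by apply: hn; rewrite ?natSinv_lt ?natSinv_lt1// subr_ge0 invf_le1// ler1n.
have c1 : cvg (complex.Re (x n) @[n --> \oo]).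
  by apply: xcau => z w; rewrite -ReB; exact: Re_le_cabs.
have c2 : cvg (complex.Im (x n) @[n --> \oo]).
  by apply: xcau => z w; rewrite -ImB; exact: Im_le_cabs.
pose l : C := lim (complex.Re (x n) @[n --> \oo]) +i* lim (complex.Im (x n) @[n --> \oo]).
have xl : (x n : C^o) @[n --> \oo] --> (l : C^o) by apply: cvg_ReIm.
exists l => e e0.
have e20 : 0 < e / 2 by rewrite divr_gt0.
have [k _ hk] := near_infty_natSinv_lt (PosNum e20).
have ke : (k.+1%:R)^-1 < e / 2 by have := hk k (leqnn k).
have [n hn] := cau k.
move/cvg_cabsP : xl => /(_ _ e20)[m _ hm].
exists (n.+1%:R)^-1; first by rewrite invr_gt0.
move=> r /andP[r0 r1] rn.
pose j := maxn m n.+1.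
have hj : cabs (x j - l) < e / 2 by apply: hm; exact: leq_maxl.
have nj : (n < j)%N by exact: leq_maxr.
have k1 : cabs (circ F r t - x j) <= (k.+1%:R)^-1.
  apply: hn => //; first by rewrite r1 andbT ltrBlDr -ltrBlDl.
    by rewrite natSinv_lt// natSinv_lt1.
  by rewrite subr_ge0 invf_le1// ler1n.
apply: le_trans (cabs_tri _ (x j) _) _; rewrite [leRHS]splitr; apply: lerD; last exact: ltW.
exact: le_trans k1 (ltW ke).
Qed.

(** The set [D] where the radial Cauchy criterion holds is Borel, being built by countable
    operations from the closed sets [E k n]. On [D] the boundary is a limit along [1 - 1/(n+1)]; off
    [D] the operator [lim] returns the constant [point]. So even the junk values are measurable. *)
Lemma bd_meas : cmeas (fun t => bd F (expi t)).
Proof.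
pose z0 : C := (point : C^o).
have bdD t : ~ D t -> bd F (expi t) = z0.
  move=> nD.
  have ncv : ~ cvg ((F (r%:C * expi t) : C^o) @[r --> (1 : R)^'-]).
    by move=> /cvg_ex[l hl]; apply: nD; apply: (@radlim_D t l); exact: cvg_radlim.
  exact: (@dvgP (C^o) _ ncv).
have mi : measurable_fun setT (\1_D : R -> R) by exact: measurable_indic.
have rn n : 0 <= 1 - (n.+1%:R)^-1 :> R by rewrite subr_ge0 invf_le1// ler1n.
have rn1 n : 1 - (n.+1%:R)^-1 < 1 :> R by rewrite gtrBl invr_gt0.
have main (p : C -> R) : (forall f : R -> C, cmeas f -> measurable_fun setT (fun t => p (f t))) ->
   (forall (u : nat -> C) (l : C), (u n : C^o) @[n --> \oo] --> (l : C^o) -> p (u n) @[n --> \oo] --> p l) ->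
   measurable_fun setT (fun t => p (bd F (expi t))).
  move=> mp cp.
  apply: (@measurable_fun_cvg _ _ R setT
    (fun n t => p (circ F (1 - (n.+1%:R)^-1) t) * \1_D t + p z0 * (1 - \1_D t))).
    move=> n; apply: measurable_funD; apply: measurable_funM => //.
      by apply: mp; apply: ccts_meas; exact: cF.
    by apply: measurable_funB.
  move=> t _; have [Dt|nD] := pselect (D t).
    have [l hl] := D_radlim Dt.
    have -> : (fun n => p (circ F (1 - (n.+1%:R)^-1) t) * \1_D t + p z0 * (1 - \1_D t)) =
       (fun n => p (circ F (1 - (n.+1%:R)^-1) t)).
      by apply/funext => n; rewrite indicE mem_set//= subrr mulr0 mulr1 addr0.
    by rewrite (bd_lim hl); apply: cp; exact: radlim_seq.
  have -> : (fun n => p (circ F (1 - (n.+1%:R)^-1) t) * \1_D t + p z0 * (1 - \1_D t)) =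
       (fun n => p z0).
    by apply/funext => n; rewrite indicE memNset//= subr0 mulr0 mulr1 add0r.
  by rewrite bdD//; exact: cvg_cst.
split; apply: main.
- by move=> f [].
- by move=> u l; exact: cvg_Re.
- by move=> f [].
- by move=> u l; exact: cvg_Im.
Qed.

End RadialBoundary.

(** * Bessel's inequality and Parseval's identity for nonnegative frequencies *)

Section Parseval.
Context (R : realType).
Local Notation C := R[i].
Implicit Types (g h : R -> C) (c : nat -> C) (e d r S : R).

Definition trig c n t : C := \sum_(i < n) c i * expi t ^+ i.

Lemma cavg_expi_conj i j :
  cavg (fun t => expi t ^+ i * (expi t)^*%C ^+ j : C) = (i == j)%:R.
Proof.
have ec t : expi t * (expi t)^*%C = 1 :> C by rewrite mul_conj cabs_expi expr1n.
have main n m : (m <= n)%N -> cavg (fun t => expi t ^+ n * (expi t)^*%C ^+ m : C) = (n == m)%:R.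
  move=> mn.
  have -> : (fun t => expi t ^+ n * (expi t)^*%C ^+ m : C) = (fun t => expi t ^+ (n - m)).
    apply/funext => t; rewrite -{1}(subnK mn) exprD -mulrA -exprMn ec expr1n mulr1//.
  have [->|nm] := eqVneq n m.
    by rewrite subnn -[RHS](cavg_cst (1 : C)); apply: cavg_eq => t; rewrite expr0.
  have : (0 < n - m)%N by rewrite subn_gt0 ltn_neqAle eq_sym nm.
  by case: (n - m)%N => // k _; rewrite cavg_expi.
have [ji|ij] := leqP j i; first exact: main.
have -> : (fun t => expi t ^+ i * (expi t)^*%C ^+ j : C) =
   (fun t => (expi t ^+ j * (expi t)^*%C ^+ i)^*%C).
  by apply/funext => t; rewrite conjM !conjX conjcK mulrC.
rewrite cavg_conj ?main ?(ltnW ij)//; last first.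
  apply: ccts_cintg; apply: cctsM; first exact: ccts_expiX.
  have -> : (fun t => (expi t)^*%C ^+ i : C) = (fun t => (expi t ^+ i)^*%C).
    by apply/funext => t; rewrite conjX.
  by apply: ccts_conj; exact: ccts_expiX.
by rewrite eq_sym; case: (_ == _); rewrite -?RtoC1 ?conjR ?conjc0.
Qed.

Lemma ccts_sum n (f : 'I_n -> R -> C) : (forall i, ccts (f i)) ->
  ccts (fun t => \sum_(i < n) f i t).
Proof.
elim: n f => [|n IH] f cf.
  by under [X in ccts X]eq_fun do rewrite big_ord0; exact: ccts_cst.
by under [X in ccts X]eq_fun do rewrite big_ord_recr; apply: cctsD => //; apply: IH.
Qed.

Lemma ccts_trig c n : ccts (trig c n).
Proof.
by apply: ccts_sum => i; apply: cctsM; [exact: ccts_cst|exact: ccts_expiX].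
Qed.

Definition fourier g c := forall n, cavg (fun t => (expi t)^*%C ^+ n * g t) = c n.

Lemma cavg_trig_conj_fourier g b c n : cintg g -> fourier g c ->
  cavg (fun t => (trig b n t)^*%C * g t) = \sum_(i < n) (b i)^*%C * c i.
Proof.
move=> ig fg.
have -> : (fun t => (trig b n t)^*%C * g t) =
   (fun t => \sum_(i < n) (b i)^*%C * ((expi t)^*%C ^+ i * g t)).
  apply/funext => t; rewrite /trig (rmorph_sum (@conjc R)) mulr_suml.
  apply: eq_bigr => i _; rewrite mulrA; congr (_ * _).
  by transitivity ((b i)^*%C * (expi t ^+ i)^*%C); [exact: conjM|rewrite conjX].
rewrite cavg_sum; last by move=> i; apply: cintgZ; exact: cintg_conjexpiM.
by apply: eq_bigr => i _; rewrite cavgZ ?fg//; exact: cintg_conjexpiM.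
Qed.

Lemma cavg_trig_conj g c n : cintg g -> fourier g c ->
  cavg (fun t => (trig c n t)^*%C * g t) = (\sum_(i < n) cabs (c i) ^+ 2)%:C.
Proof.
move=> ig fg; rewrite (cavg_trig_conj_fourier c n ig fg) (rmorph_sum (real_complex R)).
by apply: eq_bigr => i _; rewrite mulrC mul_conj.
Qed.

Lemma fourier_trig c n : fourier (trig c n) (fun i => if (i < n)%N then c i else 0).
Proof.
move=> m.
have -> : (fun t => (expi t)^*%C ^+ m * trig c n t) =
   (fun t => \sum_(i < n) c i * (expi t ^+ i * (expi t)^*%C ^+ m)).
  by apply/funext => t; rewrite /trig mulr_sumr; apply: eq_bigr => i _; rewrite mulrC mulrA.
have ci i : cintg (fun t => expi t ^+ i * (expi t)^*%C ^+ m : C).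
  under [X in cintg X]eq_fun do rewrite mulrC.
  by apply: cintg_conjexpiM; apply: ccts_cintg; exact: ccts_expiX.
rewrite cavg_sum; last by move=> i; exact: cintgZ.
under eq_bigr do rewrite cavgZ// cavg_expi_conj.
case: ltnP => mn.
  rewrite (bigD1 (Ordinal mn)) //= eqxx mulr1 big1 ?addr0// => i.
  by rewrite -val_eqE /= => /negbTE ->; rewrite mulr0.
by rewrite big1// => i _; rewrite ltn_eqF ?mulr0// (leq_trans (ltn_ord i)).
Qed.

Lemma parseval g c n : sqintg g -> fourier g c ->
  mint (fun t => cabs (g t - trig c n t) ^+ 2) =
  mint (fun t => cabs (g t) ^+ 2) - \sum_(i < n) cabs (c i) ^+ 2.
Proof.
move=> sg fg; have ig := sqintg_cintg sg.
have sT : sqintg (trig c n) by apply: sqintg_cts; exact: ccts_trig.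
set T := trig c n in sT *; set S := \sum_(i < n) _.
have E1 := cavg_trig_conj n ig fg.
have E2 : cavg (fun t => (T t)^*%C * T t) = S%:C.
  have := cavg_trig_conj n (sqintg_cintg sT) (@fourier_trig c n).
  rewrite [X in _ = X%:C](_ : _ = S); last by apply: eq_bigr => i _; rewrite ltn_ord.
  move=> <-; apply: cavg_eq => t; congr (_^*%C * _).
  by apply: eq_bigr => i _; rewrite ltn_ord.
have iTg : cintg (fun t => (T t)^*%C * g t) by apply: sqintg_mul => //; exact: sqintg_conj.
have iTT : cintg (fun t => (T t)^*%C * T t) by apply: sqintg_mul => //; exact: sqintg_conj.
have igg : cintg (fun t => (cabs (g t) ^+ 2)%:C : C).
  by split; [case: sg|exact: intg_cst].
apply: RtoC_inj; rewrite -cavg_real RtoCB -cavg_real.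
have -> : (fun t => (cabs (g t - T t) ^+ 2)%:C) = (fun t => (cabs (g t) ^+ 2)%:C -
   ((T t)^*%C * g t + (((T t)^*%C * g t)^*%C - (T t)^*%C * T t))).
  apply/funext => t; rewrite -!mul_conj conjB conjM conjcK; ring.
have iTc : cintg (fun t => ((T t)^*%C * g t)^*%C).
  have -> : (fun t => ((T t)^*%C * g t)^*%C) = (fun t => T t * (g t)^*%C).
    by apply/funext => t; rewrite conjM conjcK.
  by apply: sqintg_mul => //; exact: sqintg_conj.
rewrite cavgB//; last by apply: cintgD => //; exact: cintgB.
rewrite cavgD//; last exact: cintgB.
by rewrite cavgB// cavg_conj// E1 E2 conjR subrr addr0.
Qed.

Lemma bessel g c n : sqintg g -> fourier g c ->
  \sum_(i < n) cabs (c i) ^+ 2 <= mint (fun t => cabs (g t) ^+ 2).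
Proof.
by move=> sg fg; rewrite -subr_ge0 -parseval//; apply: mint_ge0 => t; exact: sqr_ge0.
Qed.

(** Uniform approximation makes the left side of [parseval] small, which reverses Bessel's
    inequality. *)
Lemma parseval_le g c S : sqintg g -> fourier g c ->
  (forall e, 0 < e -> exists n, forall t, cabs (g t - trig c n t) <= e) ->
  (forall n, \sum_(i < n) cabs (c i) ^+ 2 <= S) -> mint (fun t => cabs (g t) ^+ 2) <= S.
Proof.
move=> sg fg ap hS; apply/ler_addgt0Pr => e e0.
have m0 : 0 < Num.min 1 e by rewrite lt_min ltr01.
have [n hn] := ap _ m0.
have sT : sqintg (trig c n) by apply: sqintg_cts; exact: ccts_trig.
have := parseval n sg fg; move/eqP; rewrite eq_sym subr_eq => /eqP ->.
rewrite addrC; apply: lerD => //.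
rewrite -[e]mint_cst; apply: mint_le; [by have [] := sqintgB sg sT|exact: intg_cst|move=> t].
have h := hn t; have h0 := cabs_ge0 (g t - trig c n t).
move: h; rewrite le_min => /andP[h1 h2].
by apply: le_trans h2; rewrite expr2 ler_piMl.
Qed.

End Parseval.

(** * Mean convergence to the boundary function *)

Section BoundaryMean.
Context (R : realType).
Local Notation C := R[i].
Implicit Types (F f : C -> C) (z : C) (G g : R -> C) (e d r S : R).

Definition holo F := forall z, cabs z < 1 -> cdiff F z.

Definition cvg1 F G := forall e, 0 < e -> exists2 d, 0 < d &
  forall r, 0 <= r < 1 -> 1 - r < d -> mint (fun t => cabs (circ F r t - G t)) <= e.

Lemma holo_ccts F r : holo F -> 0 <= r -> r < 1 -> ccts (circ F r).
Proof. by move=> hF r0 r1; apply: (@ccts_circ_cdiff _ _ _ 1) => //; rewrite r0. Qed.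

Lemma holo_cintg F r : holo F -> 0 <= r -> r < 1 -> cintg (circ F r).
Proof. by move=> hF r0 r1; apply: ccts_cintg; exact: holo_ccts. Qed.

Lemma cavg_ae (F G : R -> C) : cmeas F -> cintg G -> {ae mC R, forall t, F t = G t} ->
  cintg F /\ cavg F = cavg G.
Proof.
move=> [m1 m2] [i1 i2] FG.
have [j1 e1] := mint_ae m1 i1 (aeS (fun t h => congr1 (@complex.Re R) h) FG).
have [j2 e2] := mint_ae m2 i2 (aeS (fun t h => congr1 (@complex.Im R) h) FG).
by split; [split|apply: ReIm_inj].
Qed.

Lemma holo_dilate F r z : holo F -> 0 <= r -> r < 1 -> cabs z < 1 ->
  F (r%:C * z) = cavg (fun t => (pois z t)%:C * circ F r t).
Proof.
move=> hF r0 r1 z1.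
have [->|rn0] := eqVneq r 0.
  have -> : (fun t => (pois z t)%:C * circ F 0 t) = (fun t => F 0 * (pois z t)%:C).
    by apply/funext => t; rewrite /circ mul0r mulrC.
  rewrite cavgZ; last by split; [exact: pois_intg|exact: intg_cst].
  by rewrite cavg_real mint_pois// mulr1 mul0r.
have rp : 0 < r by rewrite lt_def rn0.
have [a ha] := coefs_exist ltr01 hF.
have h := @poisson_formula R F 1 hF a ha (r%:C * z) r.
rewrite h//; last by rewrite cabsM cabs_nneg// gtr_pMr.
apply: cavg_eq => t; congr ((pois _ _)%:C * _).
have rn : r%:C != 0 :> C by rewrite -cabs_gt0 cabs_nneg.
by rewrite RtoCV; field.
Qed.

Lemma cvg1_poisson F G z : holo F -> cintg G -> cvg1 F G -> cabs z < 1 ->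
  F z = cavg (fun t => (pois z t)%:C * G t).
Proof.
move=> hF iG FG z1.
apply/eqP; rewrite -subr_eq0 -cabs_eq0 eq_le cabs_ge0 andbT.
apply/ler_addgt0Pr => e e0; rewrite add0r.
have K0 : 0 < 2 / (1 - cabs z) by rewrite divr_gt0// subr_gt0.
have [d1 d10 h1] := FG _ (divr_gt0 (divr_gt0 e0 (@ltr0Sn R 1)) K0).
have cz : ccont F z by apply: cdiff_cts; exact: hF.
have [d2 d20 h2] := (ccontP _ _).1 cz _ (divr_gt0 e0 (@ltr0Sn R 1)).
pose h := Num.min (1 / 2) (Num.min (d1 / 2) (d2 / 2)).
have h0 : 0 < h by rewrite !lt_min !divr_gt0.
have [l1 l2 l3] : [/\ h <= 1 / 2, h <= d1 / 2 & h <= d2 / 2] by rewrite !ge_min !lexx !orbT.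
pose r := 1 - h.
have r0 : 0 <= r by rewrite /r; lra.
have r1 : r < 1 by rewrite /r; lra.
have k1 : cabs (F (r%:C * z) - F z) <= e / 2.
  apply/ltW/h2; rewrite -[X in _ - X]mul1r -mulrBl cabsM -RtoC1 -RtoCB cabs_real.
  rewrite /r (_ : 1 - h - 1 = - h); last by ring.
  rewrite normrN ger0_norm ?(ltW h0)//.
  have := cabs_ge0 z; nra.
have iB : cintg (fun t => circ F r t - G t) by apply: cintgB => //; exact: holo_cintg.
have k2 : cabs (F (r%:C * z) - cavg (fun t => (pois z t)%:C * G t)) <= e / 2.
  rewrite holo_dilate// -cavgB; [|exact/pois_cintg/holo_cintg|exact: pois_cintg].
  rewrite (cavg_eq (G := fun t => (pois z t)%:C * (circ F r t - G t))); last first.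
    by move=> t; rewrite mulrBr.
  apply: le_trans (mint_pois_cavg z1 iB) _.
  apply: (@le_trans _ _ (mint (fun t => 2 / (1 - cabs z) * cabs (circ F r t - G t)))).
    apply: mint_le.
    - by apply: pois_intgM => //; exact: cintg_cabs.
    - by apply: intgZ; exact: cintg_cabs.
    - by move=> t; rewrite ler_wpM2r ?cabs_ge0// pois_le.
  rewrite mintZ; last exact: cintg_cabs.
  rewrite mulrC -ler_pdivlMr//; apply: h1; first by rewrite r0.
  by rewrite /r; lra.
have := cabs_tri (F z) (F (r%:C * z)) (cavg (fun t => (pois z t)%:C * G t)).
by rewrite (cabsC (F z) (F (r%:C * z))); lra.
Qed.

Definition bdf F t := bd F (expi t).

Lemma bdf_meas F : holo F -> cmeas (bdf F).
Proof. by move=> hF; apply: bd_meas => r r0 r1; exact: holo_ccts. Qed.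

(** A limit in the mean of the circle functions represents [F] as a Poisson integral; Fatou's
    theorem then identifies that limit with the radial boundary almost everywhere. *)
Lemma cvg1_boundary F G : holo F -> cintg G -> cvg1 F G ->
  [/\ cintg (bdf F), {ae mC R, forall t, bdf F t = G t},
      {ae mC R, forall t, radlim F t (bdf F t)} & cvg1 F (bdf F)].
Proof.
move=> hF iG FG.
have rl : {ae mC R, forall t, radlim F t (G t)}.
  apply: aeS (fatou_radial iG) => t h e /h[d d0 hd].
  exists d => // r r01 rd; have /andP[r0 r1] := r01.
  by rewrite (cvg1_poisson hF iG FG) ?cabs_circle//; exact: hd.
have BG : {ae mC R, forall t, bdf F t = G t} by apply: aeS rl => t /bd_lim.
have [iB _] := cavg_ae (bdf_meas hF) iG BG.
split => //.
  by apply: aeS rl => t h; rewrite /bdf (bd_lim h).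
move=> e /FG[d d0 hd]; exists d => // r r01 rd; have /andP[r0 r1] := r01.
apply: le_trans (hd r r01 rd); rewrite le_eqVlt; apply/orP; left; apply/eqP.
apply: (proj2 (mint_ae _ _ _)).
- by apply: cmeas_cabs; apply: cmeasB; [exact/cintg_meas/holo_cintg|exact: bdf_meas].
- by apply: cintg_cabs; apply: cintgB => //; exact: holo_cintg.
- by apply: aeS BG => t ->.
Qed.

Lemma cvg1_fourier F a : holo F -> coefs F 1 a -> cintg (bdf F) -> cvg1 F (bdf F) ->
  fourier (bdf F) a.
Proof.
move=> hF ha iB FB n.
apply/eqP; rewrite -subr_eq0 -cabs_eq0 eq_le cabs_ge0 andbT.
apply/ler_addgt0Pr => e e0; rewrite add0r.
have e20 : 0 < e / 2 by rewrite divr_gt0.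
have [d d0 hd] := FB _ e20.
have An : 0 < 1 + n%:R * cabs (a n) by rewrite ltr_pwDl// mulr_ge0// cabs_ge0.
pose h := Num.min (1 / 2) (Num.min (d / 2) (e / 2 / (1 + n%:R * cabs (a n)))).
have h0 : 0 < h by rewrite !lt_min !divr_gt0.
have [l1 l2 l3] : [/\ h <= 1 / 2, h <= d / 2 & h <= e / 2 / (1 + n%:R * cabs (a n))].
  by rewrite !ge_min !lexx !orbT.
pose r := 1 - h.
have r0 : 0 <= r by rewrite /r; lra.
have r1 : r < 1 by rewrite /r; lra.
have iF := holo_cintg hF r0 r1.
have iBF : cintg (fun t => circ F r t - bdf F t) by exact: cintgB.
have k1 : cabs (a n * (r ^+ n)%:C - cavg (fun t => (expi t)^*%C ^+ n * bdf F t)) <= e / 2.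
  have [|<- _] := ha r n; first by rewrite r0.
  have -> : (fun t => circ F r t * (expi t)^*%C ^+ n) = (fun t => (expi t)^*%C ^+ n * circ F r t).
    by apply/funext => t; rewrite mulrC.
  rewrite -cavgB; [|exact: cintg_conjexpiM|exact: cintg_conjexpiM].
  rewrite (cavg_eq (G := fun t => (expi t)^*%C ^+ n * (circ F r t - bdf F t))); last first.
    by move=> t; rewrite mulrBr.
  apply: le_trans (cabs_cavg (cintg_conjexpiM n iBF)) _.
  apply: le_trans (hd r _ _); [|by rewrite r0|by rewrite /r; lra].
  apply: mint_le; [exact/cintg_cabs/cintg_conjexpiM|exact: cintg_cabs|move=> t].
  by rewrite cabsM cabsX cabs_conj cabs_expi expr1n mul1r.
have k2 : cabs (a n * (r ^+ n)%:C - a n) <= e / 2.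
  rewrite -[X in _ - X]mulr1 -mulrBr cabsM -RtoC1 -RtoCB cabs_real distrC ger0_norm; last first.
    by rewrite subr_ge0 exprn_ile1// ltW.
  have bern : 1 - r ^+ n <= n%:R * h.
    elim: (n) => [|m IH]; first by rewrite expr0 subrr mul0r.
    rewrite exprS -natr1 mulrDl mul1r.
    have rm0 : 0 <= r ^+ m by exact: exprn_ge0.
    have rm1 : r ^+ m <= 1 by rewrite exprn_ile1// ltW.
    by rewrite /r in IH rm0 rm1 *; nra.
  apply: (@le_trans _ _ (cabs (a n) * (n%:R * h))); first by rewrite ler_wpM2l ?cabs_ge0.
  move: l3; rewrite ler_pdivlMr// => l3; apply: le_trans l3.
  by rewrite mulrA [leLHS]mulrC ler_wpM2l ?(ltW h0)// mulrC lerDr.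
have := cabs_tri (cavg (fun t => (expi t)^*%C ^+ n * bdf F t)) (a n * (r ^+ n)%:C) (a n).
by rewrite (cabsC (cavg _) (a n * (r ^+ n)%:C)); lra.
Qed.

End BoundaryMean.

(** * H^2 through square summable Taylor coefficients *)

Section HardyTwo.
Context (R : realType).
Local Notation C := R[i].
Implicit Types (F : C -> C) (z : C) (G g : R -> C) (a : nat -> C) (e d r S : R).

Definition sqsum a S := forall n, \sum_(i < n) cabs (a i) ^+ 2 <= S.

Lemma sqsum_ge0 a S : sqsum a S -> 0 <= S.
Proof. by move=> h; have := h 0%N; rewrite big_ord0. Qed.

Lemma sqsum_tail a S e : sqsum a S -> 0 < e -> exists N, forall n, (N <= n)%N ->
  \sum_(i < n) cabs (a i) ^+ 2 <= \sum_(i < N) cabs (a i) ^+ 2 + e.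
Proof.
move=> hS e0.
pose A := [set x | exists n, x = \sum_(i < n) cabs (a i) ^+ 2].
have hA : has_sup A.
  split; first by exists (\sum_(i < 0) cabs (a i) ^+ 2); exists 0%N.
  by exists S => _ [n ->].
have [_ [N ->] hN] := sup_adherent e0 hA.
exists N => n _; rewrite -lerBlDr; apply: ltW; apply: le_lt_trans hN.
by rewrite lerD2r; apply: ub_le_sup; [case: hA|exists n].
Qed.

Variables (F : C -> C) (a : nat -> C) (S : R).
Hypothesis hF : holo F.
Hypothesis ha : coefs F 1 a.

Lemma fourier_circ r : 0 <= r -> r < 1 -> fourier (circ F r) (fun i => a i * (r ^+ i)%:C).
Proof.
move=> r0 r1 n; have [|<- _] := ha n (r := r); first by rewrite r0.
by apply: cavg_eq => t; rewrite mulrC.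
Qed.

Lemma sqintg_circ r : 0 <= r -> r < 1 -> sqintg (circ F r).
Proof. by move=> r0 r1; apply: sqintg_cts; exact: holo_ccts. Qed.

Lemma trig_approx r e : 0 <= r -> r < 1 -> 0 < e ->
  exists N, forall n t, (N <= n)%N -> cabs (circ F r t - trig (fun i => a i * (r ^+ i)%:C) n t) <= e.
Proof.
move=> r0 r1 e0; pose rho := (1 + r) / 2.
have rr : r < rho by rewrite /rho; lra.
have rho1 : rho < 1 by rewrite /rho; lra.
have rho0 : 0 < rho by exact: le_lt_trans rr.
pose q := r / rho.
have q0 : 0 <= q by rewrite divr_ge0// ltW.
have q1 : q < 1 by rewrite ltr_pdivrMr// mul1r.
set M := mint (fun t => cabs (circ F rho t)).
have lim : 2 * q ^+ n.+1 / (1 - q) * M @[n --> \oo] --> 0.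
  rewrite -(mul0r M); apply: cvgM; last exact: cvg_cst.
  rewrite -(mul0r (1 - q)^-1) -(mulr0 2); apply: cvgM; last exact: cvg_cst.
  by apply: cvgM; [exact: cvg_cst|exact: cvg_exprS].
move/cvgrPdist_lt : lim => /(_ e e0)[N _ hN].
exists N.+1 => -[//|n] t nN.
have := @taylor_bound R F 1 hF a ha (r%:C * expi t) rho n.
rewrite cabs_circle// => /(_ rr rho1) h.
have := hN n nN; rewrite /= sub0r normrN => /ltW h'.
apply: le_trans (le_trans (ler_norm _) h'); apply: le_trans h.
rewrite le_eqVlt; apply/orP; left; apply/eqP; congr (cabs (_ - _)).
by apply: eq_bigr => i _; rewrite exprMn RtoCX mulrA.
Qed.

Lemma hardy2_coef_sum : (forall r, 0 <= r < 1 -> mint (fun t => cabs (circ F r t) ^+ 2) <= S) ->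
  sqsum a S.
Proof.
move=> hS n.
have h r : 0 <= r -> r < 1 -> \sum_(i < n) cabs (a i) ^+ 2 * (r ^+ i) ^+ 2 <= S.
  move=> r0 r1; apply: le_trans (hS r _); last by rewrite r0.
  apply: le_trans (bessel n (sqintg_circ r0 r1) (fourier_circ r0 r1)).
  by apply: ler_sum => i _; rewrite cabsM exprMn cabs_nneg ?exprn_ge0.
have lim : \sum_(i < n) cabs (a i) ^+ 2 * ((1 - k.+1%:R^-1) ^+ i) ^+ 2 @[k --> \oo] -->
   \sum_(i < n) cabs (a i) ^+ 2.
  have rl : 1 - k.+1%:R^-1 @[k --> \oo] --> (1 : R).
    rewrite -[X in _ --> X]subr0; apply: cvgB; first exact: cvg_cst.
    exact: cvg_harmonic.
  apply: cvg_big => //; first exact: add_continuous.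
  move=> i _; rewrite -[X in _ --> X]mulr1; apply: cvgM; first exact: cvg_cst.
  under eq_fun do rewrite -exprM.
  elim: (i * 2)%N => [|m IH]; first by under eq_fun do rewrite expr0; exact: cvg_cst.
  rewrite (_ : (fun k => _) = (fun k : nat => (1 - k.+1%:R^-1) * (1 - k.+1%:R^-1 : R) ^+ m)); last first.
    by apply/funext => k; rewrite exprS.
  have := @cvgM _ _ _ _ _ _ _ _ rl IH; rewrite mulr1; exact.
apply: (ler_cvg_to lim (cvg_cst S)).
apply: nearW => k; apply: h; last by rewrite gtrBl invr_gt0.
by rewrite subr_ge0 invf_le1// ler1n.
Qed.

Hypothesis hS : sqsum a S.

Lemma circ_sq_le r : 0 <= r -> r < 1 -> mint (fun t => cabs (circ F r t) ^+ 2) <= S.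
Proof.
move=> r0 r1; apply: (parseval_le (sqintg_circ r0 r1) (fourier_circ r0 r1)).
  by move=> e /(trig_approx r0 r1)[N hN]; exists N => t; exact: hN.
move=> n; apply: le_trans (hS n); apply: ler_sum => i _.
rewrite cabsM exprMn cabs_nneg ?exprn_ge0// ler_piMr ?sqr_ge0// exprn_ile1 ?exprn_ge0//.
by rewrite exprn_ile1// ltW.
Qed.

(** Parseval turns the distance of two circle functions into a sum over coefficients: beyond [N] the
    tail of [|a i|^2] is at most [e / 2], and for [i < N] Bernoulli's inequality bounds
    [|r^i - r'^i|] by [N * d]. The constant [K] is chosen so that the head is also at most
    [e / 2]. *)
Lemma circ_cauchy e : 0 < e -> exists2 d, 0 < d & forall r r', 0 <= r < 1 -> 0 <= r' < 1 ->
  1 - r < d -> 1 - r' < d -> mint (fun t => cabs (circ F r t - circ F r' t) ^+ 2) <= e.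
Proof.
move=> e0; have S0 := sqsum_ge0 hS.
have e20 : 0 < e / 2 by rewrite divr_gt0.
have [N hN] := sqsum_tail hS e20.
pose K := 1 + S * N%:R ^+ 2 + N%:R.
have K1 : 1 <= K by rewrite /K -addrA lerDl addr_ge0// mulr_ge0// sqr_ge0.
have K0 : 0 < K by exact: lt_le_trans K1.
pose d := Num.min 1 (e / 2 / K).
have d0 : 0 < d by rewrite lt_min ltr01 divr_gt0.
have [d1 d2] : d <= 1 /\ d <= e / 2 / K by rewrite !ge_min !lexx !orbT.
exists d => // r r' /andP[r0 r1] /andP[r'0 r'1] rd r'd.
pose c i := a i * (r ^+ i - r' ^+ i)%:C.
have fc : fourier (fun t => circ F r t - circ F r' t) c.
  move=> n; rewrite /c RtoCB mulrBr -(fourier_circ r0 r1) -(fourier_circ r'0 r'1) -cavgB.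
  - by apply: cavg_eq => t; rewrite mulrBr.
  - by apply: cintg_conjexpiM; exact: holo_cintg.
  - by apply: cintg_conjexpiM; exact: holo_cintg.
apply: (parseval_le (sqintgB (sqintg_circ r0 r1) (sqintg_circ r'0 r'1)) fc).
  move=> e1 e10; have e120 : 0 < e1 / 2 by rewrite divr_gt0.
  have [N1 h1] := trig_approx r0 r1 e120; have [N2 h2] := trig_approx r'0 r'1 e120.
  exists (maxn N1 N2) => t.
  have -> : trig c (maxn N1 N2) t = trig (fun i => a i * (r ^+ i)%:C) (maxn N1 N2) t -
     trig (fun i => a i * (r' ^+ i)%:C) (maxn N1 N2) t.
    by rewrite /trig -sumrB; apply: eq_bigr => i _; rewrite /c RtoCB; ring.
  set T1 := trig _ _ _; set T2 := trig _ _ _.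
  have -> : circ F r t - circ F r' t - (T1 - T2) = (circ F r t - T1) - (circ F r' t - T2) by ring.
  apply: le_trans (cabsB _ _) _; rewrite [leRHS]splitr.
  apply: lerD; first by rewrite h1// leq_maxl.
  by rewrite h2// leq_maxr.
have bern q i : 0 <= q -> q < 1 -> 1 - q < d -> 1 - q ^+ i <= i%:R * d.
  move=> q0 q1 qd; elim: i => [|i IH]; first by rewrite expr0 subrr mul0r.
  rewrite exprS -natr1 mulrDl mul1r.
  have rm0 : 0 <= q ^+ i by exact: exprn_ge0.
  have rm1 : q ^+ i <= 1 by rewrite exprn_ile1// ltW.
  nra.
have cle i : cabs (c i) ^+ 2 <= cabs (a i) ^+ 2 * (r ^+ i - r' ^+ i) ^+ 2.
  by rewrite /c cabsM exprMn cabs_real real_normK ?num_real.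
have le1 i : (r ^+ i - r' ^+ i) ^+ 2 <= 1.
  have p1 : 0 <= r ^+ i by exact: exprn_ge0.
  have p2 : r ^+ i <= 1 by rewrite exprn_ile1// ltW.
  have p3 : 0 <= r' ^+ i by exact: exprn_ge0.
  have p4 : r' ^+ i <= 1 by rewrite exprn_ile1// ltW.
  nra.
have le2 i : (i < N)%N -> (r ^+ i - r' ^+ i) ^+ 2 <= N%:R ^+ 2 * d.
  move=> iN.
  have p1 : r ^+ i <= 1 by rewrite exprn_ile1// ltW.
  have p2 : r' ^+ i <= 1 by rewrite exprn_ile1// ltW.
  have b1 := bern r i r0 r1 rd; have b2 := bern r' i r'0 r'1 r'd.
  have id : i%:R * d <= N%:R * d by rewrite ler_wpM2r ?(ltW d0)// ler_nat ltnW.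
  have : `|r ^+ i - r' ^+ i| <= N%:R * d by rewrite ler_norml; lra.
  move=> h; rewrite -(real_normK (num_real (r ^+ i - r' ^+ i))).
  apply: (@le_trans _ _ ((N%:R * d) ^+ 2)); first by rewrite lerXn2r ?nnegrE ?mulr_ge0// ltW.
  by rewrite exprMn ler_wpM2l ?sqr_ge0// expr2 ler_piMr// ltW.
have small : \sum_(i < N) cabs (c i) ^+ 2 <= e / 2.
  apply: (@le_trans _ _ (\sum_(i < N) cabs (a i) ^+ 2 * (N%:R ^+ 2 * d))).
    apply: ler_sum => i _; apply: le_trans (cle i) _.
    by rewrite ler_wpM2l ?sqr_ge0// le2.
  rewrite -mulr_suml; apply: (@le_trans _ _ (S * (N%:R ^+ 2 * d))).
    by rewrite ler_wpM2r// mulr_ge0 ?sqr_ge0// ltW.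
  move: d2; rewrite ler_pdivlMr// => d2; apply: le_trans d2.
  by rewrite mulrA mulrC ler_wpM2l ?(ltW d0)// /K addrAC lerDr addr_ge0.
move=> n.
have [nN|Nn] := leqP n N.
  apply: (@le_trans _ _ (\sum_(i < N) cabs (c i) ^+ 2)); last by lra.
  rewrite -!(big_mkord xpredT (fun i => cabs (c i) ^+ 2)) (big_cat_nat (leq0n n) nN)//= lerDl.
  by apply: sumr_ge0 => i _; exact: sqr_ge0.
rewrite -(big_mkord xpredT (fun i => cabs (c i) ^+ 2)) (big_cat_nat (leq0n N) (ltnW Nn))//= big_mkord.
rewrite [leRHS]splitr; apply: lerD => //.
have := hN n (ltnW Nn); rewrite -!(big_mkord xpredT (fun i => cabs (a i) ^+ 2)).
rewrite (big_cat_nat (leq0n N) (ltnW Nn))//= lerD2l; apply: le_trans.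
apply: ler_sum => i _; apply: le_trans (cle i) _.
by rewrite ler_piMr ?sqr_ge0.
Qed.

Definition cvg2 F G := forall e, 0 < e -> exists2 d, 0 < d &
  forall r, 0 <= r < 1 -> 1 - r < d -> mint (fun t => cabs (circ F r t - G t) ^+ 2) <= e.

Lemma cvg2_cvg1 G : sqintg G -> cvg2 F G -> cvg1 F G.
Proof.
move=> sG FG e e0; have [d d0 hd] := FG _ (exprn_gt0 2 e0).
exists d => // r r01 rd; have /andP[r0 r1] := r01.
have s := sqintgB (sqintg_circ r0 r1) sG.
have [_ h] := mint_sqr_le (cmeas_cabs s.1) s.2.
have m0 : 0 <= mint (fun t => cabs (circ F r t - G t)) by apply: mint_ge0 => t; exact: cabs_ge0.
rewrite -(@ler_pXn2r _ 2)// ?nnegrE ?(ltW e0)//.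
exact: le_trans h (hd r r01 rd).
Qed.

(** Completeness gives a limit along the radii [1 - 1/(k+1)]; [circ_cauchy] extends the convergence
    to all radii. *)
Lemma hardy2_boundary : [/\ sqintg (bdf F), cvg2 F (bdf F), cvg1 F (bdf F),
   {ae mC R, forall t, radlim F t (bdf F t)} & fourier (bdf F) a].
Proof.
pose rk k := 1 - k.+1%:R^-1 : R.
have rk0 k : 0 <= rk k by rewrite subr_ge0 invf_le1// ler1n.
have rk1 k : rk k < 1 by rewrite gtrBl invr_gt0.
have rkd d : 0 < d -> exists J, forall j, (J <= j)%N -> 1 - rk j < d.
  move=> d0; have [J _ hJ] := near_infty_natSinv_lt (PosNum d0).
  by exists J => j /hJ /=; rewrite /rk opprB addrC subrK.
have [G sG hG] : exists2 G, sqintg G & forall e, 0 < e -> exists J, forall j, (J <= j)%N ->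
     mint (fun t => cabs (circ F (rk j) t - G t) ^+ 2) <= e.
  apply: sqintg_complete; first by move=> k; exact: sqintg_circ.
  move=> e /circ_cauchy[d d0 hd]; have [J hJ] := rkd _ d0.
  exists J => j k Jj Jk; apply: hd; rewrite ?rk0 ?rk1//; exact: hJ.
have FG : cvg2 F G.
  move=> e e0; have e40 : 0 < e / 4 by rewrite divr_gt0.
  have [d d0 hd] := circ_cauchy e40; have [J hJ] := rkd _ d0; have [J' hJ'] := hG _ e40.
  exists d => // r r01 rd; have /andP[r0 r1] := r01.
  pose j := maxn J J'.
  have s1 := sqintgB (sqintg_circ r0 r1) (sqintg_circ (rk0 j) (rk1 j)).
  have s2 := sqintgB (sqintg_circ (rk0 j) (rk1 j)) sG.
  have := mint_tri_sqr s1 s2.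
  rewrite (mint_eq (g := fun t => cabs (circ F r t - G t) ^+ 2)); last first.
    by move=> t; rewrite addrA subrK.
  have h1 : mint (fun t => cabs (circ F r t - circ F (rk j) t) ^+ 2) <= e / 4.
    by apply: hd; rewrite ?rk0 ?rk1//; apply: hJ; exact: leq_maxl.
  have h2 := hJ' j (leq_maxr _ _).
  lra.
have [iB BG rl c1] := cvg1_boundary hF (sqintg_cintg sG) (cvg2_cvg1 sG FG).
have mB := bdf_meas hF.
have sB : sqintg (bdf F).
  split => //; apply: (proj1 (mint_ae _ sG.2 _)).
    by apply: measurable_funX; exact: cmeas_cabs.
  by apply: aeS BG => t ->.
split => //; last exact: cvg1_fourier.
move=> e /FG[d d0 hd]; exists d => // r r01 rd; have /andP[r0 r1] := r01.
apply: le_trans (hd r r01 rd); rewrite le_eqVlt; apply/orP; left; apply/eqP.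
have s := sqintgB (sqintg_circ r0 r1) sG.
apply: (proj2 (mint_ae _ s.2 _)).
  by apply: measurable_funX; apply: cmeas_cabs; apply: cmeasB => //; have [] := sqintg_circ r0 r1.
by apply: aeS BG => t ->.
Qed.

End HardyTwo.

(** * Holomorphic fourth roots and finite Blaschke products for polynomials *)

Section ComplexRoots.
Context (R : realType).
Local Notation C := R[i].
Implicit Types (z w a b c : C) (B q : C -> C) (e d eta : R) (s : seq C).

Lemma Re_sqrtc_gt0 w : 0 < complex.Re w -> 0 < complex.Re (sqrtc w).
Proof.
case: w => x y /= x0; rewrite sqrtr_gt0 divr_gt0// ltr_wpDl// sqrtr_ge0.
Qed.

(** The slope is [1 / (sqrtc w + sqrtc w0)]; both roots have positive real part, which keeps the
    denominator away from 0. *)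
Lemma cdiff_sqrtc w0 : 0 < complex.Re w0 -> cdiff (@sqrtc R) w0.
Proof.
move=> h0; have s0 := Re_sqrtc_gt0 h0.
set sg := complex.Re (sqrtc w0) in s0.
have sub w : 0 < complex.Re w -> sg <= cabs (sqrtc w + sqrtc w0).
  move=> /Re_sqrtc_gt0 h; apply: le_trans (Re_le _).
  by rewrite ReD lerDr ltW.
have mulE w : (sqrtc w - sqrtc w0) * (sqrtc w + sqrtc w0) = w - w0.
  by rewrite -subr_sqr !sqr_sqrtc.
have pos w : cabs (w - w0) < complex.Re w0 -> 0 < complex.Re w.
  move=> h; have := Re_le_cabs (w - w0); rewrite ReB => h'.
  by move: (le_lt_trans h' h); rewrite ltr_norml; lra.
have ct : ccont (@sqrtc R) w0.
  apply/ccontP => e e0; exists (Num.min (complex.Re w0) (sg * e)).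
    by rewrite lt_min h0 mulr_gt0.
  move=> w; rewrite lt_min => /andP[/pos/sub k1 k2].
  have E := congr1 (@cabs R) (mulE w); rewrite cabsM in E.
  have := cabs_ge0 (sqrtc w - sqrtc w0); nra.
apply: (@cdiff_near R (fun w => if 0 < complex.Re w then sqrtc w else
    sqrtc w0 + (sqrtc w + sqrtc w0)^-1 * (w - w0)) _ _ _ h0); first by move=> w /pos ->.
exists (fun w => (sqrtc w + sqrtc w0)^-1).
  apply: ccontV; last by apply: ccontD => //; exact: ccont_cst.
  by rewrite -cabs_gt0; apply: lt_le_trans (sub _ h0).
move=> w; rewrite h0; case: ifP => // hw.
have n0 : sqrtc w + sqrtc w0 != 0 by rewrite -cabs_gt0; apply: lt_le_trans (sub _ hw).
by rewrite -mulE mulrCA mulVf// mulr1 addrC subrK.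
Qed.

(* On the circle the two moduli agree: this is a Blaschke factor. *)
Lemma blaschke_factor a z : cabs (1 - a^*%C * z) ^+ 2 - cabs (z - a) ^+ 2 =
  (1 - cabs a ^+ 2) * (1 - cabs z ^+ 2).
Proof.
apply: RtoC_inj; rewrite RtoCM !RtoCB -!mul_conj !conjB conjM conjcK.
have -> : (1 : C)^*%C = 1 by rewrite -RtoC1 conjR.
rewrite RtoC1; ring.
Qed.

(* B is a finite Blaschke product and q a fourth root of a zero-free function,
   so that |p| = |q| ^ 4 on the unit circle and |p| <= |q| ^ 4 inside. *)
Definition inner_quartic (p : C -> C) eta B q :=
  [/\ 1 < eta, forall z, cabs z < eta -> cdiff B z /\ cdiff q z,
      forall z, cabs z <= 1 -> cabs (B z) <= 1,
      forall z, cabs z = 1 -> cabs (B z) = 1 &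
      forall z, cabs z < eta -> p z = B z * q z ^+ 4].

Lemma sqrtc4 w : sqrtc (sqrtc w) ^+ 4 = w.
Proof. by rewrite (exprM _ 2 2) !sqr_sqrtc. Qed.

(** The radius [2 / (1 + |b|)] exceeds 1 and still forces [|b z| < 1], so that [1 - b z] stays in
    the right half-plane, where the principal roots are holomorphic. *)
Lemma root_factor b : cabs b < 1 -> exists2 eta, 1 < eta &
  forall z, cabs z < eta -> 0 < complex.Re (1 - b * z) /\ 
    cdiff (fun z => sqrtc (sqrtc (1 - b * z))) z.
Proof.
move=> b1; have b0 := cabs_ge0 b; exists (2 / (1 + cabs b)).
  by rewrite ltr_pdivlMr; lra.
have b2 : 0 < 1 + cabs b by lra.
move=> z; rewrite ltr_pdivlMr// => zb.
have h : 0 < complex.Re (1 - b * z).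
  rewrite ReB /=; have := Re_le (b * z); rewrite cabsM => k.
  have := cabs_ge0 z; nra.
split => //; apply: (@cdiff_comp _ (@sqrtc R) (fun z => sqrtc (1 - b * z))).
  apply: (@cdiff_comp _ (@sqrtc R) (fun z => 1 - b * z)); last exact: cdiff_sqrtc.
  by apply: cdiffB; [exact: cdiff_cst|apply: cdiffM; [exact: cdiff_cst|exact: cdiff_id]].
by apply: cdiff_sqrtc; exact: Re_sqrtc_gt0.
Qed.

(** A zero inside the disk is moved into a Blaschke factor, leaving the zero-free [1 - conj a * z];
    a zero outside needs no Blaschke factor, and [z - a] is written [- a * (1 - z / a)]. *)
Lemma inner_quartic_linear a : cabs a != 1 -> exists eta B q, inner_quartic (fun z => z - a) eta B q.
Proof.
have [a1|a1 _|//] := ltgtP (cabs a) 1.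
  move=> _; have [eta eta1 h] := @root_factor a^*%C (eq_ind_r (fun x => x < 1) a1 (cabs_conj a)).
  have n0 z : cabs z < eta -> 1 - a^*%C * z != 0.
    by move=> /h[+ _]; apply: contraTneq => ->; rewrite /= ltxx.
  exists eta, (fun z => (z - a) / (1 - a^*%C * z)), (fun z => sqrtc (sqrtc (1 - a^*%C * z))).
  split => //.
  - move=> z zr; have [_ hq] := h z zr; split => //.
    apply: cdiffM; first by apply: cdiffB; [exact: cdiff_id|exact: cdiff_cst].
    apply: cdiffV; first exact: n0.
    by apply: cdiffB; [exact: cdiff_cst|apply: cdiffM; [exact: cdiff_cst|exact: cdiff_id]].
  - move=> z z1; rewrite cabsM cabsV ler_pdivrMr ?mul1r; last first.
      by rewrite cabs_gt0 n0// (le_lt_trans z1).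
    rewrite -(@ler_pXn2r _ 2)// ?nnegrE ?cabs_ge0// -subr_ge0 blaschke_factor.
    by rewrite mulr_ge0// subr_ge0 exprn_ile1 ?cabs_ge0// ltW.
  - move=> z z1; have g0 : 0 < cabs (1 - a^*%C * z) by rewrite cabs_gt0 n0// z1.
    rewrite cabsM cabsV; suff -> : cabs (1 - a^*%C * z) = cabs (z - a).
      rewrite divff//; have := blaschke_factor a z; rewrite z1 expr1n subrr mulr0 => /eqP.
      rewrite subr_eq0 eqrXn2 ?cabs_ge0// => /eqP <-; exact: lt0r_neq0.
    have := blaschke_factor a z; rewrite z1 expr1n subrr mulr0 => /eqP.
    by rewrite subr_eq0 eqrXn2 ?cabs_ge0// => /eqP.
  - by move=> z zr; rewrite sqrtc4 divfK ?n0.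
have a0 : a != 0 by rewrite -cabs_gt0 (lt_trans ltr01).
have [|eta eta1 h] := @root_factor a^-1; first by rewrite cabsV invf_lt1 ?(lt_trans ltr01).
exists eta, (fun=> 1), (fun z => sqrtc (sqrtc (- a)) * sqrtc (sqrtc (1 - a^-1 * z))); split => //.
- move=> z zr; have [_ hq] := h z zr; split; first exact: cdiff_cst.
  by apply: cdiffM => //; exact: cdiff_cst.
- by move=> z _; rewrite cabs1.
- by move=> z _; rewrite cabs1.
- by move=> z zr; rewrite exprMn !sqrtc4; field.
Qed.

Lemma inner_quartic_prod c s : (forall a, a \in s -> cabs a != 1) ->
  exists eta B q, inner_quartic (fun z => c * \prod_(a <- s) (z - a)) eta B q.
Proof.
elim: s => [|a s IH] hs.
  exists 2, (fun=> 1), (fun=> sqrtc (sqrtc c)); split; first by rewrite ltr1n.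
  - by move=> z _; split; exact: cdiff_cst.
  - by move=> z _; rewrite cabs1.
  - by move=> z _; rewrite cabs1.
  - by move=> z _; rewrite big_nil mulr1 mul1r sqrtc4.
have [|e1 [B1 [q1 [h1 d1 i1 j1 f1]]]] := IH.
  by move=> b bs; apply: hs; rewrite inE bs orbT.
have [|e2 [B2 [q2 [h2 d2 i2 j2 f2]]]] := @inner_quartic_linear a.
  by apply: hs; rewrite inE eqxx.
exists (Num.min e1 e2), (fun z => B1 z * B2 z), (fun z => q1 z * q2 z); split.
- by rewrite lt_min h1.
- move=> z; rewrite lt_min => /andP[/d1[k1 k2] /d2[k3 k4]].
  by split; apply: cdiffM.
- by move=> z z1; rewrite cabsM mulr_ile1 ?cabs_ge0// ?i1// i2.
- by move=> z z1; rewrite cabsM j1// j2// mulr1.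
- move=> z; rewrite lt_min => /andP[/f1 k1 /f2 k2].
  by rewrite big_cons mulrCA k1 k2; ring.
Qed.

(* Shrinking the variable moves the finitely many zeros off the circle. *)
Lemma avoid_moduli s : exists2 r0, r0 < 1 & forall r, r0 < r -> r < 1 ->
  forall a, a \in s -> cabs a != r.
Proof.
elim: s => [|a s [r0 r01 h]]; first by exists 0.
have [a1|a1] := ltP (cabs a) 1.
  exists (Num.max r0 (cabs a)); first by rewrite gt_max r01.
  move=> r; rewrite gt_max => /andP[k1 k2] k3 b; rewrite inE => /orP[/eqP ->|bs].
    by rewrite lt_eqF.
  exact: h.
exists r0 => // r k1 k2 b; rewrite inE => /orP[/eqP ->|bs]; last exact: h.
by rewrite gt_eqF// (lt_le_trans k2).
Qed.

(** The polynomial splits over the algebraically closed field [C]. Replacing [z] by [r z] divides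
    its zeros by [r], so it suffices that [r] avoid their moduli. *)
Lemma inner_quartic_poly (c : nat -> C) n : exists2 r0, r0 < 1 & forall r, r0 < r -> 0 < r -> r < 1 ->
  exists eta B q, inner_quartic (fun z => \sum_(i < n) c i * (r%:C * z) ^+ i) eta B q.
Proof.
pose p : {poly C} := \poly_(i < n) c i.
have [s ps] := closed_field_poly_normal p.
have pE z : \sum_(i < n) c i * z ^+ i = lead_coef p * \prod_(a <- s) (z - a).
  rewrite -horner_poly -/p {1}ps hornerZ horner_prod; congr (_ * _).
  by apply: eq_bigr => a _; rewrite !hornerE.
have [r0 r01 h] := avoid_moduli s; exists r0 => // r k1 r00 k2.
have rn : r%:C != 0 :> C by rewrite -cabs_gt0 cabs_nneg// ltW.
have [|eta [B [q [h1 d1 i1 j1 f1]]]] :=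
    @inner_quartic_prod (lead_coef p * r%:C ^+ size s) [seq a / r%:C | a <- s].
  move=> _ /mapP[a /(h _ k1 k2) ar ->]; rewrite cabsM cabsV cabs_nneg ?ltW//.
  by apply: contra ar => /eqP e; rewrite -[cabs a](divfK (lt0r_neq0 r00)) e mul1r.
exists eta, B, q; split => // z /f1 <-; rewrite pE big_map -mulrA; congr (_ * _).
elim: (s) => [|a s' IH]; first by rewrite !big_nil expr0 mulr1.
by rewrite !big_cons IH /= exprS; field.
Qed.

End ComplexRoots.

(** * Cauchy transforms and Montel's theorem *)

Section Montel.
Context (R : realType).
Local Notation C := R[i].
Implicit Types (z w : C) (F : C -> C) (G g : R -> C) (r e d M S : R).

(** Tychonoff's theorem provides a cluster point in the product of the segments; each extraction
    step controls finitely many coordinates, with a precision and a number of coordinates that both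
    improve. *)
Lemma diagonal_subsequence (x : nat -> nat -> R) (M : nat -> R) :
  (forall k n, `|x k n| <= M n) -> exists (ka : nat -> nat) (l : nat -> R),
  {homo ka : m n / (m < n)%N} /\ forall n, x (ka k) n @[k --> \oo] --> l n.
Proof.
move=> xM; pose T (_ : nat) : topologicalType := R.
have cA := @tychonoff _ T (fun n => `[- M n, M n]%classic) (fun n => @segment_compact R _ _).
have [|l [_ hl]] := cA ((x : nat -> prod_topology T) @ \oo) (fmap_proper_filter _ eventually_filter).
  by apply: (@nearW _ _ _ eventually_filter) => k n /=; rewrite in_itv /= -ler_norml.
have nb k e : 0 < e -> nbhs l [set f : prod_topology T | forall i, (i < k)%N -> `|f i - l i : R| < e].
  move=> e0; elim: k => [|k IH]; first by apply: (@nearW _ (nbhs l) _ (nbhs_filter l)) => f i.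
  have := @proj_continuous _ T k l _ (nbhsx_ballx (l k : R) e e0).
  apply: filterS2 IH => f h1 h2 i; rewrite ltnS leq_eqVlt => /orP[/eqP ->|]; last exact: h1.
  by move: h2; rewrite /ball /= distrC.
have step m k : exists j, (m < j)%N /\ forall i, (i < k)%N -> `|x j i - l i| < k.+1%:R^-1.
  have inv0 : 0 < k.+1%:R^-1 :> R by rewrite invr_gt0.
  have [|_ [[j mj ->] hj]] := hl [set f | exists2 j, (m < j)%N & f = x j] _ _ (nb k _ inv0).
    by exists m.+1 => // j mj; exists j.
  by exists j.
have [f hf] := choice (fun mk => step mk.1 mk.2).
pose ka := fix ka n := if n is m.+1 then f (ka m, m.+1) else 0%N.
exists ka, l; split.
  by apply: homo_ltn => [n m k|n]; [exact: ltn_trans|have [] := hf (ka n, n.+1)].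
move=> n; apply/cvgrPdist_lt => e e0.
have [N _ hN] := near_infty_natSinv_lt (PosNum e0).
exists (maxn N n).+1 => // -[//|k]; rewrite /= ltnS geq_max => /andP[Nk nk].
rewrite distrC; have [_ /(_ n)] := hf (ka k, k.+1); rewrite ltnS => /(_ nk) h.
by apply: lt_trans h _; apply: hN => /=; exact: leqW.
Qed.

Lemma cavg_dct (G_ : nat -> R -> C) G M : (forall k, cmeas (G_ k)) ->
  (forall k t, cabs (G_ k t) <= M) ->
  (forall t, (G_ k t : C^o) @[k --> \oo] --> (G t : C^o)) ->
  cintg G /\ (cavg (G_ k) : C^o) @[k --> \oo] --> (cavg G : C^o).
Proof.
move=> mG GM cG.
have c1 t := cvg_Re eventually_filter (cG t); have c2 t := cvg_Im eventually_filter (cG t).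
have m1 : measurable_fun setT (fun t => complex.Re (G t)).
  by apply: (measurable_fun_cvg (h := fun k t => complex.Re (G_ k t))) => [k|t _]; [have [] := mG k|exact: c1].
have m2 : measurable_fun setT (fun t => complex.Im (G t)).
  by apply: (measurable_fun_cvg (h := fun k t => complex.Im (G_ k t))) => [k|t _]; [have [] := mG k|exact: c2].
have [i1 _ l1] := mint_dct (fun k => (mG k).1) m1 (intg_cst M) (aeT c1)
  (fun k => aeT (fun t => le_trans (Re_le_cabs _) (GM k t))).
have [i2 _ l2] := mint_dct (fun k => (mG k).2) m2 (intg_cst M) (aeT c2)
  (fun k => aeT (fun t => le_trans (Im_le_cabs _) (GM k t))).
by split => //; exact: cvg_ReIm.
Qed.

Lemma cabs_cauchy_den z t : 1 - cabs z <= cabs (1 - z * (expi t)^*%C).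
Proof.
have := cabs_triB 1 (z * (expi t)^*%C).
by rewrite cabs1 cabsM cabs_conj cabs_expi mulr1.
Qed.

Lemma cauchy_den_neq0 z t : cabs z < 1 -> 1 - z * (expi t)^*%C != 0.
Proof.
by move=> z1; rewrite -cabs_gt0; apply: lt_le_trans (cabs_cauchy_den z t); rewrite subr_gt0.
Qed.

Lemma cabs_cauchy_kernel z t : cabs z < 1 -> cabs (1 - z * (expi t)^*%C)^-1 <= (1 - cabs z)^-1.
Proof.
move=> z1; rewrite cabsV lef_pV2 ?posrE ?cabs_gt0 ?cauchy_den_neq0//.
  exact: cabs_cauchy_den.
by rewrite subr_gt0.
Qed.

Lemma ccts_cauchy_kernel z : cabs z < 1 -> ccts (fun t => (1 - z * (expi t)^*%C)^-1).
Proof.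
move=> z1; apply: (@ccts_comp _ (fun w => w^-1) (fun t => 1 - z * (expi t)^*%C)).
  rewrite (_ : (fun t => _) = (fun t => 1 + - z * (expi t)^*%C)); last first.
    by apply/funext => t; rewrite mulNr.
  apply: cctsD; first exact: ccts_cst.
  by apply: cctsM; [exact: ccts_cst|apply: ccts_conj; exact: ccts_expi].
move=> t; apply: ccontV; [exact: cauchy_den_neq0|exact: ccont_id].
Qed.

Lemma cauchy_cintg z g : cabs z < 1 -> cintg g -> cintg (fun t => (1 - z * (expi t)^*%C)^-1 * g t).
Proof.
move=> z1 ig; apply: (cintgM ig (ccts_meas (ccts_cauchy_kernel z1))).
by move=> t; exact: cabs_cauchy_kernel.
Qed.

Lemma cauchy_transform_cdiff g z : cabs z < 1 -> cintg g ->
  cdiff (fun z => cavg (fun t => (1 - z * (expi t)^*%C)^-1 * g t)) z.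
Proof.
move=> z1 ig; set K := fun z t => (1 - z * (expi t)^*%C)^-1.
pose dl := (1 - cabs z) / 2.
have dl0 : 0 < dl by rewrite divr_gt0// subr_gt0.
have near1 w : cabs (w - z) < dl -> cabs w < 1 /\ dl <= 1 - cabs w.
  move=> h; have := cabs_triB w z; rewrite /dl in h *; lra.
pose psi w := cavg (fun t => (expi t)^*%C * K w t * K z t * g t).
have Kc w t : cabs w < 1 -> cabs (K w t) <= (1 - cabs w)^-1 by exact: cabs_cauchy_kernel.
have ci w : cabs w < 1 -> cintg (fun t => (expi t)^*%C * K w t * K z t * g t).
  move=> w1; apply: (@cintgM _ g (fun t => (expi t)^*%C * K w t * K z t) ((1 - cabs w)^-1 * (1 - cabs z)^-1)) => //.
    apply: ccts_meas; apply: cctsM; last exact: ccts_cauchy_kernel.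
    by apply: cctsM; [apply: ccts_conj; exact: ccts_expi|exact: ccts_cauchy_kernel].
  move=> t; rewrite !cabsM cabs_conj cabs_expi mul1r.
  by apply: ler_pM; rewrite ?cabs_ge0// Kc.
(* The resolvent identity exhibits the slope [psi] explicitly, so no differentiation under the
   integral sign is needed. *)
have KB w t : cabs w < 1 -> K w t = K z t + (expi t)^*%C * K w t * K z t * (w - z).
  by move=> w1; rewrite /K; field; rewrite !cauchy_den_neq0.
have E w : cabs (w - z) < dl -> cavg (fun t => K w t * g t) =
   cavg (fun t => K z t * g t) + psi w * (w - z).
  move=> /near1[w1 _]; rewrite mulrC -cavgZ; last exact: ci.
  rewrite -cavgD; [|exact: cauchy_cintg|by apply: cintgZ; exact: ci].
  by apply: cavg_eq => t; rewrite {1}(KB w)//; ring.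
apply: (@cdiff_near _ (fun w => cavg (fun t => K z t * g t) + psi w * (w - z)) _ _ _ dl0).
  by move=> w /E.
exists psi; last by move=> w; rewrite subrr mulr0 addr0.
apply/ccontP => e e0; set m := mint (fun t => cabs (g t)).
have m0 : 0 <= m by apply: mint_ge0 => t; exact: cabs_ge0.
pose A := dl^-1 * dl^-1 * dl^-1.
have A0 : 0 < A by rewrite !mulr_gt0// invr_gt0.
exists (Num.min dl (e / (A * m + 1))).
  by rewrite lt_min dl0 divr_gt0// ltr_wpDl// mulr_ge0// ltW.
move=> w; rewrite lt_min => /andP[wd]; have [w1 w2] := near1 _ wd.
rewrite ltr_pdivlMr; last by rewrite ltr_wpDl// mulr_ge0// ltW.
move=> h; rewrite -cavgB; [|exact: ci|exact: ci].
have ii := cintgB (ci w w1) (ci z z1).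
apply: le_lt_trans (cabs_cavg ii) _.
apply: (@le_lt_trans _ _ (mint (fun t => (cabs (w - z) * A) * cabs (g t)))).
  apply: mint_le; [exact: cintg_cabs|by apply: intgZ; exact: cintg_cabs|move=> t].
  have -> : (expi t)^*%C * K w t * K z t * g t - (expi t)^*%C * K z t * K z t * g t =
    (w - z) * ((expi t)^*%C * (expi t)^*%C * K w t * K z t * K z t) * g t.
    by rewrite {1}(KB w)//; ring.
  rewrite cabsM ler_wpM2r ?cabs_ge0// cabsM ler_wpM2l ?cabs_ge0//.
  rewrite !cabsM !cabs_conj !cabs_expi !mul1r.
  have iz : (1 - cabs z)^-1 <= dl^-1 by rewrite lef_pV2 ?posrE ?subr_gt0//; have := z1; rewrite /dl; lra.
  have iw : (1 - cabs w)^-1 <= dl^-1 by rewrite lef_pV2 ?posrE ?subr_gt0.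
  have kz := le_trans (Kc z t z1) iz; have kw := le_trans (Kc w t w1) iw.
  apply: ler_pM; rewrite ?cabs_ge0// ?mulr_ge0 ?cabs_ge0//.
  by apply: ler_pM; rewrite ?cabs_ge0.
rewrite mintZ; last exact: cintg_cabs.
rewrite -/m; apply: le_lt_trans h; have := cabs_ge0 (w - z); nra.
Qed.

Lemma cauchy_fourier z g (c : nat -> C) n : cabs z < 1 -> cintg g -> fourier g c ->
  cabs (cavg (fun t => (1 - z * (expi t)^*%C)^-1 * g t) - \sum_(i < n) c i * z ^+ i) <=
  cabs z ^+ n / (1 - cabs z) * mint (fun t => cabs (g t)).
Proof.
move=> z1 ig fg.
have E t : (1 - z * (expi t)^*%C)^-1 * g t = \sum_(i < n) z ^+ i * ((expi t)^*%C ^+ i * g t) +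
   z ^+ n * ((expi t)^*%C ^+ n * ((1 - z * (expi t)^*%C)^-1 * g t)).
  rewrite {1}(@geom_tail _ _ n); last first.
    by rewrite eq_sym -subr_eq0; exact: cauchy_den_neq0.
  rewrite mulrDl mulr_suml; congr (_ + _); last by rewrite exprMn; ring.
  by apply: eq_bigr => i _; rewrite exprMn; ring.
have ic := cauchy_cintg z1 ig.
rewrite (cavg_eq E) cavgD; last 2 first.
- by apply: cintg_sum => i; apply: cintgZ; exact: cintg_conjexpiM.
- by apply: cintgZ; exact: cintg_conjexpiM.
rewrite cavg_sum; last by move=> i; apply: cintgZ; exact: cintg_conjexpiM.
have -> : \sum_(i < n) cavg (fun t => z ^+ i * ((expi t)^*%C ^+ i * g t)) = \sum_(i < n) c i * z ^+ i.
  by apply: eq_bigr => i _; rewrite cavgZ ?fg 1?mulrC//; exact: cintg_conjexpiM.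
rewrite addrC addKr cavgZ; last exact: cintg_conjexpiM.
rewrite cabsM cabsX -mulrA ler_wpM2l ?exprn_ge0 ?cabs_ge0//.
apply: le_trans (cabs_cavg (cintg_conjexpiM n ic)) _.
rewrite -mintZ; last exact: cintg_cabs.
apply: mint_le; [exact/cintg_cabs/cintg_conjexpiM|by apply: intgZ; exact: cintg_cabs|move=> t].
rewrite !cabsM cabsX cabs_conj cabs_expi expr1n mul1r ler_wpM2r ?cabs_ge0//.
exact: cabs_cauchy_kernel.
Qed.

(** Both sides are limits of the same Taylor sums, by [cauchy_fourier] and [taylor_bound]. *)
Lemma cauchy_formula F r z : holo F -> 0 <= r -> r < 1 -> cabs z < 1 ->
  F (r%:C * z) = cavg (fun t => (1 - z * (expi t)^*%C)^-1 * circ F r t).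
Proof.
move=> hF r0 r1 z1; have [a ha] := coefs_exist ltr01 hF.
have fF := fourier_circ ha r0 r1.
pose rho := (1 + r) / 2.
have rr : r < rho by rewrite /rho; lra.
have rho1 : rho < 1 by rewrite /rho; lra.
have rho0 : 0 < rho by exact: le_lt_trans rr.
have zr : cabs (r%:C * z) < rho.
  by rewrite cabsM cabs_nneg//; apply: le_lt_trans rr; rewrite ler_piMr// ltW.
pose q := cabs (r%:C * z) / rho.
have q0 : 0 <= q by rewrite divr_ge0 ?cabs_ge0// ltW.
have q1 : q < 1 by rewrite ltr_pdivrMr// mul1r.
have lim1 : cabs z ^+ n.+1 / (1 - cabs z) * mint (fun t => cabs (circ F r t)) @[n --> \oo] --> 0.
  set m := mint _; rewrite -(mul0r m); apply: cvgM; last exact: cvg_cst.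
  rewrite -(mul0r (1 - cabs z)^-1); apply: cvgM; last exact: cvg_cst.
  by apply: cvg_exprS => //; exact: cabs_ge0.
have lim2 : 2 * q ^+ n.+1 / (1 - q) * mint (fun t => cabs (circ F rho t)) @[n --> \oo] --> 0.
  set m := mint _; rewrite -(mul0r m); apply: cvgM; last exact: cvg_cst.
  rewrite -(mul0r (1 - q)^-1) -(mulr0 2); apply: cvgM; last exact: cvg_cst.
  by apply: cvgM; [exact: cvg_cst|exact: cvg_exprS].
have := @cvgD _ _ _ _ eventually_filter _ _ _ _ lim1 lim2; rewrite addr0 => lim.
apply/eqP; rewrite -subr_eq0 -cabs_eq0 eq_le cabs_ge0 andbT.
rewrite (cabsC (F (r%:C * z))).
apply: (ler_cvg_to (cvg_cst _) lim); apply: nearW => n.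
have h1 := cauchy_fourier n.+1 z1 (holo_cintg hF r0 r1) fF.
have h2 := @taylor_bound _ F 1 hF a ha (r%:C * z) rho n zr rho1.
rewrite [X in _ - X](_ : _ = \sum_(i < n.+1) a i * (r ^+ i)%:C * z ^+ i) in h2; last first.
  by apply: eq_bigr => i _; rewrite exprMn RtoCX mulrA.
apply: le_trans (cabs_tri _ (\sum_(i < n.+1) a i * (r ^+ i)%:C * z ^+ i) _) _.
by apply: lerD => //; rewrite (cabsC _ (F _)).
Qed.

(** Dominated convergence in the Cauchy formula represents [F] near [z] as a Cauchy transform, which
    is differentiable whatever its density. *)
Lemma holo_limit (F_ : nat -> C -> C) F : (forall k, holo (F_ k)) ->
  (forall r, 0 <= r < 1 -> exists M, forall k z, cabs z <= r -> cabs (F_ k z) <= M) ->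
  (forall z, cabs z < 1 -> (F_ k z : C^o) @[k --> \oo] --> (F z : C^o)) -> holo F.
Proof.
move=> hF bF cF z z1; pose r := (1 + cabs z) / 2.
have z0 := cabs_ge0 z.
have zr : cabs z < r by rewrite /r; lra.
have r1 : r < 1 by rewrite /r; lra.
have r0 : 0 < r by exact: le_lt_trans zr.
have [|M hM] := bF r; first by rewrite ltW.
have MM k t : cabs (circ (F_ k) r t) <= M by apply: hM; rewrite cabs_circle// ltW.
have cc t : (circ (F_ k) r t : C^o) @[k --> \oo] --> (circ F r t : C^o).
  by apply: cF; rewrite cabs_circle// ltW.
have [iF _] := cavg_dct (fun k => cintg_meas (holo_cintg (hF k) (ltW r0) r1)) MM cc.
have d0 : 0 < r - cabs z by rewrite subr_gt0.
have rn : r%:C != 0 :> C by rewrite -cabs_gt0 cabs_nneg// ltW.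
apply: (@cdiff_near _ (fun w => cavg (fun t => (1 - r%:C^-1 * w * (expi t)^*%C)^-1 * circ F r t)) _ _ _ d0).
  move=> w wd; have wr : cabs w < r by have := cabs_triB w z; lra.
  have w1 : cabs (r%:C^-1 * w) < 1.
    by rewrite cabsM cabsV cabs_nneg ?ltW// mulrC ltr_pdivrMr// mul1r.
  have [iw lw] : cintg (fun t => (1 - r%:C^-1 * w * (expi t)^*%C)^-1 * circ F r t) /\
    (cavg (fun t => (1 - r%:C^-1 * w * (expi t)^*%C)^-1 * circ (F_ k) r t) : C^o) @[k --> \oo] -->
    (cavg (fun t => (1 - r%:C^-1 * w * (expi t)^*%C)^-1 * circ F r t) : C^o).
    apply: (@cavg_dct _ _ ((1 - cabs (r%:C^-1 * w))^-1 * M)).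
    - by move=> k; apply: cintg_meas; apply: cauchy_cintg => //; exact: holo_cintg (hF k) (ltW r0) r1.
    - by move=> k t; rewrite cabsM; apply: ler_pM; rewrite ?cabs_ge0 ?MM// cabs_cauchy_kernel.
    - by move=> t; apply: cvgC_mul; [exact: cvgC_cst|exact: cc].
  have Ew k : cavg (fun t => (1 - r%:C^-1 * w * (expi t)^*%C)^-1 * circ (F_ k) r t) = F_ k w.
    by rewrite -cauchy_formula ?(ltW r0)// mulVKf.
  apply: (@cvg_unique _ (@norm_hausdorff _ (C^o)) ((fun k => F_ k w : C^o) @ \oo)).
    by move: lw; under eq_fun do rewrite Ew.
  by apply: cF; exact: lt_trans r1.
apply: (@cdiff_comp _ (fun u => cavg (fun t => (1 - u * (expi t)^*%C)^-1 * circ F r t)) (fun w => r%:C^-1 * w)).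
  by apply: cdiffM; [exact: cdiff_cst|exact: cdiff_id].
apply: cauchy_transform_cdiff => //.
by rewrite cabsM cabsV cabs_nneg ?ltW// mulrC ltr_pdivrMr// mul1r.
Qed.

Lemma cauchy_cvgC (x : nat -> C) : (forall e, 0 < e -> exists J, forall j k, (J <= j)%N ->
  (J <= k)%N -> cabs (x j - x k) <= e) -> exists L, (x k : C^o) @[k --> \oo] --> (L : C^o).
Proof.
move=> h.
have real (u : nat -> R) : (forall j k, `|u j - u k| <= cabs (x j - x k)) -> cvg (u n @[n --> \oo]).
  move=> hu; apply: cauchy_cvg; apply/cauchy_exP => e e0.
  have [J hJ] := h _ (divr_gt0 e0 (@ltr0Sn R 1)); exists (u J); exists J => // j Jj.
  rewrite /ball /=; apply: (@le_lt_trans _ _ (e / 2)); last by lra.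
  exact: le_trans (hu _ _) (hJ _ _ (leqnn _) Jj).
exists (lim (complex.Re (x n) @[n --> \oo]) +i* lim (complex.Im (x n) @[n --> \oo])).
apply: cvg_ReIm => /=.
  by apply: real => j k; rewrite -ReB; exact: Re_le_cabs.
by apply: real => j k; rewrite -ImB; exact: Im_le_cabs.
Qed.

(** Coefficient bounds at radius 1/2 confine each Taylor coefficient to a compact set. Once all
    coefficients converge along a subsequence, the remainder in [taylor_bound], uniform in [k],
    gives convergence at every point. *)
Lemma montel (F_ : nat -> C -> C) : (forall k, holo (F_ k)) ->
  (forall r, 0 <= r < 1 -> exists M, forall k z, cabs z <= r -> cabs (F_ k z) <= M) ->
  exists (ka : nat -> nat) F, [/\ {homo ka : m n / (m < n)%N}, holo F &
    forall z, cabs z < 1 -> (F_ (ka k) z : C^o) @[k --> \oo] --> (F z : C^o)].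
Proof.
move=> hF bF; have [a ha] := choice (fun k => coefs_exist ltr01 (hF k)).
have h2 : 0 <= (2^-1 : R) < 1 by lra.
have [M hM] := bF _ h2.
have mM r k : 0 <= r < 1 -> forall M, (forall k z, cabs z <= r -> cabs (F_ k z) <= M) -> mint (fun t => cabs (circ (F_ k) r t)) <= M.
  move=> /andP[r0 r1] M' hM'; rewrite -[leRHS]mint_cst.
  apply: mint_le; [exact/cintg_cabs/holo_cintg|exact: intg_cst|move=> t].
  by apply: hM'; rewrite cabs_circle.
have aM k n : cabs (a k n) <= M * 2 ^+ n.
  have := @coef_bound _ (F_ k) 1 (hF k) (a k) (ha k) 2^-1 n.
  have /andP[h20 h21] := h2; move=> /(_ h20 h21) h; have := le_trans h (mM _ k h2 M hM).
  by rewrite exprVn ler_pdivrMr ?exprn_gt0.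
(* Real and imaginary parts of the coefficients are interleaved into one real sequence, so that a
   single extraction handles both. *)
pose x k n : R := if odd n then complex.Im (a k n./2) else complex.Re (a k n./2).
have [|ka [l [homo_ka cl]]] := @diagonal_subsequence x (fun n => M * 2 ^+ n./2).
  move=> k n; apply: le_trans (aM k n./2); rewrite /x.
  by case: ifP => _; [exact: Im_le_cabs|exact: Re_le_cabs].
pose b n := l n.*2 +i* l n.*2.+1.
have ab n : (a (ka k) n : C^o) @[k --> \oo] --> (b n : C^o).
  apply: cvg_ReIm => /=.
    by have := cl n.*2; rewrite /x /= odd_double doubleK.
  by have := cl n.*2.+1; rewrite /x /= odd_double /= uphalf_double.
have cv z : cabs z < 1 -> exists L, (F_ (ka k) z : C^o) @[k --> \oo] --> (L : C^o).
  move=> z1; pose r := (1 + cabs z) / 2.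
  have z0 := cabs_ge0 z.
  have zr : cabs z < r by rewrite /r; lra.
  have r1 : r < 1 by rewrite /r; lra.
  have r0 : 0 < r by exact: le_lt_trans zr.
  have [|M' hM'] := bF r; first by rewrite ltW.
  have M'0 : 0 <= M' by apply: le_trans (cabs_ge0 _) (hM' 0%N 0 _); rewrite cabs0 ltW.
  pose q := cabs z / r.
  have q0 : 0 <= q by rewrite divr_ge0// ltW.
  have q1 : q < 1 by rewrite ltr_pdivrMr// mul1r.
  have lim : 2 * q ^+ n.+1 / (1 - q) * M' @[n --> \oo] --> 0.
    rewrite -(mul0r M'); apply: cvgM; last exact: cvg_cst.
    rewrite -(mul0r (1 - q)^-1) -(mulr0 2); apply: cvgM; last exact: cvg_cst.
    by apply: cvgM; [exact: cvg_cst|exact: cvg_exprS].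
  apply: cauchy_cvgC => e e0; have e40 : 0 < e / 4 by rewrite divr_gt0.
  move/cvgrPdist_lt : lim => /(_ _ e40)[n _ /(_ n (leqnn _))].
  rewrite /= sub0r normrN => /ltW/(le_trans (ler_norm _)) hn.
  pose T k := \sum_(i < n.+1) a (ka k) i * z ^+ i.
  have tT k : cabs (F_ (ka k) z - T k) <= e / 4.
    apply: le_trans (@taylor_bound _ _ 1 (hF _) _ (ha _) z r n zr r1) _; apply: le_trans hn.
    rewrite ler_wpM2l ?mM ?(ltW r0)//.
    by rewrite divr_ge0 ?mulr_ge0 ?exprn_ge0// subr_ge0 ltW.
  have cT : (T k : C^o) @[k --> \oo] --> (\sum_(i < n.+1) b i * z ^+ i : C^o).
    rewrite /T; elim: (n.+1) => [|m IH].
      by rewrite big_ord0; under eq_fun do rewrite big_ord0; exact: cvgC_cst.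
    have c1 : (a (ka k) m * z ^+ m : C^o) @[k --> \oo] --> (b m * z ^+ m : C^o).
      by apply: cvgC_mul; [exact: ab|exact: cvgC_cst].
    rewrite big_ord_recr /= (_ : (fun k => _) =
      (fun k => \sum_(i < m) a (ka k) i * z ^+ i + a (ka k) m * z ^+ m)).
      exact: cvgC_add IH c1.
    by apply/funext => k; rewrite big_ord_recr.
  set L := (X in _ --> X) in cT; move/cvg_cabsP : cT => /(_ _ e40)[J _ hJ].
  exists J => j k Jj Jk; have := hJ j Jj; have := hJ k Jk => /= k1 k2.
  have := tT j; have := tT k => k3 k4.
  have := cabs_tri (F_ (ka j) z) (T j) (F_ (ka k) z).
  have := cabs_tri (T j) (T k) (F_ (ka k) z).
  have := cabs_tri (T j) L (T k).
  rewrite (cabsC L (T k)) (cabsC (T k) (F_ (ka k) z)); lra.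
have cv' z : exists L, cabs z < 1 -> (F_ (ka k) z : C^o) @[k --> \oo] --> (L : C^o).
  by have [/cv[L hL]|_] := ltP (cabs z) 1; [exists L|exists 0].
have [F hFz] := choice cv'.
exists ka, F; split => //; apply: holo_limit hFz => // r /bF[M' hM'].
by exists M' => k z; exact: hM'.
Qed.

End Montel.

Lemma homo_leq_id (f : nat -> nat) : {homo f : m n / (m < n)%N} -> forall n, (n <= f n)%N.
Proof. by move=> hf; elim=> // n IH; apply: leq_ltn_trans IH (hf _ _ (ltnSn n)). Qed.

Lemma cvg_homo_nat (f : nat -> nat) : {homo f : m n / (m < n)%N} -> f n @[n --> \oo] --> \oo.
Proof.
move=> hf A [n _ nA]; exists n => // k nk; apply: nA => /=; apply: leq_trans nk _.
exact: homo_leq_id.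
Qed.

(** * H^1: factorization, boundary values and the mean inequality for fourth roots *)

Section HardyOne.
Context (R : realType).
Local Notation C := R[i].
Implicit Types (z w : C) (F p B q g h : C -> C) (G H : R -> C) (x y r e d M S eta : R).

Definition root4 x := Num.sqrt (Num.sqrt x).

Lemma root4_ge0 x : 0 <= root4 x.
Proof. exact: sqrtr_ge0. Qed.

Lemma root4X x : 0 <= x -> root4 x ^+ 4 = x.
Proof. by move=> x0; rewrite (exprM _ 2 2) !sqr_sqrtr ?sqrtr_ge0. Qed.

Lemma root4K x : 0 <= x -> root4 (x ^+ 4) = x.
Proof.
by move=> x0; rewrite /root4 (exprM _ 2 2) sqrtr_sqr (ger0_norm (sqr_ge0 _)) sqrtr_sqr ger0_norm.
Qed.

Lemma root4_le x y : x <= y -> root4 x <= root4 y.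
Proof. by move=> xy; do 2 apply: ler_wsqrtr. Qed.

(* If root4 x > root4 y + e then x - y >= (root4 x - root4 y) ^+ 4 > e ^+ 4. *)
Lemma root4_approx x y e : 0 <= x -> 0 <= y -> 0 < e ->
  root4 x <= root4 y + (e + `|x - y| / e ^+ 3).
Proof.
move=> x0 y0 e0; have ex := root4X x0; have ey := root4X y0.
have := root4_ge0 x; have := root4_ge0 y; move: ex ey.
set a := root4 x; set b := root4 y => ex ey b0 a0.
have e30 : 0 < e ^+ 3 by exact: exprn_gt0.
have [ab|ab] := leP a (b + e).
  by apply: le_trans ab _; rewrite lerD2l lerDl divr_ge0// ltW.
rewrite addrA -lerBlDl; apply: (@le_trans _ _ (a - b)); first by lra.
rewrite ler_pdivlMr//; apply: le_trans (ler_norm _); rewrite -ex -ey.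
set d := a - b; have -> : a = b + d by rewrite /d addrC subrK.
have d0 : e <= d by rewrite /d; lra.
have k : d * e ^+ 3 <= d * d ^+ 3.
  by rewrite ler_pM2l ?(lt_le_trans e0)// lerXn2r// nnegrE ltW// (lt_le_trans e0).
have bd : 0 <= b * d by rewrite mulr_ge0// (le_trans (ltW e0)).
have d0' : 0 <= d by rewrite (le_trans (ltW e0)).
apply: le_trans k _; rewrite -subr_ge0.
have -> : (b + d) ^+ 4 - b ^+ 4 - d * d ^+ 3 = b * d * (4 * b ^+ 2 + 6 * b * d + 4 * d ^+ 2) by ring.
by rewrite mulr_ge0// !addr_ge0// ?mulr_ge0// sqr_ge0.
Qed.

Lemma root4_meas (f : R -> R) : measurable_fun setT f -> measurable_fun setT (fun t => root4 (f t)).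
Proof.
have ms := continuous_measurable_fun (@sqrt_continuous R).
by move=> mf; exact: measurableT_comp ms (measurableT_comp ms mf).
Qed.

Lemma root4_intg (f : R -> R) : (forall t, 0 <= f t) -> intg f -> intg (fun t => root4 (f t)).
Proof.
move=> f0 hf; apply: (@intg_le _ _ (fun t => 1 + f t)).
- by apply: root4_meas; exact: intg_meas.
- move=> t; rewrite ger0_norm ?root4_ge0//.
  have := root4_approx (f0 t) (lexx 0) ltr01.
  by rewrite /root4 !sqrtr0 add0r expr1n divr1 subr0 (ger0_norm (f0 t)).
- by apply: intgD => //; exact: intg_cst.
Qed.

Lemma poisson_unit F eta z : 1 < eta -> (forall w, cabs w < eta -> cdiff F w) -> cabs z < 1 ->
  F z = cavg (fun t => (pois z t)%:C * circ F 1 t).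
Proof.
move=> e1 hF z1; have [a ha] := coefs_exist (lt_trans ltr01 e1) hF.
rewrite (@poisson_formula _ F eta hF a ha z 1)//.
by rewrite invr1 RtoC1 mulr1.
Qed.

Lemma ccts_circ1 F eta : 1 < eta -> (forall w, cabs w < eta -> cdiff F w) -> ccts (circ F 1).
Proof. by move=> e1 hF; apply: (@ccts_circ_cdiff _ _ _ eta) => //; rewrite ler01. Qed.

Lemma hardy2_eta F eta S : 1 < eta -> (forall w, cabs w < eta -> cdiff F w) ->
  mint (fun t => cabs (circ F 1 t) ^+ 2) <= S ->
  (forall r, 0 <= r -> r < 1 -> mint (fun t => cabs (circ F r t) ^+ 2) <= S) /\
  (forall z, cabs z < 1 -> cabs (F z) <= 2 / (1 - cabs z) * (1 + S)).
Proof.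
move=> e1 hF hS; have hol : holo F by move=> z z1; apply: hF; exact: lt_trans e1.
have c1 := ccts_circ1 e1 hF; have s1 := sqintg_cts c1; have i1 := ccts_cintg c1.
have [a ha] := coefs_exist (lt_trans ltr01 e1) hF.
have ha1 : coefs F 1 a.
  by move=> r n /andP[r0 r1]; apply: ha; rewrite r0 (lt_trans r1).
have fa : fourier (circ F 1) a.
  move=> n; have [|h _] := ha 1 n; first by rewrite ler01.
  by rewrite expr1n RtoC1 mulr1 in h; rewrite -h; apply: cavg_eq => t; rewrite mulrC.
split.
  move=> r r0 r1; apply: (circ_sq_le hol ha1) => // n.
  exact: le_trans (bessel n s1 fa) hS.
move=> z z1; rewrite (poisson_unit e1 hF z1).
apply: le_trans (mint_pois_cavg z1 i1) _.
have K0 : 0 <= 2 / (1 - cabs z) by rewrite divr_ge0// subr_ge0 ltW.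
apply: (@le_trans _ _ (mint (fun t => 2 / (1 - cabs z) * (1 + cabs (circ F 1 t) ^+ 2)))).
  apply: mint_le.
  - by apply: pois_intgM => //; exact: cintg_cabs.
  - by apply: intgZ; apply: intgD; [exact: intg_cst|exact: s1.2].
  - move=> t; apply: ler_pM; rewrite ?pois_ge0 ?cabs_ge0 ?pois_le//.
    by have := cabs_ge0 (circ F 1 t); nra.
rewrite mintZ; last by apply: intgD; [exact: intg_cst|exact: s1.2].
by rewrite mintD ?mint_cst ?ler_wpM2l ?lerD2l//; [exact: intg_cst|exact: s1.2].
Qed.

(** This stands in for the subharmonicity of [|p|^(1/4)]: [q] is the Poisson integral of its own
    values, so [|q|] is below the mean of [|q|], and [|q|] equals [root4 |p|] on the circle. *)
Lemma inner_quartic_root4 p eta B q z : inner_quartic p eta B q -> cabs z < 1 ->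
  root4 (cabs (p z)) <= mint (fun t => pois z t * root4 (cabs (circ p 1 t))).
Proof.
move=> [e1 d b1 b2 pE] z1; have ze : cabs z < eta by exact: lt_trans e1.
have dq w : cabs w < eta -> cdiff q w by move=> /d[].
have iq := ccts_cintg (ccts_circ1 e1 dq).
rewrite pE// cabsM cabsX.
apply: (@le_trans _ _ (cabs (q z))).
  rewrite -[leRHS]root4K ?cabs_ge0//; apply: root4_le.
  by rewrite ler_piMl ?exprn_ge0 ?cabs_ge0// b1// ltW.
rewrite (poisson_unit e1 dq z1); apply: le_trans (mint_pois_cavg z1 iq) _.
rewrite le_eqVlt; apply/orP; left; apply/eqP; apply: mint_eq => t; congr (_ * _).
have c1 : cabs (1%:C * expi t : C) = 1 by rewrite cabs_circle.
by rewrite /circ pE ?c1// cabsM b2// mul1r cabsX root4K ?cabs_ge0.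
Qed.

Lemma inner_quartic_cdiff p eta B q z : inner_quartic p eta B q -> cabs z < eta ->
  [/\ cdiff p z, cdiff (fun z => B z * q z ^+ 2) z & cdiff (fun z => q z ^+ 2) z].
Proof.
move=> [e1 d b1 b2 pE] ze; have [dB dq] := d z ze.
have d0 : 0 < eta - cabs z by rewrite subr_gt0.
split; last exact: cdiffX.
  apply: (@cdiff_near _ (fun z => B z * q z ^+ 4) _ _ _ d0); last by apply: cdiffM => //; exact: cdiffX.
  by move=> w wz; rewrite pE//; have := cabs_triB w z; lra.
by apply: cdiffM => //; exact: cdiffX.
Qed.

Lemma circ_max F r e z : holo F -> 0 <= r -> r < 1 -> (forall t, cabs (circ F r t) <= e) ->
  cabs z < 1 -> cabs (F (r%:C * z)) <= e.
Proof.
move=> hF r0 r1 Fe z1; have iF := holo_cintg hF r0 r1.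
rewrite holo_dilate//; apply: le_trans (mint_pois_cavg z1 iF) _.
by apply: mint_pois_le => //; exact: cintg_cabs.
Qed.

(** Two dilations are composed: on radius [r1] a Taylor polynomial is [e]-close to [F], and the
    factor [s] moves its zeros off the circle. The maximum principle preserves the error, and
    [m / r1 < s] keeps [r1 * s] above [r0]. *)
Lemma inner_quartic_approx F r0 e : holo F -> r0 < 1 -> 0 < e ->
  exists r p, [/\ 0 <= r, r0 < r, r < 1, exists eta B q, inner_quartic p eta B q &
    forall t, cabs (circ p 1 t - circ F r t) <= e].
Proof.
move=> hF r01 e0; have [a ha] := coefs_exist ltr01 hF.
pose m := Num.max r0 0; have m1 : m < 1 by rewrite gt_max r01 ltr01.
have [m2 m3] : r0 <= m /\ 0 <= m by rewrite !le_max !lexx orbT.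
pose r1 := (1 + m) / 2.
have r10 : 0 < r1 by rewrite /r1; lra.
have r11 : r1 < 1 by rewrite /r1; lra.
have mr : m < r1 by rewrite /r1; lra.
have [N hN] := trig_approx hF ha (ltW r10) r11 e0.
have [s0 s01 hs] := inner_quartic_poly (fun i => a i * (r1 ^+ i)%:C) N.
pose m' := Num.max s0 (Num.max (m / r1) 0).
have m'1 : m' < 1 by rewrite !gt_max s01 ltr01 ltr_pdivrMr// mul1r mr.
have [l1 l2 l3] : [/\ s0 <= m', m / r1 <= m' & 0 <= m'] by rewrite !le_max !lexx !orbT.
pose s := (1 + m') / 2.
have s1 : s < 1 by rewrite /s; lra.
have ms : m' < s by rewrite /s; lra.
have s00 : 0 < s by exact: le_lt_trans ms.
exists (r1 * s), (fun z => \sum_(i < N) a i * (r1 ^+ i)%:C * (s%:C * z) ^+ i); split.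
- by rewrite mulr_ge0// ltW.
- apply: le_lt_trans m2 _; have := le_lt_trans l2 ms.
  by rewrite ltr_pdivrMr// mulrC.
- by rewrite mulr_ilt1// ltW.
- by apply: hs => //; exact: le_lt_trans ms.
move=> t; pose D z := \sum_(i < N) a i * z ^+ i - F z.
have hD : holo D.
  move=> z z1; apply: cdiffB; last exact: hF.
  elim: (N) => [|n IH].
    apply: (@cdiff_near _ (fun=> 0) _ _ 1) => //; last exact: cdiff_cst.
    by move=> w _; rewrite big_ord0.
  apply: (@cdiff_near _ (fun w => \sum_(i < n) a i * w ^+ i + a n * w ^+ n) _ _ 1) => //.
    by move=> w _; rewrite big_ord_recr.
  apply: cdiffD => //; apply: cdiffM; [exact: cdiff_cst|apply: cdiffX; exact: cdiff_id].
have De t' : cabs (circ D r1 t') <= e.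
  rewrite /circ /D cabsC; apply: le_trans (hN N t' (leqnn _)).
  rewrite le_eqVlt; apply/orP; left; apply/eqP; congr (cabs (_ - _)).
  by apply: eq_bigr => i _; rewrite exprMn RtoCX mulrA.
have := circ_max hD (ltW r10) r11 De (z := s%:C * expi t).
rewrite cabs_circle ?(ltW s00)// => /(_ s1).
rewrite {1}/D; have <- : circ (fun z => \sum_(i < N) a i * (r1 ^+ i)%:C * (s%:C * z) ^+ i) 1 t =
   \sum_(i < N) a i * (r1%:C * (s%:C * expi t)) ^+ i.
  by apply: eq_bigr => i _; rewrite RtoC1 mul1r -mulrA RtoCX -exprMn.
by have -> : circ F (r1 * s) t = F (r1%:C * (s%:C * expi t)) by rewrite /circ RtoCM mulrA.
Qed.

Lemma hardy2_limit (g_ : nat -> C -> C) g S : (forall k, holo (g_ k)) -> holo g ->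
  (forall k r, 0 <= r -> r < 1 -> mint (fun t => cabs (circ (g_ k) r t) ^+ 2) <= S) ->
  (forall z, cabs z < 1 -> (g_ k z : C^o) @[k --> \oo] --> (g z : C^o)) ->
  forall r, 0 <= r < 1 -> mint (fun t => cabs (circ g r t) ^+ 2) <= S.
Proof.
move=> hg_ hg hS cg r /andP[r0 r1].
apply: (proj2 (@mint_fatou _ (fun k t => cabs (circ (g_ k) r t) ^+ 2) _ S _ _ _ _ _ _)).
- by move=> k; apply: (sqintg_circ (hg_ k) r0 r1).2.
- by move=> k t; exact: sqr_ge0.
- exact: intg_meas (sqintg_circ hg r0 r1).2.
- by move=> t; exact: sqr_ge0.
- by move=> k; exact: hS.
apply: aeT => t; have c := cg (r%:C * expi t); rewrite cabs_circle// in c.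
have {}c := cvg_cabs eventually_filter (c r1).
by apply: cvgM.
Qed.

(** A weighted arithmetic-geometric inequality; compared with Cauchy-Schwarz it avoids square roots
    of means. *)
Lemma mint_mul_le G H x : sqintg G -> sqintg H -> 0 < x ->
  mint (fun t => cabs (G t) * cabs (H t)) <=
  x * mint (fun t => cabs (G t) ^+ 2) + x^-1 * mint (fun t => cabs (H t) ^+ 2).
Proof.
move=> sG sH x0; rewrite -!mintZ ?sG.2 ?sH.2// -mintD; [|exact: intgZ sG.2|exact: intgZ sH.2].
apply: mint_le.
- apply: intg_prod; [exact: cmeas_cabs sG.1|exact: cmeas_cabs sH.1|exact: sG.2|exact: sH.2].
- by apply: intgD; [exact: intgZ sG.2|exact: intgZ sH.2].
move=> t; set a := cabs (G t); set b := cabs (H t).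
have a0 : 0 <= a := cabs_ge0 _; have b0 : 0 <= b := cabs_ge0 _.
have := sqr_ge0 (x * a - b); rewrite -(@ler_pM2l _ x)// => h.
have xx : x * x^-1 = 1 by rewrite mulfV// gt_eqF.
rewrite -(@ler_pM2l _ x)// mulrDr [x * (x^-1 * _)]mulrA xx mul1r.
have : 0 <= x * a * b by rewrite !mulr_ge0// ltW.
have := sqr_ge0 (x * a - b); nra.
Qed.

(* f = g h with g, h in H^2: for polynomials p = B q^4 take g = B q^2 and
   h = q^2, then pass to the limit. *)
Lemma hardy1_factor F M : holo F ->
  (forall r, 0 <= r < 1 -> mint (fun t => cabs (circ F r t)) <= M) ->
  exists g h, [/\ holo g, holo h, forall z, cabs z < 1 -> F z = g z * h z,
    forall r, 0 <= r < 1 -> mint (fun t => cabs (circ g r t) ^+ 2) <= M + 1 &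
    forall r, 0 <= r < 1 -> mint (fun t => cabs (circ h r t) ^+ 2) <= M + 1].
Proof.
move=> hF FM.
have step k : exists y : R * (C -> C) * R * (C -> C) * (C -> C),
   let: (r, p, eta, B, q) := y in
   [/\ 0 <= r < 1, 1 - k.+1%:R^-1 < r, inner_quartic p eta B q &
       forall t, cabs (circ p 1 t - circ F r t) <= k.+1%:R^-1].
  have k0 : 0 < k.+1%:R^-1 :> R by rewrite invr_gt0.
  have k1 : 1 - k.+1%:R^-1 < 1 :> R by rewrite gtrBl.
  have [r [p [h1 h2 h3 [eta [B [q h4]]] h5]]] := inner_quartic_approx hF k1 k0.
  by exists (r, p, eta, B, q); split => //; rewrite h1.
have [y hy] := choice step.
pose r_ k := (y k).1.1.1.1; pose p_ k := (y k).1.1.1.2; pose eta_ k := (y k).1.1.2.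
pose B_ k := (y k).1.2; pose q_ k := (y k).2.
have {step} {}hy k : [/\ 0 <= r_ k < 1, 1 - k.+1%:R^-1 < r_ k, inner_quartic (p_ k) (eta_ k) (B_ k) (q_ k) &
       forall t, cabs (circ (p_ k) 1 t - circ F (r_ k) t) <= k.+1%:R^-1].
  by have := hy k; rewrite /r_ /p_ /eta_ /B_ /q_; case: (y k) => [[[[]]]].
pose g_ k z := B_ k z * q_ k z ^+ 2; pose h_ k z := q_ k z ^+ 2.
have e1 k : 1 < eta_ k by have [_ _ []] := hy k.
have dp k z : cabs z < eta_ k -> cdiff (p_ k) z.
  by have [_ _ I _] := hy k => /(inner_quartic_cdiff I)[].
have dg k z : cabs z < eta_ k -> cdiff (g_ k) z.
  by have [_ _ I _] := hy k => /(inner_quartic_cdiff I)[].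
have dh k z : cabs z < eta_ k -> cdiff (h_ k) z.
  by have [_ _ I _] := hy k => /(inner_quartic_cdiff I)[].
have pM k : mint (fun t => cabs (circ (p_ k) 1 t)) <= M + 1.
  have [r01 _ _ ap] := hy k; have /andP[r0 r1] := r01.
  have iF := cintg_cabs (holo_cintg hF r0 r1).
  apply: (@le_trans _ _ (mint (fun t => cabs (circ F (r_ k) t) + 1))).
    apply: mint_le; [exact/cintg_cabs/ccts_cintg/(ccts_circ1 (e1 k))/dp| |move=> t].
      by apply: intgD => //; exact: intg_cst.
    have := cabs_triB (circ (p_ k) 1 t) (circ F (r_ k) t); have := ap t.
    have : k.+1%:R^-1 <= 1 :> R by rewrite invf_le1 ?ler1n.
    set u := k.+1%:R^-1; lra.
  by rewrite mintD ?mint_cst ?lerD2r ?FM//; exact: intg_cst.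
have sqE k t : cabs (circ (g_ k) 1 t) ^+ 2 = cabs (circ (p_ k) 1 t) /\
    cabs (circ (h_ k) 1 t) ^+ 2 = cabs (circ (p_ k) 1 t).
  have [_ _ [_ _ _ b pE] _] := hy k.
  have c1 : cabs (1%:C * expi t : C) = 1 by rewrite cabs_circle.
  rewrite /circ pE ?c1// cabsM b// mul1r cabsX; split; last by rewrite /h_ cabsX -exprM.
  by rewrite /g_ cabsM b// mul1r cabsX -exprM.
have [gk1 gk2] : (forall k r, 0 <= r -> r < 1 -> mint (fun t => cabs (circ (g_ k) r t) ^+ 2) <= M + 1) /\
    (forall k z, cabs z < 1 -> cabs (g_ k z) <= 2 / (1 - cabs z) * (1 + (M + 1))).
  have h k : mint (fun t => cabs (circ (g_ k) 1 t) ^+ 2) <= M + 1.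
    by rewrite (mint_eq (fun t => (sqE k t).1)).
  by split => k; have [] := hardy2_eta (e1 k) (dg k) (h k).
have [hk1 hk2] : (forall k r, 0 <= r -> r < 1 -> mint (fun t => cabs (circ (h_ k) r t) ^+ 2) <= M + 1) /\
    (forall k z, cabs z < 1 -> cabs (h_ k z) <= 2 / (1 - cabs z) * (1 + (M + 1))).
  have h k : mint (fun t => cabs (circ (h_ k) 1 t) ^+ 2) <= M + 1.
    by rewrite (mint_eq (fun t => (sqE k t).2)).
  by split => k; have [] := hardy2_eta (e1 k) (dh k) (h k).
have M0 : 0 <= 1 + (M + 1).
  have : 0 <= M by apply: le_trans (FM 0 _); [apply: mint_ge0 => t; exact: cabs_ge0|rewrite lexx ltr01].
  lra.
have loc (f_ : nat -> C -> C) : (forall k z, cabs z < 1 -> cabs (f_ k z) <= 2 / (1 - cabs z) * (1 + (M + 1))) ->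
   forall r, 0 <= r < 1 -> exists M', forall k z, cabs z <= r -> cabs (f_ k z) <= M'.
  move=> hf r /andP[r0 r1]; exists (2 / (1 - r) * (1 + (M + 1))) => k z zr.
  apply: le_trans (hf k z (le_lt_trans zr r1)) _; rewrite ler_wpM2r// ler_wpM2l//.
  by rewrite lef_pV2 ?posrE ?subr_gt0 ?(le_lt_trans zr)// lerD2l lerN2.
have hg_ k : holo (g_ k) by move=> z z1; apply: dg; exact: lt_trans (e1 k).
have hh_ k : holo (h_ k) by move=> z z1; apply: dh; exact: lt_trans (e1 k).
have [ka [g [homo_a hg cg]]] := montel hg_ (loc _ gk2).
(* The second extraction runs along the first, so that both factors converge along the same
   indices. *)
have [|kb [h [homo_b hh ch]]] := @montel _ (h_ \o ka) (fun k => hh_ (ka k)).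
  by apply: loc => k z; exact: hk2.
have kaa k : (k <= ka (kb k))%N by apply: leq_trans (homo_leq_id homo_b k) (homo_leq_id homo_a _).
have cg' z : cabs z < 1 -> (g_ (ka (kb k)) z : C^o) @[k --> \oo] --> (g z : C^o).
  by move=> z1 A nA; exact: cvg_homo_nat homo_b _ (cg z z1 A nA).
exists g, h; split => //.
- move=> z z1; apply/eqP; rewrite -subr_eq0 -cabs_eq0 eq_le cabs_ge0 andbT.
  apply/ler_addgt0Pr => e e0; rewrite add0r.
  have e30 : 0 < e / 3 by rewrite divr_gt0.
  have cp : (g_ (ka (kb k)) z * h_ (ka (kb k)) z : C^o) @[k --> \oo] --> (g z * h z : C^o).
    by apply: cvgC_mul; [exact: cg'|exact: ch].
  move/cvg_cabsP : cp => /(_ _ e30)[J1 _ hJ1].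
  have cz : ccont F z by apply: cdiff_cts; exact: hF.
  have [d d0 hd] := (ccontP _ _).1 cz _ e30.
  have m0 : 0 < Num.min d (e / 3) by rewrite lt_min d0.
  have [J2 _ hJ2] := near_infty_natSinv_lt (PosNum m0).
  pose j := maxn J1 J2; pose k := ka (kb j).
  have Jk : (J2 <= k)%N by exact: leq_trans (leq_maxr J1 J2) (kaa j).
  have := hJ2 k Jk => /=; rewrite lt_min => /andP[k1 k2].
  have /= k3 := hJ1 j (leq_maxl _ _); rewrite -/k in k3.
  have [r01 rk I ap] := hy k; have /andP[r0 r1] := r01.
  have pE : p_ k z = g_ k z * h_ k z.
    have [_ _ _ _ pE] := I; rewrite pE ?(lt_trans z1)//.
    by rewrite /g_ /h_; ring.
  have k4 : cabs (F ((r_ k)%:C * z) - F z) < e / 3.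
    apply: hd; rewrite -[X in _ - X]mul1r -mulrBl cabsM -RtoC1 -RtoCB cabs_real distrC ger0_norm.
      by move: k1 rk; set u := k.+1%:R^-1; have := cabs_ge0 z; nra.
    by rewrite subr_ge0 ltW.
  have k5 : cabs (p_ k z - F ((r_ k)%:C * z)) <= e / 3.
    have i1 := ccts_cintg (ccts_circ1 (e1 k) (dp k)).
    have i2 := holo_cintg hF r0 r1.
    rewrite (poisson_unit (e1 k) (dp k) z1) holo_dilate// -cavgB; [|exact: pois_cintg|exact: pois_cintg].
    rewrite (cavg_eq (G := fun t => (pois z t)%:C * (circ (p_ k) 1 t - circ F (r_ k) t))); last first.
      by move=> t; rewrite mulrBr.
    apply: le_trans (mint_pois_cavg z1 (cintgB i1 i2)) _.
    apply: mint_pois_le => //; first by apply: cintg_cabs; exact: cintgB.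
    by move=> t; apply: le_trans (ap t) _; exact: ltW.
  rewrite -pE in k3.
  have := cabs_tri (F z) (F ((r_ k)%:C * z)) (g z * h z).
  have := cabs_tri (F ((r_ k)%:C * z)) (p_ k z) (g z * h z).
  rewrite (cabsC (F z) (F ((r_ k)%:C * z))) (cabsC (F ((r_ k)%:C * z)) (p_ k z)); lra.
- by apply: (hardy2_limit _ hg _ cg') => [k|k r r0 r1]; [exact: hg_|exact: gk1].
- by apply: (hardy2_limit _ hh _ ch) => [k|k r r0 r1]; [exact: hh_|exact: hk1].
Qed.

(** Bounded L^1 means do not by themselves force convergence in the mean: for harmonic functions the
    limit may be a singular measure. The factorization does it, since the product of two sequences
    converging in L^2 converges in L^1. *)
Lemma hardy1_boundary F M : holo F ->
  (forall r, 0 <= r < 1 -> mint (fun t => cabs (circ F r t)) <= M) ->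
  [/\ cintg (bdf F), cvg1 F (bdf F) & {ae mC R, forall t, radlim F t (bdf F t)}].
Proof.
move=> hF FM; have [g [h [hg hh FE gM hM]]] := hardy1_factor hF FM.
have [a ha] := coefs_exist ltr01 hg; have [b hb] := coefs_exist ltr01 hh.
have [sG cG _ _ _] := hardy2_boundary hg ha (hardy2_coef_sum hg ha gM).
have [sH cH _ _ _] := hardy2_boundary hh hb (hardy2_coef_sum hh hb hM).
have iGH := sqintg_mul sG sH.
suff c1 : cvg1 F (fun t => bdf g t * bdf h t).
  by have [] := cvg1_boundary hF iGH c1.
move=> e e0; pose S := 1 + Num.max (M + 1) (mint (fun t => cabs (bdf g t) ^+ 2)).
have [l1 l2] : M + 1 <= S /\ mint (fun t => cabs (bdf g t) ^+ 2) <= S.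
  by split; rewrite /S -lerBlDl le_max; apply/orP; [left|right]; lra.
have S0 : 0 < S.
  rewrite /S ltr_wpDr// le_max; apply/orP; right; apply: mint_ge0 => t; exact: sqr_ge0.
(* The weight gives [x^-1 * S = e / 4]; the radii are then taken so that [x] times each squared
   distance is at most [e / 4], and four such terms occur. *)
pose x := 4 * S / e; have x0 : 0 < x by rewrite divr_gt0// mulr_gt0.
have y0 : 0 < e / 4 / x by apply: divr_gt0 x0; exact: divr_gt0.
have [d1 d10 h1] := cG _ y0; have [d2 d20 h2] := cH _ y0.
exists (Num.min d1 d2); first by rewrite lt_min d10.
move=> r r01; rewrite lt_min => /andP[rd1 rd2]; have /andP[r0 r1] := r01.
have sg := sqintg_circ hg r0 r1; have sh := sqintg_circ hh r0 r1.
have sgG := sqintgB sg sG; have shH := sqintgB sh sH.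
have k1 := mint_mul_le sgG sh x0.
have k2 := mint_mul_le shH sG x0.
have xS : x^-1 * S = e / 4 by rewrite /x; field; rewrite !gt_eqF.
have b1 : x * mint (fun t => cabs (circ g r t - bdf g t) ^+ 2) <= e / 4.
  by rewrite mulrC -ler_pdivlMr//; exact: h1.
have b2 : x * mint (fun t => cabs (circ h r t - bdf h t) ^+ 2) <= e / 4.
  by rewrite mulrC -ler_pdivlMr//; exact: h2.
have b3 : x^-1 * mint (fun t => cabs (circ h r t) ^+ 2) <= e / 4.
  by rewrite -xS ler_wpM2l ?invr_ge0 ?(ltW x0)//; apply: le_trans (hM r r01) l1.
have b4 : x^-1 * mint (fun t => cabs (bdf g t) ^+ 2) <= e / 4.
  by rewrite -xS ler_wpM2l ?invr_ge0 ?(ltW x0).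
have i1 : intg (fun t => cabs (circ g r t - bdf g t) * cabs (circ h r t)).
  by apply: intg_prod; [exact: cmeas_cabs sgG.1|exact: cmeas_cabs sh.1|exact: sgG.2|exact: sh.2].
have i2 : intg (fun t => cabs (circ h r t - bdf h t) * cabs (bdf g t)).
  by apply: intg_prod; [exact: cmeas_cabs shH.1|exact: cmeas_cabs sG.1|exact: shH.2|exact: sG.2].
apply: (@le_trans _ _ (mint (fun t => cabs (circ g r t - bdf g t) * cabs (circ h r t) +
   cabs (circ h r t - bdf h t) * cabs (bdf g t)))).
  apply: mint_le; [|exact: intgD|move=> t].
    by apply: cintg_cabs; apply: cintgB => //; exact: holo_cintg.
  rewrite -!cabsM; apply: le_trans (cabsD _ _); rewrite le_eqVlt; apply/orP; left; apply/eqP.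
  by congr (cabs _); rewrite {1}/circ FE ?cabs_circle// -/(circ g r t) -/(circ h r t); ring.
by rewrite mintD//; lra.
Qed.

Lemma hardy1_root4 F M z : holo F ->
  (forall r, 0 <= r < 1 -> mint (fun t => cabs (circ F r t)) <= M) -> cabs z < 1 ->
  root4 (cabs (F z)) <= mint (fun t => pois z t * root4 (cabs (bdf F t))).
Proof.
move=> hF FM z1; have [iB c1 _] := hardy1_boundary hF FM.
apply/ler_addgt0Pr => e e0.
have e30 : 0 < e / 3 by rewrite divr_gt0.
pose K := 2 / (1 - cabs z).
have K0 : 0 < K by rewrite divr_gt0// subr_gt0.
(* [root4_approx] is used twice with tolerance [e / 3], once at [z] and once under the kernel, which
   is at most [K]. The remaining errors total [2 * (K + 1) * y / (e / 3) ^+ 3], and [y] makes this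
   at most [e / 3]. *)
pose y := (e / 3) ^+ 4 / (3 * (K + 1)).
have y0 : 0 < y by rewrite divr_gt0 ?exprn_gt0// mulr_gt0// addr_gt0.
have yE : (3 * (K + 1)) * y / (e / 3) ^+ 3 = e / 3.
  by rewrite /y; field; rewrite !gt_eqF// addr_gt0.
have [d d0 hd] := c1 _ y0.
have cz : ccont F z by apply: cdiff_cts; exact: hF.
have [d2 d20 hd2] := (ccontP _ _).1 cz _ y0.
have r01 : 1 - Num.min d d2 < 1 by rewrite gtrBl lt_min d0.
have [r [p [r0 rd r1 [eta [B [q I]]] ap]]] := inner_quartic_approx hF r01 y0.
have [rd1 rd2] : 1 - r < d /\ 1 - r < d2.
  have [k1 k2] : Num.min d d2 <= d /\ Num.min d d2 <= d2 by rewrite !ge_min !lexx orbT.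
  lra.
have e1 : 1 < eta by have [] := I.
have dp w : cabs w < eta -> cdiff p w by move=> /(inner_quartic_cdiff I)[].
have ip := ccts_cintg (ccts_circ1 e1 dp).
have iF := holo_cintg hF r0 r1.
have k4 : cabs (F (r%:C * z) - F z) <= y.
  apply/ltW/hd2; rewrite -[X in _ - X]mul1r -mulrBl cabsM -RtoC1 -RtoCB cabs_real distrC ger0_norm.
    by have := cabs_ge0 z; nra.
  by rewrite subr_ge0 ltW.
have k5 : cabs (p z - F (r%:C * z)) <= y.
  rewrite (poisson_unit e1 dp z1) holo_dilate// -cavgB; [|exact: pois_cintg|exact: pois_cintg].
  rewrite (cavg_eq (G := fun t => (pois z t)%:C * (circ p 1 t - circ F r t))); last first.
    by move=> t; rewrite mulrBr.
  apply: le_trans (mint_pois_cavg z1 (cintgB ip iF)) _.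
  by apply: mint_pois_le => //; apply: cintg_cabs; exact: cintgB.
have k6 : cabs (F z - p z) <= 2 * y.
  have := cabs_tri (F z) (F (r%:C * z)) (p z).
  rewrite (cabsC (F z) (F (r%:C * z))) (cabsC (F (r%:C * z)) (p z)); lra.
have k7 : mint (fun t => cabs (circ p 1 t - bdf F t)) <= 2 * y.
  have i1 := cintg_cabs (cintgB iF iB).
  apply: (@le_trans _ _ (mint (fun t => y + cabs (circ F r t - bdf F t)))).
    apply: mint_le; [by apply: cintg_cabs; exact: cintgB| |move=> t].
      by apply: intgD => //; exact: intg_cst.
    apply: le_trans (cabs_tri _ (circ F r t) _) _; by rewrite lerD2r.
  have := hd r; rewrite r0 r1 => /(_ isT rd1).
  by rewrite mintD ?mint_cst//; [lra|exact: intg_cst].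
have i4 (f : R -> C) : cintg f -> intg (fun t => root4 (cabs (f t))).
  by move=> /cintg_cabs; apply: root4_intg => t; exact: cabs_ge0.
have q1 : root4 (cabs (F z)) <= root4 (cabs (p z)) + (e / 3 + 2 * y / (e / 3) ^+ 3).
  apply: le_trans (root4_approx (cabs_ge0 _) (cabs_ge0 (p z)) e30) _.
  rewrite !lerD2l ler_wpM2r ?invr_ge0 ?exprn_ge0 ?(ltW e30)//.
  exact: le_trans (cabs_dist _ _) k6.
have q2 : root4 (cabs (p z)) <= mint (fun t => pois z t * root4 (cabs (bdf F t))) +
    (e / 3 + K * ((2 * y) / (e / 3) ^+ 3)).
  apply: le_trans (inner_quartic_root4 I z1) _.
  have ij := cintg_cabs (cintgB ip iB).
  have i5 : intg (fun t => pois z t * root4 (cabs (bdf F t))) by apply: pois_intgM => //; exact: i4.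
  have i6 : intg (fun t => e / 3 * pois z t + K / (e / 3) ^+ 3 * cabs (circ p 1 t - bdf F t)).
    by apply: intgD; apply: intgZ => //; exact: pois_intg.
  apply: (@le_trans _ _ (mint (fun t => pois z t * root4 (cabs (bdf F t)) +
    (e / 3 * pois z t + K / (e / 3) ^+ 3 * cabs (circ p 1 t - bdf F t))))).
    apply: mint_le; [by apply: pois_intgM => //; exact: i4|exact: intgD|move=> t].
    have p0 := pois_ge0 t z1; have pK := pois_le t z1.
    apply: le_trans (ler_wpM2l p0 (root4_approx (cabs_ge0 _) (cabs_ge0 (bdf F t)) e30)) _.
    rewrite !mulrDr lerD2l mulrC lerD2l -mulrA [_^-1 * _]mulrC.
    apply: ler_pM => //; first by rewrite divr_ge0// exprn_ge0// ltW.
    by rewrite ler_wpM2r ?invr_ge0 ?exprn_ge0 ?(ltW e30)// cabs_dist.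
  rewrite mintD// lerD2l mintD; [|by apply: intgZ; exact: pois_intg|exact: intgZ].
  rewrite (mintZ _ (pois_intg z1)) (mintZ _ ij) (mint_pois z1) mulr1 lerD2l.
  rewrite mulrAC -mulrA ler_wpM2l ?(ltW K0)// ler_wpM2r//.
  by rewrite invr_ge0 exprn_ge0// ltW.
have q3 : 2 * y / (e / 3) ^+ 3 + K * ((2 * y) / (e / 3) ^+ 3) <= e / 3.
  rewrite -[leRHS]yE; set v := (e / 3) ^+ 3.
  have v0 : 0 < v by rewrite exprn_gt0.
  have -> : 2 * y / v + K * (2 * y / v) = 2 * (K + 1) * (y / v) by ring.
  have -> : 3 * (K + 1) * y / v = 3 * (K + 1) * (y / v) by ring.
  have yv : 0 <= y / v by rewrite divr_ge0 ?(ltW y0) ?(ltW v0).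
  by apply: ler_wpM2r => //; have := K0; lra.
lra.
Qed.

End HardyOne.

(** The inverse is replaced by [x |-> (Num.max x c)^-1], which is continuous on the whole line and
    agrees with it on the values of [A]. *)
Lemma measurable_inv_ge (R : realType) d (T : measurableType d) (A : T -> R) (c : R) : 0 < c ->
  measurable_fun setT A -> (forall p, c <= A p) -> measurable_fun setT (fun p => (A p)^-1).
Proof.
move=> c0 mA cA.
have minv : measurable_fun setT (fun x : R => (Num.max x c)^-1).
  apply: continuous_measurable_fun => x; apply: cvgV.
    by rewrite gt_eqF// lt_max c0 orbT.
  exact: (@continuous_max R R (fun y => y) (fun=> c) x cvg_id (cvg_cst _)).
have -> : (fun p => (A p)^-1) = (fun p => (Num.max (A p) c)^-1).
  by apply/funext => p; rewrite max_l.
exact: measurableT_comp minv mA.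
Qed.

(** * Poisson integrals along an analytic self-map of the disk *)

Section Subordination.
Context (R : realType).
Local Notation C := R[i].
Implicit Types (z w : C) (F Phi : C -> C) (Z : R -> C) (u : R -> R) (r e d rho t : R).

Lemma circ_sup F r : holo F -> (forall z, cabs z < 1 -> cabs (F z) < 1) -> 0 <= r < 1 ->
  exists2 rho, 0 <= rho < 1 & forall t, cabs (circ F r t) <= rho.
Proof.
move=> hF F1 /andP[r0 r1]; have cF := ccts_cabs (holo_ccts hF r0 r1).
have pi2 : 0 <= 2 * pi :> R by rewrite ltW// twopi_gt0.
have [c _ hc] := EVT_max pi2 (continuous_subspaceT cF).
exists (cabs (circ F r c)); first by rewrite cabs_ge0 F1// cabs_circle.
move=> t; have [t' /andP[t0 t1] e] := polar (expi t).
rewrite cabs_expi RtoC1 mul1r in e.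
by rewrite {1}/circ e; apply: hc; rewrite in_itv /= t0.
Qed.

Lemma pois_joint_meas Z rho : cmeas Z -> rho < 1 -> (forall s, cabs (Z s) <= rho) ->
  measurable_fun setT (fun p : R * R => pois (Z p.1) p.2).
Proof.
move=> [mZ1 mZ2] rho1 Zr; pose c := (1 - rho) ^+ 2.
have c0 : 0 < c by rewrite exprn_gt0// subr_gt0.
have m1 (f : R -> R) : measurable_fun setT f -> measurable_fun setT (fun p : R * R => f p.1).
  by move=> mf; apply: measurableT_comp => //; exact: measurable_fst.
have m2 (f : R -> R) : continuous f -> measurable_fun setT (fun p : R * R => f p.2).
  move=> cf; apply: (measurableT_comp (f := f)); last exact: measurable_snd.
  exact: continuous_measurable_fun.
pose A (p : R * R) := (cos p.2 - complex.Re (Z p.1)) ^+ 2 + (sin p.2 - complex.Im (Z p.1)) ^+ 2.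
have mA : measurable_fun setT A.
  apply: measurable_funD; apply: measurable_funX; apply: measurable_funB.
  - by apply: m2; exact: continuous_cos.
  - exact: m1 mZ1.
  - by apply: m2; exact: continuous_sin.
  - exact: m1 mZ2.
have EA p : cabs (expi p.2 - Z p.1) ^+ 2 = A p by rewrite cabs_sqr ReB ImB.
have -> : (fun p : R * R => pois (Z p.1) p.2) = (fun p =>
   (1 - (complex.Re (Z p.1) ^+ 2 + complex.Im (Z p.1) ^+ 2)) * (A p)^-1).
  by apply/funext => p; rewrite /pois -cabs_sqr EA.
apply: measurable_funM; last first.
  apply: (measurable_inv_ge c0 mA) => p; rewrite -EA.
  rewrite lerXn2r// ?nnegrE ?cabs_ge0 ?subr_ge0 ?(ltW rho1)//.
  by apply: le_trans (cabs_expiB _ _); rewrite lerD2l lerN2.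
apply: measurable_funB; first exact: measurable_cst.
by apply: measurable_funD; apply: measurable_funX; [exact: m1 mZ1|exact: m1 mZ2].
Qed.

Variable Phi : C -> C.
Hypothesis hPhi : holo Phi.
Hypothesis Phi1 : forall z, cabs z < 1 -> cabs (Phi z) < 1.

(** For fixed [t] the Poisson kernel is the real part of a holomorphic function of [z], and the mean
    value property applies after composition with [Phi]. *)
Lemma mint_pois_comp r t : 0 <= r < 1 -> mint (fun s => pois (circ Phi r s) t) = pois (Phi 0) t.
Proof.
move=> /andP[r0 r1].
pose H z := (expi t + Phi z) / (expi t - Phi z).
have hH : forall z, cabs z < 1 -> cdiff H z.
  move=> z z1; apply: cdiffM; first by apply: cdiffD; [exact: cdiff_cst|exact: hPhi].
  apply: cdiffV; last by apply: cdiffB; [exact: cdiff_cst|exact: hPhi].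
  by rewrite -cabs_gt0 cabs_expiB_gt0// Phi1.
have := @mean_value _ H 1 r hH; rewrite r0 => /(_ r1) /(congr1 (@complex.Re R)) /=.
rewrite pois_Re ?Phi1 ?cabs0// => <-; apply: mint_eq => s.
by rewrite pois_Re// Phi1// cabs_circle.
Qed.

(** Littlewood's subordination principle in the case of a Poisson integral, where it is an equality:
    exchange the means and apply [mint_pois_comp]. *)
Lemma subordination u r : 0 <= r < 1 -> intg u -> (forall t, 0 <= u t) ->
  intg (fun s => mint (fun t => pois (circ Phi r s) t * u t)) /\
  mint (fun s => mint (fun t => pois (circ Phi r s) t * u t)) = mint (fun t => pois (Phi 0) t * u t).
Proof.
move=> r01 iu u0; have [rho /andP[rho0 rho1] hrho] := circ_sup hPhi Phi1 r01.
have /andP[r0 r1] := r01.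
have mk := pois_joint_meas (ccts_meas (holo_ccts hPhi r0 r1)) rho1 hrho.
have z1 s : cabs (circ Phi r s) < 1 by exact: le_lt_trans (hrho s) rho1.
have kM s t : 0 <= pois (circ Phi r s) t <= 2 / (1 - rho).
  rewrite pois_ge0//=; apply: le_trans (pois_le t (z1 s)) _.
  by rewrite ler_wpM2l// lef_pV2 ?posrE ?subr_gt0// lerD2l lerN2.
have [_ i e] := mint_swap mk kM (intg_cst 1) iu (fun=> ler01) u0.
split; first exact: i.
rewrite (mint_eq (g := fun s => 1 * mint (fun t => pois (circ Phi r s) t * u t))); last first.
  by move=> s; rewrite mul1r.
rewrite e; apply: mint_eq => t; rewrite mulrC; congr (_ * _).
by rewrite -(mint_pois_comp t r01); apply: mint_eq => s; rewrite mulr1.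
Qed.

End Subordination.

(** * The Hardy spaces of the statement in terms of circle means *)

Section HardyMembership.
Context (R : realType).
Local Notation C := R[i].
Implicit Types (z : C) (F : C -> C) (f : disk R -> C) (r M : R).

Lemma hardyP n f : hardy n%:R f <-> holo (extend f) /\
  exists M, forall r, 0 <= r < 1 -> mint (fun t => cabs (circ (extend f) r t) ^+ n) <= M.
Proof.
have E r : holo (extend f) -> 0 <= r < 1 ->
  circle_integral (fun z => (cabs (extend f (r%:C * z)%R) `^ n%:R)%:E) =
  (mint (fun t => cabs (circ (extend f) r t) ^+ n))%:E.
  move=> hF /andP[r0 r1]; rewrite (_ : (fun z => _) = (fun z => (cabs (extend f (r%:C * z)) ^+ n)%:E)).
    rewrite circle_integralEr//; apply: intg_cts => t.
    exact: (continuous_comp (ccts_cabs (holo_ccts hF r0 r1) (x := t)) (@exprn_continuous R n _)).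
  by apply/funext => z; rewrite powR_mulrn// cabs_ge0.
rewrite /hardy /=; split=> [[/analyticP hF sup]|[hF [M hM]]]; last first.
  split; first exact/analyticP.
  apply: (@le_lt_trans _ _ M%:E); last exact: ltry.
  apply: ub_ereal_sup => _ [r r01 <-]; move: r01; rewrite /= in_itv /= => r01.
  by rewrite E// lee_fin hM.
split => //; set S := ereal_sup _ in sup.
have up r : 0 <= r < 1 -> ((mint (fun t => cabs (circ (extend f) r t) ^+ n))%:E <= S)%E.
  by move=> r01; rewrite -E//; apply: ereal_sup_ubound; exists r => //=; rewrite in_itv.
have up0 : (0 <= S)%E.
  apply: le_trans (up 0 _); last by rewrite lexx ltr01.
  by rewrite lee_fin mint_ge0// => t; rewrite exprn_ge0 ?cabs_ge0.
have Sf : S \is a fin_num by rewrite ge0_fin_numE.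
by exists (fine S) => r r01; rewrite -lee_fin (fineK Sf); exact: up.
Qed.

Lemma extend_comp (phi : disk R -> disk R) f z : cabs z < 1 ->
  extend (comp_op phi f) z = extend f (extend (fun y => val (phi y)) z).
Proof. by move=> /in_disk[w <-]; rewrite !extendE. Qed.

Lemma circ_extend_comp (phi : disk R -> disk R) f r t : 0 <= r < 1 ->
  circ (extend (comp_op phi f)) r t = extend f (circ (extend (fun y => val (phi y))) r t).
Proof. by move=> /andP[r0 r1]; rewrite /circ extend_comp// cabs_circle. Qed.

Lemma self_map_lt1 (phi : disk R -> disk R) z : cabs z < 1 ->
  cabs (extend (fun y => val (phi y)) z) < 1.
Proof. by move=> /in_disk[w <-]; rewrite extendE disk_cabs. Qed.

Lemma holo_extend_comp (phi : disk R -> disk R) f : analytic (fun y => val (phi y)) ->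
  holo (extend f) -> holo (extend (comp_op phi f)).
Proof.
move=> /analyticP hphi hf z z1; have d0 : 0 < 1 - cabs z by rewrite subr_gt0.
apply: (@cdiff_near _ (fun z => extend f (extend (fun y => val (phi y)) z)) _ _ _ d0).
  by move=> w wd; rewrite extend_comp//; have := cabs_triB w z; lra.
by apply: (cdiff_comp (hphi z z1)); apply: hf; exact: self_map_lt1.
Qed.

Lemma hardy1_le_poisson F M z : holo F ->
  (forall r, 0 <= r < 1 -> mint (fun t => cabs (circ F r t)) <= M) -> cabs z < 1 ->
  cabs (F z) <= mint (fun t => pois z t * cabs (bdf F t)).
Proof.
move=> hF FM z1; have [iB c1 _] := hardy1_boundary hF FM.
by rewrite (cvg1_poisson hF iB c1 z1); exact: mint_pois_cavg.
Qed.

End HardyMembership.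

(** * The Orlicz function on the real line and the Luxemburg norm *)

Section Orlicz.
Context (R : realType) (Psi : \bar R -> \bar R).
Hypothesis Psi_orlicz : orlicz_function Psi.
Local Notation C := R[i].
Implicit Types (x y a b t : R) (u : R -> R) (z : C).

(** Negative arguments are sent to 0, so that [psi] is nondecreasing and continuous on the whole
    line; by [psiE], [fine] discards no infinite value. *)
Definition psi y := fine (Psi (Num.max y 0)%:E).

(** Finiteness comes from strict convexity: [y] is the midpoint of [0] and [2 * y], so [Psi y] is
    strictly below some extended real. *)
Lemma psiE y : 0 <= y -> Psi y%:E = (psi y)%:E.
Proof.
move=> y0; rewrite /psi max_l// fineK// ge0_fin_numE; last first.
  by have [[p0 _ _ _ _] _] := Psi_orlicz; apply: p0; rewrite lee_fin.
have [[p0 _ _ P0 _] [_ strict _]] := Psi_orlicz.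
have [->|yn] := eqVneq y 0; first by rewrite P0 ltry.
have h : 0 < (2^-1 : R) < 1 by lra.
have := strict 2^-1 0 (2 * y) h (lexx 0); rewrite mulr0 add0r.
have -> : (1 - 2^-1) * (2 * y) = y by field.
move=> /(_ _ _)/lt_le_trans; apply; [by rewrite mulr_ge0| |exact: leey].
by move/esym/eqP; rewrite mulf_eq0 (negbTE yn) orbF pnatr_eq0.
Qed.

Lemma psi_ge0 y : 0 <= psi y.
Proof.
have [[p0 _ _ _ _] _] := Psi_orlicz.
by apply: fine_ge0; apply: p0; rewrite lee_fin le_max lexx orbT.
Qed.

Lemma psi0 : psi 0 = 0.
Proof. by have [[_ _ _ P0 _] _] := Psi_orlicz; rewrite /psi maxxx P0. Qed.

Lemma psi_max a : psi (Num.max a 0) = psi a.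
Proof. by rewrite /psi (max_l (_ : 0 <= Num.max a 0))// le_max lexx orbT. Qed.

Lemma psi_le x y : x <= y -> psi x <= psi y.
Proof.
move=> xy; have [[_ mono _ _ _] _] := Psi_orlicz.
have m0 a : 0 <= Num.max a 0 by rewrite le_max lexx orbT.
rewrite -(psi_max x) -(psi_max y) -lee_fin -!psiE//; apply: mono; rewrite lee_fin//.
by rewrite ge_max le_max xy/= le_max lexx orbT.
Qed.

Lemma psi_convex t x y : 0 <= t <= 1 -> 0 <= x -> 0 <= y ->
  psi (t * x + (1 - t) * y) <= t * psi x + (1 - t) * psi y.
Proof.
move=> t01 x0 y0; have [[_ _ cvx _ _] _] := Psi_orlicz; have /andP[t0 t1] := t01.
have h0 : 0 <= t * x + (1 - t) * y by rewrite addr_ge0 ?mulr_ge0// subr_ge0.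
have := cvx t x%:E y%:E t01; rewrite !lee_fin => /(_ x0 y0).
by rewrite -!EFinM -EFinD !psiE// -!EFinM -EFinD lee_fin.
Qed.

Lemma psi_gt0 y : 0 < y -> 0 < psi y.
Proof.
move=> y0; have [_ [_ strict _]] := Psi_orlicz.
have h : 0 < (2^-1 : R) < 1 by lra.
have n0 : 0 <> y by move=> e; move: y0; rewrite -e ltxx.
have := strict 2^-1 0 y h (lexx 0) (ltW y0) n0.
rewrite mulr0 add0r !psiE ?mulr_ge0 ?(ltW y0)//; last by lra.
rewrite psi0 -!EFinM -EFinD lte_fin; have := psi_ge0 ((1 - 2^-1) * y); lra.
Qed.

(** The quotient [psi y / y] is nondecreasing, by convexity between 0 and [y]. Unlike convexity,
    this property survives the passage to [y |-> root4 (psi (y ^+ 4))]. *)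
Lemma psi_star b y : 0 < b -> b <= y -> psi b * y <= psi y * b.
Proof.
move=> b0 yb; have y0 : 0 < y by exact: lt_le_trans yb.
have t01 : 0 <= b / y <= 1 by rewrite divr_ge0 ?(ltW b0) ?(ltW y0)//= ler_pdivrMr// mul1r.
have := psi_convex t01 (ltW y0) (lexx 0); rewrite mulr0 addr0 divfK ?gt_eqF// psi0 mulr0 addr0.
by rewrite -ler_pdivlMr// (_ : psi y * b / y = b / y * psi y)//; ring.
Qed.

(** On [[x, x + 1]] convexity bounds the increase from [x] by [psi (x + 1)] times the distance; the
    truncation at 0 is a contraction, which covers negative arguments. *)
Lemma psi_cts : continuous psi.
Proof.
have lip x y : 0 <= x -> x <= y -> y <= x + 1 -> psi y - psi x <= (y - x) * psi (x + 1).
  move=> x0 xy y1.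
  have t01 : 0 <= 1 - (y - x) <= 1 by lra.
  have := psi_convex t01 x0 (addr_ge0 x0 ler01).
  have -> : (1 - (y - x)) * x + (1 - (1 - (y - x))) * (x + 1) = y by ring.
  have := psi_ge0 x; have yx : 0 <= y - x by rewrite subr_ge0.
  have -> : 1 - (1 - (y - x)) = y - x by ring.
  nra.
have main x y : 0 <= x -> 0 <= y -> `|x - y| <= 1 -> `|psi x - psi y| <= `|x - y| * psi (x + 1).
  move=> x0 y0; have [xy|yx] := leP x y.
    rewrite distrC (ger0_norm (_ : 0 <= y - x)) ?subr_ge0// => h.
    by rewrite distrC ger0_norm ?subr_ge0 ?psi_le// lip//; lra.
  rewrite (gtr0_norm (_ : 0 < x - y)) ?subr_gt0// => h.
  rewrite ger0_norm ?subr_ge0 ?psi_le ?(ltW yx)//; apply: le_trans (lip y x y0 (ltW yx) _) _; first lra.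
  by rewrite ler_wpM2l ?subr_ge0 ?(ltW yx)// psi_le// lerD2r ltW.
have mm a b : `|Num.max a 0 - Num.max b 0| <= `|a - b|.
  have k1 := ler_norm (a - b); have k2 : b - a <= `|a - b| by rewrite distrC ler_norm.
  have k3 := normr_ge0 (a - b); rewrite ler_norml.
  by case: (leP a 0) => ha; case: (leP b 0) => hb; lra.
move=> x; apply/cvgrPdist_lt => e e0.
set K := psi (Num.max x 0 + 1).
have K0 : 0 <= K by exact: psi_ge0.
have K1 : 0 < K + 1 by lra.
have q0 : 0 < e / (K + 1) by exact: divr_gt0.
have d0 : 0 < Num.min 1 (e / (K + 1)) by rewrite lt_min ltr01.
near=> y.
have h : `|x - y| < Num.min 1 (e / (K + 1)).
  by near: y; exact: (nbhsx_ballx x _ d0).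
move: h; rewrite lt_min => /andP[h1]; rewrite ltr_pdivlMr ?ltr_wpDl// => h2.
rewrite -psi_max -(psi_max y); have h3 := mm x y.
apply: le_lt_trans (main _ _ _ _ (le_trans h3 (ltW h1))) _; rewrite ?le_max ?lexx ?orbT//.
rewrite -/K; have := normr_ge0 (x - y); nra.
Unshelve. all: by end_near. Qed.

Lemma psi_meas u : measurable_fun setT u -> measurable_fun setT (fun t => psi (u t)).
Proof. by move=> mu; apply: measurableT_comp mu; apply: continuous_measurable_fun; exact: psi_cts. Qed.

(* Jensen's inequality for the Poisson mean, up to a factor 2, for a function f
   with f y / y nondecreasing: f y >= (f b / b) (y - b). *)
Lemma poisson_star (f u : R -> R) b z : cabs z < 1 -> f 0 = 0 -> (forall y, 0 <= f y) ->
  (forall b y, 0 < b -> b <= y -> f b * y <= f y * b) -> (forall t, 0 <= u t) ->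
  intg u -> intg (fun t => f (u t)) -> 0 <= b -> 2 * b <= mint (fun t => pois z t * u t) ->
  f b <= mint (fun t => pois z t * f (u t)).
Proof.
move=> z1 f0 fp star u0 iu ifu b0 hb.
have [b00|bn] := eqVneq b 0.
  by rewrite b00 f0 mint_ge0// => t; rewrite mulr_ge0// pois_ge0.
have {b0 bn}b0 : 0 < b by rewrite lt_def bn.
rewrite -(ler_pM2l b0) -mintZ; last exact: pois_intgM.
apply: (@le_trans _ _ (f b * (mint (fun t => pois z t * u t) - b))).
  by rewrite mulrC ler_wpM2l//; lra.
have -> : f b * (mint (fun t => pois z t * u t) - b) =
    mint (fun t => f b * (pois z t * u t - b * pois z t)).
  have i1 := pois_intgM z1 iu; have i2 : intg (fun t => b * pois z t) by apply: intgZ; exact: pois_intg.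
  rewrite mintZ; last exact: intgB.
  by rewrite mintB// (mintZ _ (pois_intg z1)) mint_pois// mulr1.
have i1 := pois_intgM z1 iu; have i2 : intg (fun t => b * pois z t) by apply: intgZ; exact: pois_intg.
apply: mint_le; [by apply: intgZ; exact: intgB|by apply: intgZ; exact: pois_intgM|move=> t].
have p0 := pois_ge0 t z1.
have -> : f b * (pois z t * u t - b * pois z t) = pois z t * (f b * (u t - b)) by ring.
have -> : b * (pois z t * f (u t)) = pois z t * (b * f (u t)) by ring.
rewrite ler_wpM2l//; have [ub|ub] := leP b (u t).
  have := star b (u t) b0 ub; have := fp b; nra.
have := fp b; have := fp (u t); nra.
Qed.

Lemma orlicz_integralE (g : C -> C) c : measurable_fun setT (fun t : R => cabs (g (expi t))) -> 0 < c ->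
  orlicz_integral Psi g c = (\int[mC R]_t (psi (cabs (g (expi t)) / c))%:E)%E.
Proof.
move=> mg c0; have q0 z : 0 <= cabs (g z) / c by rewrite divr_ge0 ?cabs_ge0// ltW.
rewrite /orlicz_integral (_ : (fun z => _) = (fun z => (psi (cabs (g z) / c))%:E)); last first.
  by apply/funext => z; rewrite psiE.
rewrite circle_integralE// => [|z]; last by rewrite lee_fin psi_ge0.
apply/measurable_EFinP; apply: psi_meas; apply: measurable_funM => //.
Qed.

Lemma hardy_orliczP (f : disk R -> C) : hardy_orlicz Psi f <->
  [/\ holo (extend f),
      exists M, forall r, 0 <= r < 1 -> mint (fun t => cabs (circ (extend f) r t)) <= M &
      exists2 c, 0 < c & intg (fun t => psi (cabs (bdf (extend f) t) / c))].
Proof.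
have H1 : hardy 1 f <-> holo (extend f) /\
  exists M, forall r, 0 <= r < 1 -> mint (fun t => cabs (circ (extend f) r t)) <= M.
  exact: (hardyP 1).
rewrite /hardy_orlicz /orlicz_space /= H1.
have mq c : holo (extend f) -> measurable_fun setT (fun t => psi (cabs (bdf (extend f) t) / c)).
  move=> hF; apply: psi_meas; apply: measurable_funM; last exact: measurable_cst.
  by apply: cmeas_cabs; exact: bdf_meas.
split=> [[[hF FM] [_ [c [c0 hc]]]]|[hF FM [c c0 hc]]].
  split => //; exists c => //; apply: intg_ge0; [exact: mq|by move=> t; exact: psi_ge0|].
  by rewrite -(@orlicz_integralE (boundary f))//; by apply: cmeas_cabs; exact: bdf_meas.
split => //; split.
  have [m1 m2] := bdf_meas hF.
  by split; apply: measurable_funTS.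
exists c; split => //; rewrite orlicz_integralE//; last by apply: cmeas_cabs; exact: bdf_meas.
by rewrite mintE// ltry.
Qed.

Lemma luxemburg_le (f : disk R -> C) c : holo (extend f) -> 0 < c ->
  intg (fun t => psi (cabs (bdf (extend f) t) / c)) ->
  mint (fun t => psi (cabs (bdf (extend f) t) / c)) <= 1 ->
  (hardy_orlicz_norm Psi f <= c%:E)%E.
Proof.
move=> hF c0 ic hc; apply: ereal_inf_lbound; exists c => //; split => //.
rewrite orlicz_integralE//; last by apply: cmeas_cabs; exact: bdf_meas.
by rewrite mintE// lee_fin.
Qed.

(** The constant 2 in place of 1 leaves aside whether the infimum defining the norm is attained. *)
Lemma luxemburg_ball (f : disk R -> C) : holo (extend f) -> (hardy_orlicz_norm Psi f <= 1)%E ->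
  intg (fun t => psi (cabs (bdf (extend f) t) / 2)) /\
  mint (fun t => psi (cabs (bdf (extend f) t) / 2)) <= 1.
Proof.
move=> hF h1; have : (hardy_orlicz_norm Psi f < 2%:E)%E.
  by apply: le_lt_trans h1 _; rewrite lte_fin ltr1n.
move/ereal_inf_lt => [_ [c [c0 hc] <-]]; rewrite lte_fin => c2.
have mB := cmeas_cabs (bdf_meas hF).
rewrite orlicz_integralE// in hc.
apply: intg_lee; [by apply: psi_meas; exact: measurable_funM|by move=> t; exact: psi_ge0|].
apply: le_trans hc; apply: ge0_le_integral => //.
- by move=> t _; rewrite lee_fin psi_ge0.
- by apply/measurable_EFinP; apply: psi_meas; exact: measurable_funM.
- by apply/measurable_EFinP; apply: psi_meas; exact: measurable_funM.
- move=> t _; rewrite lee_fin psi_le// ler_wpM2l ?cabs_ge0// lef_pV2 ?posrE//.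
  exact: ltW.
Qed.

End Orlicz.

(** * The inner product of H^2 and weak compactness of its balls *)

Section HardyTwoInnerProduct.
Context (R : realType).
Local Notation C := R[i].
Local Notation ip := (@hardy2_ip R).
Implicit Types (f g h : disk R -> C) (F G : C -> C) (z : C) (c : C) (B r e S x : R).

Lemma extend_lin c f g z : extend (c *: f + g) z = c * extend f z + extend g z.
Proof.
by rewrite /extend; case: (insub z) => [w|] //=; rewrite mulr0 addr0.
Qed.

Definition h2sq f := mint (fun t => cabs (bdf (extend f) t) ^+ 2).

Lemma hardy2_facts f : hardy 2 f -> [/\ holo (extend f), sqintg (bdf (extend f)),
  {ae mC R, forall t, radlim (extend f) t (bdf (extend f) t)} & 
  forall a, coefs (extend f) 1 a -> fourier (bdf (extend f)) a].
Proof.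
move=> /(hardyP 2)[hF [M hM]]; have [a ha] := coefs_exist ltr01 hF.
have [s1 s2 s3 s4 s5] := hardy2_boundary hF ha (hardy2_coef_sum hF ha hM).
split => // b hb.
by have [] := hardy2_boundary hF hb (hardy2_coef_sum hF hb hM).
Qed.

Lemma hardy2_lin c f g : hardy 2 f -> hardy 2 g -> hardy 2 (c *: f + g).
Proof.
move=> /(hardyP 2)[hF [M hM]] /(hardyP 2)[hG [N hN]].
have E : extend (c *: f + g) = (fun z => c * extend f z + extend g z).
  by apply/funext => z; rewrite extend_lin.
apply/(hardyP 2); rewrite E; split.
  by move=> z z1; apply: cdiffD; [apply: cdiffM; [exact: cdiff_cst|exact: hF]|exact: hG].
exists (2 * (cabs c ^+ 2 * M) + 2 * N) => r r01; have /andP[r0 r1] := r01.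
have sF := sqintg_circ hF r0 r1; have sG := sqintg_circ hG r0 r1.
apply: le_trans (mint_tri_sqr (sqintgZ c sF) sG) _.
apply: lerD; last by rewrite ler_pM2l// hN.
rewrite ler_pM2l//.
rewrite (mint_eq (g := fun t => cabs c ^+ 2 * cabs (circ (extend f) r t) ^+ 2)); last first.
  by move=> t; rewrite cabsM exprMn.
by rewrite mintZ ?ler_wpM2l ?sqr_ge0 ?hM//; exact: sF.2.
Qed.

Lemma bdf_lin c f g : hardy 2 f -> hardy 2 g ->
  {ae mC R, forall t, bdf (extend (c *: f + g)) t = c * bdf (extend f) t + bdf (extend g) t}.
Proof.
move=> hf hg; have [_ _ rf _] := hardy2_facts hf; have [_ _ rg _] := hardy2_facts hg.
apply: aeS (aeI rf rg) => t [kf kg].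
apply: bd_lim => e e0.
have c0 : 0 < cabs c + 1 by rewrite ltr_wpDl// cabs_ge0.
have e1 : 0 < e / 2 / (cabs c + 1) by rewrite !divr_gt0.
have [d1 d10 h1] := kf _ e1; have [d2 d20 h2] := kg _ (divr_gt0 e0 (@ltr0Sn R 1)).
exists (Num.min d1 d2); first by rewrite lt_min d10.
move=> r r01; rewrite lt_min => /andP[rd1 rd2]; rewrite extend_lin.
set u := extend f _; set v := extend g _; set p := bdf _ t; set q := bdf _ t.
have -> : c * u + v - (c * p + q) = c * (u - p) + (v - q) by ring.
apply: le_trans (cabsD _ _) _; rewrite cabsM [leRHS]splitr; apply: lerD; last exact: h2.
have := h1 r r01 rd1; rewrite -/u -/p ler_pdivlMr// => k.
have := cabs_ge0 (u - p); nra.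
Qed.

Lemma hardy2_ipE f g : hardy 2 f -> hardy 2 g ->
  ip f g = cavg (fun t => bdf (extend f) t * (bdf (extend g) t)^*%C).
Proof.
move=> hf hg; have [_ sf _ _] := hardy2_facts hf; have [_ sg _ _] := hardy2_facts hg.
have [i1 i2] := sqintg_mul sf (sqintg_conj sg).
rewrite /hardy2_ip /circle_Cintegral.
rewrite (@circle_integralEr _ (fun z => complex.Re (boundary f z * (boundary g z)^*%C)))//.
by rewrite (@circle_integralEr _ (fun z => complex.Im (boundary f z * (boundary g z)^*%C))).
Qed.

Lemma hardy2_ip_lin c f g h : hardy 2 f -> hardy 2 g -> hardy 2 h ->
  ip (c *: f + g) h = c * ip f h + ip g h.
Proof.
move=> hf hg hh; have hfg := hardy2_lin c hf hg; rewrite !hardy2_ipE//.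
have [_ sf _ _] := hardy2_facts hf; have [_ sg _ _] := hardy2_facts hg.
have [_ sh _ _] := hardy2_facts hh; have [_ sfg _ _] := hardy2_facts hfg.
have if' := sqintg_mul sf (sqintg_conj sh); have ig' := sqintg_mul sg (sqintg_conj sh).
rewrite -cavgZ// -cavgD//; last exact: cintgZ.
apply: (proj2 (cavg_ae _ _ _)).
- by apply: cmeasM; [exact: sfg.1|exact: cmeas_conj sh.1].
- by apply: cintgD => //; exact: cintgZ.
- by apply: aeS (bdf_lin c hf hg) => t ->; rewrite mulrDl mulrA.
Qed.

Lemma hardy2_ip_conj f g : hardy 2 f -> hardy 2 g -> ip g f = (ip f g)^*%C.
Proof.
move=> hf hg; rewrite !hardy2_ipE//.
have [_ sf _ _] := hardy2_facts hf; have [_ sg _ _] := hardy2_facts hg.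
rewrite -cavg_conj; last by apply: sqintg_mul => //; exact: sqintg_conj.
by apply: cavg_eq => t; rewrite conjM conjcK mulrC.
Qed.

Lemma hardy2_ip_sq f : hardy 2 f -> ip f f = (h2sq f)%:C.
Proof.
move=> hf; rewrite hardy2_ipE// -cavg_real; apply: cavg_eq => t; exact: mul_conj.
Qed.

Lemma hardy2_circ_le f r : hardy 2 f -> 0 <= r -> r < 1 ->
  mint (fun t => cabs (circ (extend f) r t) ^+ 2) <= h2sq f.
Proof.
move=> hf r0 r1; have [hF sf _ fa] := hardy2_facts hf.
have [a ha] := coefs_exist ltr01 hF.
by apply: (circ_sq_le hF ha) => // n; apply: bessel => //; exact: fa.
Qed.

Lemma hardy2_sq_le f S : hardy 2 f ->
  (forall r, 0 <= r < 1 -> mint (fun t => cabs (circ (extend f) r t) ^+ 2) <= S) -> h2sq f <= S.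
Proof.
move=> hf hS; have [hF sf rf _] := hardy2_facts hf.
have r01 n : 0 <= (1 - n.+1%:R^-1 : R) < 1.
  by rewrite subr_ge0 invf_le1 ?ler1n//= gtrBl invr_gt0.
apply: (proj2 (@mint_fatou _ (fun n t => cabs (circ (extend f) (1 - n.+1%:R^-1) t) ^+ 2) _ S _ _ _ _ _ _)).
- by move=> n; have /andP[r0 r1] := r01 n; exact: (sqintg_circ hF r0 r1).2.
- by move=> n t; exact: sqr_ge0.
- exact: intg_meas sf.2.
- by move=> t; exact: sqr_ge0.
- by move=> n; exact: hS.
apply: aeS rf => t /radlim_seq h; have {}h := cvg_cabs eventually_filter h.
by apply: cvgM.
Qed.

Lemma hardy2_local_bound f z : hardy 2 f -> cabs z < 1 ->
  cabs (extend f z) <= 2 / (1 - cabs z) * (1 + h2sq f).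
Proof.
move=> hf z1; have [hF sf _ fa] := hardy2_facts hf.
have := hf => /(hardyP 2)[_ [M hM]]; have [a ha] := coefs_exist ltr01 hF.
have [_ _ c1 _ _] := hardy2_boundary hF ha (hardy2_coef_sum hF ha hM).
have iF := sqintg_cintg sf.
rewrite (cvg1_poisson hF iF c1 z1); apply: le_trans (mint_pois_cavg z1 iF) _.
apply: (@le_trans _ _ (mint (fun t => 2 / (1 - cabs z) * (1 + cabs (bdf (extend f) t) ^+ 2)))).
  apply: mint_le.
  - by apply: pois_intgM => //; exact: cintg_cabs.
  - by apply: intgZ; apply: intgD; [exact: intg_cst|exact: sf.2].
  - move=> t; apply: ler_pM; rewrite ?pois_ge0 ?cabs_ge0 ?pois_le//.
    by have := cabs_ge0 (bdf (extend f) t); nra.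
rewrite mintZ; last by apply: intgD; [exact: intg_cst|exact: sf.2].
by rewrite mintD ?mint_cst//; [exact: intg_cst|exact: sf.2].
Qed.

Lemma extend_restrict F : (forall z, cabs z < 1 -> extend (fun w : disk R => F (val w)) z = F z).
Proof. by move=> z /in_disk[w <-]; rewrite extendE. Qed.

Lemma holo_eq F G : (forall z, cabs z < 1 -> F z = G z) -> holo F -> holo G.
Proof.
move=> FG hF z z1; have d0 : 0 < 1 - cabs z by rewrite subr_gt0.
apply: (cdiff_near d0 _ (hF z z1)) => w wd; apply: FG.
by have := cabs_triB w z; lra.
Qed.

Lemma coefs_limit (F_ : nat -> C -> C) F (a_ : nat -> nat -> C) a n :
  (forall k, holo (F_ k)) -> holo F ->
  (forall r, 0 <= r < 1 -> exists M, forall k z, cabs z <= r -> cabs (F_ k z) <= M) ->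
  (forall z, cabs z < 1 -> (F_ k z : C^o) @[k --> \oo] --> (F z : C^o)) ->
  (forall k, coefs (F_ k) 1 (a_ k)) -> coefs F 1 a -> (a_ k n : C^o) @[k --> \oo] --> (a n : C^o).
Proof.
move=> hF_ hF bF cF ha_ ha; pose r : R := 2^-1.
have r01 : 0 <= r < 1 by rewrite /r; lra.
have /andP[r0 r1] := r01; have [M hM] := bF r r01.
have [_ l] : cintg (fun t => circ F r t * (expi t)^*%C ^+ n) /\
   (cavg (fun t => circ (F_ k) r t * (expi t)^*%C ^+ n) : C^o) @[k --> \oo] -->
   (cavg (fun t => circ F r t * (expi t)^*%C ^+ n) : C^o).
  apply: (@cavg_dct _ _ _ M).
  - move=> k; apply: cmeasM; first exact: ccts_meas (holo_ccts (hF_ k) r0 r1).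
    rewrite (_ : (fun t => _) = (fun t => (expi t ^+ n)^*%C)); last by apply/funext => t; rewrite conjX.
    by apply: cmeas_conj; apply: ccts_meas; exact: ccts_expiX.
  - move=> k t; rewrite cabsM cabsX cabs_conj cabs_expi expr1n mulr1.
    by apply: hM; rewrite cabs_circle.
  - move=> t; apply: cvgC_mul; last exact: cvgC_cst.
    by apply: cF; rewrite cabs_circle.
have rn : (r ^+ n)%:C != 0 :> C.
  by rewrite -cabs_gt0 cabs_nneg ?exprn_ge0// exprn_gt0// /r invr_gt0.
have E k : cavg (fun t => circ (F_ k) r t * (expi t)^*%C ^+ n) = a_ k n * (r ^+ n)%:C.
  by have [] := ha_ k r n r01.
have E' : cavg (fun t => circ F r t * (expi t)^*%C ^+ n) = a n * (r ^+ n)%:C.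
  by have [] := ha r n r01.
have lc : ((r ^+ n)%:C^-1 : C^o) @[k --> \oo] --> ((r ^+ n)%:C^-1 : C^o) by exact: cvgC_cst.
have l2 := cvgC_mul eventually_filter l lc.
have -> : a n = cavg (fun t => circ F r t * (expi t)^*%C ^+ n) * (r ^+ n)%:C^-1 by rewrite E' mulfK.
have -> : (fun k => a_ k n) = (fun k => cavg (fun t => circ (F_ k) r t * (expi t)^*%C ^+ n) * (r ^+ n)%:C^-1).
  by apply/funext => k; rewrite E mulfK.
exact: l2.
Qed.

Lemma hardy2_ip_approx f g (a b : nat -> C) n x : hardy 2 f -> hardy 2 g ->
  coefs (extend f) 1 a -> coefs (extend g) 1 b -> 0 < x ->
  cabs (ip f g - \sum_(i < n) (b i)^*%C * a i) <=
  x * h2sq f + x^-1 * (h2sq g - \sum_(i < n) cabs (b i) ^+ 2).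
Proof.
move=> hf hg ha hb x0; have [_ sf _ fa] := hardy2_facts hf; have [_ sg _ fb] := hardy2_facts hg.
have sT : sqintg (trig b n) by apply: sqintg_cts; exact: ccts_trig.
have if' := sqintg_cintg sf.
rewrite hardy2_ipE// -(cavg_trig_conj_fourier b n if' (fa a ha)) -cavgB; last 2 first.
- by apply: sqintg_mul => //; exact: sqintg_conj.
- by apply: sqintg_mul => //; exact: sqintg_conj.
rewrite (cavg_eq (G := fun t => bdf (extend f) t * (bdf (extend g) t - trig b n t)^*%C)); last first.
  by move=> t; rewrite conjB mulrBr [in RHS](mulrC (bdf _ _) (trig _ _ _)^*%C).
have sgT := sqintgB sg sT.
apply: le_trans (cabs_cavg (sqintg_mul sf (sqintg_conj sgT))) _.
rewrite -(parseval n sg (fb b hb)); apply: le_trans (mint_mul_le sf sgT x0).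
rewrite le_eqVlt; apply/orP; left; apply/eqP; apply: mint_eq => t.
by rewrite cabsM cabs_conj.
Qed.

Lemma hardy2_parseval_tail g (b : nat -> C) e : hardy 2 g -> coefs (extend g) 1 b -> 0 < e ->
  exists N, h2sq g - \sum_(i < N) cabs (b i) ^+ 2 <= e.
Proof.
move=> hg hb e0; have [hG sg _ fb] := hardy2_facts hg.
have sS : sqsum b (h2sq g) by move=> n; apply: bessel => //; exact: fb.
have [N hN] := sqsum_tail sS e0; exists N; rewrite lerBlDl.
apply: (hardy2_sq_le hg) => r /andP[r0 r1]; apply: (circ_sq_le hG hb) => // n.
have [Nn|nN] := leqP N n; first exact: hN.
apply: le_trans (_ : \sum_(i < N) cabs (b i) ^+ 2 <= _); last by rewrite lerDl ltW.
rewrite -!(big_mkord xpredT (fun i => cabs (b i) ^+ 2)) (big_cat_nat (leq0n n) (ltnW nN))//= lerDl.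
by apply: sumr_ge0 => i _; exact: sqr_ge0.
Qed.

(** Montel's theorem supplies the limit. Against a fixed [g] only finitely many coefficients matter
    up to a small error, by [hardy2_parseval_tail], and each coefficient converges by
    [coefs_limit]. *)
Lemma hardy2_weak_compact (f_ : nat -> disk R -> C) B : (forall k, hardy 2 (f_ k)) ->
  (forall k, h2sq (f_ k) <= B) -> exists (ka : nat -> nat) f, [/\ {homo ka : m n / (m < n)%N},
   hardy 2 f & forall g, hardy 2 g -> (ip (f_ (ka k)) g : C^o) @[k --> \oo] --> (ip f g : C^o)].
Proof.
move=> hf_ hB; pose F_ k := extend (f_ k).
have hF_ k : holo (F_ k) by have [] := hardy2_facts (hf_ k).
have B0 : 0 <= B by apply: le_trans (hB 0%N); apply: mint_ge0 => t; exact: sqr_ge0.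
have loc r : 0 <= r < 1 -> exists M', forall k z, cabs z <= r -> cabs (F_ k z) <= M'.
  move=> /andP[r0 r1]; exists (2 / (1 - r) * (1 + B)) => k z zr.
  apply: le_trans (hardy2_local_bound (hf_ k) (le_lt_trans zr r1)) _.
  have z1 := le_lt_trans zr r1.
  apply: ler_pM; rewrite ?lerD2l ?hB// ?divr_ge0 ?subr_ge0 ?(ltW z1)//.
    by rewrite addr_ge0// mint_ge0// => t; exact: sqr_ge0.
  by rewrite ler_pM2l// lef_pV2 ?posrE ?subr_gt0// lerD2l lerN2.
have [ka [F [homo_ka hF cF]]] := montel hF_ loc.
pose f (w : disk R) := F (val w).
have fF z : cabs z < 1 -> extend f z = F z by exact: extend_restrict.
have hef : holo (extend f) by apply: holo_eq hF => z z1; rewrite fF.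
have hf : hardy 2 f.
  apply/(hardyP 2); split => //; exists B => r r01.
  apply: (@hardy2_limit _ (fun k => F_ (ka k)) _ B _ hef _ _ r r01) => [k|k s s0 s1|z z1]; first exact: hF_.
    by apply: le_trans (hB (ka k)); exact: hardy2_circ_le.
  by rewrite fF//; exact: cF.
exists ka, f; split => // g hg.
have [a_ ha_] := choice (fun k => coefs_exist ltr01 (hF_ k)).
have [a ha] := coefs_exist ltr01 hef; have [hG _ _ _] := hardy2_facts hg.
have [b hb] := coefs_exist ltr01 hG.
have ca n : (a_ (ka k) n : C^o) @[k --> \oo] --> (a n : C^o).
  apply: (@coefs_limit (fun k => F_ (ka k)) (extend f) (fun k => a_ (ka k))) => [k||r /loc[M hM]|z z1|k|].
  - exact: hF_.
  - exact: hef.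
  - by exists M => k z; exact: hM.
  - by rewrite fF//; exact: cF.
  - exact: ha_.
  - exact: ha.
apply/cvg_cabsP => e e0.
have f0 : 0 <= h2sq f by apply: mint_ge0 => t; exact: sqr_ge0.
have [B' [B'0 BB' fB']] : exists B', [/\ 0 < B', B <= B' & h2sq f <= B'].
  by exists (B + h2sq f + 1); rewrite ltr_wpDl ?addr_ge0// -!addrA lerDl addr_ge0// addrCA lerDl addr_ge0.
have [x x0 xB] : exists2 x, 0 < x & x * B' = e / 8.
  by exists (e / 8 / B'); [exact/divr_gt0/B'0/divr_gt0|rewrite divfK// gt_eqF].
have xe : 0 < x * (e / 8) by rewrite mulr_gt0// divr_gt0.
have [N hN] := hardy2_parseval_tail hg hb xe.
have t1 : x^-1 * (h2sq g - \sum_(i < N) cabs (b i) ^+ 2) <= e / 8.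
  by rewrite mulrC ler_pdivrMr// mulrC.
have t3 u : u <= B' -> x * u <= e / 8 by move=> uB; rewrite -xB ler_wpM2l// ltW.
have e48 : e / 4 = e / 8 + e / 8 by field.
have cT : (\sum_(i < N) (b i)^*%C * a_ (ka k) i : C^o) @[k --> \oo] --> (\sum_(i < N) (b i)^*%C * a i : C^o).
  elim: (N) => [|m IH].
    by rewrite big_ord0; under eq_fun do rewrite big_ord0; exact: cvgC_cst.
  have c1 : ((b m)^*%C * a_ (ka k) m : C^o) @[k --> \oo] --> ((b m)^*%C * a m : C^o).
    by apply: cvgC_mul; [exact: cvgC_cst|exact: ca].
  rewrite big_ord_recr /= (_ : (fun k => _) =
    (fun k => \sum_(i < m) (b i)^*%C * a_ (ka k) i + (b m)^*%C * a_ (ka k) m)).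
    exact: cvgC_add IH c1.
  by apply/funext => k; rewrite big_ord_recr.
have e40 : 0 < e / 4 by rewrite divr_gt0.
set L := (X in _ --> X) in cT; move/cvg_cabsP : cT => /(_ _ e40) h.
near=> k; have /= k1 : cabs (\sum_(i < N) (b i)^*%C * a_ (ka k) i - L) < e / 4 by near: k.
have k2 := hardy2_ip_approx N (hf_ (ka k)) hg (ha_ (ka k)) hb x0.
have k3 := hardy2_ip_approx N hf hg ha hb x0; rewrite -/L in k3.
set Lk := \sum_(i < N) _ in k1 k2.
have k4 := le_trans k2 (lerD (t3 _ (le_trans (hB (ka k)) BB')) t1).
have k5 : cabs (ip f g - L) <= e / 8 + e / 8.
  exact: le_trans k3 (lerD (t3 _ fB') t1).
have h1 := cabs_tri (ip (f_ (ka k)) g) Lk (ip f g); have h2 := cabs_tri Lk L (ip f g).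
apply: le_lt_trans h1 _; apply: le_lt_trans (lerD k4 h2) _.
apply: (@lt_le_trans _ _ (e / 8 + e / 8 + (e / 4 + (e / 8 + e / 8)))).
  by rewrite ltrD2l; apply: ltr_leD => //; rewrite (cabsC L (ip f g)).
by clear -e0 e48; lra.
Unshelve. all: by end_near. Qed.

End HardyTwoInnerProduct.

(** * Almost orthogonal systems and singular numbers in an abstract inner product space *)

Section SingularNumbers.
Context (R : realType) (V : lmodType R[i]) (H : set V) (ip : V -> V -> R[i]) (q : V -> R).
Local Notation C := R[i].
Implicit Types (u v w x : V) (c : C).
Hypothesis Hlin : forall c u v, H u -> H v -> H (c *: u + v).
Hypothesis ip_lin : forall c u v w, H u -> H v -> H w -> ip (c *: u + v) w = c * ip u w + ip v w.
Hypothesis ip_conj : forall u v, H u -> H v -> ip v u = (ip u v)^*%C.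
Hypothesis ip_sq : forall u, H u -> ip u u = (q u)%:C.
Hypothesis q_ge0 : forall u, 0 <= q u.

Lemma sub_lin0 u : H u -> H 0.
Proof. by move=> hu; have := Hlin (-1) hu hu; rewrite scaleN1r addNr. Qed.

Lemma ip0l w : H w -> ip 0 w = 0.
Proof.
move=> hw; have := ip_lin (-1) hw hw hw; rewrite scaleN1r addNr => ->.
by rewrite mulN1r addNr.
Qed.

Lemma sub_lin_sum (e : nat -> V) (c : nat -> C) n v : H v -> (forall i, H (e i)) ->
  H (\sum_(i < n) c i *: e i).
Proof.
move=> hv he; elim: n => [|n IH]; first by rewrite big_ord0; exact: sub_lin0 hv.
by rewrite big_ord_recr /= addrC; exact: Hlin.
Qed.

Lemma lin_form_sum (L : V -> C) (e : nat -> V) (c : nat -> C) n w : H w -> (forall i, H (e i)) ->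
  (forall c u v, H u -> H v -> L (c *: u + v) = c * L u + L v) ->
  L (\sum_(i < n) c i *: e i) = \sum_(i < n) c i * L (e i).
Proof.
move=> hw he Ll; elim: n => [|n IH].
  rewrite !big_ord0; have := Ll (-1) w w hw hw; rewrite scaleN1r addNr => ->.
  by rewrite mulN1r addNr.
rewrite !big_ord_recr /= addrC Ll//; last exact: (sub_lin_sum _ _ hw).
by rewrite IH addrC.
Qed.

Lemma ip_sum (e : nat -> V) (c : nat -> C) n w : H w -> (forall i, H (e i)) ->
  ip (\sum_(i < n) c i *: e i) w = \sum_(i < n) c i * ip (e i) w.
Proof.
by move=> hw he; apply: (lin_form_sum _ _ hw he (L := ip^~ w)) => c' u v hu hv; exact: ip_lin.
Qed.

Lemma ip_sumr (e : nat -> V) (c : nat -> C) n w : H w -> (forall i, H (e i)) ->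
  ip w (\sum_(i < n) c i *: e i) = \sum_(i < n) (c i)^*%C * ip w (e i).
Proof.
move=> hw he; rewrite ip_conj ?ip_sum//; last exact: (sub_lin_sum _ _ hw).
rewrite (rmorph_sum (@conjc R)); apply: eq_bigr => i _.
by rewrite (ip_conj (he i) hw); exact: conjM.
Qed.

Lemma ip_linr c u v w : H u -> H v -> H w -> ip w (c *: u + v) = c^*%C * ip w u + ip w v.
Proof.
move=> hu hv hw; rewrite ip_conj ?ip_lin//; last exact: Hlin.
by rewrite conjD conjM -!ip_conj.
Qed.

(* 0 <= | e - lambda sum_j <e, v_j> v_j |^2 with lambda = 1 / K; the double sum
   is estimated by 2 |x_i| |x_j| <= |x_i|^2 + |x_j|^2. *)
Lemma almost_orthogonal_bessel (v : nat -> V) n e K : H e -> (forall i, H (v i)) -> 0 < K ->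
  (forall j, \sum_(i < n) cabs (ip (v i) (v j)) <= K) ->
  \sum_(j < n) cabs (ip e (v j)) ^+ 2 <= K * q e.
Proof.
move=> he hv K0 hK; pose x j := ip e (v j); set X := \sum_(j < n) _.
pose s := \sum_(i < n) x i *: v i.
have hs : H s by exact: (sub_lin_sum _ _ he).
pose y := (- K^-1)%:C *: s + e.
have hy : H y by exact: Hlin.
have X0 : 0 <= X by apply: sumr_ge0 => i _; exact: sqr_ge0.
have es : ip e s = X%:C.
  rewrite ip_sumr// (rmorph_sum (real_complex R)); apply: eq_bigr => i _.
  by rewrite mulrC mul_conj.
have se : ip s e = X%:C by rewrite (ip_conj he hs) es conjR.
have symm i j : cabs (ip (v i) (v j)) = cabs (ip (v j) (v i)).
  by rewrite (ip_conj (hv j) (hv i)) cabs_conj.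
have ss : complex.Re (ip s s) <= K * X.
  apply: le_trans (Re_le _) _; rewrite ip_sum//.
  apply: le_trans (cabs_sum _ _ _) _.
  apply: (@le_trans _ _ (\sum_(i < n) \sum_(j < n)
     (2^-1 * (cabs (x i) ^+ 2 * cabs (ip (v j) (v i))) + 2^-1 * (cabs (x j) ^+ 2 * cabs (ip (v i) (v j)))))).
    apply: ler_sum => i _; rewrite cabsM ip_sumr//.
    apply: le_trans (ler_wpM2l (cabs_ge0 _) (cabs_sum _ _ _)) _.
    rewrite mulr_sumr; apply: ler_sum => j _; rewrite cabsM cabs_conj (symm j i).
    have := sqr_ge0 (cabs (x i) - cabs (x j)); have := cabs_ge0 (ip (v i) (v j)).
    set w := cabs (ip _ _); nra.
  rewrite (eq_bigr (fun i : 'I_n => \sum_(j < n) 2^-1 * (cabs (x i) ^+ 2 * cabs (ip (v j) (v i))) +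
      \sum_(j < n) 2^-1 * (cabs (x j) ^+ 2 * cabs (ip (v i) (v j))))); last by move=> i _; rewrite big_split.
  rewrite big_split /= [X in _ + X]exchange_big /=.
  have half : \sum_(i < n) \sum_(j < n) 2^-1 * (cabs (x i) ^+ 2 * cabs (ip (v j) (v i))) <= 2^-1 * (K * X).
    rewrite /X mulr_sumr mulr_sumr; apply: ler_sum => i _.
    rewrite -mulr_sumr -mulr_sumr ler_wpM2l// [K * _]mulrC ler_wpM2l ?sqr_ge0//; exact: hK.
  have := half; lra.
have := q_ge0 y; have E : q y = complex.Re (ip y y) by rewrite ip_sq.
rewrite E /y ip_lin//.
rewrite !ip_linr// conjR se es !(ReD, ReZ) /= (ip_sq he) /=.
have kk : K^-1 * K = 1 by rewrite mulVf// gt_eqF.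
have k0 : 0 < K^-1 by rewrite invr_gt0.
set S := complex.Re (ip s s) in ss *; set k := K^-1 in kk k0 *.
have k1 : k * S <= X.
  have : k * S <= k * (K * X) by rewrite ler_wpM2l// ltW.
  by rewrite mulrA kk mul1r.
have k2 : k * (k * S) <= k * X by rewrite ler_wpM2l// ltW.
move=> h; have h2 : k * X <= q e by lra.
have : K * (k * X) <= K * q e by rewrite ler_wpM2l// ltW.
by rewrite mulrA [K * k]mulrC kk mul1r.
Qed.

Hypothesis weak_compact : forall (x : nat -> V) (B : R), (forall k, H (x k)) -> (forall k, q (x k) <= B) ->
  exists (ka : nat -> nat) y, [/\ {homo ka : m n / (m < n)%N}, H y &
   forall w, H w -> (ip (x (ka k)) w : C^o) @[k --> \oo] --> (ip y w : C^o)].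

Variables (T P : V -> V) (e : nat -> V) (s : nat -> R).
Hypothesis HT : forall u, H u -> H (T u).
Hypothesis absT : is_absolute_value H ip T P.
Hypothesis He : forall n, H (e n).
Hypothesis e_on : forall m n, ip (e m) (e n) = (m == n)%:R.
Hypothesis Pe : forall n, P (e n) = (s n)%:C *: e n.
Hypothesis Pker : forall v, H v -> (forall n, ip v (e n) = 0) -> P v = 0.
Hypothesis s_ge0 : forall n, 0 <= s n.
Hypothesis s_dec : forall n, s n.+1 <= s n.

(** The system [e] is not given as a basis, so the expansion of [T^* T] has to be recovered. The
    quadratic form at [v] is its value on the first [K] eigenvectors plus a term linear in the rest
    [x K]; these rests have a weak limit orthogonal to every [e n], which [P] kills, so that term
    vanishes in the limit. *)
Lemma singular_split v M : H v ->
  q (T v) <= s 0%N ^+ 2 * (\sum_(n < M) cabs (ip v (e n)) ^+ 2) + s M ^+ 2 * q v.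
Proof.
move=> hv; have [[HP Plin] _ PP] := absT.
have h0 := sub_lin0 hv.
have P0 : P 0 = 0 by have := Plin (-1) v v hv hv; rewrite !scaleN1r !addNr.
have PZ c u : H u -> P (c *: u) = c *: P u.
  by move=> hu; rewrite -[c *: u]addr0 Plin// P0 addr0.
pose B u w := ip (P (P u)) w.
have hPP u : H u -> H (P (P u)) by move=> hu; exact/HP/HP.
have Bl c u u' w : H u -> H u' -> H w -> B (c *: u + u') w = c * B u w + B u' w.
  by move=> hu hu' hw; rewrite /B !Plin ?ip_lin//; [exact: hPP|exact: hPP|exact: HP|exact: HP].
have Bc u w : H u -> H w -> B w u = (B u w)^*%C.
  by move=> hu hw; rewrite /B !PP// ip_conj//; exact: HT.
have Be n w : H w -> B (e n) w = (s n ^+ 2)%:C * ip (e n) w.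
  move=> hw; rewrite /B Pe PZ// Pe scalerA -RtoCM -expr2.
  by rewrite -[_ *: _]addr0 ip_lin// ip0l// addr0.
pose c n := ip v (e n).
pose pr K := \sum_(i < K) c i *: e i.
have hpr K : H (pr K) by exact: (sub_lin_sum _ _ hv).
pose x K := (-1) *: pr K + v.
have hx K : H (x K) by exact: Hlin.
have vE K : v = 1 *: pr K + x K by rewrite /x scale1r scaleN1r addNKr.
have pre K n : (n < K)%N -> ip (pr K) (e n) = c n.
  move=> nK; rewrite ip_sum// (bigD1 (Ordinal nK)) //= e_on eqxx mulr1 big1 ?addr0// => i.
  by rewrite -val_eqE /= e_on => /negbTE ->; rewrite mulr0.
have xe K n : (n < K)%N -> ip (x K) (e n) = 0.
  by move=> nK; rewrite ip_lin// pre// -/(c n) mulN1r addNr.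
have prx K : ip (pr K) (x K) = 0.
  rewrite ip_sum// big1// => i _; rewrite (ip_conj (hx K) (He i)) xe//.
  by rewrite conjc0 mulr0.
have qx K : q (x K) = q v - \sum_(i < K) cabs (c i) ^+ 2.
  apply: RtoC_inj; rewrite -ip_sq// {1}/x ip_lin// prx mulr0 add0r {1}/x ip_linr//.
  rewrite ip_sq// (ip_conj (hpr K) hv) ip_sum// RtoCB (rmorph_sum (real_complex R)) addrC.
  have -> : (-1 : C)^*%C = -1 by rewrite conjN -RtoC1 conjR.
  rewrite mulN1r; congr (_ - _); rewrite (rmorph_sum (@conjc R)); apply: eq_bigr => i _.
  rewrite (ip_conj hv (He i)) -/(c i); transitivity ((c i)^*%C * ((c i)^*%C)^*%C); first exact: conjM.
  by rewrite conjcK; exact: etrans (mulrC _ _) (mul_conj _).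
have qxv K : q (x K) <= q v.
  by rewrite qx gerBl; apply: sumr_ge0 => i _; exact: sqr_ge0.
have bes K : \sum_(i < K) cabs (c i) ^+ 2 <= q v by have := q_ge0 (x K); rewrite qx subr_ge0.
have Bprl K w : H w -> B (pr K) w = \sum_(i < K) c i * ((s i ^+ 2)%:C * ip (e i) w).
  move=> hw; rewrite (lin_form_sum _ _ hv He (L := B^~ w)) => [|c' u u' hu hu']; last exact: Bl.
  by apply: eq_bigr => i _; rewrite Be.
have ex K i : (i < K)%N -> ip (e i) (x K) = 0.
  by move=> iK; rewrite (ip_conj (hx K) (He i)) xe// conjc0.
have Bprx K : B (pr K) (x K) = 0.
  by rewrite Bprl// big1// => i _; rewrite ex// !mulr0.
have Bxpr K : B (x K) (pr K) = 0 by rewrite (Bc _ _ (hpr K) (hx K)) Bprx conjc0.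
have Bprpr K : B (pr K) (pr K) = (\sum_(i < K) s i ^+ 2 * cabs (c i) ^+ 2)%:C.
  rewrite Bprl// (rmorph_sum (real_complex R)); apply: eq_bigr => i _.
  rewrite (ip_conj (hpr K) (He i)) pre//.
  transitivity ((s i ^+ 2)%:C * (c i * (c i)^*%C)); first by ring.
  by rewrite mul_conj; exact: esym (RtoCM _ _).
have Br u w w' : H u -> H w -> H w' -> B u (1 *: w + w') = B u w + B u w'.
  by move=> hu hw hw'; rewrite /B ip_linr//; [rewrite -RtoC1 conjR RtoC1 mul1r|exact: hPP].
have Bxv K : B (x K) v = B (x K) (x K) by rewrite [in LHS](vE K) Br// Bxpr add0r.
have Bvv K : B v v = (\sum_(i < K) s i ^+ 2 * cabs (c i) ^+ 2)%:C + B (x K) v.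
  by rewrite {1}(vE K) Bl// mul1r; congr (_ + _); rewrite {1}(vE K) Br// Bprpr Bprx addr0.
have [ka [y [homo_ka hy cy]]] := weak_compact hx qxv.
have ye n : ip y (e n) = 0.
  apply: (@cvg_unique _ (@norm_hausdorff _ (C^o)) ((fun k => ip (x (ka k)) (e n) : C^o) @ \oo)).
    exact: cy.
  apply/cvg_cabsP => d d0; exists n.+1 => // k nk /=.
  by rewrite xe ?subrr ?cabs0//; exact: leq_trans nk (homo_leq_id homo_ka k).
have Py : P y = 0 by exact: Pker.
have yPPv : ip y (P (P v)) = 0.
  have hPPv := hPP v hv.
  by rewrite (ip_conj hPPv hy) -/(B v y) -(Bc _ _ hv hy) /B Py P0 ip0l.
have lim : (ip (x (ka k)) (P (P v)) : C^o) @[k --> \oo] --> (0 : C^o).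
  by rewrite -yPPv; apply: cy; exact: hPP.
have sdec m n : (m <= n)%N -> s n <= s m.
  elim: n => [|n IH]; first by rewrite leqn0 => /eqP ->.
  by rewrite leq_eqVlt ltnS => /orP[/eqP ->//|/IH]; exact: le_trans (s_dec n).
have bound K : \sum_(i < K) s i ^+ 2 * cabs (c i) ^+ 2 <=
    s 0%N ^+ 2 * (\sum_(n < M) cabs (c n) ^+ 2) + s M ^+ 2 * q v.
  apply: (@le_trans _ _ (\sum_(i < maxn K M) s i ^+ 2 * cabs (c i) ^+ 2)).
    rewrite -!(big_mkord xpredT (fun i => s i ^+ 2 * cabs (c i) ^+ 2)).
    rewrite (big_cat_nat (leq0n K) (leq_maxl K M))//= lerDl.
    by apply: sumr_ge0 => i _; rewrite mulr_ge0 ?sqr_ge0.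
  rewrite -(big_mkord xpredT (fun i => s i ^+ 2 * cabs (c i) ^+ 2)).
  rewrite (big_cat_nat (leq0n M) (leq_maxr K M))//= big_mkord.
  have sq m n : (m <= n)%N -> s n ^+ 2 <= s m ^+ 2.
    by move=> mn; rewrite lerXn2r ?nnegrE ?sdec.
  apply: lerD.
    by rewrite mulr_sumr; apply: ler_sum => i _; rewrite ler_wpM2r ?sqr_ge0// sq.
  apply: (@le_trans _ _ (s M ^+ 2 * \sum_(M <= i < maxn K M) cabs (c i) ^+ 2)).
    rewrite mulr_sumr big_nat [leRHS]big_nat; apply: ler_sum => i /andP[Mi _].
    by rewrite ler_wpM2r ?sqr_ge0// sq.
  rewrite ler_wpM2l ?sqr_ge0//; apply: le_trans (bes (maxn K M)).
  rewrite -(big_mkord xpredT (fun i => cabs (c i) ^+ 2)) (big_cat_nat (leq0n M) (leq_maxr K M))//= lerDr.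
  by apply: sumr_ge0 => i _; exact: sqr_ge0.
apply/ler_addgt0Pr => d d0; move/cvg_cabsP : lim => /(_ _ d0)[N _ /(_ N (leqnn N))] /=.
rewrite subr0 => hN.
have qT : q (T v) = complex.Re (B v v) by rewrite /B PP// ip_sq//; exact: HT.
rewrite qT (Bvv (ka N)) ReD /=; apply: lerD; first exact: bound.
rewrite (Bc v _ hv (hx _)) Re_conj /B (ip_conj (hx _) (hPP v hv)) Re_conj.
exact: le_trans (Re_le _) (ltW hN).
Qed.

End SingularNumbers.

Lemma sum_ord_const (R : pzRingType) n (c : R) : \sum_(i < n) c = n%:R * c.
Proof. by rewrite sumr_const card_ord mulr_natl. Qed.

(** * From Schatten summability to a power rate for averages *)

Section SchattenDecay.
Context (R : realType).
Local Notation C := R[i].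

Lemma nat_sqrt_exists n : exists m, (m ^ 2 <= n < m.+1 ^ 2)%N.
Proof.
elim: n => [|n [m /andP[h1 h2]]]; first by exists 0%N.
have [h|h] := leqP (m.+1 ^ 2) n.+1; last by exists m; rewrite h (leq_trans h1).
by exists m.+1; rewrite h/= (leq_ltn_trans h2)// ltn_sqr.
Qed.

(** [M] is the integer part of the square root of [N + 1]: the head is then [O((N+1)^(1/2))], and
    since [s] decreases, [s M ^+ 2] is [O((N+1)^(-1/p))]. Hence [d = min (1/2, 1/p)]. *)
Lemma powR_tail_rate (s : nat -> R) (p S : R) : 0 < p -> (forall n, 0 <= s n) ->
  (forall n, s n.+1 <= s n) -> (forall n, \sum_(i < n) s i `^ p <= S) ->
  exists d B : R, [/\ 0 < d, d <= 2^-1, 0 <= B & forall N, exists M,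
    s 0%N ^+ 2 * M%:R + N.+1%:R * s M ^+ 2 <= B * (N.+1%:R * N.+1%:R `^ (- d))].
Proof.
move=> p0 s0 sdec hS.
have S0 : 0 <= S by have := hS 0%N; rewrite big_ord0.
have sle m n : (m <= n)%N -> s n <= s m.
  elim: n => [|n IH]; first by rewrite leqn0 => /eqP ->.
  by rewrite leq_eqVlt ltnS => /orP[/eqP ->//|/IH]; exact: le_trans (sdec n).
pose d := Num.min 2^-1 p^-1.
have d0 : 0 < d by rewrite lt_min !invr_gt0 p0 andbT.
have [d1 d2] : d <= 2^-1 /\ d <= p^-1 by rewrite !ge_min !lexx orbT.
exists d, (s 0%N ^+ 2 + S `^ (2 / p)).
split => //; first by rewrite addr_ge0 ?sqr_ge0 ?powR_ge0.
move=> N; have [M /andP[]] := nat_sqrt_exists N.+1.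
set x : R := N.+1%:R => h1 h2; exists M.
have x1 : 1 <= x by rewrite ler1n.
have x0 : 0 < x by exact: lt_le_trans x1.
have M1 : M%:R ^+ 2 <= x by rewrite -natrX ler_nat.
have M2 : x <= M.+1%:R ^+ 2 by rewrite -natrX ler_nat ltnW.
have xd e : d <= e -> x `^ (- e) <= x `^ (- d) by move=> de; rewrite ler_powR// lerN2.
have k1 : s 0%N ^+ 2 * M%:R <= s 0%N ^+ 2 * (x * x `^ (- d)).
  rewrite ler_wpM2l ?sqr_ge0//; apply: (@le_trans _ _ (x * x `^ (- 2^-1))); last first.
    by rewrite ler_wpM2l ?(ltW x0)// xd.
  have -> : x * x `^ (- 2^-1) = x `^ 2^-1.
    rewrite -{1}(powRr1 (ltW x0)) -powRD; last by apply/implyP => _; rewrite gt_eqF.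
    by congr (_ `^ _); field.
  have -> : M%:R = (M%:R ^+ 2) `^ 2^-1 :> R.
    by rewrite -powR_mulrn// -powRrM mulfV// powRr1.
  by apply: ge0_ler_powR; rewrite ?nnegrE ?sqr_ge0 ?(ltW x0) ?invr_ge0.
have k2 : s M ^+ 2 <= S `^ (2 / p) * x `^ (- d).
  have h3 : M.+1%:R * s M `^ p <= S.
    apply: le_trans (hS M.+1); rewrite -[M.+1 in leLHS]card_ord -sumr_const mulr_suml.
    apply: ler_sum => i _; rewrite mul1r; apply: ge0_ler_powR; rewrite ?nnegrE// ?(ltW p0)//.
    by apply: sle; rewrite -ltnS.
  have h4 : s M `^ p <= S / M.+1%:R by rewrite ler_pdivlMr ?ltr0n// mulrC.
  have -> : s M ^+ 2 = (s M `^ p) `^ (2 / p).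
    by rewrite -powRrM mulrCA mulfV ?gt_eqF// mulr1 powR_mulrn.
  apply: (@le_trans _ _ ((S / M.+1%:R) `^ (2 / p))).
    by apply: ge0_ler_powR; rewrite ?nnegrE ?powR_ge0 ?divr_ge0// ltW.
  rewrite powRM// ?invr_ge0// ler_wpM2l ?powR_ge0//.
  apply: (@le_trans _ _ (x `^ (- p^-1))); last exact: xd.
  rewrite -[_^-1](powR_inv1 (ler0n R M.+1)) -powRrM mulN1r !powRN lef_pV2 ?posrE ?powR_gt0 ?ltr0n//.
  rewrite powRrM powR_mulrn//; apply: ge0_ler_powR; rewrite ?nnegrE ?sqr_ge0 ?(ltW x0)//.
  by rewrite invr_ge0 ltW.
rewrite mulrDl; apply: lerD => //.
by rewrite [leRHS]mulrCA ler_wpM2l// ltW.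
Qed.

Local Notation H2 := (hardy 2).
Local Notation ip := (@hardy2_ip R).

(** [singular_split] is summed over [j]. Each of the [M] leading eigenvectors costs at most 4 by the
    almost orthogonal Bessel inequality, and each [v j] has squared norm at most 4. The row bound 4
    is the one that [dyadic_row_sum] provides for the kernels. *)
Lemma schatten_average (T : (disk R -> C) -> disk R -> C) (p : R) : 0 < p ->
  schatten_class H2 ip p T -> exists d B : R, [/\ 0 < d, d <= 2^-1, 0 <= B &
  forall v : nat -> disk R -> C, (forall i, H2 (v i)) ->
    (forall n j, \sum_(i < n) cabs (ip (v i) (v j)) <= 4) ->
    forall N, \sum_(j < N.+1) h2sq (T (v j)) <= B * (N.+1%:R * N.+1%:R `^ (- d))].
Proof.
move=> p0 [[[HT _] _] [s [[P [e [absT [He e_on Pe Pker [s0 sdec]]]]] sumS]]].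
have q0 (f : disk R -> C) : 0 <= h2sq f by apply: mint_ge0 => t; exact: sqr_ge0.
pose S := fine (\sum_(0 <= n <oo) (s n `^ p)%:E)%E.
have hS n : \sum_(i < n) s i `^ p <= S.
  have pos k : (0%R <= (s k `^ p)%:E)%E by rewrite lee_fin powR_ge0.
  have h := @nneseries_lim_ge R (fun n => (s n `^ p)%:E) xpredT 0 n (fun k _ _ => pos k).
  rewrite -lee_fin fineK ?ge0_fin_numE ?nneseries_ge0// -sumEFin -(big_mkord xpredT (fun i => (s i `^ p)%:E)).
  exact: h.
have [d [B [d0 d1 B0 hB]]] := powR_tail_rate p0 s0 sdec hS.
exists d, (4 * B); split => //; first by rewrite mulr_ge0.
move=> v hv vv N; have [M hM] := hB N.
have split_j j : h2sq (T (v j)) <= s 0%N ^+ 2 * (\sum_(n < M) cabs (ip (v j) (e n)) ^+ 2) + s M ^+ 2 * h2sq (v j).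
  exact: (@singular_split R _ H2 ip (@h2sq R) (@hardy2_lin R) (@hardy2_ip_lin R) (@hardy2_ip_conj R)
    (@hardy2_ip_sq R) q0 (@hardy2_weak_compact R) T P e s HT absT He e_on Pe Pker s0 sdec (v j) M (hv j)).
have q4 j : h2sq (v j) <= 4.
  apply: le_trans (vv j.+1 j); rewrite big_ord_recr /= hardy2_ip_sq// cabs_nneg// lerDr.
  by apply: sumr_ge0 => i _; exact: cabs_ge0.
have qe n : h2sq (e n) = 1.
  have := hardy2_ip_sq (He n); rewrite e_on eqxx => h; apply: RtoC_inj.
  by rewrite -h RtoC1.
have bes n : \sum_(j < N.+1) cabs (ip (v j) (e n)) ^+ 2 <= 4.
  have := almost_orthogonal_bessel (@hardy2_lin R) (@hardy2_ip_lin R) (@hardy2_ip_conj R)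
    (@hardy2_ip_sq R) q0 (He n) hv (ltr0n R 4) (vv N.+1).
  rewrite qe mulr1; apply: le_trans; apply: ler_sum => j _.
  by rewrite (hardy2_ip_conj (He n) (hv j)) cabs_conj.
apply: (@le_trans _ _ (4 * (s 0%N ^+ 2 * M%:R + N.+1%:R * s M ^+ 2))); last first.
  by rewrite -mulrA ler_wpM2l.
apply: le_trans (_ : _ <= \sum_(j < N.+1) (s 0%N ^+ 2 * (\sum_(n < M) cabs (ip (v j) (e n)) ^+ 2) +
    s M ^+ 2 * h2sq (v j))) _; first by apply: ler_sum => j _; exact: split_j.
rewrite big_split /= mulrDr; apply: lerD.
  rewrite -mulr_sumr mulrCA ler_wpM2l ?sqr_ge0// exchange_big /=.
  by rewrite -[leRHS]mulrC -sum_ord_const; apply: ler_sum => n _; exact: bes.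
rewrite -mulr_sumr mulrCA mulrC mulrA ler_wpM2r ?sqr_ge0//.
by rewrite -sum_ord_const; apply: ler_sum => j _; exact: q4.
Qed.

End SchattenDecay.

(** * Test functions: normalized Cauchy kernels and monomials *)

Section TestFunctions.
Context (R : realType).
Local Notation C := R[i].
Local Notation H2 := (hardy 2).
Local Notation ip := (@hardy2_ip R).
Implicit Types (F G : C -> C) (z w xi : C) (eta r d e : R).

Definition restrict F (w : disk R) : C := F (val w).

Lemma cauchy_unit F eta z : 1 < eta -> (forall w, cabs w < eta -> cdiff F w) -> cabs z < 1 ->
  F z = cavg (fun t => (1 - z * (expi t)^*%C)^-1 * circ F 1 t).
Proof.
move=> e1 hF z1; pose e := (1 + eta) / 2.
have e2 : 1 < e by rewrite /e; lra.
have e3 : e < eta by rewrite /e; lra.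
have e0 : 0 < e by exact: lt_trans e2.
have en : e%:C != 0 :> C by rewrite -cabs_gt0 cabs_nneg// ltW.
pose G w := F (e%:C * w).
have hG : holo G.
  move=> w w1; apply: (@cdiff_comp _ F (fun w => e%:C * w)).
    by apply: cdiffM; [exact: cdiff_cst|exact: cdiff_id].
  apply: hF; rewrite cabsM cabs_nneg ?(ltW e0)//; apply: le_lt_trans e3.
  by rewrite ler_piMr// ltW.
have i0 : 0 <= e^-1 by rewrite invr_ge0 ltW.
have i1 : e^-1 < 1 by rewrite invf_lt1.
have -> : F z = G ((e^-1)%:C * z) by rewrite /G RtoCV mulVKf.
rewrite (cauchy_formula hG i0 i1 z1); apply: cavg_eq => t; congr (_ * _).
by rewrite /circ /G RtoCV mulVKf// RtoC1 mul1r.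
Qed.

Lemma restrict_unit F eta : 1 < eta -> (forall w, cabs w < eta -> cdiff F w) ->
  H2 (restrict F) /\ forall t, bdf (extend (restrict F)) t = circ F 1 t.
Proof.
move=> e1 hF; have eF z : cabs z < 1 -> extend (restrict F) z = F z by exact: extend_restrict.
have hol : holo F by move=> z z1; apply: hF; exact: lt_trans e1.
split.
  apply/(hardyP 2); split; first by apply: holo_eq hol => z z1; rewrite eF.
  exists (mint (fun t => cabs (circ F 1 t) ^+ 2)) => r /andP[r0 r1].
  have [h _] := hardy2_eta e1 hF (lexx _).
  rewrite (mint_eq (g := fun t => cabs (circ F r t) ^+ 2)) ?h// => t.
  by rewrite /circ eF// cabs_circle.
move=> t; apply: bd_lim => e e0.
have c1 : cabs (expi t : C) < eta by rewrite cabs_expi.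
have [d d0 hd] := (ccontP _ _).1 (cdiff_cts (hF _ c1)) _ e0.
exists d => // r /andP[r0 r1] rd; rewrite /circ RtoC1 mul1r eF ?cabs_circle//.
apply/ltW/hd; rewrite -[X in _ - X]mul1r -mulrBl cabsM cabs_expi mulr1 -RtoC1 -RtoCB cabs_real.
by rewrite distrC ger0_norm ?subr_ge0// ltW.
Qed.

(* Up to normalization, the reproducing kernel of H^2 at xi / (1 + tau). *)
Definition vtau xi (tau : R) z : C := (Num.sqrt tau)%:C / ((1 + tau)%:C - xi^*%C * z).

Lemma vtau_den xi (tau : R) z : cabs xi = 1 -> 1 + tau - cabs z <= cabs ((1 + tau)%:C - xi^*%C * z).
Proof.
move=> x1; apply: le_trans (cabs_triB _ _); rewrite cabsM cabs_conj x1 mul1r lerD2r.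
by rewrite cabs_real ler_norm.
Qed.

Lemma vtau_cdiff xi (tau : R) z : cabs xi = 1 -> cabs z < 1 + tau -> cdiff (vtau xi tau) z.
Proof.
move=> x1 z1; apply: cdiffM; first exact: cdiff_cst.
apply: cdiffV.
  by rewrite -cabs_gt0; apply: lt_le_trans (vtau_den tau z x1); rewrite subr_gt0.
by apply: cdiffB; [exact: cdiff_cst|apply: cdiffM; [exact: cdiff_cst|exact: cdiff_id]].
Qed.

(* The inner product is computed with the Cauchy formula: the conjugate of
   v_sigma is, up to a factor, the Cauchy kernel at xi / (1 + sigma). *)
Lemma vtau_ip xi (tau sigma : R) : cabs xi = 1 -> 0 < tau -> 0 < sigma ->
  cabs (ip (restrict (vtau xi tau)) (restrict (vtau xi sigma))) <=
  Num.sqrt tau * Num.sqrt sigma / (tau + sigma).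
Proof.
move=> x1 t0 s0.
have t1 : 1 < 1 + tau by rewrite ltrDl.
have s1 : 1 < 1 + sigma by rewrite ltrDl.
have s10 : 0 < 1 + sigma by exact: lt_trans s1.
have hF w : cabs w < 1 + tau -> cdiff (vtau xi tau) w by exact: vtau_cdiff.
have hG w : cabs w < 1 + sigma -> cdiff (vtau xi sigma) w by exact: vtau_cdiff.
have [hf bf] := restrict_unit t1 hF; have [hg bg] := restrict_unit s1 hG.
rewrite hardy2_ipE//.
pose z := xi * ((1 + sigma)^-1)%:C.
have z1 : cabs z < 1 by rewrite cabsM x1 mul1r cabs_nneg ?invf_lt1// invr_ge0 ltW.
have sn : (1 + sigma)%:C != 0 :> C by rewrite -cabs_gt0 cabs_nneg// ltW.
have E t : bdf (extend (restrict (vtau xi tau))) t * (bdf (extend (restrict (vtau xi sigma))) t)^*%C =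
  (Num.sqrt sigma)%:C / (1 + sigma)%:C * ((1 - z * (expi t)^*%C)^-1 * circ (vtau xi tau) 1 t).
  rewrite bf bg; set A := circ (vtau xi tau) 1 t.
  rewrite /circ /vtau RtoC1 mul1r conjM conjR conjV conjB conjR conjM conjcK.
  have n1 : 1 - z * (expi t)^*%C != 0 by exact: cauchy_den_neq0.
  have -> : (1 + sigma)%:C - xi * (expi t)^*%C = (1 + sigma)%:C * (1 - z * (expi t)^*%C).
    by rewrite /z RtoCV; move: sn; move: (1 + sigma)%:C => c sn; field.
  by rewrite invfM; ring.
have i1 := ccts_cintg (ccts_circ1 t1 hF).
rewrite (cavg_eq E) cavgZ; last exact: cauchy_cintg.
rewrite -(cauchy_unit t1 hF z1) /vtau.
have -> : (1 + tau)%:C - xi^*%C * z = ((1 + tau) - (1 + sigma)^-1)%:C.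
  rewrite /z mulrA [xi^*%C * xi]mulrC mul_conj x1 expr1n RtoC1 mul1r.
  exact: esym (RtoCB _ _).
rewrite -!RtoCV -!RtoCM cabs_nneg; last first.
  rewrite !mulr_ge0 ?invr_ge0 ?sqrtr_ge0 ?(ltW s10)// subr_ge0.
  by apply: (@le_trans _ _ 1); [rewrite invf_le1// ltW|exact: ltW].
have ts : 0 < tau + sigma by exact: addr_gt0.
have tsp : 0 < tau + sigma + tau * sigma by rewrite addr_gt0// mulr_gt0.
have -> : Num.sqrt sigma / (1 + sigma) * (Num.sqrt tau / (1 + tau - (1 + sigma)^-1)) =
   Num.sqrt tau * Num.sqrt sigma / (tau + sigma + tau * sigma).
  have n2 : (1 + tau) * (1 + sigma) - 1 != 0 by rewrite gt_eqF//; nra.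
  by field; rewrite !gt_eqF//=; nra.
by rewrite ler_wpM2l ?mulr_ge0 ?sqrtr_ge0// lef_pV2 ?posrE// lerDl mulr_ge0 ?(ltW t0) ?(ltW s0).
Qed.

Lemma sqrt_quarter j : Num.sqrt ((4 ^+ j)^-1) = (2 ^+ j)^-1 :> R.
Proof.
have -> : (4 ^+ j)^-1 = ((2 ^+ j)^-1) ^+ 2 :> R by rewrite four_expr exprVn.
by rewrite sqrtr_sqr ger0_norm// invr_ge0 exprn_ge0.
Qed.

(** Each term is at most [2^(-|i - j|)], by bounding the denominator below by its larger summand;
    two geometric series give 3. *)
Lemma dyadic_row_sum n j :
  \sum_(i < n) ((2 ^+ i)^-1 * (2 ^+ j)^-1 / ((4 ^+ i)^-1 + (4 ^+ j)^-1)) <= 4 :> R.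
Proof.
have p2 i : 0 < 2 ^+ i :> R by exact: exprn_gt0.
pose x i : R := (2 ^+ i)^-1 * (2 ^+ j)^-1 / ((4 ^+ i)^-1 + (4 ^+ j)^-1).
have xb i : x i <= 2 ^+ i / 2 ^+ j /\ x i <= 2 ^+ j / 2 ^+ i.
  rewrite /x !four_expr; set a := 2 ^+ i; set b := 2 ^+ j.
  have a0 : 0 < a := p2 i; have b0 : 0 < b := p2 j.
  have -> : a^-1 * b^-1 / ((a ^+ 2)^-1 + (b ^+ 2)^-1) = a * b / (a ^+ 2 + b ^+ 2).
    by field; rewrite !gt_eqF//= ?addr_gt0 ?exprn_gt0//; nra.
  have ab : 0 < a ^+ 2 + b ^+ 2 by rewrite addr_gt0 ?exprn_gt0.
  split; rewrite ler_pdivrMr// mulrAC ler_pdivlMr//; rewrite -subr_ge0.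
    have -> : a * (a ^+ 2 + b ^+ 2) - a * b * b = a ^+ 3 by ring.
    by rewrite exprn_ge0// ltW.
  have -> : b * (a ^+ 2 + b ^+ 2) - a * b * a = b ^+ 3 by ring.
  by rewrite exprn_ge0// ltW.
rewrite -/(x _).
have low m : (m <= j.+1)%N -> \sum_(i < m) x i <= 2 ^+ m / 2 ^+ j.
  elim: m => [|m IH] mj; first by rewrite big_ord0 divr_ge0// ltW.
  rewrite big_ord_recr /= exprS; have := IH (ltnW mj); have [h _] := xb m.
  set u := 2 ^+ m / 2 ^+ j in h *; have -> : 2 * 2 ^+ m / 2 ^+ j = 2 * u by rewrite mulrA.
  lra.
have high m : \sum_(i < j.+1 + m) x i <= 3 - 2 ^+ j.+1 / 2 ^+ (j.+1 + m).
  elim: m => [|m IH].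
    rewrite addn0; apply: le_trans (low _ (leqnn _)) _.
    by rewrite divff ?gt_eqF// exprS mulfK ?gt_eqF//; lra.
  rewrite addnS big_ord_recr /=; have [_ h] := xb (j.+1 + m)%N; move: IH h.
  have -> : 2 ^+ j.+1 / 2 ^+ (j.+1 + m).+1 = 2 ^+ j / 2 ^+ (j.+1 + m) :> R.
    by rewrite [in LHS]exprS [2 ^+ (j.+1 + m).+1]exprS invfM mulrACA mulfV ?mul1r ?pnatr_eq0.
  have -> : 2 ^+ j.+1 / 2 ^+ (j.+1 + m) = 2 * (2 ^+ j / 2 ^+ (j.+1 + m)) :> R by rewrite exprS mulrA.
  lra.
have [nj|nj] := leqP n j.+1.
  apply: le_trans (low n nj) _; rewrite ler_pdivrMr//.
  apply: (@le_trans _ _ (2 ^+ j.+1)); first by rewrite ler_eXn2l// ltr1n.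
  by rewrite exprS; apply: ler_wpM2r; [exact: ltW|rewrite ler_nat].
rewrite -(subnKC (ltnW nj)); apply: le_trans (high _) _.
have : 0 <= 2 ^+ j.+1 / 2 ^+ (j.+1 + (n - j.+1)) :> R by rewrite divr_ge0// ltW.
lra.
Qed.

Lemma monomial_ip i j : ip (restrict (fun z => z ^+ i)) (restrict (fun z => z ^+ j)) = (i == j)%:R.
Proof.
have h k w : cabs w < 2 -> cdiff (fun z : C => z ^+ k) w by move=> _; apply: cdiffX; exact: cdiff_id.
have [hf bf] := restrict_unit (ltr1n R 2) (h i); have [hg bg] := restrict_unit (ltr1n R 2) (h j).
rewrite hardy2_ipE// -(cavg_expi_conj R i j); apply: cavg_eq => t.
by rewrite bf bg /circ RtoC1 mul1r conjX.
Qed.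

End TestFunctions.

Lemma Re_inv (R : realType) (z : R[i]) : z != 0 -> complex.Re z^-1 = complex.Re z / cabs z ^+ 2.
Proof.
move=> z0; have c0 : z^*%C != 0 by rewrite -cabs_gt0 cabs_conj cabs_gt0.
have -> : z^-1 = ((cabs z ^+ 2)^-1)%:C * z^*%C by rewrite RtoCV -mul_conj invfM divfK.
by rewrite ReZ Re_conj mulrC.
Qed.

(** * Decay of the kernel means of the symbol *)

Section KernelDecay.
Context (R : realType) (phi : disk R -> disk R).
Local Notation C := R[i].
Local Notation Phi := (extend (fun y => val (phi y))).
Hypothesis phi_analytic : analytic (fun y => val (phi y)).
Implicit Types (z xi : C) (r tau : R).

Lemma holo_Phi : holo Phi.
Proof. by move=> z z1; move/analyticP : phi_analytic; exact. Qed.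

(** The mean of [|vtau xi tau|^2] along [Phi] on the circle of radius [r]. *)
Definition kmean xi r tau := mint (fun s => tau / cabs ((1 + tau)%:C - xi^*%C * circ Phi r s) ^+ 2).

Lemma den_Phi xi r tau s : cabs xi = 1 -> 0 <= r < 1 -> tau <= cabs ((1 + tau)%:C - xi^*%C * circ Phi r s).
Proof.
move=> x1 /andP[r0 r1]; apply: le_trans (vtau_den tau _ x1).
have : cabs (circ Phi r s) < 1 by apply: self_map_lt1; rewrite cabs_circle.
lra.
Qed.

Lemma cdiff_den xi tau z : cabs xi = 1 -> 0 < tau -> cabs z < 1 ->
  cdiff (fun z => ((1 + tau)%:C - xi^*%C * Phi z)^-1) z.
Proof.
move=> x1 t0 z1; apply: cdiffV.
  rewrite -cabs_gt0; apply: lt_le_trans (vtau_den tau _ x1).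
  by have := self_map_lt1 phi z1; lra.
apply: cdiffB; first exact: cdiff_cst.
by apply: cdiffM; [exact: cdiff_cst|exact: holo_Phi].
Qed.

Lemma kmean_intg xi r tau : cabs xi = 1 -> 0 < tau -> 0 <= r < 1 ->
  intg (fun s => tau / cabs ((1 + tau)%:C - xi^*%C * circ Phi r s) ^+ 2).
Proof.
move=> x1 t0 /andP[r0 r1].
have hol : holo (fun z => ((1 + tau)%:C - xi^*%C * Phi z)^-1) by move=> z; exact: cdiff_den.
have := (sqintg_circ hol r0 r1).2 => h; apply: intgZ.
by under [X in intg X]eq_fun do rewrite -exprVn -cabsV.
Qed.

(* With X = 1 - conj xi phi, Re X >= 0: tau / |X + tau|^2 =
   Re (1 / (X + tau)) - Re X / |X + tau|^2, where the mean of the first term is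
   given by the mean value property and the second is monotone in tau. *)
Lemma kmean_quasi_mono xi r tau sigma : cabs xi = 1 -> 0 < tau -> tau <= sigma -> 0 <= r < 1 ->
  kmean xi r tau <= kmean xi r sigma + sigma / (1 - cabs (Phi 0)) ^+ 2.
Proof.
move=> x1 t0 ts r01; have s0 : 0 < sigma by exact: lt_le_trans ts.
have /andP[r0 r1] := r01.
pose g u z := ((1 + u)%:C - xi^*%C * Phi z)^-1.
have hg u : 0 < u -> forall z, cabs z < 1 -> cdiff (g u) z by move=> u0 z; exact: cdiff_den.
have mv u : 0 < u -> mint (fun s => complex.Re (circ (g u) r s)) = complex.Re (g u 0).
  by move=> u0; rewrite -(@mean_value _ (g u) 1 r (hg u u0)).
have ig u : 0 < u -> intg (fun s => complex.Re (circ (g u) r s)).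
  by move=> u0; exact: (holo_cintg (hg u u0) r0 r1).1.
have c0 : 0 < 1 - cabs (Phi 0) by rewrite subr_gt0 self_map_lt1// cabs0.
have pw s : tau / cabs ((1 + tau)%:C - xi^*%C * circ Phi r s) ^+ 2 - complex.Re (circ (g tau) r s) <=
   sigma / cabs ((1 + sigma)%:C - xi^*%C * circ Phi r s) ^+ 2 - complex.Re (circ (g sigma) r s).
  rewrite /circ /g -/(circ Phi r s).
  have w1 : cabs (circ Phi r s) < 1 by apply: self_map_lt1; rewrite cabs_circle.
  set w := circ Phi r s in w1 *; pose X := 1 - xi^*%C * w.
  have X0 : 0 <= complex.Re X.
    rewrite /X ReB /= subr_ge0; apply: le_trans (Re_le _) _.
    by rewrite cabsM cabs_conj x1 mul1r ltW.
  have key u : 0 < u -> u / cabs ((1 + u)%:C - xi^*%C * w) ^+ 2 -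
      complex.Re ((1 + u)%:C - xi^*%C * w)^-1 = - (complex.Re X / ((complex.Re X + u) ^+ 2 + complex.Im X ^+ 2)).
    move=> u0.
    have YE : (1 + u)%:C - xi^*%C * w = X + u%:C by rewrite RtoCD RtoC1 /X; ring.
    have Y0 : X + u%:C != 0.
      by apply/eqP => /(congr1 (@complex.Re R)); rewrite ReD /=; lra.
    rewrite YE Re_inv//.
    have E : cabs (X + u%:C) ^+ 2 = (complex.Re X + u) ^+ 2 + complex.Im X ^+ 2.
      by rewrite cabs_sqr ReD ImD /= addr0.
    have ReY : complex.Re (X + u%:C) = complex.Re X + u by rewrite ReD.
    by rewrite E ReY; move: (complex.Re X) (complex.Im X) => a b; ring.
  rewrite !key// lerN2 ler_wpM2l// lef_pV2 ?posrE ?ltr_wpDr ?sqr_ge0 ?exprn_gt0 ?ltr_wpDl//.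
  by rewrite lerD2r lerXn2r// ?nnegrE ?addr_ge0 ?(ltW t0) ?(ltW s0)// lerD2l.
have it := kmean_intg x1 t0 r01; have is' := kmean_intg x1 s0 r01.
have := mint_le (intgB it (ig _ t0)) (intgB is' (ig _ s0)) pw.
rewrite !mintB ?ig// !mv// -/(kmean xi r tau) -/(kmean xi r sigma) => h.
have h2 : complex.Re (g tau 0) - complex.Re (g sigma 0) <= sigma / (1 - cabs (Phi 0)) ^+ 2.
  rewrite -ReB; apply: le_trans (Re_le _) _.
  have b u : 0 < u -> 1 - cabs (Phi 0) <= cabs ((1 + u)%:C - xi^*%C * Phi 0).
    by move=> u0; apply: le_trans (vtau_den u _ x1); rewrite lerD2r lerDl ltW.
  have n0 u : 0 < u -> (1 + u)%:C - xi^*%C * Phi 0 != 0.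
    by move=> u0; rewrite -cabs_gt0; exact: lt_le_trans (b u u0).
  have -> : g tau 0 - g sigma 0 = (sigma - tau)%:C *
     (((1 + tau)%:C - xi^*%C * Phi 0)^-1 * ((1 + sigma)%:C - xi^*%C * Phi 0)^-1).
    have nt := n0 _ t0; have ns := n0 _ s0.
    rewrite /g; move: nt ns; rewrite RtoCB !RtoCD; set u := tau%:C; set v := sigma%:C => nt ns.
    by field; rewrite nt ns.
  rewrite !cabsM !cabsV cabs_nneg ?subr_ge0// expr2 invfM.
  apply: ler_pM; rewrite ?subr_ge0// ?mulr_ge0 ?invr_ge0 ?cabs_ge0//; first by rewrite gerBl ltW.
  by apply: ler_pM; rewrite ?invr_ge0 ?cabs_ge0// lef_pV2 ?posrE ?b ?cabs_gt0 ?n0.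
by clear -h h2; lra.
Qed.

Hypothesis phi_schatten : exists p : R, 0 < p /\ schatten_class (hardy 2) (@hardy2_ip R) p (comp_op phi).

Lemma quarter_sum n : \sum_(j < n) (4 ^+ j)^-1 <= 2 :> R.
Proof.
apply: le_trans (dyadic_sum R n); apply: ler_sum => j _.
by rewrite lef_pV2 ?posrE ?exprn_gt0// lerXn2r ?nnegrE// ler_nat.
Qed.

(** [schatten_average] says nothing about an individual index. Comparing the small parameter [tau]
    with every [4^-j], [j <= N], by quasi-monotonicity turns the bound for the average into a bound
    at [tau], with constants independent of [xi] and [r]. *)
Lemma schatten_kernel_decay : exists d B : R, [/\ 0 < d, 0 <= B,
  (forall xi r tau N, cabs xi = 1 -> 0 <= r < 1 -> 0 < tau -> tau <= (4 ^+ N)^-1 ->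
     kmean xi r tau <= B * N.+1%:R `^ (- d)) &
  (forall r N, 0 <= r < 1 -> mint (fun s => cabs (circ Phi r s) ^+ (2 * N)) <= B * N.+1%:R `^ (- d))].
Proof.
have [p [p0 sch]] := phi_schatten; have [[[HT _] _] _] := sch.
have [d [B [d0 d1 B0 hB]]] := schatten_average p0 sch.
have c0 : 0 < 1 - cabs (Phi 0) by rewrite subr_gt0 self_map_lt1// cabs0.
pose D := 2 / (1 - cabs (Phi 0)) ^+ 2.
have D0 : 0 <= D by rewrite divr_ge0// sqr_ge0.
have n1 N : 1 <= N.+1%:R :> R by rewrite ler1n.
have np N : 0 < N.+1%:R :> R by rewrite ltr0n.
(* Since [d <= 1/2], the quantity [(N+1)^(1-d)] is at least 1, so the errors of the
   quasi-monotonicity, at most [D] in total, are absorbed at the same rate. *)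
have Nd N : 1 <= N.+1%:R * N.+1%:R `^ (- d) :> R.
  rewrite -[X in X * _](powRr1 (ltW (np N))) -powRD; last by apply/implyP => _; rewrite gt_eqF.
  by rewrite -[leLHS](powRr0 (N.+1%:R : R)) ler_powR//; lra.
exists d, (B + D); split => //; first exact: addr_ge0.
- move=> xi r tau N x1 r01 t0 tN; have /andP[r0 r1] := r01.
  pose v j := restrict (vtau xi ((4 ^+ j)^-1)).
  have q0 j : 0 < (4 ^+ j)^-1 :> R by rewrite invr_gt0 exprn_gt0.
  have e1 j : 1 < 1 + (4 ^+ j)^-1 :> R by rewrite ltrDl.
  have hv j : hardy 2 (v j).
    by have [] := restrict_unit (e1 j) (fun w => @vtau_cdiff R xi ((4 ^+ j)^-1) w x1).
  have vv n j : \sum_(i < n) cabs (hardy2_ip (v i) (v j)) <= 4.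
    apply: le_trans (dyadic_row_sum R n j); apply: ler_sum => i _.
    by apply: le_trans (vtau_ip x1 (q0 i) (q0 j)) _; rewrite !sqrt_quarter.
  have kv j : kmean xi r ((4 ^+ j)^-1) <= h2sq (comp_op phi (v j)).
    apply: le_trans (hardy2_circ_le (HT _ (hv j)) r0 r1).
    rewrite le_eqVlt; apply/orP; left; apply/eqP; apply: mint_eq => s.
    rewrite circ_extend_comp// extend_restrict; last by apply: self_map_lt1; rewrite cabs_circle.
    by rewrite cabsM cabsV exprMn exprVn cabs_nneg ?sqrtr_ge0// sqr_sqrtr// ltW.
  have kj (j : 'I_N.+1) : kmean xi r tau <= h2sq (comp_op phi (v j)) + (4 ^+ j)^-1 / (1 - cabs (Phi 0)) ^+ 2.
    apply: (@le_trans _ _ (kmean xi r ((4 ^+ j)^-1) + (4 ^+ j)^-1 / (1 - cabs (Phi 0)) ^+ 2)); last by rewrite lerD2r.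
    apply: kmean_quasi_mono => //; apply: le_trans tN _.
    rewrite lef_pV2 ?posrE ?exprn_gt0// ler_weXn2l ?ler1n//; by rewrite -ltnS.
  have h : N.+1%:R * kmean xi r tau <=
      \sum_(j < N.+1) (h2sq (comp_op phi (v j)) + (4 ^+ j)^-1 / (1 - cabs (Phi 0)) ^+ 2).
    by rewrite -sum_ord_const; apply: ler_sum => j _; exact: kj.
  rewrite big_split /= -mulr_suml in h.
  have h2 : (\sum_(i < N.+1) (4 ^+ i)^-1) / (1 - cabs (Phi 0)) ^+ 2 <= D.
    by rewrite /D ler_wpM2r ?invr_ge0 ?sqr_ge0// quarter_sum.
  rewrite -(ler_pM2l (np N)); apply: le_trans h _.
  rewrite mulrCA mulrDl; apply: lerD; first exact: hB.
  by apply: le_trans h2 _; rewrite ler_peMr.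
- move=> r N r01; have /andP[r0 r1] := r01.
  pose v j := restrict (fun z : C => z ^+ j).
  have hv j : hardy 2 (v j).
    by have [] := restrict_unit (ltr1n R 2) (fun w (_ : cabs w < 2) => cdiffX j (cdiff_id w)).
  have vv n j : \sum_(i < n) cabs (hardy2_ip (v i) (v j)) <= 4.
    have [jn|nj] := ltnP j n; last first.
      rewrite big1// => i _; rewrite monomial_ip ltn_eqF ?cabs0//.
      exact: leq_trans (ltn_ord i) nj.
    rewrite (bigD1 (Ordinal jn)) //= monomial_ip eqxx cabs1 big1 ?addr0 ?ler1n// => i.
    by rewrite -val_eqE /= monomial_ip => /negbTE ->; rewrite cabs0.
  have Phi1 s : cabs (circ Phi r s) <= 1 by apply/ltW/self_map_lt1; rewrite cabs_circle.
  have iN j : intg (fun s => cabs (circ Phi r s) ^+ j).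
    apply: (intg_bounded (M := 1)).
      by apply: measurable_funX; apply: cmeas_cabs; exact: ccts_meas (holo_ccts holo_Phi r0 r1).
    by move=> s; rewrite ger0_norm ?exprn_ge0 ?cabs_ge0// exprn_ile1 ?cabs_ge0.
  (* Monotonicity replaces quasi-monotonicity here: [|Phi| <= 1], so the mean of [|Phi|^(2N)] is
     below those of all lower powers. *)
  have kj (j : 'I_N.+1) : mint (fun s => cabs (circ Phi r s) ^+ (2 * N)) <= h2sq (comp_op phi (v j)).
    apply: le_trans (hardy2_circ_le (HT _ (hv j)) r0 r1).
    rewrite [leRHS](mint_eq (g := fun s => cabs (circ Phi r s) ^+ (2 * j))); last first.
      move=> s; rewrite circ_extend_comp// extend_restrict; last by apply: self_map_lt1; rewrite cabs_circle.
      by rewrite cabsX -exprM mulnC.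
    apply: mint_le => // s; rewrite ler_wiXn2l ?cabs_ge0// leq_mul2l /= -ltnS //.
  rewrite -(ler_pM2l (np N)); apply: (@le_trans _ _ (\sum_(j < N.+1) h2sq (comp_op phi (v j)))).
    by rewrite -sum_ord_const; apply: ler_sum => j _; exact: kj.
  apply: le_trans (hB v hv vv N) _; rewrite [leRHS]mulrCA ler_wpM2r ?lerDl//.
Qed.

End KernelDecay.

Lemma one_minus_prod_sqr (R : realDomainType) (a b : R) : a <= 1 -> b <= 1 ->
  1 - (a * b) ^+ 2 <= 2 * (1 - a + (1 - b)).
Proof.
rewrite -subr_ge0 => a1; rewrite -subr_ge0 => b1; rewrite -subr_ge0.
have -> : 2 * (1 - a + (1 - b)) - (1 - (a * b) ^+ 2) = 2 * ((1 - a) * (1 - b)) + (1 - a * b) ^+ 2 by ring.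
by rewrite addr_ge0 ?sqr_ge0// !mulr_ge0.
Qed.

(** * Measure of the level sets of a Poisson integral composed with the symbol *)

Section LevelSets.
Context (R : realType).
Local Notation C := R[i].
Implicit Types (z w q xi : C) (G : R -> R) (r e d s t : R).

Lemma Re_cayley q : q != 1 -> complex.Re ((1 + q) / (1 - q)) = (1 - cabs q ^+ 2) / cabs (1 - q) ^+ 2.
Proof.
move=> q1; have n0 : 1 - q != 0 by rewrite subr_eq0 eq_sym.
have -> : (1 + q) / (1 - q) = 2%:R%:C * (1 - q)^-1 - 1.
  have -> : 2%:R%:C = 1 + 1 :> C by rewrite -RtoC1 -RtoCD.
  by field.
rewrite ReB ReZ Re_inv//= -[X in _ - X](@divff _ (cabs (1 - q) ^+ 2)); last first.
  by rewrite expf_neq0// cabs_eq0.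
rewrite mulrA -mulrBl; congr (_ / _); rewrite !cabs_sqr ReB ImB /=; ring.
Qed.

(** On the circle [pois w] is the real part of a Cayley transform of [conj w * y], holomorphic
    beyond the closed disk; its Poisson integral at [z] is therefore its value there. *)
Lemma mint_pois_pois z w : cabs z < 1 -> cabs w < 1 ->
  mint (fun t => pois z t * pois w t) = (1 - (cabs z * cabs w) ^+ 2) / cabs (1 - w^*%C * z) ^+ 2.
Proof.
move=> z1 w1; have w0 := cabs_ge0 w; have w2 : 0 < 1 + cabs w by lra.
pose eta := 2 / (1 + cabs w).
have e1 : 1 < eta by rewrite /eta ltr_pdivlMr//; lra.
have n1 y : cabs y < eta -> w^*%C * y != 1.
  rewrite /eta ltr_pdivlMr// => h; apply/eqP => /(congr1 (@cabs R)).
  rewrite cabsM cabs_conj cabs1 => k; have := cabs_ge0 y; nra.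
pose H y := (1 + w^*%C * y) / (1 - w^*%C * y).
have hH y : cabs y < eta -> cdiff H y.
  move=> ye; have dw : cdiff (fun y => w^*%C * y) y by apply: cdiffM; [exact: cdiff_cst|exact: cdiff_id].
  apply: cdiffM; first by apply: cdiffD => //; exact: cdiff_cst.
  apply: cdiffV; first by rewrite subr_eq0 eq_sym n1.
  by apply: cdiffB => //; exact: cdiff_cst.
have := congr1 (@complex.Re R) (poisson_unit e1 hH z1).
rewrite /H Re_cayley ?n1 ?(lt_trans z1)// cabsM cabs_conj [cabs w * _]mulrC => -> /=.
apply: mint_eq => t; rewrite ReZ; congr (_ * _).
have c1 : cabs (1%:C * expi t : C) = 1 by rewrite cabs_circle.
rewrite /circ Re_cayley ?n1 ?c1// cabsM cabs_conj c1 mulr1 RtoC1 mul1r /pois; congr (_ / _ ^+ 2).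
have -> : expi t - w = expi t * (1 - w^*%C * expi t)^*%C.
  rewrite conjB conjM conjcK -RtoC1 conjR RtoC1 mulrBr mulr1 mulrCA mul_conj cabs_expi expr1n RtoC1.
  by rewrite mulr1.
by rewrite cabsM cabs_expi mul1r cabs_conj.
Qed.

Section TwoPointKernel.
Variables (Z : R -> C) (rho : R).
Hypothesis mZ : cmeas Z.
Hypothesis rho1 : rho < 1.
Hypothesis hrho : forall s, cabs (Z s) <= rho.

Definition kern2 s s' : R := (cabs (1 - (Z s)^*%C * Z s') ^+ 2)^-1.

Lemma kern2_sym s s' : kern2 s s' = kern2 s' s.
Proof.
rewrite /kern2; congr (_ ^+ 2)^-1; rewrite -cabs_conj; congr cabs.
by rewrite conjB conjM conjcK -RtoC1 conjR mulrC.
Qed.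

Lemma kern2_den s s' : (1 - rho) ^+ 2 <= cabs (1 - (Z s)^*%C * Z s') ^+ 2.
Proof.
have r0 : 0 <= 1 - rho by rewrite subr_ge0 ltW.
rewrite lerXn2r ?nnegrE ?cabs_ge0//.
apply: le_trans (cabs_triB _ _); rewrite cabs1 cabsM cabs_conj lerD2l lerN2.
apply: (@le_trans _ _ (rho * 1)); last by rewrite mulr1.
by apply: ler_pM; rewrite ?cabs_ge0//; apply: le_trans (hrho s') (ltW rho1).
Qed.

Lemma kern2_den_gt0 s s' : 0 < cabs (1 - (Z s)^*%C * Z s') ^+ 2.
Proof. by apply: lt_le_trans (kern2_den s s'); rewrite exprn_gt0// subr_gt0. Qed.

Lemma kern2_bound s s' : 0 <= kern2 s s' <= ((1 - rho) ^+ 2)^-1.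
Proof.
rewrite invr_ge0 sqr_ge0/= lef_pV2 ?posrE ?kern2_den ?kern2_den_gt0//.
by rewrite exprn_gt0// subr_gt0.
Qed.

Lemma kern2_meas : measurable_fun setT (fun p : R * R => kern2 p.1 p.2).
Proof.
have [mZ1 mZ2] := mZ.
have m1 (f : R -> R) : measurable_fun setT f -> measurable_fun setT (fun p : R * R => f p.1).
  by move=> mf; apply: measurableT_comp => //; exact: measurable_fst.
have m2 (f : R -> R) : measurable_fun setT f -> measurable_fun setT (fun p : R * R => f p.2).
  by move=> mf; apply: measurableT_comp => //; exact: measurable_snd.
have rr : 0 < (1 - rho) ^+ 2 by rewrite exprn_gt0// subr_gt0.
apply: (measurable_inv_ge rr) => [|p]; last exact: kern2_den.
rewrite (_ : (fun p : R * R => _) = (fun p =>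
   (1 - (complex.Re (Z p.1) * complex.Re (Z p.2) + complex.Im (Z p.1) * complex.Im (Z p.2))) ^+ 2 +
   (complex.Re (Z p.1) * complex.Im (Z p.2) - complex.Im (Z p.1) * complex.Re (Z p.2)) ^+ 2)); last first.
  by apply/funext => p; rewrite cabs_sqr ReB ImB ReM ImM Re_conj Im_conj /=; ring.
have a1 := measurable_funM (m1 _ mZ1) (m2 _ mZ1); have a2 := measurable_funM (m1 _ mZ2) (m2 _ mZ2).
have a3 := measurable_funM (m1 _ mZ1) (m2 _ mZ2); have a4 := measurable_funM (m1 _ mZ2) (m2 _ mZ1).
apply: measurable_funD; apply: measurable_funX; apply: measurable_funB => //.
exact: measurable_funD.
Qed.

Variables (G e : R -> R) (sigma K : R).
Hypothesis mG : measurable_fun setT G.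
Hypothesis iG2 : intg (fun t => G t ^+ 2).
Hypothesis G0 : forall t, 0 <= G t.
Hypothesis me : measurable_fun setT e.
Hypothesis e01 : forall s, e s = 0 \/ e s = 1.

(* The T T^* argument: Q is the Poisson balayage of the level set, and its L^2
   norm is a double mean of the kernel 1 / |1 - Z(s) conj Z(s')|^2. *)
Lemma level_set_balayage : 0 <= sigma -> 0 <= K ->
  (forall s, e s = 1 -> sigma <= mint (fun t => pois (Z s) t * G t)) ->
  (forall s, e s * (1 - cabs (Z s)) * mint (fun s' => kern2 s s' * e s') <= K * e s) ->
  sigma ^+ 2 * mint e <= 4 * K * mint (fun t => G t ^+ 2).
Proof.
move=> sig0 K0 hsig key.
have z1 s : cabs (Z s) < 1 by exact: le_lt_trans (hrho s) rho1.
have e0 s : 0 <= e s by have [->|->] := e01 s.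
have e1 s : e s <= 1 by have [->|->] := e01 s.
have ne s : `|e s| <= 1 by rewrite ger0_norm.
have ie : intg e by exact: (intg_bounded (M := 1) me).
have [iG _] := mint_sqr_le mG iG2.
have mk := pois_joint_meas mZ rho1 hrho.
pose M := 2 / (1 - rho).
have kM s t : 0 <= pois (Z s) t <= M.
  rewrite pois_ge0//=; apply: le_trans (pois_le t (z1 s)) _.
  by rewrite ler_wpM2l// lef_pV2 ?posrE ?subr_gt0// lerD2l lerN2.
pose Q t := mint (fun s => pois (Z s) t * e s).
have Q0 t : 0 <= Q t by apply: mint_ge0 => s; rewrite mulr_ge0//; have /andP[] := kM s t.
have [iGQ i2 E1] := mint_swap mk kM ie iG e0 G0.
have swapQ (g : R -> R) : intg g -> (forall t, 0 <= g t) -> intg Q /\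
  mint (fun s => e s * mint (fun t => pois (Z s) t * g t)) = mint (fun t => g t * Q t).
  move=> ig g0; have [i _ E] := mint_swap mk kM ie ig e0 g0; exact: conj i E.
have [iQ _] := swapQ G iG G0.
have M0 : 0 <= M by have /andP[h1 h2] := kM 0 0; exact: le_trans h1 h2.
have QM t : `|Q t| <= M.
  rewrite ger0_norm//; apply: (@le_trans _ _ (mint (fun=> M))); last by rewrite mint_cst.
  apply: mint_le; [|exact: intg_cst|move=> s].
    apply: (@intgM _ _ _ M ie); first exact: (measurable_fun_pair1 t mk).
    by move=> s; rewrite ger0_norm; have /andP[] := kM s t.
  have /andP[k0 kk] := kM s t; apply: le_trans kk; exact: ler_piMr.
have iQ2 : intg (fun t => Q t ^+ 2).
  apply: (intg_bounded (M := M ^+ 2)); first by apply: measurable_funX; exact: intg_meas.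
  by move=> t; rewrite normrX lerXn2r ?nnegrE.
clearbody Q.
pose h := kern2.
have mh : measurable_fun setT (fun p : R * R => h p.1 p.2) := kern2_meas.
have hM s s' : 0 <= h s s' <= ((1 - rho) ^+ 2)^-1 by exact: kern2_bound.
have hE s s' : h s s' = (cabs (1 - (Z s)^*%C * Z s') ^+ 2)^-1 by [].
have hsym s s' : h s s' = h s' s by exact: kern2_sym.
clearbody h.
have h0 s s' : 0 <= h s s' by have /andP[] := hM s s'.
pose dl s := 1 - cabs (Z s).
have dl0 s : 0 < dl s by rewrite subr_gt0.
have dl1 s : dl s <= 1 by rewrite gerBl cabs_ge0.
have mdl : measurable_fun setT dl.
  by apply: measurable_funB; [exact: measurable_cst|exact: cmeas_cabs].
have {}key s : e s * dl s * mint (fun s' => h s s' * e s') <= K * e s.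
  rewrite (mint_eq (g := fun s' => kern2 s s' * e s')); first exact: key.
  by move=> s'; rewrite hE.
have dlE s : dl s = 1 - cabs (Z s) by [].
clearbody dl.
have ied : intg (fun s => e s * dl s).
  apply: (intg_bounded (M := 1)); first exact: measurable_funM.
  move=> s; rewrite (ger0_norm (mulr_ge0 (e0 s) (ltW (dl0 s)))).
  exact: mulr_ile1 (e0 s) (ltW (dl0 s)) (e1 s) (dl1 s).
have ed0 s : 0 <= e s * dl s by exact: mulr_ge0 (e0 s) (ltW (dl0 s)).
have [ih1 ih2 E2] := mint_swap mh hM ied ie ed0 e0.
have E2' : mint (fun s => e s * mint (fun s' => h s s' * (e s' * dl s'))) =
    mint (fun s => e s * dl s * mint (fun s' => h s s' * e s')).
  by rewrite E2; apply: mint_eq => s; congr (_ * _); apply: mint_eq => s'; rewrite hsym.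
have QQ : mint (fun t => Q t ^+ 2) <= 4 * K * mint e.
  have -> : mint (fun t => Q t ^+ 2) = mint (fun s => e s * mint (fun t => pois (Z s) t * Q t)).
    by have [_ ->] := swapQ Q iQ Q0; apply: mint_eq => t; rewrite expr2.
  have inner s : mint (fun t => pois (Z s) t * Q t) =
     mint (fun s' => e s' * ((1 - (cabs (Z s) * cabs (Z s')) ^+ 2) * h s s')).
    have [_ <-] := swapQ (pois (Z s)) (pois_intg (z1 s)) (fun t => pois_ge0 t (z1 s)).
    apply: mint_eq => s'; congr (_ * _).
    by rewrite hE (mint_pois_pois (z1 s') (z1 s)) [cabs (Z s') * _]mulrC.
  have mhs s : measurable_fun setT (h s) := measurable_fun_pair2 s mh.
  have hb s s' : `|h s s'| <= ((1 - rho) ^+ 2)^-1.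
    by rewrite (ger0_norm (h0 s s')); have /andP[_] := hM s s'.
  have i_e s : intg (fun s' => h s s' * e s') by exact: (@intgM _ _ _ _ ie (mhs s) (hb s)).
  have i_ed s : intg (fun s' => h s s' * (e s' * dl s')) by exact: (@intgM _ _ _ _ ied (mhs s) (hb s)).
  (* By [one_minus_prod_sqr] the numerator of the composed kernel is at most [2 * (dl s + dl s')].
     By symmetry of [h] both halves have the same double mean, and [key] bounds it. *)
  have split_s s : mint (fun t => pois (Z s) t * Q t) <=
     2 * (dl s * mint (fun s' => h s s' * e s')) + 2 * mint (fun s' => h s s' * (e s' * dl s')).
    have j1 : intg (fun s' => 2 * (dl s * (h s s' * e s'))) by do 2 apply: intgZ.
    have j2 : intg (fun s' => 2 * (h s s' * (e s' * dl s'))) by exact: intgZ.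
    rewrite inner -(mintZ _ (i_e s)) -(mintZ _ (intgZ (dl s) (i_e s))) -(mintZ _ (i_ed s)) -(mintD j1 j2).
    have ms' : measurable_fun setT (fun s' => e s' * ((1 - (cabs (Z s) * cabs (Z s')) ^+ 2) * h s s')).
      apply: (measurable_funM me); apply: measurable_funM (mhs s).
      apply: measurable_funB; first exact: measurable_cst.
      apply: measurable_funX; apply: measurable_funM; [exact: measurable_cst|exact: cmeas_cabs].
    have up s' : e s' * ((1 - (cabs (Z s) * cabs (Z s')) ^+ 2) * h s s') <=
       2 * (dl s * (h s s' * e s')) + 2 * (h s s' * (e s' * dl s')).
      have -> : 2 * (dl s * (h s s' * e s')) + 2 * (h s s' * (e s' * dl s')) =
         (e s' * h s s') * (2 * (dl s + dl s')) by ring.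
      have -> : e s' * ((1 - (cabs (Z s) * cabs (Z s')) ^+ 2) * h s s') =
         (e s' * h s s') * (1 - (cabs (Z s) * cabs (Z s')) ^+ 2) by ring.
      apply: ler_wpM2l; first exact: mulr_ge0 (e0 s') (h0 s s').
      rewrite !dlE; exact: one_minus_prod_sqr (ltW (z1 s)) (ltW (z1 s')).
    have lo s' : 0 <= e s' * ((1 - (cabs (Z s) * cabs (Z s')) ^+ 2) * h s s').
      apply: (mulr_ge0 (e0 s')); apply: mulr_ge0 (h0 s s'); rewrite subr_ge0.
      apply: exprn_ile1; first exact: mulr_ge0 (cabs_ge0 _) (cabs_ge0 _).
      exact: mulr_ile1 (cabs_ge0 _) (cabs_ge0 _) (ltW (z1 s)) (ltW (z1 s')).
    have j3 := intgD j1 j2.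
    have j4 : intg (fun s' => e s' * ((1 - (cabs (Z s) * cabs (Z s')) ^+ 2) * h s s')).
      by apply: (intg_le ms' _ j3) => s'; rewrite (ger0_norm (lo s')); exact: up.
    exact: mint_le j4 j3 up.
  have mint0 s : 0 <= mint (fun s' => h s s' * e s').
    by apply: mint_ge0 => s'; exact: mulr_ge0 (h0 s s') (e0 s').
  have mH : measurable_fun setT (fun s => mint (fun s' => h s s' * e s')) := intg_meas ih2.
  have i3 : intg (fun s => e s * dl s * mint (fun s' => h s s' * e s')).
    apply: (intg_le _ _ (intgZ K ie)); first exact: measurable_funM (measurable_funM me mdl) mH.
    by move=> s; rewrite (ger0_norm (mulr_ge0 (ed0 s) (mint0 s))); exact: key.
  have i4 : intg (fun s => e s * mint (fun s' => h s s' * (e s' * dl s'))).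
    have -> : (fun s => e s * mint (fun s' => h s s' * (e s' * dl s'))) =
       (fun s => e s * mint (fun s' => h s' s * (e s' * dl s'))).
      by apply/funext => s; congr (_ * _); apply: mint_eq => s'; rewrite hsym.
    exact: (@intgM _ _ _ 1 ih1 me ne).
  have j3 := intgZ 2 i3; have j4 := intgZ 2 i4.
  apply: (@le_trans _ _ (mint (fun s => 2 * (e s * dl s * mint (fun s' => h s s' * e s')) +
     2 * (e s * mint (fun s' => h s s' * (e s' * dl s')))))).
    have [_ iPQ _] := mint_swap mk kM ie iQ e0 Q0.
    apply: (mint_le (@intgM _ _ _ 1 iPQ me ne) (intgD j3 j4)) => s.
    apply: le_trans (ler_wpM2l (e0 s) (split_s s)) _.
    by rewrite le_eqVlt; apply/orP; left; apply/eqP; ring.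
  rewrite (mintD j3 j4) (mintZ _ i3) (mintZ _ i4) E2'.
  have := mint_le i3 (intgZ K ie) key; rewrite (mintZ _ ie).
  have -> : 4 * K * mint e = 2 * (K * mint e) + 2 * (K * mint e) by ring.
  by move=> hx; have hx2 := ler_wpM2l (ler0n R 2) hx; exact: (lerD hx2 hx2).
have [_ EG] := swapQ G iG G0.
(* Duality: the level set is tested against the Poisson mean, and Cauchy-Schwarz with [QQ] gives a
   bound quadratic in [mint e] on the left and linear on the right, so one factor is divided out. *)
have L : sigma * mint e <= mint (fun t => G t * Q t).
  rewrite -(mintZ _ ie) -EG; apply: (mint_le (intgZ sigma ie) (@intgM _ _ _ 1 i2 me ne)) => s.
  have [->|es] := e01 s; first by rewrite mulr0 mul0r.
  by rewrite es mulr1 mul1r; exact: hsig es.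
have CS := cauchy_schwarz mG (intg_meas iQ) iG2 iQ2.
have m0 : 0 <= mint e by exact: mint_ge0 e0.
have g0 : 0 <= mint (fun t => G t ^+ 2) by apply: mint_ge0 => t; exact: sqr_ge0.
have [->|mn] := eqVneq (mint e) 0; first by rewrite mulr0 !mulr_ge0.
have mp : 0 < mint e by rewrite lt_def mn.
have S1 : (sigma * mint e) ^+ 2 <= mint (fun t => G t ^+ 2) * (4 * K * mint e).
  apply: (@le_trans _ _ (mint (fun t => G t * Q t) ^+ 2)).
    have l0 := mulr_ge0 sig0 m0; have l1 := le_trans l0 L.
    by apply: (lerXn2r 2 _ _ L); rewrite nnegrE.
  exact: le_trans CS (ler_wpM2l g0 QQ).
rewrite -(ler_pM2r mp); apply: le_trans (le_trans _ S1) _.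
  by rewrite exprMn [X in _ <= _ * X]expr2 mulrA.
by rewrite le_eqVlt; apply/orP; left; apply/eqP; ring.
Qed.

End TwoPointKernel.

Variable phi : disk R -> disk R.
Local Notation Phi := (extend (fun y => val (phi y))).
Hypothesis phi_analytic : analytic (fun y => val (phi y)).

Let hPhi := holo_Phi phi_analytic.

Lemma boundary_direction z w xi : cabs xi = 1 -> cabs z < 1 -> cabs w < 1 -> z = (cabs z)%:C * xi ->
  cabs ((1 + (1 - cabs z))%:C - xi^*%C * w) <= 3 * cabs (1 - z^*%C * w).
Proof.
move=> x1 z1 w1 zE; set d := 1 - cabs z.
have d0 : 0 < d by rewrite subr_gt0.
have -> : (1 + d)%:C - xi^*%C * w = (1 - z^*%C * w) + (d%:C - d%:C * (xi^*%C * w)).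
  by rewrite zE conjM conjR /d RtoCD RtoCB !RtoC1; ring.
have k1 : d <= cabs (1 - z^*%C * w).
  apply: le_trans (cabs_triB _ _); rewrite cabs1 cabsM cabs_conj lerD2l lerN2.
  by rewrite ler_piMr ?cabs_ge0// ltW.
have k2 : cabs (d%:C - d%:C * (xi^*%C * w)) <= 2 * d.
  apply: le_trans (cabsB _ _) _; rewrite !cabsM cabs_conj x1 mul1r cabs_nneg ?(ltW d0)//.
  by nra.
apply: le_trans (cabsD _ _) _; lra.
Qed.

(* With xi the direction of Z(s) and d = 1 - |Z(s)|, the kernel of the balayage
   satisfies |1 + d - conj xi w| <= 3 |1 - conj Z(s) w|, which produces kmean. *)
Lemma level_set_bound (r : R) (G e : R -> R) (sigma kappa : R) :
  0 <= r < 1 -> measurable_fun setT G -> intg (fun t => G t ^+ 2) -> (forall t, 0 <= G t) ->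
  measurable_fun setT e -> (forall s, e s = 0 \/ e s = 1) -> 0 <= sigma -> 0 <= kappa ->
  (forall s, e s = 1 -> sigma <= mint (fun t => pois (circ Phi r s) t * G t)) ->
  (forall s xi, e s = 1 -> cabs xi = 1 -> kmean phi xi r (1 - cabs (circ Phi r s)) <= kappa) ->
  sigma ^+ 2 * mint e <= 36 * kappa * mint (fun t => G t ^+ 2).
Proof.
move=> r01 mG iG2 G0 me e01 sig0 kap0 hsig hkap; have /andP[r0 r1] := r01.
have [rho /andP[rho0 rho1] hrho] := circ_sup hPhi (self_map_lt1 phi) r01.
have mZ := ccts_meas (holo_ccts hPhi r0 r1).
have -> : 36 * kappa = 4 * (9 * kappa) by ring.
apply: (level_set_balayage mZ rho1 hrho mG iG2 G0 me e01 sig0 _ hsig); first exact: mulr_ge0.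
have e0 s : 0 <= e s by have [->|->] := e01 s.
have e1 s : e s <= 1 by have [->|->] := e01 s.
have ne s : `|e s| <= 1 by rewrite ger0_norm.
have ie : intg e by exact: (intg_bounded (M := 1) me).
have kd := kern2_den rho1 hrho; have kM := kern2_bound rho1 hrho; have km := kern2_meas mZ rho1 hrho.
have kd0 := kern2_den_gt0 rho1 hrho.
set Z := circ Phi r in hsig hkap hrho mZ kd kM km kd0 *; pose h := kern2 Z.
have z1 s : cabs (Z s) < 1 by exact: le_lt_trans (hrho s) rho1.
pose dl s := 1 - cabs (Z s).
have dl0 s : 0 < dl s by rewrite subr_gt0.
have mhs s : measurable_fun setT (h s) := measurable_fun_pair2 s km.
have hb s s' : `|h s s'| <= ((1 - rho) ^+ 2)^-1 by have /andP[h1 h2] := kM s s'; rewrite ger0_norm.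
have i_e s : intg (fun s' => h s s' * e s') by exact: (@intgM _ _ _ _ ie (mhs s) (hb s)).
move=> s; have [->|es] := e01 s; first by rewrite !mul0r mulr0.
rewrite es mul1r mulr1; have [a _ aE] := polar (Z s).
have x1 : cabs (expi a : C) = 1 by exact: cabs_expi.
have ik := kmean_intg phi_analytic x1 (dl0 s) r01.
apply: (@le_trans _ _ (9 * kmean phi (expi a) r (dl s))); last by rewrite ler_wpM2l// hkap.
rewrite -[X in X * _]/(dl s) /kmean -(mintZ _ (i_e s)) -(mintZ _ ik).
apply: mint_le; [exact: intgZ|exact: intgZ|move=> s'].
have h3 := boundary_direction x1 (z1 s) (z1 s') aE; rewrite -/(dl s) in h3.
have d1 := den_Phi phi (dl s) s' x1 r01; rewrite -/Z in d1 *.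
set D := cabs _ in h3 d1; have D0 : 0 < D by exact: lt_le_trans d1.
have hD : h s s' <= 9 / D ^+ 2.
  rewrite /h /kern2 ler_pdivlMr ?exprn_gt0// ler_pdivrMl ?kd0//.
  have : D ^+ 2 <= (3 * cabs (1 - (Z s)^*%C * Z s')) ^+ 2 by rewrite lerXn2r// nnegrE ltW// (lt_le_trans D0).
  by rewrite exprMn [leRHS]mulrC -natrX.
have h0 : 0 <= h s s' by have /andP[] := kM s s'.
rewrite -/D; have -> : 9 * (dl s / D ^+ 2) = dl s * (9 / D ^+ 2) by ring.
rewrite ler_wpM2l ?(ltW (dl0 s))//; apply: le_trans hD.
by rewrite ler_piMr.
Qed.

End LevelSets.

(** * Two elementary facts for the dyadic decomposition *)

Section Elementary.
Context (R : realType).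

Lemma dyadic_square_sum n (x : R) : \sum_(k < n) 4 ^+ k * (2 ^+ k < x)%R%:R <= 2 * x ^+ 2.
Proof.
have geo m : \sum_(k < m) 4 ^+ k <= 4 ^+ m :> R.
  elim: m => [|m IH]; first by rewrite big_ord0 exprn_ge0.
  by rewrite big_ord_recr /= exprS; have p0 := exprn_ge0 m (ler0n R 4); lra.
elim: n => [|n IH]; first by rewrite big_ord0 mulr_ge0// sqr_ge0.
rewrite big_ord_recr /=; case: ltP => h; last by rewrite mulr0 addr0.
apply: (@le_trans _ _ (4 ^+ n + 4 ^+ n)).
  rewrite mulr1 lerD2r; apply: le_trans (geo n); apply: ler_sum => k _.
  by case: (_ < _); rewrite ?mulr1 ?mulr0// exprn_ge0.
have p0 : 0 <= 2 ^+ n :> R by exact: exprn_ge0.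
rewrite four_expr; have : (2 ^+ n) ^+ 2 <= x ^+ 2 by rewrite lerXn2r// ?nnegrE ltW// (le_lt_trans p0).
lra.
Qed.

Lemma ltr_meas (u v : R -> R) : measurable_fun setT u -> measurable_fun setT v ->
  measurable_fun setT (fun t => (u t < v t)%R%:R : R).
Proof.
move=> mu mv; have -> : (fun t => (u t < v t)%R%:R : R) = \1_[set t | (u t < v t)%R].
  by apply/funext => t; rewrite indicE; congr (nat_of_bool _)%:R; apply/idP/idP; rewrite inE.
apply: measurable_indic; rewrite -[X in measurable X]setTI.
exact: (measurable_fun_ltr mu mv measurableT (Y := [set true])).
Qed.

End Elementary.

(** * Weighted summation over dyadic levels *)

Section LevelSum.
Context (R : realType) (phi : disk R -> disk R).
Local Notation C := R[i].
Local Notation Phi := (extend (fun y => val (phi y))).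
Hypothesis phi_analytic : analytic (fun y => val (phi y)).
Variables (d B : R).
Hypothesis d0 : 0 < d.
Hypothesis B0 : 0 <= B.
Hypothesis decay : forall (xi : C) r tau N, cabs xi = 1 -> 0 <= r < 1 -> 0 < tau -> tau <= (4 ^+ N)^-1 ->
  kmean phi xi r tau <= B * N.+1%:R `^ (- d).

Section Levels.
Variables (G : R -> R) (r : R).
Hypothesis r01 : 0 <= r < 1.
Hypothesis mG : measurable_fun setT G.
Hypothesis G0 : forall t, 0 <= G t.
Hypothesis iG4 : intg (fun t => G t ^+ 4).
Hypothesis G41 : mint (fun t => G t ^+ 4) <= 1.
Local Notation Z := (circ Phi r).

Definition pmean s := mint (fun t => pois (Z s) t * G t).

Let Z1 s : cabs (Z s) < 1.
Proof. by have /andP[r0 r1] := r01; apply: self_map_lt1; rewrite cabs_circle. Qed.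

Let iG2 : intg (fun t => G t ^+ 2).
Proof.
have i4 : intg (fun t => (G t ^+ 2) ^+ 2).
  by rewrite (_ : (fun t => _) = (fun t => G t ^+ 4))//; apply/funext => t; rewrite -exprM.
by have [] := mint_sqr_le (measurable_funX 2 mG) i4.
Qed.

Let G21 : mint (fun t => G t ^+ 2) <= 1.
Proof.
have i4 : intg (fun t => (G t ^+ 2) ^+ 2).
  by rewrite (_ : (fun t => _) = (fun t => G t ^+ 4))//; apply/funext => t; rewrite -exprM.
have [_ h] := mint_sqr_le (measurable_funX 2 mG) i4.
have g0 : 0 <= mint (fun t => G t ^+ 2) by apply: mint_ge0 => t; exact: sqr_ge0.
rewrite -(@ler_pXn2r _ 2)// ?nnegrE// expr1n; apply: le_trans h _.
by apply: le_trans G41; rewrite le_eqVlt; apply/orP; left; apply/eqP; apply: mint_eq => t; rewrite -exprM.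
Qed.

Let iG : intg G.
Proof. by have [] := mint_sqr_le mG iG2. Qed.

Lemma pmean_meas : measurable_fun setT pmean.
Proof. by have [i _] := subordination (holo_Phi phi_analytic) (self_map_lt1 phi) r01 iG G0; exact: intg_meas i. Qed.

(** For fixed [r] the values of [Phi] stay in a smaller disk, so only finitely many levels are
    nonempty. The bound depends on [r], but it only serves to end an induction. *)
Lemma pmean_bounded : exists n : nat, forall s, pmean s <= 2 ^+ n.
Proof.
have [rho /andP[rho0 rho1] hrho] := circ_sup (holo_Phi phi_analytic) (self_map_lt1 phi) r01.
have [n hn] : exists n : nat, 2 / (1 - rho) * mint G <= n%:R.
  exists (Num.bound `|2 / (1 - rho) * mint G|); apply: le_trans (ler_norm _) (ltW _).
  exact: archi_boundP.
exists n => s; apply: (@le_trans _ _ n%:R); last first.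
  by rewrite -natrX ler_nat ltnW// ltn_expl.
apply: le_trans hn; rewrite -mintZ//; apply: mint_le; [exact: pois_intgM|exact: intgZ|move=> t].
rewrite ler_wpM2r//; apply: le_trans (pois_le t (Z1 s)) _.
by rewrite ler_wpM2l// lef_pV2 ?posrE ?subr_gt0// lerD2l lerN2.
Qed.

(* Since mint (G ^ 2) <= 1, a large value of the Poisson mean at z forces 1 - |z|
   to be small. *)
Lemma pmean_level s k : 2 ^+ k < pmean s -> 1 - cabs (Z s) <= 2 * (4 ^+ k)^-1.
Proof.
move=> h; have c0 : 0 < 1 - cabs (Z s) by rewrite subr_gt0.
have p2 : 0 < 2 ^+ k :> R by exact: exprn_gt0.
have i2 := pois_intgM (Z1 s) iG2.
have k1 : pmean s ^+ 2 <= mint (fun t => pois (Z s) t * G t ^+ 2).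
  have a1 := intgZ (pmean s ^+ 2) (pois_intg (Z1 s)).
  have a2 := intgZ (2 * pmean s) (pois_intgM (Z1 s) iG).
  have : mint (fun t => 2 * pmean s * (pois (Z s) t * G t)) <=
      mint (fun t => pmean s ^+ 2 * pois (Z s) t + pois (Z s) t * G t ^+ 2).
    apply: (mint_le a2 (intgD a1 i2)) => t; have p0 := pois_ge0 t (Z1 s).
    have := mulr_ge0 p0 (sqr_ge0 (pmean s - G t)); move: (pois _ _) (pmean s) (G t) => p u g; nra.
  rewrite (mintD a1 i2) (mintZ _ (pois_intg (Z1 s))) mint_pois// (mintZ _ (pois_intgM (Z1 s) iG)).
  by rewrite -/(pmean s) mulr1; nra.
have k2 : mint (fun t => pois (Z s) t * G t ^+ 2) <= 2 / (1 - cabs (Z s)).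
  apply: (@le_trans _ _ (2 / (1 - cabs (Z s)) * mint (fun t => G t ^+ 2))).
    rewrite -mintZ//; apply: mint_le => //; first exact: intgZ.
    by move=> t; rewrite ler_wpM2r ?sqr_ge0// pois_le.
  by rewrite ler_piMr// divr_ge0// ltW.
have k3 : (2 ^+ k) ^+ 2 <= 2 / (1 - cabs (Z s)).
  apply: le_trans k2; apply: le_trans k1; rewrite lerXn2r// ?nnegrE ?ltW//.
  exact: lt_trans h.
by move: k3; rewrite -four_expr ler_pdivlMr// mulrC -ler_pdivlMr ?exprn_gt0.
Qed.

Definition level k s : R := (2 ^+ k < pmean s)%R%:R.

Lemma level_meas k : measurable_fun setT (level k).
Proof. by apply: ltr_meas; [exact: measurable_cst|exact: pmean_meas]. Qed.

Lemma level01 k s : level k s = 0 \/ level k s = 1.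
Proof. by rewrite /level; case: (_ < _); [right|left]. Qed.

Lemma level_intg k : intg (level k).
Proof.
apply: (intg_bounded (M := 1) (level_meas k)) => s.
by have [->|->] := level01 k s; rewrite ?normr0 ?normr1.
Qed.

(** The truncation of real interpolation: the discarded part is at most [2 ^+ k / 2], hence so is
    its Poisson mean, and on the level [k] the kept part accounts for at least half of [2 ^+ k]. *)
Definition truncG k t := G t * (2 ^+ k < 2 * G t)%R%:R.

Lemma truncG_bounds k t : 0 <= truncG k t <= G t.
Proof. by rewrite /truncG; case: (_ < _); rewrite ?mulr1 ?mulr0 G0 ?lexx. Qed.

Lemma truncG_meas k : measurable_fun setT (truncG k).
Proof.
apply: (measurable_funM mG); apply: ltr_meas; first exact: measurable_cst.
by apply: measurable_funM; [exact: measurable_cst|exact: mG].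
Qed.

Lemma truncG_intg2 k : intg (fun t => truncG k t ^+ 2).
Proof.
apply: (intg_le _ _ iG2); first by apply: measurable_funX; exact: truncG_meas.
move=> t; have /andP[h1 h2] := truncG_bounds k t.
by rewrite ger0_norm ?sqr_ge0// lerXn2r// nnegrE.
Qed.

Lemma level_measure_bound k :
  16 ^+ k.+1 * mint (level k.+1) <= 144 * B * k.+1%:R `^ (- d) * (4 ^+ k.+1 * mint (fun t => truncG k.+1 t ^+ 2)).
Proof.
have p2 : 0 < 2 ^+ k.+1 :> R by exact: exprn_gt0.
pose sg : R := 2 ^+ k.+1 / 2; have sg0 : 0 <= sg by rewrite divr_ge0// ltW.
have kap0 : 0 <= B * k.+1%:R `^ (- d) by rewrite mulr_ge0 ?powR_ge0.
have T0 t : 0 <= truncG k.+1 t by have /andP[] := truncG_bounds k.+1 t.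
have iT : intg (truncG k.+1) by have [] := mint_sqr_le (truncG_meas k.+1) (truncG_intg2 k.+1).
have lev s : level k.+1 s = 1 -> 2 ^+ k.+1 < pmean s.
  by rewrite /level; case: (_ < _) => // /eqP; rewrite eq_sym oner_eq0.
have hs s : level k.+1 s = 1 -> sg <= mint (fun t => pois (Z s) t * truncG k.+1 t).
  move=> /lev h; have ip := pois_intgM (Z1 s) iT.
  have is' := intgZ sg (pois_intg (Z1 s)).
  have : pmean s <= mint (fun t => sg * pois (Z s) t + pois (Z s) t * truncG k.+1 t).
    apply: (mint_le (pois_intgM (Z1 s) iG) (intgD is' ip)) => t.
    rewrite [sg * _]mulrC -mulrDr ler_wpM2l ?pois_ge0//.
    rewrite /truncG; case: ltP => k1; rewrite ?mulr1 ?mulr0 ?addr0 ?lerDr//.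
    by rewrite /sg ler_pdivlMr// mulrC.
  rewrite (mintD is' ip) (mintZ _ (pois_intg (Z1 s))) mint_pois// mulr1 => h2.
  have e : 2 ^+ k.+1 = sg + sg by rewrite -splitr.
  by rewrite -(lerD2l sg) -e; apply: le_trans (ltW h) h2.
have hk s (xi : C) : level k.+1 s = 1 -> cabs xi = 1 ->
    kmean phi xi r (1 - cabs (Z s)) <= B * k.+1%:R `^ (- d).
  move=> /lev h x1; apply: decay => //; first by rewrite subr_gt0.
  (* [2 / 4 ^+ k.+1 <= 1 / 4 ^+ k]: the factor 2 costs one index, which is why the level [k.+1] is
     paired with [N = k] in [decay]. *)
  apply: le_trans (pmean_level h) _; rewrite exprS invfM mulrA.
  by rewrite ler_piMl ?invr_ge0 ?exprn_ge0//; lra.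
have := level_set_bound phi_analytic r01 (truncG_meas k.+1) (truncG_intg2 k.+1) T0
  (level_meas k.+1) (level01 k.+1) sg0 kap0 hs hk.
set m := mint (level k.+1); set g := mint _; set w := k.+1%:R `^ (- d) => h.
have h2 : 4 ^+ k.+1 * (4 * (sg ^+ 2 * m)) <= 4 ^+ k.+1 * (4 * (36 * (B * w) * g)).
  by rewrite ler_wpM2l ?exprn_ge0// ler_wpM2l.
have e1 : 16 ^+ k.+1 * m = 4 ^+ k.+1 * (4 * (sg ^+ 2 * m)).
  have -> : 16 ^+ k.+1 = 4 ^+ k.+1 * 4 ^+ k.+1 :> R by rewrite -exprMn -natrM.
  by rewrite /sg expr_div_n -four_expr; field.
rewrite e1; apply: le_trans h2 _.
by rewrite le_eqVlt; apply/orP; left; apply/eqP; ring.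
Qed.

(** Half of the decay [(j+1)^(-d)] cancels the weight and the other half is at most its value at
    [j1]. Exchanging sum and mean, [dyadic_square_sum] at [2 * G t] gives [8 * G t ^+ 4], whence
    1152 = 144 * 8. *)
Lemma level_weighted_sum j1 n : \sum_(j1 <= j < n) (j.+1%:R `^ (d / 2)) * 16 ^+ j.+1 * mint (level j.+1) <=
  1152 * B * j1.+1%:R `^ (- (d / 2)).
Proof.
have np j : 0 < j.+1%:R :> R by rewrite ltr0n.
set w1 := j1.+1%:R `^ (- (d / 2)).
have w10 : 0 <= w1 by exact: powR_ge0.
apply: (@le_trans _ _ (\sum_(j1 <= j < n) 144 * B * w1 * (4 ^+ j.+1 * mint (fun t => truncG j.+1 t ^+ 2)))).
  rewrite big_nat [leRHS]big_nat; apply: ler_sum => j /andP[j1j _].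
  have g0 : 0 <= 4 ^+ j.+1 * mint (fun t => truncG j.+1 t ^+ 2).
    by rewrite mulr_ge0 ?exprn_ge0// mint_ge0// => t; exact: sqr_ge0.
  rewrite -mulrA; apply: le_trans (ler_wpM2l (powR_ge0 _ _) (level_measure_bound j)) _.
  set T := 4 ^+ j.+1 * _ in g0 *; set a := _ `^ (d / 2); set b := _ `^ (- d).
  have -> : a * (144 * B * b * T) = 144 * B * (a * b) * T by ring.
  rewrite ler_wpM2r// ler_wpM2l ?mulr_ge0// /a /b.
  rewrite -powRD; last by apply/implyP => _; rewrite gt_eqF.
  have -> : d / 2 - d = - (d / 2) by field.
  rewrite /w1 !powRN lef_pV2 ?posrE ?powR_gt0//.
  by apply: ge0_ler_powR; rewrite ?nnegrE ?ler_nat// divr_ge0// ltW.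
rewrite -mulr_sumr.
have -> : 1152 * B * w1 = 144 * B * w1 * 8 by ring.
rewrite ler_wpM2l ?mulr_ge0//.
have i2 j := intgZ (4 ^+ j.+1) (truncG_intg2 j.+1).
apply: (@le_trans _ _ (\sum_(j < n) mint (fun t => 4 ^+ j.+1 * truncG j.+1 t ^+ 2))).
  rewrite -(big_mkord xpredT (fun j => mint (fun t => 4 ^+ j.+1 * truncG j.+1 t ^+ 2))).
  have pos j : 0 <= mint (fun t => 4 ^+ j.+1 * truncG j.+1 t ^+ 2).
    by apply: mint_ge0 => t; apply: mulr_ge0; [exact: exprn_ge0|exact: sqr_ge0].
  have [jn|nj] := leqP j1 n; last first.
    by rewrite (big_geq (m := j1)) ?(ltnW nj)//; apply: sumr_ge0 => j _; exact: pos.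
  rewrite (big_cat_nat (leq0n j1) jn)/=.
  under eq_bigr => j _ do rewrite -(mintZ _ (truncG_intg2 j.+1)).
  by rewrite lerDr; apply: sumr_ge0 => j _; exact: pos.
rewrite -(mint_sum _ (fun j : 'I_n => i2 j)).
apply: (@le_trans _ _ (mint (fun t => 8 * G t ^+ 4))); last by rewrite mintZ// ler_piMr.
apply: mint_le; [by apply: intg_sum => j; exact: i2|exact: intgZ|move=> t].
have := dyadic_square_sum n.+1 (2 * G t); rewrite big_ord_recl /= => h.
apply: (@le_trans _ _ (G t ^+ 2 * \sum_(j < n) 4 ^+ j.+1 * (2 ^+ j.+1 < 2 * G t)%R%:R)).
  rewrite mulr_sumr; apply: ler_sum => j _; rewrite /truncG exprMn.
  by case: (_ < _); rewrite ?expr1n ?mulr1 ?expr0n ?mulr0 ?mul0r// mulrC.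
have -> : 8 * G t ^+ 4 = G t ^+ 2 * (2 * (2 * G t) ^+ 2) by ring.
rewrite ler_wpM2l ?sqr_ge0//; apply: le_trans h; rewrite lerDr mulr_ge0//.
Qed.

(** The set is sliced by the dyadic size of [pmean]: where it lies between [2 ^+ j.+1] and
    [2 ^+ j.+2], [f] is at most [D] times the weight of index [j], and the slice is contained in the
    level [j.+1]. *)
Lemma level_integral_bound (f : R -> R) D j1 : measurable_fun setT f -> (forall s, 0 <= f s) -> 0 <= D ->
  (forall s j, pmean s <= 2 ^+ j.+2 -> f s <= D * (j.+1%:R `^ (d / 2) * 16 ^+ j.+1)) ->
  intg (fun s => f s * level j1.+1 s) /\
  mint (fun s => f s * level j1.+1 s) <= D * (1152 * B * j1.+1%:R `^ (- (d / 2))).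
Proof.
move=> mf f0 D0 hf; have [n0 hn0] := pmean_bounded.
pose n := (j1 + n0)%N.
pose c j : R := D * (j.+1%:R `^ (d / 2) * 16 ^+ j.+1).
have c0 j : 0 <= c j by rewrite mulr_ge0// mulr_ge0 ?powR_ge0 ?exprn_ge0.
have l0 j s : 0 <= level j s by have [->|->] := level01 j s.
have pw s : f s * level j1.+1 s <= \sum_(j1 <= j < n) c j * level j.+1 s.
  have un : pmean s <= 2 ^+ n.+1.
    apply: le_trans (hn0 s) _; rewrite ler_weXn2l ?ler1n//.
    by rewrite leqW// leq_addl.
  have : (j1 <= n)%N by exact: leq_addr.
  elim: (n) un => [|m IH] um jm.
    move: jm; rewrite leqn0 => /eqP j10; rewrite j10 big_geq// /level ltNge um mulr0//.
  move: jm; rewrite leq_eqVlt => /orP[/eqP j1m|jm].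
    by rewrite j1m big_geq// /level ltNge um mulr0.
  rewrite big_nat_recr//=; have [um'|um'] := leP (pmean s) (2 ^+ m.+1).
    by apply: le_trans (IH um' jm) _; rewrite lerDl mulr_ge0.
  apply: (@le_trans _ _ (c m * level m.+1 s)); last first.
    by rewrite lerDr sumr_ge0// => j _; rewrite mulr_ge0.
  rewrite {2}/level um' mulr1; apply: le_trans (hf s m um).
  by rewrite ler_piMr//; have [->|->] := level01 j1.+1 s.
have is' : intg (fun s => \sum_(j1 <= j < n) c j * level j.+1 s).
  by apply: intg_sum => j; apply: intgZ; exact: level_intg.
have ifl : intg (fun s => f s * level j1.+1 s).
  apply: (intg_le _ _ is'); first by apply: measurable_funM => //; exact: level_meas.
  by move=> s; rewrite ger0_norm ?mulr_ge0.
split => //; apply: le_trans (mint_le ifl is' pw) _.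
rewrite mint_sum; last by move=> j; apply: intgZ; exact: level_intg.
apply: le_trans (ler_wpM2l D0 (level_weighted_sum j1 n)); rewrite mulr_sumr.
by apply: ler_sum => j _; rewrite (mintZ _ (level_intg j.+1)) mulrA.
Qed.

End Levels.
End LevelSum.


(** * Growth of Psi and the uniform estimate for composed functions *)

Section Compactness.
Context (R : realType) (Psi : \bar R -> \bar R).
Local Notation C := R[i].
Hypothesis Psi_orlicz : orlicz_function Psi.
Local Notation psi := (psi Psi).
Implicit Types (F : C -> C) (z : C) (r c A M S : R).

Let psi_ge0 := psi_ge0 Psi_orlicz.
Let psi_le := psi_le Psi_orlicz.

Lemma powR_decay_small (d e : R) : 0 < d -> 0 < e -> exists N, N.+1%:R `^ (- d) <= e.
Proof.
move=> d0 e0; pose y := (e^-1) `^ (d^-1).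
have y0 : 0 <= y by exact: powR_ge0.
exists (Num.bound y); rewrite powRN -[leRHS]invrK lef_pV2 ?posrE ?powR_gt0 ?invr_gt0 ?ltr0n//.
have -> : e^-1 = y `^ d by rewrite /y -powRrM mulVf ?gt_eqF// powRr1// invr_ge0 ltW.
apply: ge0_ler_powR; rewrite ?nnegrE ?(ltW d0)//.
by apply: le_trans (ltW (archi_boundP y0)) _; rewrite ler_nat.
Qed.

(** Bernoulli's inequality for [rho = 1 - 1 / (4 (N + 1))]. It turns the bound on the mean of
    [|phi|^(2N)] into a bound on the measure of [|phi| > rho]. *)
Lemma radius_power N : exists2 rho : R, 0 <= rho < 1 & 2^-1 <= rho ^+ (2 * N).
Proof.
pose h : R := (4 * N.+1%:R)^-1.
have n1 : 1 <= N.+1%:R :> R by rewrite ler1n.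
have h0 : 0 < h by rewrite invr_gt0 mulr_gt0// ltr0n.
have hN : h * (4 * N.+1%:R) = 1 by rewrite mulVf// gt_eqF// mulr_gt0// ltr0n.
have h1 : h <= 1 by rewrite invf_le1 ?mulr_gt0 ?ltr0n//; lra.
exists (1 - h); first by rewrite subr_ge0 h1 gtrBl h0.
have bern m : 1 - m%:R * h <= (1 - h) ^+ m.
  elim: m => [|m IH]; first by rewrite expr0 mul0r subr0.
  have p0 : 0 <= m%:R * h by rewrite mulr_ge0// ltW.
  have q0 : 0 <= 1 - h by rewrite subr_ge0.
  rewrite exprS; apply: le_trans (ler_wpM2l q0 IH); rewrite -natr1; nra.
apply: le_trans (bern _); rewrite natrM.
have : N%:R * h <= N.+1%:R * h by rewrite ler_wpM2r ?(ltW h0)// ler_nat.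
move: hN; set u := N.+1%:R * h; have -> : h * (4 * N.+1%:R) = 4 * u by rewrite /u; ring.
rewrite -mulrA; set v := N%:R * h; lra.
Qed.

Lemma psi_ge_linear y : 1 <= y -> psi 1 * y <= psi y.
Proof. by move=> y1; have := psi_star Psi_orlicz ltr01 y1; rewrite mulr1. Qed.

Lemma psi_unbounded M : exists2 X, 1 <= X & M < psi X.
Proof.
have p1 := psi_gt0 Psi_orlicz ltr01.
pose X := 1 + `|M| / psi 1.
have X1 : 1 <= X by rewrite lerDl divr_ge0// ltW.
exists X => //; apply: lt_le_trans (psi_ge_linear X1).
rewrite /X mulrDr mulr1 mulrCA mulfV ?gt_eqF// mulr1.
by apply: le_lt_trans (ler_norm M) _; rewrite ltrDr.
Qed.

Lemma psi_small_at0 (e : R) : 0 < e -> exists2 x, 0 < x & psi x <= e.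
Proof.
move=> e0; have p1 := psi_gt0 Psi_orlicz ltr01.
pose x := e / (psi 1 + e).
have q0 : 0 < psi 1 + e by exact: addr_gt0.
have x0 : 0 < x by exact: divr_gt0.
have x1 : x <= 1 by rewrite ler_pdivrMr// mul1r lerDr ltW.
exists x => //; have := psi_star Psi_orlicz x0 x1; rewrite mulr1 => /le_trans; apply.
rewrite /x mulrA ler_pdivrMr// mulrC; apply: ler_wpM2l; rewrite ?lerDl ltW//.
Qed.

Hypothesis Psi_growth : forall A eps : R, 1 < A -> 0 < eps ->
   (fun x : R => fine (Psi (A * x)%:E) : R^o) =O_ (pinfty_nbhs R)
   (fun x : R => fine (Psi x%:E) * (ln (fine (Psi x%:E)) `^ eps) : R^o).

(** Up to the threshold [X] the left side is below the constant [psi (A * X)], absorbed in [D]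
    because the weight is at least 1. Beyond [X] the growth hypothesis applies, and [psi x >= 1]
    makes the logarithm nonnegative. *)
Lemma psi_growth_dyadic A (d : R) : 1 < A -> 0 < d -> exists2 D, 0 <= D &
  forall x j, 0 <= x -> psi x <= 16 ^+ j.+2 -> psi (A * x) <= D * (j.+1%:R `^ d * 16 ^+ j.+1).
Proof.
move=> A1 d0; have := Psi_growth A1 d0; move/eqO_exP => [k k0 [X0 [_ hX0]]].
have [X1 X11 hX1] := psi_unbounded 1.
pose X := Num.max X1 (X0 + 1).
have [l1 l2] : X1 <= X /\ X0 + 1 <= X by rewrite !le_max !lexx orbT.
have X00 : 0 <= X by apply: le_trans l1; exact: le_trans ler01 X11.
have A0 : 0 < A by exact: lt_trans A1.
pose D := psi (A * X) + k * 16 * 32 `^ d.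
have D0 : 0 <= k * 16 * 32 `^ d by rewrite !mulr_ge0 ?powR_ge0// ltW.
exists D; first by rewrite addr_ge0.
move=> x j x0 hx.
have j1 : 1 <= j.+1%:R `^ d :> R.
  by rewrite -[leLHS](powRr0 (j.+1%:R : R)) ler_powR ?ler1n// ltW.
have e1 : 1 <= 16 ^+ j.+1 :> R by rewrite exprn_ege1// ler1n.
have je : 0 <= j.+1%:R `^ d * 16 ^+ j.+1 :> R by rewrite mulr_ge0 ?powR_ge0 ?exprn_ge0.
rewrite mulrDl; have [xX|Xx] := leP x X.
  apply: (@le_trans _ _ (psi (A * X))); first by rewrite psi_le// ler_pM2l.
  apply: (@le_trans _ _ (psi (A * X) * (j.+1%:R `^ d * 16 ^+ j.+1))).
    by rewrite ler_peMr// mulr_ege1.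
  by rewrite lerDl mulr_ge0.
have xX0 : X0 < x by apply: lt_trans Xx; lra.
have := hX0 x xX0; rewrite /= !psiE ?mulr_ge0 ?(ltW A0)//= ger0_norm// => h.
have p1 : 1 <= psi x by apply: ltW; apply: lt_le_trans hX1 (psi_le _); apply: le_trans l1 (ltW Xx).
have p0 : 0 < psi x by exact: lt_le_trans p1.
have ln0 : 0 <= ln (psi x) by rewrite ln_ge0.
rewrite ger0_norm in h; last by rewrite mulr_ge0 ?powR_ge0// ltW.
apply: le_trans h _; apply: (@le_trans _ _ (k * 16 * 32 `^ d * (j.+1%:R `^ d * 16 ^+ j.+1))); last first.
  by rewrite lerDr mulr_ge0.
(* [ln (16 ^+ j.+2) = (j+2) * ln 16], with [ln 16 <= 16] and [j + 2 <= 2 (j + 1)]. *)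
have lnb : ln (psi x) <= 32 * j.+1%:R.
  apply: (@le_trans _ _ (ln (16 ^+ j.+2))); first by rewrite ler_ln ?posrE ?exprn_gt0.
  rewrite lnXn// -[ln _ *+ _]mulr_natr; have l16 : ln (16 : R) <= 16 by apply/ltW/ln_sublinear.
  have n1 : 1 <= j.+1%:R :> R by rewrite ler1n.
  have l0 : 0 <= ln (16 : R) by rewrite ln_ge0// ler1n.
  by rewrite -[j.+2%:R]natr1; set u := j.+1%:R in n1 *; nra.
have lp : ln (psi x) `^ d <= 32 `^ d * j.+1%:R `^ d.
  by rewrite -powRM//; apply: ge0_ler_powR; rewrite ?nnegrE ?mulr_ge0// ltW.
have -> : k * 16 * 32 `^ d * (j.+1%:R `^ d * 16 ^+ j.+1) = k * (16 ^+ j.+2 * (32 `^ d * j.+1%:R `^ d)).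
  by rewrite [16 ^+ j.+2]exprS; ring.
by apply: (ler_wpM2l (ltW k0)); apply: (ler_pM (ltW p0) (powR_ge0 _ _) hx lp).
Qed.

Lemma root4M (a b : R) : 0 <= a -> root4 (a * b) = root4 a * root4 b.
Proof. by move=> a0; rewrite /root4 sqrtrM// sqrtrM// sqrtr_ge0. Qed.

(* y |-> root4 (psi (y ^ 4)) satisfies the hypotheses of poisson_star, and
   root4 |F| is below the Poisson mean of its boundary values. *)
Lemma orlicz_root4 F M z : holo F ->
  (forall r, 0 <= r < 1 -> mint (fun t => cabs (circ F r t)) <= M) ->
  intg (fun t => psi (cabs (bdf F t) / 8)) -> cabs z < 1 ->
  root4 (psi (cabs (F z) / 128)) <= mint (fun t => pois z t * root4 (psi (cabs (bdf F t) / 8))).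
Proof.
move=> hF FM ipsi z1; have [iB _ _] := hardy1_boundary hF FM.
pose u t := root4 (cabs (bdf F t) / 8); pose f y := root4 (psi (y ^+ 4)).
have u80 t : 0 <= cabs (bdf F t) / 8 by rewrite divr_ge0// cabs_ge0.
have fu t : f (u t) = root4 (psi (cabs (bdf F t) / 8)) by rewrite /f /u root4X.
have iu : intg u.
  apply: root4_intg => //; under [X in intg X]eq_fun do rewrite mulrC.
  by apply: intgZ; exact: cintg_cabs.
have ifu : intg (fun t => f (u t)).
  under [X in intg X]eq_fun do rewrite fu.
  by apply: root4_intg => // t; exact: psi_ge0.
(* The factor 2 lost in [poisson_star] becomes [2 ^+ 4 = 16] after the fourth power, so 8 turns into
   128. *)
pose b := root4 (cabs (F z) / 8) / 2.
have b4 : b ^+ 4 = cabs (F z) / 128.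
  rewrite /b expr_div_n root4X ?divr_ge0 ?cabs_ge0//.
  by rewrite -mulrA -invfM; congr (_ / _); rewrite -natrX -natrM.
have -> : root4 (psi (cabs (F z) / 128)) = f b by rewrite /f b4.
rewrite (mint_eq (g := fun t => pois z t * f (u t))); last by move=> t; rewrite fu.
apply: (poisson_star z1 (f := f)) => //.
- by rewrite /f expr0n /= psi0// /root4 !sqrtr0.
- by move=> y; exact: root4_ge0.
- move=> c y c0 cy; have y0 : 0 <= y by apply: le_trans cy; exact: ltW.
  have c4 : 0 < c ^+ 4 by exact: exprn_gt0.
  have cy4 : c ^+ 4 <= y ^+ 4 by rewrite lerXn2r// nnegrE ltW.
  rewrite -(@ler_pXn2r _ 4)// ?nnegrE ?mulr_ge0 ?root4_ge0 ?(ltW c0)//.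
  by rewrite !exprMn /f !root4X//; exact: psi_star.
- by move=> t; exact: root4_ge0.
- by rewrite divr_ge0// root4_ge0.
rewrite /b mulrCA mulfV ?mulr1 ?pnatr_eq0//.
rewrite root4M ?cabs_ge0// mulrC (mint_eq (g := fun t => root4 8^-1 * (pois z t * root4 (cabs (bdf F t))))).
  have ir : intg (fun t => root4 (cabs (bdf F t))).
    by apply: root4_intg; [move=> t; exact: cabs_ge0|exact: cintg_cabs].
  rewrite (mintZ _ (pois_intgM z1 ir)) ler_wpM2l ?root4_ge0//; exact: hardy1_root4 FM z1.
by move=> t; rewrite /u root4M ?cabs_ge0// [RHS]mulrC mulrA.
Qed.

Lemma psi_poisson F M c z : holo F ->
  (forall r, 0 <= r < 1 -> mint (fun t => cabs (circ F r t)) <= M) -> 0 < c ->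
  intg (fun t => psi (cabs (bdf F t) / c)) -> cabs z < 1 ->
  psi (cabs (F z) / (2 * c)) <= mint (fun t => pois z t * psi (cabs (bdf F t) / c)).
Proof.
move=> hF FM c0 ipsi z1; have [iB _ _] := hardy1_boundary hF FM; have iC := cintg_cabs iB.
have iu : intg (fun t => cabs (bdf F t) / c).
  by under [X in intg X]eq_fun do rewrite mulrC; exact: intgZ.
apply: (poisson_star z1 (f := psi) (u := fun t => cabs (bdf F t) / c)) => //.
- exact: psi0.
- exact: psi_star.
- by move=> t; rewrite divr_ge0 ?cabs_ge0// ltW.
- by rewrite divr_ge0 ?cabs_ge0// mulr_ge0// ltW.
have -> : 2 * (cabs (F z) / (2 * c)) = c^-1 * cabs (F z) by field; rewrite gt_eqF.
rewrite (mint_eq (g := fun t => c^-1 * (pois z t * cabs (bdf F t)))); last by move=> t; ring.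
rewrite (mintZ _ (pois_intgM z1 iC)) ler_wpM2l ?invr_ge0 ?(ltW c0)//.
exact: hardy1_le_poisson FM z1.
Qed.

Lemma psi_circ_intg F c r : holo F -> 0 <= r < 1 -> intg (fun t => psi (cabs (circ F r t) / c)).
Proof.
move=> hF /andP[r0 r1]; apply: intg_cts => t.
apply: (continuous_comp (f := fun t => cabs (circ F r t) / c) (g := psi)).
  by apply: cvgM; [exact: (ccts_cabs (holo_ccts hF r0 r1) (x := t))|exact: cvg_cst].
exact: psi_cts.
Qed.

Lemma psi_fatou F M c S : holo F ->
  (forall r, 0 <= r < 1 -> mint (fun t => cabs (circ F r t)) <= M) ->
  (forall r, 0 <= r < 1 -> mint (fun t => psi (cabs (circ F r t) / c)) <= S) ->
  intg (fun t => psi (cabs (bdf F t) / c)) /\ mint (fun t => psi (cabs (bdf F t) / c)) <= S.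
Proof.
move=> hF FM hS; have [iB _ rl] := hardy1_boundary hF FM.
have r01 n : 0 <= (1 - n.+1%:R^-1 : R) < 1.
  by rewrite subr_ge0 invf_le1 ?ler1n//= gtrBl invr_gt0.
apply: (@mint_fatou _ (fun n t => psi (cabs (circ F (1 - n.+1%:R^-1) t) / c))).
- by move=> n; exact: psi_circ_intg.
- by move=> n t; exact: psi_ge0.
- apply: psi_meas => //; apply: measurable_funM; last exact: measurable_cst.
  by apply: cmeas_cabs; exact: bdf_meas.
- by move=> t; exact: psi_ge0.
- by move=> n; exact: hS.
apply: aeS rl => t /radlim_seq h; have {}h := cvg_cabs eventually_filter h.
have h2 : cabs (F ((1 - n.+1%:R^-1)%:C * expi t)) / c @[n --> \oo] --> cabs (bdf F t) / c.
  by apply: cvgM; [exact: h|exact: cvg_cst].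
by apply: (cvg_comp _ _ h2); exact: psi_cts.
Qed.

Variable phi : disk R -> disk R.
Local Notation Phi := (extend (fun y => val (phi y))).
Hypothesis phi_analytic : analytic (fun y => val (phi y)).
Hypothesis phi_schatten : exists p : R, 0 < p /\ schatten_class (hardy 2) (@hardy2_ip R) p (comp_op phi).

(** The mean is split as 1/2 + 1/4 + 1/4: high levels; points with [|phi| <= rho], where [F] is
    small; and the rest, where [F o phi] is bounded and which has small measure. The order of choice
    is [j1], then the bound [B1], then [N] and [rho], and [eta]; none depends on [F], [M] or [r]. *)
Lemma composed_orlicz_estimate A : 1 < A -> exists rho eta, [/\ 0 <= rho < 1, 0 < eta &
  forall F M, holo F -> (forall r, 0 <= r < 1 -> mint (fun t => cabs (circ F r t)) <= M) ->
    intg (fun t => psi (cabs (bdf F t) / 8)) -> mint (fun t => psi (cabs (bdf F t) / 8)) <= 1 ->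
    (forall z, cabs z <= rho -> cabs (F z) <= eta) ->
    forall r, 0 <= r < 1 -> mint (fun s => psi (A * cabs (F (circ Phi r s)))) <= 1].
Proof.
move=> A1; have A0 : 0 < A by exact: lt_trans A1.
have [d [B [d0 B0 decay radial]]] := schatten_kernel_decay phi_analytic phi_schatten.
have d20 : 0 < d / 2 by exact: divr_gt0.
have A'1 : 1 < 128 * A by lra.
have [D D0 hD] := psi_growth_dyadic A'1 d20.
have [W W0 eW] : exists2 W : R, 0 <= W & W = D * (1152 * B).
  exists (D * (1152 * B)); last reflexivity.
  exact: (mulr_ge0 D0 (mulr_ge0 (ler0n _ _) B0)).
have q0 : 0 < (2 * (W + 1))^-1 by rewrite invr_gt0 mulr_gt0// ltr_wpDl.
have [j1 hj1] := powR_decay_small d20 q0.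
(* Off the level set, [psi (|F| / 128)] is at most [T1], the fourth power of the threshold; as
   [psi X1 > T1], monotonicity forces [|F| / 128 <= X1] there. *)
pose T1 : R := (2 ^+ j1.+1) ^+ 4.
have [X1 X11 hX1] := psi_unbounded T1.
pose B1 := psi (128 * A * X1).
have B10 : 0 <= B1 by exact: psi_ge0.
have BB0 : 0 <= B1 * B by exact: mulr_ge0.
have q1 : 0 < (8 * (B1 * B + 1))^-1 by rewrite invr_gt0 mulr_gt0// ltr_wpDl.
have [N hN] := powR_decay_small d0 q1.
have [rho rho01 hrho] := radius_power N.
have q2 : 0 < 4^-1 :> R by rewrite invr_gt0.
have [x0 x00 hx0] := psi_small_at0 q2.
have /andP[rho0 rho1] := rho01.
exists rho, (x0 / A); split => //; first exact: divr_gt0.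
move=> F M hF FM ipsi psi1 small r r01; have /andP[r0 r1] := r01.
set Z := circ Phi r.
have Z1 s : cabs (Z s) < 1 by apply: self_map_lt1; rewrite cabs_circle.
pose G t := root4 (psi (cabs (bdf F t) / 8)).
have G0 t : 0 <= G t by exact: root4_ge0.
have G4 t : G t ^+ 4 = psi (cabs (bdf F t) / 8) by rewrite /G root4X// psi_ge0.
have mG : measurable_fun setT G by apply: root4_meas; exact: intg_meas ipsi.
have iG4 : intg (fun t => G t ^+ 4) by under [X in intg X]eq_fun do rewrite G4.
have G41 : mint (fun t => G t ^+ 4) <= 1 by rewrite (mint_eq G4).
pose f s := psi (A * cabs (F (Z s))).
have fE s : f s = psi (128 * A * (cabs (F (Z s)) / 128)) by rewrite /f; congr psi; field.
have x0s s : 0 <= cabs (F (Z s)) / 128 by rewrite divr_ge0// cabs_ge0.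
have up s : psi (cabs (F (Z s)) / 128) <= pmean phi G r s ^+ 4.
  rewrite -[leLHS]root4X ?psi_ge0// lerXn2r ?nnegrE ?root4_ge0//.
    by apply: mint_ge0 => t; rewrite mulr_ge0// pois_ge0.
  exact: orlicz_root4 FM ipsi (Z1 s).
have hol : holo (fun z => F (Phi z)).
  by move=> z z1; apply: (cdiff_comp (holo_Phi phi_analytic z1)); apply: hF; exact: self_map_lt1.
have if' : intg f.
  have := psi_circ_intg A^-1 hol r01; rewrite invrK.
  by under [X in intg X -> _]eq_fun do rewrite mulrC.
have f0 s : 0 <= f s by exact: psi_ge0.
have pg s : 0 <= pmean phi G r s by apply: mint_ge0 => t; rewrite mulr_ge0// pois_ge0.
have fj s j : pmean phi G r s <= 2 ^+ j.+2 -> f s <= D * (j.+1%:R `^ (d / 2) * 16 ^+ j.+1).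
  move=> h; rewrite fE; apply: hD => //; apply: le_trans (up s) _.
  have e4 : 2 ^+ 4 = 16 :> R by rewrite -natrX.
  have -> : 16 ^+ j.+2 = (2 ^+ j.+2) ^+ 4 :> R by rewrite -exprM mulnC exprM e4.
  by rewrite lerXn2r ?nnegrE ?exprn_ge0.
have [il hl] := level_integral_bound phi_analytic d0 B0 decay r01 mG G0 iG4 G41 j1 (intg_meas if') f0 D0 fj.
have mZ := ccts_meas (holo_ccts (holo_Phi phi_analytic) r0 r1).
have iZ : intg (fun s => cabs (Z s) ^+ (2 * N)).
  apply: (intg_bounded (M := 1)); first by apply: measurable_funX; exact: cmeas_cabs.
  by move=> s; rewrite ger0_norm ?exprn_ge0 ?cabs_ge0// exprn_ile1 ?cabs_ge0// ltW.
have pw s : f s <= f s * level phi G r j1.+1 s + (4^-1 + B1 * 2 * cabs (Z s) ^+ (2 * N)).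
  have zn : 0 <= B1 * 2 * cabs (Z s) ^+ (2 * N) by rewrite !mulr_ge0 ?exprn_ge0 ?cabs_ge0.
  rewrite /level; case: ltP => [_|h]; first by rewrite mulr1 lerDl addr_ge0.
  rewrite mulr0 add0r; have [zr|zr] := leP (cabs (Z s)) rho.
    apply: (@le_trans _ _ 4^-1); last by rewrite lerDl.
    apply: le_trans hx0; apply: psi_le; have := small _ zr; rewrite ler_pdivlMr// mulrC.
    by [].
  apply: (@le_trans _ _ (B1 * 2 * cabs (Z s) ^+ (2 * N))); last by rewrite lerDr.
  apply: (@le_trans _ _ B1).
    rewrite fE; apply: psi_le; rewrite ler_pM2l ?mulr_gt0//.
    rewrite leNgt; apply/negP => X1x; have := psi_le (ltW X1x); apply/negP; rewrite -ltNge.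
    apply: le_lt_trans hX1; apply: le_trans (up s) _.
    by rewrite /T1 lerXn2r ?nnegrE ?exprn_ge0.
  (* Chebyshev's inequality in pointwise form: where [|Z| > rho], [2 * |Z|^(2N)] is at least
     [2 * rho^(2N) >= 1]. *)
  rewrite -mulrA ler_peMr//; apply: (@le_trans _ _ (2 * rho ^+ (2 * N))); first by rewrite -[leLHS](@mulfV _ (2 : R)) ?pnatr_eq0// ler_pM2l.
  by rewrite ler_pM2l// lerXn2r// ?nnegrE ?cabs_ge0// ltW.
have i3 : intg (fun s => 4^-1 + B1 * 2 * cabs (Z s) ^+ (2 * N)).
  by apply: intgD; [exact: intg_cst|exact: intgZ].
apply: le_trans (mint_le if' (intgD il i3) pw) _.
rewrite (mintD il i3) (mintD (intg_cst _) (intgZ _ iZ)) mint_cst (mintZ _ iZ).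
have b1 : mint (fun s => f s * level phi G r j1.+1 s) <= 2^-1.
  apply: le_trans hl _; move: hj1; set w := _ `^ _ => hj1.
  have w0 : 0 <= w by exact: powR_ge0.
  have -> : D * (1152 * B * w) = w * W by rewrite eW mulrA [LHS]mulrC mulrA.
  move: hj1; rewrite -[_^-1]mul1r ler_pdivlMr ?mulr_gt0 ?ltr_wpDl// => hj1.
  clear -w0 W0 hj1; nra.
have b2 : B1 * 2 * mint (fun s => cabs (Z s) ^+ (2 * N)) <= 4^-1.
  apply: le_trans (ler_wpM2l _ (radial r N r01)) _; first by rewrite mulr_ge0.
  move: hN; set w := _ `^ _ => hN.
  have w0 : 0 <= w by exact: powR_ge0.
  move: hN; rewrite -[_^-1]mul1r ler_pdivlMr ?mulr_gt0 ?ltr_wpDl// => hN.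
  have -> : B1 * 2 * (B * w) = w * (2 * (B1 * B)) by ring.
  move: (B1 * B) BB0 hN => y y0 hN; clear -w0 y0 hN; nra.
have e1 : 2^-1 + (4^-1 + 4^-1) = 1 :> R by field.
rewrite -[leRHS]e1; exact: (lerD b1 (lerD (lexx _) b2)).
Qed.

End Compactness.

(** * From pointwise to locally uniform convergence *)

Section LocallyUniform.
Context (R : realType).
Local Notation C := R[i].
Implicit Types (F : C -> C) (z : C) (r rho M : R).

Lemma cauchy_bound F rho z : holo F -> 0 <= rho < 1 -> cabs z <= rho ->
  cabs (F z) <= 2 / (1 - rho) * mint (fun t => cabs (circ F ((1 + rho) / 2) t)).
Proof.
move=> hF /andP[rho0 rho1] zr; pose r := (1 + rho) / 2.
have r0 : 0 < r by rewrite /r; lra.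
have r1 : r < 1 by rewrite /r; lra.
have rC : r%:C != 0 :> C by rewrite -cabs_eq0 cabs_nneg ?gt_eqF// ltW.
have zr1 : cabs (z / r%:C) <= rho / r.
  by rewrite cabsM cabsV cabs_nneg ?(ltW r0)// ler_wpM2r ?invr_ge0 ?(ltW r0).
have rr : rho / r < 1 by rewrite ltr_pdivrMr// mul1r /r; lra.
have k0 : 0 < 1 - rho / r by rewrite subr_gt0.
have z1 : cabs (z / r%:C) < 1 by exact: le_lt_trans rr.
have ic := holo_cintg hF (ltW r0) r1.
have ii := cauchy_cintg z1 ic.
have := cauchy_formula hF (ltW r0) r1 z1; rewrite mulrC divfK// => ->.
apply: le_trans (cabs_cavg ii) _; rewrite -(mintZ _ (cintg_cabs ic)).
apply: (mint_le (cintg_cabs ii) (intgZ _ (cintg_cabs ic))) => t.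
rewrite cabsM ler_wpM2r ?cabs_ge0//; apply: le_trans (cabs_cauchy_kernel t z1) _.
apply: (@le_trans _ _ (1 - rho / r)^-1); first by rewrite lef_pV2 ?posrE ?subr_gt0// lerD2l lerN2.
have q0 : 0 < 1 - rho by rewrite subr_gt0.
have -> : (1 - rho / r)^-1 = (1 + rho) / (1 - rho).
  by rewrite /r; field; rewrite !gt_eqF//; lra.
by rewrite ler_wpM2r ?invr_ge0 ?(ltW q0)//; lra.
Qed.

(** Dominated convergence on one circle gives convergence in the mean there, and [cauchy_bound]
    converts it into uniform convergence inside. *)
Lemma locally_uniform (W_ : nat -> C -> C) M : (forall k, holo (W_ k)) ->
  (forall k r, 0 <= r < 1 -> mint (fun t => cabs (circ (W_ k) r t)) <= M) ->
  (forall z, cabs z < 1 -> (W_ k z : C^o) @[k --> \oo] --> (0 : C^o)) ->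
  forall rho eta : R, 0 <= rho < 1 -> 0 < eta ->
  exists J, forall k z, (J <= k)%N -> cabs z <= rho -> cabs (W_ k z) <= eta.
Proof.
move=> hW WM W0 rho eta /andP[rho0 rho1] eta0; pose r := (1 + rho) / 2.
have r0 : 0 <= r by rewrite /r; lra.
have r1 : r < 1 by rewrite /r; lra.
pose r' := (1 + r) / 2.
have rr1 : 0 <= r' < 1 by rewrite /r'; apply/andP; split; lra.
have q0 : 0 < 1 - rho by rewrite subr_gt0.
pose B := 2 / (1 - r) * M.
have [_ _ lim0] : [/\ intg (fun=> 0 : R), forall k, intg (fun t => cabs (circ (W_ k) r t)) &
    mint (fun t => cabs (circ (W_ k) r t)) @[k --> \oo] --> mint (fun=> 0 : R)].
  apply: (@mint_dct _ _ _ (fun=> B)).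
  - by move=> k; exact: cmeas_cabs (ccts_meas (holo_ccts (hW k) r0 r1)).
  - exact: measurable_cst.
  - exact: intg_cst.
  - apply: aeT => t; have z1 : cabs (r%:C * expi t : C) < 1 by rewrite cabs_circle.
    by have := cvg_cabs eventually_filter (W0 _ z1); rewrite cabs0.
  - move=> k; apply: aeT => t; rewrite ger0_norm ?cabs_ge0//.
    apply: le_trans (cauchy_bound (rho := r) (hW k) _ _) _; first by rewrite r0.
      by rewrite cabs_circle.
    by rewrite ler_wpM2l ?WM// divr_ge0// subr_ge0 ltW.
rewrite mint_cst in lim0.
have d0 : 0 < eta * (1 - rho) / 2 by rewrite divr_gt0// mulr_gt0.
move/cvgrPdist_le : lim0 => /(_ _ d0)[J _ hJ].
exists J => k z Jk zr; have rho01 : 0 <= rho < 1 by rewrite rho0.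
apply: le_trans (cauchy_bound (hW k) rho01 zr) _.
have := hJ k Jk; rewrite /= sub0r normrN => h; have {h} := le_trans (ler_norm _) h.
rewrite -/r => h; apply: le_trans (ler_wpM2l _ h) _; first by rewrite divr_ge0// ltW.
by rewrite le_eqVlt; apply/orP; left; apply/eqP; field; rewrite gt_eqF.
Qed.

End LocallyUniform.

(** * The composition operator on the Hardy-Orlicz space *)

Section OrliczComposition.
Context (R : realType) (Psi : \bar R -> \bar R).
Local Notation C := R[i].
Hypothesis Psi_orlicz : orlicz_function Psi.
Local Notation psi := (psi Psi).
Implicit Types (F : C -> C) (z : C) (r c A M S : R).

Let psi_ge0 := psi_ge0 Psi_orlicz.
Let psi_le := psi_le Psi_orlicz.

Lemma pois0 t : pois 0 t = 1 :> R.
Proof. by rewrite /pois cabs0 expr0n !subr0 cabs_expi expr1n divr1. Qed.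

Section SelfMap.
Variable Phi : C -> C.
Hypothesis hPhi : holo Phi.
Hypothesis Phi1 : forall z, cabs z < 1 -> cabs (Phi z) < 1.

Lemma holo_comp_self F : holo F -> holo (fun z => F (Phi z)).
Proof. by move=> hF z z1; apply: (cdiff_comp (hPhi z1)); apply: hF; exact: Phi1. Qed.

(** The bound does not depend on [r], since subordination evaluates the mean of a composed Poisson
    integral at [Phi 0]. *)
Lemma mean_cabs_comp F M r : holo F ->
  (forall r, 0 <= r < 1 -> mint (fun t => cabs (circ F r t)) <= M) -> 0 <= r < 1 ->
  mint (fun s => cabs (F (circ Phi r s))) <= mint (fun t => pois (Phi 0) t * cabs (bdf F t)).
Proof.
move=> hF FM r01; have /andP[r0 r1] := r01; have [iB _ _] := hardy1_boundary hF FM.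
have [is' <-] := subordination hPhi Phi1 r01 (cintg_cabs iB) (fun t => cabs_ge0 _).
apply: (mint_le _ is').
  exact: (cintg_cabs (holo_cintg (holo_comp_self hF) r0 r1)).
by move=> s; apply: (hardy1_le_poisson hF FM); apply: Phi1; rewrite cabs_circle.
Qed.

Lemma mean_psi_comp F M c r : holo F ->
  (forall r, 0 <= r < 1 -> mint (fun t => cabs (circ F r t)) <= M) -> 0 < c ->
  intg (fun t => psi (cabs (bdf F t) / c)) -> 0 <= r < 1 ->
  mint (fun s => psi (cabs (F (circ Phi r s)) / (2 * c))) <=
  mint (fun t => pois (Phi 0) t * psi (cabs (bdf F t) / c)).
Proof.
move=> hF FM c0 ipsi r01; have /andP[r0 r1] := r01.
have [is' <-] := subordination hPhi Phi1 r01 ipsi (fun t => psi_ge0 _).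
apply: (mint_le _ is').
  exact: (psi_circ_intg Psi_orlicz (2 * c) (holo_comp_self hF) r01).
by move=> s; apply: (psi_poisson Psi_orlicz hF FM c0 ipsi); apply: Phi1; rewrite cabs_circle.
Qed.

End SelfMap.

Lemma hardy_orlicz_of_means (f : disk R -> C) M c S : holo (extend f) ->
  (forall r, 0 <= r < 1 -> mint (fun t => cabs (circ (extend f) r t)) <= M) -> 0 < c ->
  (forall r, 0 <= r < 1 -> mint (fun t => psi (cabs (circ (extend f) r t) / c)) <= S) ->
  hardy_orlicz Psi f.
Proof.
move=> hF FM c0 FS; apply/(hardy_orliczP Psi_orlicz); split => //; first by exists M.
by exists c => //; have [] := psi_fatou Psi_orlicz hF FM FS.
Qed.

Lemma hardy_orlicz_comp (phi : disk R -> disk R) f : analytic (fun y => val (phi y)) ->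
  hardy_orlicz Psi f -> hardy_orlicz Psi (comp_op phi f).
Proof.
move=> hphi /(hardy_orliczP Psi_orlicz)[hF [M FM] [c c0 ic]].
have hP := holo_Phi hphi; have P1 := self_map_lt1 phi.
apply: (@hardy_orlicz_of_means _
  (mint (fun t => pois (extend (fun y => val (phi y)) 0) t * cabs (bdf (extend f) t))) (2 * c)
  (mint (fun t => pois (extend (fun y => val (phi y)) 0) t * psi (cabs (bdf (extend f) t) / c)))).
- exact: holo_extend_comp.
- move=> r r01; under [X in mint X]eq_fun do rewrite circ_extend_comp//.
  exact: (mean_cabs_comp hP P1 hF FM r01).
- exact: mulr_gt0.
- move=> r r01; under [X in mint X]eq_fun do rewrite circ_extend_comp//.
  exact: (mean_psi_comp hP P1 hF FM c0 ic r01).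
Qed.

Lemma le_psi y : y <= 1 + psi y / psi 1.
Proof.
have p1 := psi_gt0 Psi_orlicz ltr01.
have q0 : 0 <= psi y / psi 1 by rewrite divr_ge0// ltW.
have [y1|y1] := leP 1 y; last by apply: le_trans (ltW y1) _; rewrite lerDl.
have : y <= psi y / psi 1 by rewrite ler_pdivlMr// mulrC; exact: psi_ge_linear.
by move=> h; apply: le_trans h _; rewrite lerDr.
Qed.

Lemma hardy_orlicz_ball (f : disk R -> C) : hardy_orlicz Psi f -> (hardy_orlicz_norm Psi f <= 1)%E ->
  [/\ holo (extend f),
      forall r, 0 <= r < 1 -> mint (fun t => cabs (circ (extend f) r t)) <= 2 * (1 + (psi 1)^-1) &
      forall r, 0 <= r < 1 -> mint (fun t => psi (cabs (circ (extend f) r t) / 4)) <= 1].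
Proof.
move=> /(hardy_orliczP Psi_orlicz)[hF [M FM] _] n1.
have [ip p1] := luxemburg_ball Psi_orlicz hF n1.
(* With the identity as self-map, the composition estimates bound the circle means of [f] itself.
   The constant 4 collects the 2 of [luxemburg_ball] and the 2 of [psi_poisson]. *)
have hid : holo (fun z : C => z) by move=> z _; exact: cdiff_id.
have id1 z : cabs z < 1 -> cabs z < 1 by [].
have [iB _ _] := hardy1_boundary hF FM; have q0 := psi_gt0 Psi_orlicz ltr01.
split => // r r01.
  apply: le_trans (mean_cabs_comp hid id1 hF FM r01) _.
  have i2 : intg (fun t => 2 * (1 + (psi 1)^-1 * psi (cabs (bdf (extend f) t) / 2))).
    by apply: intgZ; apply: intgD; [exact: intg_cst|exact: intgZ].
  apply: (@le_trans _ _ (mint (fun t => 2 * (1 + (psi 1)^-1 * psi (cabs (bdf (extend f) t) / 2))))).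
    apply: (mint_le _ i2); first by apply: pois_intgM; [rewrite cabs0|exact: cintg_cabs].
    move=> t; rewrite pois0 mul1r; have := le_psi (cabs (bdf (extend f) t) / 2).
    by rewrite ler_pdivrMr// [_ * 2]mulrC [_ / psi 1]mulrC.
  rewrite mintZ; last by apply: intgD; [exact: intg_cst|exact: intgZ].
  rewrite (mintD (intg_cst _) (intgZ _ ip)) mint_cst (mintZ _ ip).
  by rewrite ler_wpM2l// lerD2l ler_piMr ?invr_ge0// ltW.
have -> : 4 = 2 * 2 :> R by rewrite -natrM.
apply: le_trans (mean_psi_comp hid id1 hF FM _ ip r01) _ => //.
by rewrite (mint_eq (g := fun t => psi (cabs (bdf (extend f) t) / 2)))// => t; rewrite pois0 mul1r.
Qed.

Lemma extendB (f g : disk R -> C) z : extend (f - g) z = extend f z - extend g z.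
Proof. by rewrite /extend; case: insub => [w|] //=; rewrite subr0. Qed.

Lemma luxemburg_ge0 g : (0 <= luxemburg_norm Psi g)%E.
Proof. by apply: le_ereal_inf_tmp => _ [c [c0 _] <-]; rewrite lee_fin ltW. Qed.

(** The reciprocal form of the bound matches [psi (A |F o phi|)] in [composed_orlicz_estimate],
    where [A] is arbitrary. *)
Lemma cvg_norm0 (x : nat -> \bar R) : (forall k, 0 <= x k)%E ->
  (forall A, 1 < A -> exists J, forall k, (J <= k)%N -> (x k <= (A^-1)%:E)%E) ->
  x k @[k --> \oo] --> 0%E.
Proof.
move=> x0 h; apply/fine_cvgP; split.
  have [J hJ] := h 2 (ltr1n R 2); exists J => // k /hJ xk.
  by rewrite ge0_fin_numE//; apply: le_lt_trans xk (ltry _).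
apply/cvgrPdist_le => e e0; pose A := 1 + e^-1.
have ei : 0 < e^-1 by rewrite invr_gt0.
have [J hJ] := h A (ltr_pwDr ei (lexx 1)); exists J => // k /hJ xk /=.
have fx : x k \is a fin_num by rewrite ge0_fin_numE//; apply: le_lt_trans xk (ltry _).
rewrite sub0r normrN ger0_norm ?fine_ge0//; rewrite -(fineK fx) lee_fin in xk.
apply: le_trans xk _; rewrite -[leRHS]invrK lef_pV2 ?posrE//; last by rewrite addr_gt0.
by rewrite lerDr.
Qed.

Hypothesis Psi_growth : forall A eps : R, 1 < A -> 0 < eps ->
   (fun x : R => fine (Psi (A * x)%:E) : R^o) =O_ (pinfty_nbhs R)
   (fun x : R => fine (Psi x%:E) * (ln (fine (Psi x%:E)) `^ eps) : R^o).
Variable phi : disk R -> disk R.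
Local Notation Phi := (extend (fun y => val (phi y))).
Hypothesis phi_analytic : analytic (fun y => val (phi y)).
Hypothesis phi_schatten : exists p : R, 0 < p /\ schatten_class (hardy 2) (@hardy2_ip R) p (comp_op phi).

(** Montel's theorem gives [v], and Fatou's lemma passes the circle bounds with constant 4 on to it.
    By convexity [psi] of half a sum is at most the half sum, so differences satisfy the same bound
    with constant 8, the one required by [composed_orlicz_estimate]. *)
Lemma hardy_orlicz_subsequence (u : nat -> disk R -> C) :
  (forall n, hardy_orlicz Psi (u n) /\ (hardy_orlicz_norm Psi (u n) <= 1)%E) ->
  exists (ka : nat -> nat) v M, [/\ {homo ka : m n / (m < n)%N}, hardy_orlicz Psi v &
    (forall z, cabs z < 1 -> (extend (u (ka k) - v) z : C^o) @[k --> \oo] --> (0 : C^o)) /\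
    forall k, [/\ holo (extend (u (ka k) - v)),
      forall r, 0 <= r < 1 -> mint (fun t => cabs (circ (extend (u (ka k) - v)) r t)) <= M &
      forall r, 0 <= r < 1 -> mint (fun t => psi (cabs (circ (extend (u (ka k) - v)) r t) / 8)) <= 1]].
Proof.
move=> hu; pose F k := extend (u k); pose L := 2 * (1 + (psi 1)^-1).
have hb k := hardy_orlicz_ball (hu k).1 (hu k).2.
have hF k : holo (F k) by have [] := hb k.
have FL k r : 0 <= r < 1 -> mint (fun t => cabs (circ (F k) r t)) <= L by have [_ h _] := hb k; exact: h.
have Fp k r : 0 <= r < 1 -> mint (fun t => psi (cabs (circ (F k) r t) / 4)) <= 1 by have [_ _ h] := hb k; exact: h.
have [|ka [G0 [ka_mono hG0 cG0]]] := montel hF.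
  move=> r r01; exists (2 / (1 - r) * L) => k z zr; have /andP[r0 r1] := r01.
  apply: le_trans (cauchy_bound (hF k) r01 zr) _.
  rewrite ler_wpM2l ?divr_ge0 ?subr_ge0 ?(ltW r1)//; apply: FL.
  by apply/andP; split; lra.
pose v := restrict G0; pose G := extend v.
have eG z : cabs z < 1 -> G z = G0 z by exact: extend_restrict.
have hG : holo G by apply: holo_eq hG0 => z /eG.
have cG z : cabs z < 1 -> (F (ka k) z : C^o) @[k --> \oo] --> (G z : C^o).
  by move=> z1; rewrite (eG z z1); exact: cG0.
have cGr r t : 0 <= r < 1 -> cabs (circ (F (ka k)) r t) @[k --> \oo] --> cabs (circ G r t).
  by move=> /andP[r0 r1]; apply: (cvg_cabs eventually_filter); apply: cG; rewrite cabs_circle.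
have GL r : 0 <= r < 1 -> mint (fun t => cabs (circ G r t)) <= L.
  move=> r01; have /andP[r0 r1] := r01.
  have [] // := @mint_fatou _ (fun k t => cabs (circ (F (ka k)) r t)) (fun t => cabs (circ G r t)) L.
  - by move=> k; exact: cintg_cabs (holo_cintg (hF _) r0 r1).
  - by move=> k t; exact: cabs_ge0.
  - exact: cmeas_cabs (ccts_meas (holo_ccts hG r0 r1)).
  - by move=> t; exact: cabs_ge0.
  - by move=> k; exact: FL.
  - by apply: aeT => t; exact: cGr.
have Gp r : 0 <= r < 1 -> mint (fun t => psi (cabs (circ G r t) / 4)) <= 1.
  move=> r01.
  have [] // := @mint_fatou _ (fun k t => psi (cabs (circ (F (ka k)) r t) / 4))
    (fun t => psi (cabs (circ G r t) / 4)) 1.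
  - by move=> k; exact: psi_circ_intg.
  - by apply: intg_meas; exact: psi_circ_intg.
  - by move=> k; exact: Fp.
  apply: aeT => t; have h2 : cabs (circ (F (ka k)) r t) / 4 @[k --> \oo] --> cabs (circ G r t) / 4.
    by apply: cvgM; [exact: cGr|exact: cvg_cst].
  by apply: (cvg_comp _ _ h2); exact: psi_cts.
have eW k : extend (u (ka k) - v) = fun z => F (ka k) z - G z by apply/funext => z; exact: extendB.
have four0 : 0 < 4 :> R by [].
exists ka, v, (L + L); split; [exact: ka_mono| |].
  exact: (hardy_orlicz_of_means hG GL four0 Gp).
split=> [z z1|k].
  apply/cvg_cabsP => e e0; move/cvg_cabsP : (cG z z1) => /(_ _ e0)[J _ hJ].
  by exists J => // k Jk /=; rewrite eW subr0; exact: hJ.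
rewrite eW; split.
- by move=> z z1; apply: cdiffB; [exact: hF|exact: hG].
- move=> r r01; have /andP[r0 r1] := r01.
  have iF := cintg_cabs (holo_cintg (hF (ka k)) r0 r1); have iG := cintg_cabs (holo_cintg hG r0 r1).
  apply: (@le_trans _ _ (mint (fun t => cabs (circ (F (ka k)) r t) + cabs (circ G r t)))).
    apply: (mint_le _ (intgD iF iG)).
      by apply: cintg_cabs; exact: (cintgB (holo_cintg (hF (ka k)) r0 r1) (holo_cintg hG r0 r1)).
    by move=> t; exact: cabsB.
  by rewrite (mintD iF iG); apply: lerD; [exact: FL|exact: GL].
- move=> r r01.
  have iF := psi_circ_intg Psi_orlicz 4 (hF (ka k)) r01; have iG := psi_circ_intg Psi_orlicz 4 hG r01.
  have hW : holo (fun z => F (ka k) z - G z).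
    by move=> z z1; apply: cdiffB; [exact: hF|exact: hG].
  apply: (@le_trans _ _ (mint (fun t => 2^-1 * psi (cabs (circ (F (ka k)) r t) / 4) +
      2^-1 * psi (cabs (circ G r t) / 4)))).
    apply: (mint_le (psi_circ_intg Psi_orlicz 8 hW r01) (intgD (intgZ _ iF) (intgZ _ iG))) => t.
    have c1 := cabs_ge0 (circ (F (ka k)) r t); have c2 := cabs_ge0 (circ G r t).
    have h01 : 0 <= (2^-1 : R) <= 1 by apply/andP; split; lra.
    have e2 : 1 - 2^-1 = 2^-1 :> R by field.
    have := psi_convex Psi_orlicz h01 (divr_ge0 c1 (ltW four0)) (divr_ge0 c2 (ltW four0)).
    rewrite e2; apply: le_trans; apply: psi_le.
    have := cabsB (circ (F (ka k)) r t) (circ G r t); rewrite /circ; move: (cabs _) (cabs _) (cabs _) => x y w.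
    by lra.
  rewrite (mintD (intgZ _ iF) (intgZ _ iG)) (mintZ _ iF) (mintZ _ iG).
  by have h1 := Fp (ka k) r r01; have h2 := Gp r r01; lra.
Qed.

(** Local uniform convergence supplies the smallness on [|z| <= rho]. The resulting bound on every
    circle passes to the boundary by Fatou's lemma, where it is a Luxemburg bound with constant
    [A^-1]. *)
Lemma hardy_orlicz_comp_small (w : nat -> disk R -> C) M A : 1 < A ->
  (forall k, [/\ holo (extend (w k)),
      forall r, 0 <= r < 1 -> mint (fun t => cabs (circ (extend (w k)) r t)) <= M &
      forall r, 0 <= r < 1 -> mint (fun t => psi (cabs (circ (extend (w k)) r t) / 8)) <= 1]) ->
  (forall z, cabs z < 1 -> (extend (w k) z : C^o) @[k --> \oo] --> (0 : C^o)) ->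
  exists J, forall k, (J <= k)%N -> (hardy_orlicz_norm Psi (comp_op phi (w k)) <= (A^-1)%:E)%E.
Proof.
move=> A1 hw cw; have A0 : 0 < A by exact: lt_trans A1.
have [rho [eta [rho01 eta0 est]]] :=
  composed_orlicz_estimate Psi_orlicz Psi_growth phi_analytic phi_schatten A1.
have hW k : holo (extend (w k)) by have [] := hw k.
have WM k r : 0 <= r < 1 -> mint (fun t => cabs (circ (extend (w k)) r t)) <= M by have [_ h _] := hw k; exact: h.
have Wp k r : 0 <= r < 1 -> mint (fun t => psi (cabs (circ (extend (w k)) r t) / 8)) <= 1.
  by have [_ _ h] := hw k; exact: h.
have [J hJ] := locally_uniform hW WM cw rho01 eta0.
exists J => k Jk; have [iW W1] := psi_fatou Psi_orlicz (hW k) (WM k) (Wp k).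
have hC := holo_extend_comp phi_analytic (hW k).
have CM r : 0 <= r < 1 -> mint (fun t => cabs (circ (extend (comp_op phi (w k))) r t)) <=
    mint (fun t => pois (Phi 0) t * cabs (bdf (extend (w k)) t)).
  move=> r01; under [X in mint X]eq_fun do rewrite circ_extend_comp//.
  exact: (mean_cabs_comp (holo_Phi phi_analytic) (self_map_lt1 phi) (hW k) (WM k) r01).
have Cp r : 0 <= r < 1 -> mint (fun t => psi (cabs (circ (extend (comp_op phi (w k))) r t) / A^-1)) <= 1.
  move=> r01; rewrite (mint_eq (g := fun s => psi (A * cabs (extend (w k) (circ Phi r s))))).
    exact: (est _ _ (hW k) (WM k) iW W1 (fun z => hJ k z Jk) r r01).
  by move=> s; rewrite circ_extend_comp// invrK mulrC.
have [iC C1] := psi_fatou Psi_orlicz hC CM Cp.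
by apply: (luxemburg_le Psi_orlicz hC _ iC C1); rewrite invr_gt0.
Qed.

End OrliczComposition.

Theorem proposition3p3 (R : realType) (Psi : \bar R -> \bar R)
    (Psi_orlicz : orlicz_function Psi)
    (Psi_growth : forall A eps : R, 1 < A -> 0 < eps ->
       (fun x : R => fine (Psi (A * x)%:E) : R^o) =O_ (pinfty_nbhs R)
       (fun x : R => fine (Psi x%:E) * (ln (fine (Psi x%:E)) `^ eps) : R^o))
    (phi : disk R -> disk R)
    (phi_analytic : analytic (fun z => val (phi z)))
    (phi_schatten : exists p : R, 0 < p /\
       schatten_class (hardy 2) (@hardy2_ip R) p (comp_op phi)) :
  @compact_operator R R[i] _ (hardy_orlicz Psi) (hardy_orlicz_norm Psi) (comp_op phi).
Proof.
split; first split.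
- by move=> f hf; exact: (hardy_orlicz_comp Psi_orlicz phi_analytic hf).
- by move=> a f g _ _; apply/funext.
move=> u hu; have [ka [v [M [ka_mono hv [cw hw]]]]] := hardy_orlicz_subsequence Psi_orlicz hu.
exists ka, (comp_op phi v); split; [exact: ka_mono|exact: (hardy_orlicz_comp Psi_orlicz phi_analytic hv)|].
apply: cvg_norm0 => [k|A A1]; first exact: luxemburg_ge0.
exact: (hardy_orlicz_comp_small Psi_orlicz Psi_growth phi_analytic phi_schatten A1 hw cw).
Qed.
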